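(* There are constants $c_0,c_1,\gamma_0,\gamma_1>0$ and $\varepsilon_0>0$ such that for every $0\le\varepsilon<\varepsilon_0$, every $(1+\varepsilon)$-quasiconformal mapping $f:\mathbb C\to\mathbb C$ that is conformal in the unit disk $\mathbb D$, and every $A\subset\partial\mathbb D$: (i) if $\dim(A)\ge1-c_0\varepsilon^2$ then $\dim(f(A))\ge1-c_1\varepsilon^2$; (ii) if $\dim(A)\le1-\gamma_0\varepsilon^2$ then $\dim(f(A))\le1-\gamma_1\varepsilon^2$.
   Context: A homeomorphism of $\mathbb C$ is $K$-quasiconformal if it lies in $W^{1,2}_{loc}$ and $\max_\alpha|\partial_\alpha f|\le K\min_\alpha|\partial_\alpha f|$ a.e. $\dim$ denotes Hausdorff dimension. *)

(* Defs.v *)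
From HB Require Import structures.
From mathcomp Require Import all_boot all_order all_algebra.
From mathcomp Require Import all_classical all_reals all_analysis.
Set Implicit Arguments. Unset Strict Implicit. Unset Printing Implicit Defensive.
Import Order.TTheory GRing.Theory Num.Theory.
Import numFieldNormedType.Exports.
Local Open Scope classical_set_scope.
Local Open Scope ring_scope.

Section Defs.
Variable R : realType.
Local Notation C := (R * R)%type.

Definition edist (p q : C) : R :=
  Num.sqrt ((p.1 - q.1) ^+ 2 + (p.2 - q.2) ^+ 2).

Definition enorm (p : C) : R := Num.sqrt (p.1 ^+ 2 + p.2 ^+ 2).

(* H^s_delta(A): infimum of sum_n r_n^s over countable covers (F_n) of A with
   diam(F_n) <= r_n <= delta  (equivalently, sum of diam(F_n)^s). *)
Definition Hcontent (s delta : R) (A : set C) : \bar R :=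
  ereal_inf [set x : \bar R | exists (F : nat -> set C) (r : nat -> R),
    [/\ (forall n, 0 <= r n <= delta),
        (forall n p q, F n p -> F n q -> edist p q <= r n),
        A `<=` \bigcup_n F n &
        x = (\sum_(0 <= n <oo) ((r n) `^ s)%:E)%E]].

Definition Hmeasure (s : R) (A : set C) : \bar R :=
  ereal_sup [set Hcontent s d A | d in [set d : R | 0 < d]].

Definition hdim (A : set C) : \bar R :=
  ereal_inf [set s%:E | s in [set s : R | 0 < s /\ Hmeasure s A = 0%E]].

Definition mu2 := ((@lebesgue_measure R) \x (@lebesgue_measure R))%E.

Definition pd (b : bool) (phi : C -> R) : C -> R := fun p =>
  if b then derive1 (fun t => phi (t, p.2)) p.1 else derive1 (fun t => phi (p.1, t)) p.2.

Definition pds (l : seq bool) (phi : C -> R) : C -> R := foldr pd phi l.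

Definition section_fun (b : bool) (psi : C -> R) (p : C) : R -> R :=
  if b then fun t => psi (t, p.2) else fun t => psi (p.1, t).

Definition section_pt (b : bool) (p : C) : R := if b then p.1 else p.2.

Definition smooth (phi : C -> R) : Prop :=
  forall l : seq bool, continuous (pds l phi) /\
    (forall b p, derivable (section_fun b (pds l phi) p) (section_pt b p) 1).

Definition compact_support (phi : C -> R) : Prop :=
  exists M : R, forall p : C, M < `|p.1| \/ M < `|p.2| -> phi p = 0.

Definition test_fun (phi : C -> R) : Prop := smooth phi /\ compact_support phi.

Definition box (M : R) : set C := [set p | `|p.1| <= M /\ `|p.2| <= M].

Definition locL2 (u : C -> R) : Prop :=
  measurable_fun setT u /\
  forall M : R, (\int[mu2]_(p in box M) (u p ^+ 2)%:E < +oo)%E.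

Definition weak_pd (b : bool) (u g : C -> R) : Prop :=
  forall phi, test_fun phi ->
    (\int[mu2]_p (u p * pd b phi p)%:E = - \int[mu2]_p (g p * phi p)%:E)%E.

Definition homeomorphism (f : C -> C) : Prop :=
  exists g : C -> C, cancel f g /\ cancel g f /\ continuous f /\ continuous g.

(* directional derivative d_alpha f = cos(alpha) f_x + sin(alpha) f_y,
   computed from the weak gradient (fx, fy) *)
Definition ddir (fx fy : C -> C) (alpha : R) (p : C) : C :=
  (cos alpha * (fx p).1 + sin alpha * (fy p).1,
   cos alpha * (fx p).2 + sin alpha * (fy p).2).

(* f is K-quasiconformal: a homeomorphism of C in W^{1,2}_loc with
   max_alpha |d_alpha f| <= K min_alpha |d_alpha f| a.e. *)
Definition quasiconformal (K : R) (f : C -> C) : Prop :=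
  homeomorphism f /\
  exists fx fy : C -> C,
    (locL2 (fun p => (f p).1) /\ locL2 (fun p => (f p).2) /\
     locL2 (fun p => (fx p).1) /\ locL2 (fun p => (fx p).2) /\
     locL2 (fun p => (fy p).1) /\ locL2 (fun p => (fy p).2)) /\
    (weak_pd true (fun p => (f p).1) (fun p => (fx p).1) /\
     weak_pd true (fun p => (f p).2) (fun p => (fx p).2) /\
     weak_pd false (fun p => (f p).1) (fun p => (fy p).1) /\
     weak_pd false (fun p => (f p).2) (fun p => (fy p).2)) /\
    {ae mu2, forall p, forall alpha beta : R,
           enorm (ddir fx fy alpha p) <= K * enorm (ddir fx fy beta p)}.

Definition cmul (z w : C) : C := (z.1 * w.1 - z.2 * w.2, z.1 * w.2 + z.2 * w.1).
Definition cinv (z : C) : C :=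
  (z.1 / (z.1 ^+ 2 + z.2 ^+ 2), - z.2 / (z.1 ^+ 2 + z.2 ^+ 2)).

Definition unit_disk : set C := [set p | p.1 ^+ 2 + p.2 ^+ 2 < 1].
Definition unit_circle : set C := [set p | p.1 ^+ 2 + p.2 ^+ 2 = 1].

Definition conformal_on (D : set C) (f : C -> C) : Prop :=
  forall z, D z -> exists w : C,
    (fun h : C => cmul ((f (z.1 + h.1, z.2 + h.2)).1 - (f z).1,
                        (f (z.1 + h.1, z.2 + h.2)).2 - (f z).2) (cinv h))
      @ ((0 : R), (0 : R))^' --> w.

End Defs.

(* Main.v *)
(* Let z be a point of the disc, D = f'(z) <> 0, and let G(w) be 1 / (f(z + w) - f(z)) minus
   its pole 1 / (D w). The dbar-derivative of G vanishes on a disc of radius comparable to 1 - |z| and is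
   O(eps) relative to the gradient elsewhere. The energy of 1 / (f(z + w) - f(z)) decays along
   dyadic frames (Caccioppoli and Poincare inequalities, hole filling), so the Cauchy formula bounds G and gives
     |f(z + w) - f(z) - D w| <= K eps |D| |w|   for |w| <= (1 - |z|) / 4.
   Chaining along radii, f is a similarity up to relative error O(eps) on every boundary arc, at the scale
   of that arc. If the image of an arc has chord Z = X + Y, where X and Y are the chords of its halves, then
   |X - Y| <= eta |Z| with eta = O(eps + length), and the parallelogram law makes the error quadratic:
     |X|^2 + |Y|^2 <= (1 + 8 eta^2) |Z|^2 / 2,   |X|^-2 + |Y|^-2 <= 8 (1 + 8 eta^2) |Z|^-2.
   Hence suitably weighted sums over all dyadic arcs of the squared chords, and of their inverses, converge, and
   Young's inequality turns covers of A into covers of f(A), and conversely, with a loss of O(eps^2) in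
   the dimension. *)
Require Import Defs.
From HB Require Import structures.
From mathcomp Require Import all_boot all_order all_algebra.
From mathcomp Require Import all_classical all_reals all_analysis.
From mathcomp Require Import measurable_realfun.
From mathcomp Require Import ring lra.
Set Implicit Arguments.
Unset Strict Implicit.
Unset Printing Implicit Defensive.
Import Order.TTheory GRing.Theory Num.Theory.
Import numFieldNormedType.Exports.
Local Open Scope classical_set_scope.
Local Open Scope ring_scope.


(** * Integration *)

(** The inverse is used because nothing bounds [f] at infinity, whereas 1 / (f(z + w) - f(z)) tends
    to 0 there by properness. Its only pole is cancelled by 1 / (D w), so the Cauchy formula for G
    leaves no boundary terms, and only frame energies of the inverse are needed. These are bounded
    by its supremum on an inner frame, a bound that the estimate of G in turn improves: a bootstrap
    closes the argument. Two difficulties sit in the definitions. The distortion inequality does not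
    see the sign of the Jacobian: the sign is read off inside the disc and carried to the plane by
    the constancy of a mollified degree. And [conformal_on] gives a pointwise derivative, possibly
    zero, while distortion concerns weak gradients: mollification identifies the two, and
    injectivity together with near-linearity at neighbouring points excludes D = 0. The error at a
    single scale is only O(eps); it becomes eps^2 because it is squared at each subdivision. After n
    subdivisions the sums are off by a factor exp(O(eps^2) n), a power of the scale with exponent
    O(eps^2). *)

Section RealIntegral.
Context d (T : measurableType d) (R : realType) (m : {measure set T -> \bar R}).
Implicit Types F G : T -> R.

(** Real integrals always run over the whole space. Restriction to a set is multiplication by an
    indicator, so linearity applies without conditions on domains. *)
Definition L1 F := m.-integrable setT (EFin \o F).
Definition Int F : R := \int[m]_x F x.

Lemma L1_meas F : L1 F -> measurable_fun setT F.
Proof. by move=> /integrableP[/measurable_EFinP]. Qed.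

Lemma EInt F : L1 F -> (\int[m]_x (F x)%:E)%E = (Int F)%:E.
Proof. by move=> h; rewrite /Int /Rintegral fineK//; exact: integrable_fin_num. Qed.

Lemma L1_le G F : measurable_fun setT F -> (forall x, `|F x| <= G x) -> L1 G -> L1 F.
Proof.
move=> mF h; apply: le_integrable => //; first exact/measurable_EFinP.
move=> x _ /=; rewrite lee_fin; apply: (le_trans (h x)); exact: ler_norm.
Qed.

Lemma L1_fin F : measurable_fun setT F -> (forall x, 0 <= F x) ->
  (\int[m]_x (F x)%:E < +oo)%E -> L1 F.
Proof.
move=> mF F0 h; apply/integrableP; split; first exact/measurable_EFinP.
rewrite (_ : (fun x => `|(EFin \o F) x|%E) = (fun x => (F x)%:E))//.
by apply/funext => x /=; rewrite ger0_norm.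
Qed.

Lemma L1_ext F G : (forall x, F x = G x) -> L1 F -> L1 G.
Proof. by move=> h; rewrite (_ : F = G)//; apply/funext. Qed.

Lemma Int_ext F G : (forall x, F x = G x) -> Int F = Int G.
Proof. by move=> h; congr Int; apply/funext. Qed.

Lemma L1D F G : L1 F -> L1 G -> L1 (fun x => F x + G x).
Proof. by move=> hF hG; have := integrableD measurableT hF hG. Qed.

Lemma L1Z (k : R) F : L1 F -> L1 (fun x => k * F x).
Proof. by move=> hF; have := integrableZl measurableT k hF. Qed.

Lemma L1N F : L1 F -> L1 (fun x => - F x).
Proof. by move=> /(L1Z (-1)); apply: L1_ext => x; rewrite mulN1r. Qed.

Lemma L1B F G : L1 F -> L1 G -> L1 (fun x => F x - G x).
Proof. by move=> hF /L1N; exact: L1D. Qed.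

Lemma L10 : L1 (fun=> 0).
Proof. exact: integrable0. Qed.

Lemma L1_abs F : L1 F -> L1 (fun x => `|F x|).
Proof.
move=> hF; apply: (@L1_le (fun x => `|F x|)).
- by apply/measurableT_comp => //; exact: L1_meas.
- by move=> x; rewrite normr_id.
- by have := integrable_abse hF.
Qed.

Lemma IntD F G : L1 F -> L1 G -> Int (fun x => F x + G x) = Int F + Int G.
Proof. by move=> hF hG; exact: RintegralD. Qed.

Lemma IntB F G : L1 F -> L1 G -> Int (fun x => F x - G x) = Int F - Int G.
Proof. by move=> hF hG; exact: RintegralB. Qed.

Lemma IntZ (k : R) F : L1 F -> Int (fun x => k * F x) = k * Int F.
Proof. by move=> hF; exact: RintegralZl. Qed.

Lemma IntN F : L1 F -> Int (fun x => - F x) = - Int F.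
Proof.
move=> hF; rewrite -[RHS]mulN1r -IntZ//; apply: Int_ext => x.
by rewrite mulN1r.
Qed.

Lemma Int0 : Int (fun=> 0) = 0.
Proof. by rewrite /Int /Rintegral integral0. Qed.

Lemma Int_le F G : L1 F -> L1 G -> (forall x, F x <= G x) -> Int F <= Int G.
Proof. by move=> hF hG h; apply: le_Rintegral. Qed.

Lemma Int_ge0 F : (forall x, 0 <= F x) -> 0 <= Int F.
Proof. by move=> h; apply: Rintegral_ge0. Qed.

Lemma Int_abs F : L1 F -> `|Int F| <= Int (fun x => `|F x|).
Proof. by move=> h; exact: le_normr_Rintegral. Qed.

Lemma Int_abs_le F G : L1 F -> L1 G -> (forall x, `|F x| <= G x) -> `|Int F| <= Int G.
Proof.
move=> hF hG h; apply: (le_trans (Int_abs hF)); apply: Int_le => //.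
exact: L1_abs.
Qed.

Lemma L1_ae F G : measurable_fun setT G -> {ae m, forall x, F x = G x} ->
  L1 F -> L1 G.
Proof.
move=> mG h hF; apply/integrableP; split; first exact/measurable_EFinP.
have /integrableP[mF iF] := hF.
rewrite (@ae_eq_integral _ _ _ m setT (fun x => `|(EFin \o F) x|%E))//.
- by apply: measurableT_comp => //; exact/measurable_EFinP.
- exact: measurableT_comp.
- by apply: filterS h => x /= -> _.
Qed.

Lemma Int_ae F G : measurable_fun setT F -> measurable_fun setT G ->
  {ae m, forall x, F x = G x} -> Int F = Int G.
Proof.
move=> mF mG h; rewrite /Int /Rintegral (@ae_eq_integral _ _ _ m setT (EFin \o G))//.
- exact/measurable_EFinP.
- exact/measurable_EFinP.
- by apply: filterS h => x /= -> _.
Qed.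

(** Replacing [G] by the maximum of [F] and [G] changes it on a null set only and makes the
    comparison hold everywhere. *)
Lemma Int_le_ae F G : L1 F -> L1 G -> {ae m, forall x, F x <= G x} -> Int F <= Int G.
Proof.
move=> hF hG h.
have mF := L1_meas hF; have mG := L1_meas hG.
have mM : measurable_fun setT (fun x => Num.max (F x) (G x)) by exact: measurable_maxr.
have e : {ae m, forall x, G x = Num.max (F x) (G x)}.
  by apply: filterS h => x fg; rewrite max_r.
rewrite (Int_ae mG mM e); apply: Int_le => //; first exact: L1_ae hG.
by move=> x; rewrite le_max lexx.
Qed.

Lemma Int_ge0_eq0 F : L1 F -> (forall x, 0 <= F x) -> Int F <= 0 ->
  {ae m, forall x, F x = 0}.
Proof.
move=> hF F0 h.
have i0 : (\int[m]_x `|(F x)%:E| = 0)%E.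
  under eq_integral => x _ do rewrite /= ger0_norm ?F0//.
  rewrite EInt//; congr EFin; apply/eqP; rewrite eq_le h; exact: Int_ge0.
have mF : measurable_fun setT (EFin \o F) by apply/measurable_EFinP; exact: L1_meas.
have := (ae_eq_integral_abs m measurableT mF).1 i0.
by apply: filterS => x /= /(_ I) [].
Qed.

Lemma L1_sq_mul F G : measurable_fun setT F -> measurable_fun setT G ->
  L1 (fun x => F x ^+ 2) -> L1 (fun x => G x ^+ 2) -> L1 (fun x => F x * G x).
Proof.
move=> mF mG hF hG; apply: (@L1_le (fun x => F x ^+ 2 + G x ^+ 2)).
- exact: measurable_funM.
- by move=> x; rewrite ler_norml; apply/andP; split; nra.
- exact: L1D.
Qed.

Lemma L1_sqD F G : measurable_fun setT F -> measurable_fun setT G ->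
  L1 (fun x => F x ^+ 2) -> L1 (fun x => G x ^+ 2) -> L1 (fun x => (F x + G x) ^+ 2).
Proof.
move=> mF mG hF hG.
have hFG := L1_sq_mul mF mG hF hG.
apply: L1_ext (L1D (L1D hF (L1Z 2 hFG)) hG) => x /=; ring.
Qed.

(** The form [s ^+ 2 * a - 2 * s * t * c + t ^+ 2 * b] is the integral of a square. At
    [(s, t) = (b, c)] it equals [b * (a * b - c ^+ 2)]. When [b = 0], the pair [(c, a)] leaves
    [- a * c ^+ 2], and if [a] vanishes too, the pairs [(1, 1)] and [(1, -1)] force [c = 0]. *)
Lemma Int_CS F G : measurable_fun setT F -> measurable_fun setT G ->
  L1 (fun x => F x ^+ 2) -> L1 (fun x => G x ^+ 2) ->
  Int (fun x => F x * G x) ^+ 2 <= Int (fun x => F x ^+ 2) * Int (fun x => G x ^+ 2).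
Proof.
move=> mF mG hF hG; have hFG := L1_sq_mul mF mG hF hG.
set a := Int (fun x => F x ^+ 2); set b := Int (fun x => G x ^+ 2).
set c := Int (fun x => F x * G x).
have key s t : 0 <= s ^+ 2 * a - 2 * s * t * c + t ^+ 2 * b.
  have : 0 <= Int (fun x => (s * F x - t * G x) ^+ 2) by apply: Int_ge0 => x; exact: sqr_ge0.
  rewrite (@Int_ext _ (fun x => s ^+ 2 * F x ^+ 2 - 2 * s * t * (F x * G x) + t ^+ 2 * G x ^+ 2)); last by move=> x; ring.
  rewrite IntD; [|by apply: L1B; exact: L1Z|exact: L1Z].
  by rewrite IntB ?IntZ//; exact: L1Z.
have a0 : 0 <= a by apply: Int_ge0 => x; exact: sqr_ge0.
have b0 : 0 <= b by apply: Int_ge0 => x; exact: sqr_ge0.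
have [b00|bn0] := eqVneq b 0.
  have [a00|an0] := eqVneq a 0.
    have := key 1 1; have := key 1 (-1); rewrite a00 b00 => h1 h2.
    have -> : c = 0 by lra.
    by rewrite expr0n/= mulr0.
  have a1 : 0 < a by rewrite lt0r an0.
  have := key c a; rewrite b00 => h.
  suff : a * (c ^+ 2) <= 0 by rewrite pmulr_rle0// mulr0.
  nra.
have b1 : 0 < b by rewrite lt0r bn0.
have := key b c => h.
have : 0 <= b * (a * b - c ^+ 2).
  by have -> : b * (a * b - c ^+ 2) = b ^+ 2 * a - 2 * b * c * c + c ^+ 2 * b by ring.
by rewrite pmulr_rge0// subr_ge0.
Qed.

Lemma Int_cvg (Fn : nat -> T -> R) F G : (forall n, measurable_fun setT (Fn n)) ->
  measurable_fun setT F -> L1 G -> (forall n x, `|Fn n x| <= G x) ->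
  (forall x, Fn n x @[n --> \oo] --> F x) ->
  L1 F /\ Int (Fn n) @[n --> \oo] --> Int F.
Proof.
move=> mFn mF hG hle hc.
have [|||||iF _ cI] := @dominated_convergence _ _ _ m setT measurableT
  (fun n => EFin \o Fn n) (EFin \o F) (EFin \o G).
- by move=> n; exact/measurable_EFinP.
- exact/measurable_EFinP.
- apply: aeW => x _; apply: cvg_EFin; [exact: nearW|exact: hc].
- exact: hG.
- by apply: aeW => x n _ /=; rewrite lee_fin.
split=> //.
exact: (fine_cvg (eq_ind _ (fun z => _ --> z) cI _ (EInt iF))).
Qed.

End RealIntegral.

Module SigmaFiniteTonelli.
Section Tonelli.
Context d1 d2 (T1 : measurableType d1) (T2 : measurableType d2) (R : realType).
Variables (m1 : {measure set T1 -> \bar R}) (m2 : {measure set T2 -> \bar R}).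
Variables (sf1 : sigma_finite setT m1) (sf2 : sigma_finite setT m2).
Let b1 := Measure.sort m1.
HB.instance Definition _ := Measure.on b1.
HB.instance Definition _ := Measure_isSigmaFinite.Build _ _ _ b1 sf1.
Let b2 := Measure.sort m2.
HB.instance Definition _ := Measure.on b2.
HB.instance Definition _ := Measure_isSigmaFinite.Build _ _ _ b2 sf2.

(** Sigma-finiteness enters as a proposition and becomes structure locally, because [PM] is handled
    as a plain measure whose sigma-finiteness is proved separately. *)
Lemma tonelli_sf (K : T1 * T2 -> \bar R) : measurable_fun setT K -> (forall z, 0 <= K z)%E ->
  (\int[m1]_p \int[m2]_q K (p, q) = \int[m2]_q \int[m1]_p K (p, q))%E.
Proof.
move=> mK K0; exact: (@fubini_tonelli _ _ _ _ _ (b1 : {sigma_finite_measure set T1 -> \bar R})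
  (b2 : {sigma_finite_measure set T2 -> \bar R}) K mK K0).
Qed.

End Tonelli.
End SigmaFiniteTonelli.
Definition tonelli_sf := @SigmaFiniteTonelli.tonelli_sf.
Arguments tonelli_sf {d1 d2 T1 T2 R m1 m2} _ _ {K}.
Global Opaque L1 Int.

(** * The plane: sup norm, continuity, Lebesgue measure and translations *)

Section Plane.
Variable R : realType.
Local Notation C := (R * R)%type.
Local Notation M1 := (measurableTypeR R).
Implicit Types (F G : C -> R) (p q c : C).

Definition PM : {measure set (M1 * M1) -> \bar R} :=
  ((@lebesgue_measure R) \x (@lebesgue_measure R))%E.

Lemma PME (A B : set R) : measurable (A : set M1) -> measurable (B : set M1) ->
  PM (A `*` B) = (lebesgue_measure A * lebesgue_measure B)%E.
Proof. by move=> mA mB; have := @product_measure1E _ _ _ _ _ (@lebesgue_measure R) (@lebesgue_measure R) _ _ mA mB. Qed.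

Definition pp p q : C := (p.1 + q.1, p.2 + q.2).
Definition pm p q : C := (p.1 - q.1, p.2 - q.2).

(* The balls of the sup norm are squares, so that coordinatewise arguments apply. *)
Definition nm p : R := Num.max `|p.1| `|p.2|.

Lemma nm_le p r : (nm p <= r) = (`|p.1| <= r) && (`|p.2| <= r).
Proof. by rewrite /nm ge_max. Qed.
Lemma nm_lt p r : (nm p < r) = (`|p.1| < r) && (`|p.2| < r).
Proof. by rewrite /nm gt_max. Qed.
Lemma nm_ge0 p : 0 <= nm p.
Proof. by rewrite /nm le_max normr_ge0. Qed.
Lemma nm1 p : `|p.1| <= nm p.
Proof. by rewrite /nm le_max lexx. Qed.
Lemma nm2 p : `|p.2| <= nm p.
Proof. by rewrite /nm le_max lexx orbT. Qed.
Lemma nmD p q : nm (pp p q) <= nm p + nm q.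
Proof.
by rewrite nm_le /=; apply/andP; split; apply: (le_trans (ler_normD _ _)); apply: lerD; rewrite ?nm1 ?nm2.
Qed.
Lemma nmN p q : nm (pm p q) = nm (pm q p).
Proof. by rewrite /nm /= distrC (distrC p.2). Qed.
Lemma nmB p q : nm (pm p q) <= nm p + nm q.
Proof.
by rewrite nm_le /=; apply/andP; split; apply: (le_trans (ler_normB _ _)); apply: lerD; rewrite ?nm1 ?nm2.
Qed.
Lemma nm_tri q p c : nm (pm p c) <= nm (pm p q) + nm (pm q c).
Proof.
apply: le_trans (nmD _ _); rewrite le_eqVlt; apply/orP; left; apply/eqP; rewrite /pp /pm /=.
by congr (nm (_, _)); ring.
Qed.
Lemma pmD p q : pm (pp p q) q = p.
Proof. by case: p => a b; rewrite /pp /pm /= !addrK. Qed.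
Lemma ppB p q : pp (pm p q) q = p.
Proof. by case: p => a b; rewrite /pp /pm /= !subrK. Qed.
Lemma ppC p q : pp p q = pp q p.
Proof. by rewrite /pp addrC (addrC p.2). Qed.
Lemma pm0 p : pm p (0, 0) = p.
Proof. by case: p => a b; rewrite /pm /= !subr0. Qed.
Lemma nm_eq0 p : nm p = 0 -> p = (0, 0).
Proof.
move=> h; have := nm1 p; have := nm2 p; rewrite h !normr_le0 => /eqP h2 /eqP h1.
by rewrite [p]surjective_pairing h1 h2.
Qed.

(** Equivalent to topological continuity by [ctP]; the explicit sup-norm radius is what the
    quantitative estimates consume. *)
Definition ct F := forall p (e : R), 0 < e -> exists2 d : R, 0 < d &
  forall q, nm (pm q p) < d -> `|F q - F p| < e.

Lemma nbhs_nmP p (A : set C) :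
  nbhs p A <-> exists2 d : R, 0 < d & forall q, nm (pm q p) < d -> A q.
Proof.
split=> [[[A1 A2]] [/= /nbhs_ballP[d1 /= d10 h1] /nbhs_ballP[d2 /= d20 h2]] AA|[d d0 hd]].
  exists (Num.min d1 d2); first by rewrite lt_min d10.
  move=> q; rewrite nm_lt /= !lt_min => /andP[/andP[q1 _] /andP[_ q2]]; apply: AA.
  by split => /=; [apply: h1|apply: h2]; rewrite /ball /= distrC.
exists (ball p.1 d, ball p.2 d); first by split; exact: nbhsx_ballx.
move=> q [/= h1 h2]; apply: hd; rewrite nm_lt /= distrC.
by apply/andP; split=> //; rewrite distrC.
Qed.

Lemma ctP F : ct F <-> continuous F.
Proof.
split=> [h p|h p e e0].
  apply/cvgrPdist_lt => e e0; have [d d0 hd] := h p e e0.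
  by apply/nbhs_nmP; exists d => // q hq; rewrite distrC; exact: hd.
have /cvgrPdist_lt/(_ e e0)/nbhs_nmP[d d0 hd] := h p.
by exists d => // q hq; rewrite distrC; exact: hd.
Qed.

Lemma ct_cst (k : R) : ct (fun=> k).
Proof. by move=> p e e0; exists 1 => // q _; rewrite subrr normr0. Qed.
Lemma ctD F G : ct F -> ct G -> ct (fun p => F p + G p).
Proof. by move=> /ctP hF /ctP hG; apply/ctP => p; apply: cvgD; [exact: hF|exact: hG]. Qed.
Lemma ctM F G : ct F -> ct G -> ct (fun p => F p * G p).
Proof. by move=> /ctP hF /ctP hG; apply/ctP => p; apply: cvgM; [exact: hF|exact: hG]. Qed.
Lemma ctN F : ct F -> ct (fun p => - F p).
Proof. by move=> /ctP hF; apply/ctP => p; apply: cvgN; exact: hF. Qed.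
Lemma ctB F G : ct F -> ct G -> ct (fun p => F p - G p).
Proof. by move=> hF hG; apply: ctD => //; exact: ctN. Qed.
Lemma ctZ (k : R) F : ct F -> ct (fun p => k * F p).
Proof. by move=> h; apply: ctM => //; exact: ct_cst. Qed.
Lemma ctX F n : ct F -> ct (fun p => F p ^+ n).
Proof.
move=> h; elim: n => [|n ih]; first exact: ct_cst.
rewrite (_ : (fun p => _) = (fun p => F p * F p ^+ n)); first exact: ctM.
by apply/funext => p; rewrite exprS.
Qed.
Lemma ct1 : ct fst.
Proof. by move=> p e e0; exists e => // q; apply: le_lt_trans (nm1 (pm q p)). Qed.
Lemma ct2 : ct snd.
Proof. by move=> p e e0; exists e => // q; apply: le_lt_trans (nm2 (pm q p)). Qed.
Lemma ct_comp1 (h : R -> R) F : continuous h -> ct F -> ct (fun p => h (F p)).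
Proof. by move=> hh /ctP hF; apply/ctP => p; apply: (continuous_comp (hF p) (hh _)). Qed.
Lemma ct_comp2 (u v : C -> R) F : ct u -> ct v -> ct F -> ct (fun p => F (u p, v p)).
Proof.
move=> hu hv hF p e e0; have [d d0 hd] := hF (u p, v p) e e0.
have [d1 d10 h1] := hu p d d0; have [d2 d20 h2] := hv p d d0.
exists (Num.min d1 d2); first by rewrite lt_min d10.
by move=> q; rewrite lt_min => /andP[/h1 H1 /h2 H2]; apply: hd; rewrite nm_lt H1.
Qed.
Lemma ct_ext F G : (forall p, F p = G p) -> ct F -> ct G.
Proof. by move=> /funext ->. Qed.
Lemma ct_shift c F : ct F -> ct (fun p => F (pp p c)).
Proof.
by move=> hF; apply: (ct_comp2 (u := fun p => p.1 + c.1) (v := fun p => p.2 + c.2)) => //;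
  apply: ctD (ct_cst _); [exact: ct1|exact: ct2].
Qed.
Lemma ct_norm F : ct F -> ct (fun p => `|F p|).
Proof. by move=> h; apply: ct_comp1 h => x; exact: norm_continuous. Qed.

Lemma ct_secx (y : R) F : ct F -> continuous (fun x => F (x, y)).
Proof.
move=> h x; apply/cvgrPdist_lt => e e0; have [d d0 hd] := h (x, y) e e0.
apply/nbhs_ballP; exists d => //= z hz; rewrite distrC; apply: hd.
by rewrite nm_lt /= subrr normr0 d0 andbT distrC.
Qed.
Lemma ct_secy (x : R) F : ct F -> continuous (fun y => F (x, y)).
Proof.
move=> h y; apply/cvgrPdist_lt => e e0; have [d d0 hd] := h (x, y) e e0.
apply/nbhs_ballP; exists d => //= z hz; rewrite distrC; apply: hd.
by rewrite nm_lt /= subrr normr0 d0 /= distrC.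
Qed.

Lemma box_compact r : compact [set p : C | nm p <= r].
Proof.
rewrite (_ : [set p : C | _] = `[(- r), r]%classic `*` `[(- r), r]%classic).
  by apply: compact_setX; exact: segment_compact.
apply/seteqP; split=> -[x y] /=; rewrite nm_le /= !in_itv /= -!ler_norml.
  by move/andP.
by case=> -> ->.
Qed.

Lemma ct_bounded F r : ct F -> exists2 K, 0 < K & forall p, nm p <= r -> `|F p| <= K.
Proof.
move=> /ctP hF.
have := continuous_compact (continuous_subspaceT hF) (@box_compact r).
move=> /compact_bounded[K [_ hK]]; exists (`|K| + 1); first by rewrite ltr_wpDl.
move=> p hp; apply: (hK (`|K| + 1)) => /=.
  by apply: (le_lt_trans (ler_norm K)); rewrite ltrDl.
by exists p.
Qed.

Lemma ct_unif F r (e : R) : ct F -> 0 < e -> exists2 d : R, 0 < d &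
  forall p q, nm p <= r -> nm (pm q p) < d -> `|F q - F p| < e.
Proof.
move=> hF e0; have := (@box_compact r); rewrite compact_near_coveringP => nc.
have h : (forall x : C, [set p | nm p <= r] x ->
   \forall x' \near x & i \near (0 : R)^'+, (fun d p => forall q, nm (pm q p) < d -> `|F q - F p| < e) i x').
  move=> x _; have e20 : 0 < e / 2 by lra.
  have [d d0 hd] := hF x (e / 2) e20.
  have d20 : 0 < d / 2 by lra.
  exists ([set y | nm (pm y x) < d / 2], [set i | i < d / 2]); last first.
    move=> [y i] [/= hy hi] q hq.
    have h1 : nm (pm y x) < d by lra.
    have h2 : nm (pm q x) < d by have := nm_tri y q x; lra.
    have := hd _ h1; have := hd _ h2; have := ler_distD (F x) (F q) (F y).
    by rewrite (distrC (F x)); lra.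
  split => /=; last exact: nbhs_right_lt.
  by apply/nbhs_nmP; exists (d / 2).
have := nc R ((0 : R)^'+) (fun d p => forall q, nm (pm q p) < d -> `|F q - F p| < e) _ h.
move=> H; have [d [d0 hd]] : exists d : R, 0 < d /\ forall p, nm p <= r -> forall q, nm (pm q p) < d -> `|F q - F p| < e.
  have /filter_ex[d [d0 hd]] : \forall d \near (0 : R)^'+, 0 < d /\ forall p, nm p <= r -> forall q, nm (pm q p) < d -> `|F q - F p| < e.
    by near=> d; split=> //; near: d; exact: H.
  by exists d.
by exists d => // p q hp hq; exact: hd hq.
Unshelve. all: by end_near. Qed.

(** Rounding the first coordinate down to a multiple of [n.+1%:R^-1] gives functions that converge
    pointwise to [F]. The preimage of a Borel set under each of them is a countable union of
    rectangles, measurable slice by slice. *)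
Lemma meas_ct F : ct F -> measurable_fun (setT : set (M1 * M1)) F.
Proof.
move=> hF.
pose G (n : nat) (p : C) := F ((Num.floor (p.1 * n.+1%:R))%:~R / n.+1%:R, p.2).
have n0 (n : nat) : 0 < n.+1%:R :> R by rewrite ltr0n.
apply: (@measurable_fun_cvg _ _ _ _ G).
  move=> n _ B mB; rewrite setTI.
  rewrite (_ : G n @^-1` B = \bigcup_(k : int)
     ([set x : R | (k%:~R / n.+1%:R <= x) && (x < (k + 1)%:~R / n.+1%:R)] `*`
      [set y : R | B (F (k%:~R / n.+1%:R, y))])).
    apply: countable_bigcupT_measurable => // k; apply: measurableX.
      rewrite (_ : [set x | _] = `[(k%:~R / n.+1%:R), ((k + 1)%:~R / n.+1%:R)[%classic) //.
    have := continuous_measurable_fun (ct_secy (x := k%:~R / n.+1%:R) hF) measurableT mB.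
    by rewrite setTI.
  apply/seteqP; split => [[x y] h|[x y] [k _ [/= h1 h2]]].
    exists (Num.floor (x * n.+1%:R)) => //; split => //=.
    by rewrite ler_pdivrMr// ltr_pdivlMr// ; apply/andP; split; [exact: floor_le_tmp|exact: floorD1_gt].
  rewrite /preimage /G /=; suff -> : Num.floor (x * n.+1%:R) = k by [].
  by apply/floor_def; move: h1; rewrite ler_pdivrMr// ltr_pdivlMr.
move=> [x y] _; apply/cvgrPdist_lt => e e0.
have [d d0 hd] := hF (x, y) e e0.
near=> n; rewrite distrC; apply: hd; rewrite nm_lt /= subrr normr0 d0 andbT.
have h1 := floor_le_tmp (x * n.+1%:R); have h2 := floorD1_gt (x * n.+1%:R).
have h3 : n.+1%:R^-1 < d by near: n; exact: near_infty_natSinv_lt (PosNum d0).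
have h4 : 0 < n.+1%:R^-1 :> R by rewrite invr_gt0.
set N := n.+1%:R in h1 h2 h3 h4 *; set fl := Num.floor _ in h1 h2 *.
have N0 : 0 < N by exact: n0.
rewrite intrD in h2.
apply: le_lt_trans h3; rewrite distrC ler_norml; apply/andP; split.
  by rewrite -(ler_pM2r N0) mulrBl divfK ?gt_eqF// mulNr mulVf ?gt_eqF//; lra.
by rewrite -(ler_pM2r N0) mulrBl divfK ?gt_eqF// mulVf ?gt_eqF//; lra.
Unshelve. all: by end_near. Qed.

(** Indicator of the closed square of half-side [r]. *)
Definition qi (r : R) p : R := ((nm p <= r)%R)%:R.

Lemma qi01 r p : 0 <= qi r p <= 1.
Proof. by rewrite /qi; case: (nm p <= r)%R; rewrite ?lexx ?ler01. Qed.
Lemma qi1 r p : nm p <= r -> qi r p = 1.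
Proof. by rewrite /qi => ->. Qed.
Lemma qi0 r p : r < nm p -> qi r p = 0.
Proof. by rewrite /qi ltNge => /negbTE ->. Qed.

Lemma qiE r : qi r = \1_(`[(- r), r]%classic `*` `[(- r), r]%classic) :> (C -> R).
Proof.
apply/funext => -[x y]; rewrite indicE /qi nm_le /=; congr (nat_of_bool _)%:R.
by rewrite in_setX /= !mem_setE /= !in_itv /= -!ler_norml.
Qed.

Lemma meas_qi r : measurable_fun (setT : set (M1 * M1)) (qi r).
Proof. by rewrite qiE; apply: measurable_indic; apply: measurableX; exact: measurable_itv. Qed.

Lemma L_qi r : L1 PM (qi r).
Proof.
apply: L1_fin; [exact: meas_qi|by move=> p; case/andP: (qi01 r p)|].
rewrite qiE integral_indic ?setIT//; last by apply: measurableX; exact: measurable_itv.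
rewrite PME//; [|exact: measurable_itv..].
by rewrite !lebesgue_measure_itv/=; case: ifP => _; rewrite ?mul0e ?ltry// -EFinB -EFinM ltry.
Qed.

Lemma Int_qi r : 0 <= r -> Int PM (qi r) = 4 * r ^+ 2.
Proof.
move=> r0; apply: EFin_inj; rewrite -EInt; last exact: L_qi.
rewrite qiE integral_indic ?setIT//; last by apply: measurableX; exact: measurable_itv.
rewrite PME//; [|exact: measurable_itv..].
rewrite lebesgue_measure_itv /= lte_fin; case: ifPn => h.
  by rewrite -EFinB -EFinM; congr EFin; ring.
have -> : r = 0 by apply/eqP; rewrite eq_le r0 andbT; move: h; rewrite -leNgt; lra.
by rewrite mule0 expr0n/= mulr0.
Qed.

Definition bs r F := forall p, r < nm p -> F p = 0.

Lemma L_bs r K F : measurable_fun (setT : set (M1 * M1)) F -> bs r F ->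
  (forall p, `|F p| <= K) -> L1 PM F.
Proof.
move=> mF hb hK; apply: (@L1_le _ _ _ PM (fun p => K * qi r p)) => //; last exact: L1Z (L_qi r).
move=> p; case: (leP (nm p) r) => h; first by rewrite qi1// mulr1.
by rewrite qi0// mulr0 hb// normr0.
Qed.

Lemma bs_bounded r F : ct F -> bs r F -> exists2 K, 0 < K & forall p, `|F p| <= K.
Proof.
move=> cF hb; have [K K0 hK] := ct_bounded r cF; exists K => // p.
by case: (leP (nm p) r) => [/hK//|/hb ->]; rewrite normr0 ltW.
Qed.

Lemma L_cc r F : ct F -> bs r F -> L1 PM F.
Proof.
move=> cF hb; have [K _ hK] := bs_bounded cF hb.
exact: (L_bs (meas_ct cF) hb hK).
Qed.

(** On the line, translation invariance follows from uniqueness of the measure with given values on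
    intervals; in the plane, from uniqueness of the product measure on rectangles. *)
Lemma PM_shift c (A : set C) : measurable (A : set (M1 * M1)) ->
  PM ((fun p => pp p c) @^-1` A) = PM A.
Proof.
have m1 (a : R) : measurable_fun setT (fun x : M1 => x + a : M1).
  by apply: continuous_measurable_fun => x; apply: cvgD; [exact: cvg_id|exact: cvg_cst].
have mc : measurable_fun setT ((fun p => pp p c) : M1 * M1 -> M1 * M1).
  apply: measurable_fun_pair; first exact: measurableT_comp (m1 c.1) measurable_fst.
  exact: measurableT_comp (m1 c.2) measurable_snd.
have l1 (a : R) (B : set R) : measurable B -> (@lebesgue_measure R) ((fun x => x + a) @^-1` B) = lebesgue_measure B.
  move=> mB; pose f : {mfun M1 >-> M1} := HB.pack (fun x : M1 => x + a) (isMeasurableFun.Build _ _ _ _ _ (m1 a)).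
  apply/esym; apply: (@lebesgue_measure_unique _ (pushforward (@lebesgue_measure R) f)) => //= _ [[x y]] _ <-.
  rewrite /pushforward /= (_ : _ @^-1` _ = `](x - a), (y - a)]%classic); last first.
    by apply/seteqP; split => z /=; rewrite !in_itv /= ltrBlDr lerBrDr.
  by rewrite !lebesgue_measure_itv /= !lte_fin ltrD2r -!EFinB; case: ifP => // _; congr EFin; ring.
move=> mA; pose f : {mfun (M1 * M1)%type >-> (M1 * M1)%type} := HB.pack (fun p : M1 * M1 => pp p c : M1 * M1) (isMeasurableFun.Build _ _ _ _ _ mc).
apply/esym; apply: (@product_measure_unique _ _ _ _ _ _ _ (pushforward PM f)) => // X Y mX mY.
transitivity (PM (((fun x => x + c.1) @^-1` X) `*` ((fun x => x + c.2) @^-1` Y))); first by [].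
have mX' := m1 c.1 measurableT X mX; have mY' := m1 c.2 measurableT Y mY.
rewrite !setTI in mX' mY'.
by rewrite PME// !l1.
Qed.

Lemma meas_shift c : measurable_fun setT ((fun p => pp p c) : M1 * M1 -> M1 * M1).
Proof.
apply: measurable_fun_pair; first by apply: (meas_ct (F := fun p => p.1 + c.1)); apply: ctD ct1 (ct_cst _).
by apply: (meas_ct (F := fun p => p.2 + c.2)); apply: ctD ct2 (ct_cst _).
Qed.

Lemma int_shift c (F : C -> \bar R) : measurable_fun (setT : set (M1 * M1)) F -> (forall p, 0 <= F p)%E ->
  (\int[PM]_p F (pp p c) = \int[PM]_p F p)%E.
Proof.
move=> mF F0.
have := @ge0_integral_pushforward _ _ _ _ _ _ (meas_shift c) PM setT F measurableT mF (fun x _ => F0 x).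
rewrite preimage_setT => <-.
apply: eq_measure_integral => [|mm A mA _]; first exact: meas_shift.
exact: PM_shift.
Qed.

Lemma L_shift c F : L1 PM F -> L1 PM (fun p => F (pp p c)).
Proof.
move=> hF; have mF := L1_meas hF.
have mF' := measurableT_comp mF (meas_shift c).
have h : L1 PM (fun p => `|F (pp p c)|).
  apply: L1_fin => //; first exact: measurableT_comp mF'.
  rewrite (int_shift c (F := fun p => (`|F p|)%:E)) ?EInt ?ltry//; first exact: L1_abs.
  by apply/measurable_EFinP; exact: measurableT_comp mF.
exact: L1_le h.
Qed.

Lemma Int_shift c F : L1 PM F -> Int PM (fun p => F (pp p c)) = Int PM F.
Proof.
have pos G : L1 PM G -> (forall p, 0 <= G p) -> Int PM (fun p => G (pp p c)) = Int PM G.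
  move=> hG G0; apply: EFin_inj; rewrite -!EInt//; last exact: L_shift.
  have mG : measurable_fun (setT : set (M1 * M1)) (fun p => (G p)%:E).
    by apply/measurable_EFinP; exact: L1_meas hG.
  by apply: (int_shift c mG) => p; rewrite lee_fin.
move=> hF.
have h1 : L1 PM (fun p => `|F p| + F p) by apply: L1D (L1_abs hF) hF.
have h2 := L1_abs hF.
have e : forall p, F p = (`|F p| + F p) - `|F p| by move=> p; ring.
rewrite (Int_ext PM e) (Int_ext PM (fun p => e (pp p c))) !IntB//; [|exact: (L_shift c h1)|exact: (L_shift c h2)].
rewrite (pos (fun p => `|F p| + F p))// ?(pos (fun p => `|F p|))// => p.
by have := ler_norm (- F p); rewrite normrN; lra.
Qed.

Lemma ae_shift c (P : C -> Prop) : {ae PM, forall p, P p} -> {ae PM, forall p, P (pp p c)}.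
Proof.
case=> A [mA A0 sA]; exists ((fun p => pp p c) @^-1` A); split.
- by have := meas_shift c measurableT mA; rewrite setTI.
- by rewrite PM_shift.
- by move=> p hp; apply: sA.
Qed.

Lemma Int_sec F : L1 PM F -> (forall y, (\int[@lebesgue_measure R]_x (F (x, y))%:E = 0)%E) -> Int PM F = 0.
Proof.
move=> hF h; apply: EFin_inj; rewrite -EInt//.
apply: etrans (esym (@integral21_prod_meas1 _ _ _ _ _ (@lebesgue_measure R) (@lebesgue_measure R) (EFin \o F) hF)) _.
by rewrite /fubini_G /= integral0_eq// => y _; rewrite h.
Qed.

Lemma Int_sec2 F : L1 PM F -> (forall x, (\int[@lebesgue_measure R]_y (F (x, y))%:E = 0)%E) -> Int PM F = 0.
Proof.
move=> hF h; apply: EFin_inj; rewrite -EInt//.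
apply: etrans (esym (@integral12_prod_meas1 _ _ _ _ _ (@lebesgue_measure R) (@lebesgue_measure R) (EFin \o F) hF)) _.
by rewrite /fubini_F /= integral0_eq// => y _; rewrite h.
Qed.

End Plane.
Global Opaque PM qi.


(** * Test functions and mollification *)

Section Der.
Variable R : realType.
Implicit Types (f g : R -> R) (x y l k : R).

(** The form without quotients covers the increment 0 and passes directly under integrals; [derP]
    identifies it with [is_derive]. *)
Definition der f x l := forall e : R, 0 < e -> exists2 d : R, 0 < d &
  forall h, `|h| < d -> `|f (x + h) - f x - h * l| <= e * `|h|.

Lemma derP f x l : der f x l <-> is_derive (x : R) (1 : R) (f : R -> R) l.
Proof.
split=> [H|[Hd Hl] e e0].
  have c : (fun h : R => h^-1 *: (f (h *: (1:R) + x) - f x)) @ 0^' --> l.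
    apply/cvgrPdist_le => e e0; have [d d0 hd] := H e e0.
    exists d => //= h /=; rewrite sub0r normrN => hh h0.
    have := hd h hh; rewrite scaler1 /GRing.scale /= (addrC h).
    have -> : l - h^-1 * (f (x + h) - f x) = - (h^-1 * (f (x + h) - f x - h * l)) by field.
    rewrite normrN normrM normfV => h1.
    by rewrite mulrC ler_pdivrMr// normr_gt0.
  apply: DeriveDef; first by apply/cvg_ex; exists l.
  exact: cvg_lim c.
have c : (fun h : R => h^-1 *: (f (h *: (1:R) + x) - f x)) @ 0^' --> l.
  by rewrite -Hl; exact: Hd.
have /cvgrPdist_le/(_ e e0)[d /= d0 hd] := c.
exists d => // h hh; have [->|h0] := eqVneq h 0.
  by rewrite addr0 mul0r subrr subr0 normr0 mulr0.
have := hd h; rewrite /= sub0r normrN scaler1 (addrC h) => /(_ hh h0) h1.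
have -> : f (x + h) - f x - h * l = - (h * (l - h^-1 * (f (x + h) - f x))) by field.
rewrite normrN normrM mulrC; exact: ler_wpM2r.
Qed.

Lemma der_uniq f x l k : der f x l -> der f x k -> l = k.
Proof. by move=> /derP h1 /derP h2; rewrite -(@derive_val _ _ _ _ _ _ _ h1) (@derive_val _ _ _ _ _ _ _ h2). Qed.
Lemma der_derive1 f x l : der f x l -> derive1 f x = l.
Proof. by move=> /derP h; rewrite derive1E derive_val. Qed.
Lemma der_derivable f x l : der f x l -> derivable f x 1.
Proof. by move=> /derP []. Qed.
Lemma der_cts f x l : der f x l -> {for x, continuous f}.
Proof.
by move=> /der_derivable h; apply: differentiable_continuous; apply/derivable1_diffP.
Qed.
Lemma der_eql f x l k : der f x l -> l = k -> der f x k.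
Proof. by move=> h <-. Qed.
Lemma der_ext f g x l : (forall y, f y = g y) -> der f x l -> der g x l.
Proof. by move=> /funext ->. Qed.
Lemma der_near f g x l (d : R) : 0 < d -> (forall y, `|y - x| < d -> f y = g y) -> der f x l -> der g x l.
Proof.
move=> d0 hfg H e e0; have [d' d'0 hd] := H e e0.
exists (Num.min d d'); first by rewrite lt_min d0.
move=> h; rewrite lt_min => /andP[h1 h2].
rewrite -!hfg ?subrr ?normr0//; first exact: hd.
by rewrite addrC addKr.
Qed.
Lemma der_cst k x : der (fun=> k) x 0.
Proof. by apply/derP; exact: is_derive_cst. Qed.
Lemma der_id x : der (fun y => y) x 1.
Proof. by apply/derP; exact: is_derive_id. Qed.
Lemma derD f g x l k : der f x l -> der g x k -> der (fun y => f y + g y) x (l + k).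
Proof. by move=> /derP h1 /derP h2; apply/derP; exact: is_deriveD. Qed.
Lemma derN f x l : der f x l -> der (fun y => - f y) x (- l).
Proof. by move=> /derP h1; apply/derP; exact: is_deriveN. Qed.
Lemma derB f g x l k : der f x l -> der g x k -> der (fun y => f y - g y) x (l - k).
Proof. by move=> h1 h2; apply: derD => //; exact: derN. Qed.
Lemma derM f g x l k : der f x l -> der g x k -> der (fun y => f y * g y) x (l * g x + f x * k).
Proof.
move=> /derP h1 /derP h2; have h := is_deriveM h1 h2.
apply/derP; apply: is_derive_eq h _; rewrite /GRing.scale /=; ring.
Qed.
Lemma derZ a f x l : der f x l -> der (fun y => a * f y) x (a * l).
Proof. by move=> h; apply: (der_eql (derM (der_cst a x) h)); ring. Qed.
Lemma der_comp f g x l k : der f (g x) l -> der g x k -> der (fun y => f (g y)) x (l * k).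
Proof. by move=> /derP h1 /derP h2; apply/derP; have := is_derive1_comp h1 h2. Qed.
Lemma derX f x l n : der f x l -> der (fun y => f y ^+ n.+1) x (n.+1%:R * f x ^+ n * l).
Proof.
move=> h; elim: n => [|n ih].
  by apply: der_eql h _; rewrite expr0 !mul1r.
apply: (der_eql (derM h ih)).
by rewrite [in RHS](natrD _ 1 n.+1) exprS; ring.
Qed.
Lemma der_inv x : x != 0 -> der (fun y => y^-1) x (- x ^- 2).
Proof.
move=> x0; have h := @is_deriveV R (@id R) x 1 1 x0 (is_derive_id _ _).
by apply/derP; apply: is_derive_eq h _; rewrite /GRing.scale /= mulr1.
Qed.
Lemma der_exp x : der (fun y => expR y) x (expR x).
Proof. by apply/derP; exact: is_derive_expR. Qed.
Lemma der_sin x : der (fun y => sin y) x (cos x).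
Proof. by apply/derP; exact: is_derive_sin. Qed.
Lemma der_aff a b x : der (fun y => a * y + b) x a.
Proof.
apply: (der_eql (derD (derZ a (der_id x)) (der_cst b x))); ring.
Qed.

Lemma der_mvt f f' (a b : R) : a < b -> (forall x, a <= x <= b -> der f x (f' x)) ->
  exists2 c, a < c < b & f b - f a = f' c * (b - a).
Proof.
move=> ab h; have [||c] := @MVT R f f' a b ab.
- by move=> x; rewrite in_itv /= => /andP[x1 x2]; apply/derP/h; rewrite !ltW.
- apply: continuous_in_subspaceT => x; rewrite inE /= in_itv /= => hx.
  exact: der_cts (h x hx).
by rewrite in_itv /= => hc he; exists c.
Qed.

Lemma der_lip f f' (a b K : R) :
  (forall x, `|x - a| <= `|b - a| -> der f x (f' x)) ->
  (forall x, `|x - a| <= `|b - a| -> `|f' x| <= K) -> `|f b - f a| <= K * `|b - a|.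
Proof.
move=> hd hK; case: (ltgtP a b) => ab.
- have [x hx|c /andP[c1 c2] ->] := @der_mvt f f' a b ab.
    by apply: hd; rewrite !ger0_norm; lra.
  by rewrite normrM ler_wpM2r// hK// !ger0_norm; lra.
- have [x hx|c /andP[c1 c2] e] := @der_mvt f f' b a ab.
    by apply: hd; rewrite !ler0_norm; lra.
  by rewrite distrC e normrM (distrC b) ler_wpM2r// hK// ?ler0_norm ?ger0_norm; lra.
- by rewrite ab !subrr normr0 mulr0.
Qed.

Lemma ftc f f' (a b : R) : a <= b -> continuous f' -> (forall x, der f x (f' x)) ->
  (\int[@lebesgue_measure R]_(x in `[a, b]) (f' x)%:E = (f b - f a)%:E)%E.
Proof.
rewrite le_eqVlt => /predU1P[<- _ _|ab c h].
  by rewrite subrr set_itv1 integral_set1.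
rewrite EFinB; apply: (@continuous_FTC2 R f' f a b ab).
- exact: continuous_subspaceT.
- split; first by move=> x _; exact: der_derivable (h x).
  + by apply: cvg_at_right_filter; exact: der_cts (h a).
  + by apply: cvg_at_left_filter; exact: der_cts (h b).
- by move=> x _; exact: der_derive1 (h x).
Qed.

Lemma int_der_cc f f' (r : R) : continuous f' -> (forall x, der f x (f' x)) ->
  (forall x, r < `|x| -> f x = 0) -> (\int[@lebesgue_measure R]_x (f' x)%:E = 0)%E.
Proof.
move=> c h h0; pose r1 := `|r| + 1.
have r1r : r < r1 by apply: le_lt_trans (ler_norm r) _; rewrite ltrDl.
have r10 : 0 < r1 by rewrite ltr_wpDl.
have z x : r < `|x| -> f' x = 0.
  move=> hx; apply: der_uniq (h x) _; apply: (@der_near (fun=> 0) f x 0 (`|x| - r)); rewrite ?subr_gt0//.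
    move=> y hy; apply/esym/h0; have := ler_normB y (y - x).
    by rewrite (_ : y - (y - x) = x); [lra|ring].
  exact: der_cst.
transitivity (\int[@lebesgue_measure R]_(x in `[(- r1)%R, r1]) (f' x)%:E)%E.
  rewrite [RHS]integral_mkcond; apply: eq_integral => x _.
  rewrite patchE; case: ifPn => //; rewrite mem_setE /= in_itv /= -ler_norml -ltNge => hx.
  by rewrite z//; lra.
rewrite (@ftc f f')//; last by lra.
by rewrite !h0 ?subrr// ?normrN gtr0_norm.
Qed.

(** This asks for [n] successive derivatives, the last without continuity. Taken for all [n] it is
    smoothness, and each finite level is closed under products by plain induction. *)
Fixpoint Cn n f : Prop :=
  if n is m.+1 then exists2 f', (forall x, der f x (f' x)) & Cn m f' else True.

Lemma CnS n f : Cn n.+1 f -> Cn n f.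
Proof. by elim: n f => [//|n ih] f [f' h1 h2]; exists f' => //; exact: ih. Qed.
Lemma Cn_cst n k : Cn n (fun=> k).
Proof. by elim: n k => [//|n ih] k; exists (fun=> 0) => // x; exact: der_cst. Qed.
Lemma CnD n f g : Cn n f -> Cn n g -> Cn n (fun x => f x + g x).
Proof.
elim: n f g => [//|n ih] f g [f' h1 h2] [g' h3 h4].
by exists (fun x => f' x + g' x); [move=> x; exact: derD|exact: ih].
Qed.
Lemma CnM n f g : Cn n f -> Cn n g -> Cn n (fun x => f x * g x).
Proof.
elim: n f g => [//|n ih] f g Hf Hg; have Hf' := CnS Hf; have Hg' := CnS Hg.
case: Hf => f' h1 h2; case: Hg => g' h3 h4.
by exists (fun x => f' x * g x + f x * g' x); [move=> x; exact: derM|apply: CnD; exact: ih].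
Qed.
Lemma Cn_aff n f a b : Cn n f -> Cn n (fun x => f (a * x + b)).
Proof.
elim: n f => [//|n ih] f [f' h1 h2]; exists (fun x => f' (a * x + b) * a).
  by move=> x; apply: (der_comp (f := f) (g := fun x => a * x + b)); [exact: h1|exact: der_aff].
by apply: CnM; [exact: ih|exact: Cn_cst].
Qed.

Definition smooth1 f := forall n, Cn n f.

Lemma smooth1_der f : smooth1 f -> exists2 f', (forall x, der f x (f' x)) & smooth1 f'.
Proof.
move=> h; have [f' h1 _] := h 1; exists f' => // n.
have [g h3 h4] := h n.+1; suff -> : f' = g by [].
by apply/funext => x; exact: der_uniq (h1 x) (h3 x).
Qed.
Lemma smooth1_cts f : smooth1 f -> continuous f.
Proof. by move=> h x; have [f' h1 _] := h 1; exact: der_cts (h1 x). Qed.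

(* The factor [x^-k] makes this family of flat functions stable under differentiation, up to linear combinations. *)
Definition eflat (k : nat) x : R := if 0 < x then x^-1 ^+ k * expR (- x^-1) else 0.

(** With [t = x^-1], the inequality [1 + y <= expR y] at [y = t / k.+1%:R], raised to the power
    [k.+1], gives [t ^+ k.+1 <= k.+1%:R ^+ k.+1 * expR t]. The spare power of [t] pays for the
    factor [x]. *)
Lemma eflat_le (k : nat) : exists2 K, 0 < K & forall x, 0 < x -> eflat k x <= K * x.
Proof.
exists (k.+1%:R ^+ k.+1); first by rewrite exprn_gt0.
move=> x x0; rewrite /eflat x0.
have t0 : 0 < x^-1 by rewrite invr_gt0.
have h : x^-1 ^+ k.+1 <= k.+1%:R ^+ k.+1 * expR (x^-1).
  have -> : expR (x^-1) = expR (x^-1 / k.+1%:R) ^+ k.+1.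
    by rewrite -expRM_natl mulrC divfK.
  rewrite -exprMn; apply: lerXn2r; rewrite ?nnegrE ?ltW// ?mulr_gt0 ?expR_gt0//.
  have := expR_ge1Dx (x^-1 / k.+1%:R).
  have k0 : 0 < k.+1%:R :> R by [].
  move=> h; have : k.+1%:R * (1 + x^-1 / k.+1%:R) <= k.+1%:R * expR (x^-1 / k.+1%:R) by rewrite ler_pM2l.
  by rewrite mulrDr mulrCA mulfV ?gt_eqF// mulr1; lra.
rewrite expRN ler_pdivrMr ?expR_gt0//.
have : x * x^-1 ^+ k.+1 <= x * (k.+1%:R ^+ k.+1 * expR x^-1) by rewrite ler_pM2l.
by rewrite exprS (mulrA x x^-1) mulfV ?gt_eqF// mul1r; lra.
Qed.

Lemma eflat_ge0 (k : nat) x : 0 <= eflat k x.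
Proof. by rewrite /eflat; case: ifP => // x0; rewrite mulr_ge0 ?expR_ge0// exprn_ge0// invr_ge0 ltW. Qed.

Lemma eflat_der (k : nat) x : der (eflat k) x (- k%:R * eflat k.+1 x + eflat k.+2 x).
Proof.
case: (ltgtP 0 x) => [x0|x0|<-].
- apply: (@der_near (fun y => y^-1 ^+ k * expR (- y^-1)) _ x _ x x0).
    move=> y; rewrite ltr_norml => /andP[y1 y2]; rewrite /eflat ifT//; lra.
  have x1 : x != 0 by rewrite gt_eqF.
  have h1 := der_inv x1.
  have h2 : der (fun y => y^-1 ^+ k) x (- k%:R * x^-1 ^+ k.+1).
    case: k => [|k]; first by rewrite oppr0 mul0r; exact: der_cst.
    apply: (der_eql (derX k h1)); rewrite -exprVn expr2 !exprS.
    by move: (k.+1%:R : R) => n; ring.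
  have h3 := der_comp (f := fun y => expR y) (g := fun y => - y^-1) (der_exp (- x^-1)) (derN h1).
  apply: (der_eql (derM h2 h3)); rewrite /eflat x0 !exprS; field.
  by rewrite x1.
- apply: (@der_near (fun=> 0) _ x _ (- x)); first by lra.
    move=> y; rewrite ltr_norml => /andP[y1 y2]; rewrite /eflat ifF//; apply/negbTE; rewrite -leNgt; lra.
  rewrite /eflat !ifF ?mulr0 ?addr0; [exact: der_cst|exact/lt_gtF..].
- rewrite /eflat !ltxx mulr0 addr0 => e e0.
  have [K K0 hK] := eflat_le k.+1.
  exists (e / K); first by rewrite divr_gt0.
  move=> h hh; rewrite add0r ltxx mulr0 !subr0 -/(eflat k h) ger0_norm ?eflat_ge0//.
  case: (ltP 0 h) => h0; last by rewrite /eflat ltNge h0 /= mulr_ge0// ltW.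
  rewrite gtr0_norm// in hh *.
  (* The extracted factor [h], with the linear bound on [eflat k.+1], makes the remainder at 0
     quadratic. *)
  have -> : eflat k h = h * eflat k.+1 h.
    by rewrite /eflat h0 exprS !mulrA mulfV ?gt_eqF// mul1r.
  have h1 : eflat k.+1 h <= e.
    apply: (le_trans (hK _ h0)); rewrite -(ler_pdivlMl _ _ K0) mulrC; exact: ltW.
  by rewrite mulrC ler_pM2r.
Qed.

Lemma eflat_smooth (k : nat) : smooth1 (eflat k).
Proof.
move=> n; elim: n k => [//|n ih] k; exists (fun x => - k%:R * eflat k.+1 x + eflat k.+2 x).
  exact: eflat_der.
by apply: CnD => //; apply: CnM => //; exact: Cn_cst.
Qed.

(** The arguments keep the shape [a * x + b] of [Cn_aff]. One factor vanishes to the left of -1, the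
    other to the right of 1. *)
Definition bump x : R := eflat 0 (1 * x + 1) * eflat 0 (-1 * x + 1).

Lemma bump_smooth : smooth1 bump.
Proof. by move=> n; apply: CnM; apply: Cn_aff; exact: eflat_smooth. Qed.
Lemma bump_ge0 x : 0 <= bump x.
Proof. by rewrite mulr_ge0// eflat_ge0. Qed.
Lemma bump_even x : bump (- x) = bump x.
Proof. by rewrite /bump mulrC; congr (eflat 0 _ * eflat 0 _); ring. Qed.
Lemma bump_out x : 1 <= `|x| -> bump x = 0.
Proof.
rewrite /bump ler_normr => /orP[h|h].
  by rewrite mulrC {1}/eflat ifF ?mul0r//; apply/negbTE; rewrite -leNgt; lra.
by rewrite {1}/eflat ifF ?mul0r//; apply/negbTE; rewrite -leNgt; lra.
Qed.
(** Uniform positivity on the half interval feeds the lower bound [Z_low] on the normalising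
    constants. *)
Lemma bump_low : exists2 b0, 0 < b0 & forall x, `|x| <= 1/2 -> b0 <= bump x.
Proof.
have e1 x : `|x| <= 1 / 2 -> expR (-2) <= eflat 0 (x + 1).
  rewrite ler_norml => /andP[h1 h2]; rewrite /eflat ifT; last by lra.
  rewrite expr0 mul1r ler_expR lerN2 -[leRHS]invrK lef_pV2 ?posrE ?invr_gt0; lra.
exists (expR (-2) * expR (-2)); first by rewrite mulr_gt0 ?expR_gt0.
move=> x hx; rewrite /bump; apply: ler_pM; rewrite ?expR_ge0//.
  by rewrite mul1r e1.
by rewrite mulN1r e1// normrN.
Qed.

End Der.

(** * Integration by parts and convolution *)

Section Conv.
Variable R : realType.
Local Notation C := (R * R)%type.
Local Notation M1 := (measurableTypeR R).
Local Notation L := (L1 (@PM R)).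
Local Notation I := (Int (@PM R)).
Local Notation meas := (measurable_fun (setT : set (M1 * M1))).
Implicit Types (F G u v w : C -> R) (p q c : C) (r s : R).

(** The partial derivatives are arguments and not existential witnesses, so that integrals can name
    and compare them. *)
Definition C1 F Fx Fy := [/\ ct F, ct Fx, ct Fy,
  forall p, der (fun t => F (t, p.2)) p.1 (Fx p) &
  forall p, der (fun t => F (p.1, t)) p.2 (Fy p)].

Lemma C1_ext F Fx Fy G Gx Gy : C1 F Fx Fy -> (forall p, F p = G p) ->
  (forall p, Fx p = Gx p) -> (forall p, Fy p = Gy p) -> C1 G Gx Gy.
Proof. by move=> h /funext <- /funext <- /funext <-. Qed.
Lemma C1_cst (k : R) : C1 (fun=> k) (fun=> 0) (fun=> 0).
Proof. by split; try exact: ct_cst; move=> p; exact: der_cst. Qed.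
Lemma C1_fst : C1 fst (fun=> 1) (fun=> 0).
Proof.
by split; [exact: ct1|exact: ct_cst|exact: ct_cst|move=> p; exact: der_id|move=> p; exact: der_cst].
Qed.
Lemma C1_snd : C1 snd (fun=> 0) (fun=> 1).
Proof.
by split; [exact: ct2|exact: ct_cst|exact: ct_cst|move=> p; exact: der_cst|move=> p; exact: der_id].
Qed.
Lemma C1_add F Fx Fy G Gx Gy : C1 F Fx Fy -> C1 G Gx Gy ->
  C1 (fun p => F p + G p) (fun p => Fx p + Gx p) (fun p => Fy p + Gy p).
Proof.
move=> [a1 a2 a3 a4 a5] [b1 b2 b3 b4 b5]; split; try exact: ctD.
  by move=> p; exact: derD.
by move=> p; exact: derD.
Qed.
Lemma C1_mul F Fx Fy G Gx Gy : C1 F Fx Fy -> C1 G Gx Gy ->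
  C1 (fun p => F p * G p) (fun p => Fx p * G p + F p * Gx p) (fun p => Fy p * G p + F p * Gy p).
Proof.
move=> [a1 a2 a3 a4 a5] [b1 b2 b3 b4 b5]; split.
- exact: ctM.
- by apply: ctD; exact: ctM.
- by apply: ctD; exact: ctM.
- by move=> [x y]; exact: (derM (a4 (x, y)) (b4 (x, y))).
- by move=> [x y]; exact: (derM (a5 (x, y)) (b5 (x, y))).
Qed.
Lemma C1_scale (k : R) F Fx Fy : C1 F Fx Fy ->
  C1 (fun p => k * F p) (fun p => k * Fx p) (fun p => k * Fy p).
Proof.
move=> h; apply: (C1_ext (C1_mul (C1_cst k) h)) => // p; ring.
Qed.
Lemma C1_opp F Fx Fy : C1 F Fx Fy -> C1 (fun p => - F p) (fun p => - Fx p) (fun p => - Fy p).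
Proof. by move=> h; apply: (C1_ext (C1_scale (-1) h)) => p; rewrite mulN1r. Qed.
Lemma C1_sub F Fx Fy G Gx Gy : C1 F Fx Fy -> C1 G Gx Gy ->
  C1 (fun p => F p - G p) (fun p => Fx p - Gx p) (fun p => Fy p - Gy p).
Proof. by move=> h1 h2; exact: C1_add h1 (C1_opp h2). Qed.
Lemma C1_comp1 (h h' : R -> R) F Fx Fy : continuous h' -> (forall x, der h x (h' x)) ->
  C1 F Fx Fy -> C1 (fun p => h (F p)) (fun p => h' (F p) * Fx p) (fun p => h' (F p) * Fy p).
Proof.
move=> ch dh [a1 a2 a3 a4 a5]; split.
- by apply: ct_comp1 a1 => x; exact: der_cts (dh x).
- by apply: ctM => //; exact: ct_comp1 ch a1.
- by apply: ctM => //; exact: ct_comp1 ch a1.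
- by move=> [x y]; exact: (der_comp (dh _) (a4 (x, y))).
- by move=> [x y]; exact: (der_comp (dh _) (a5 (x, y))).
Qed.
Lemma der_shiftarg (f : R -> R) (x c l : R) : der f (x + c) l -> der (fun y => f (y + c)) x l.
Proof.
move=> h; have := der_comp (f := f) (g := fun y => 1 * y + c) (x := x) (l := l) (k := 1).
rewrite mul1r => /(_ h (der_aff 1 c x)); rewrite mulr1.
by apply: der_ext => y; rewrite mul1r.
Qed.
Lemma C1_shift c F Fx Fy : C1 F Fx Fy ->
  C1 (fun p => F (pp p c)) (fun p => Fx (pp p c)) (fun p => Fy (pp p c)).
Proof.
move=> [a1 a2 a3 a4 a5]; split; try exact: ct_shift.
  by move=> p; exact: der_shiftarg (a4 (pp p c)).
by move=> p; exact: der_shiftarg (a5 (pp p c)).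
Qed.

Lemma bs_der r F Fx Fy : C1 F Fx Fy -> bs r F -> bs r Fx /\ bs r Fy.
Proof.
move=> [a1 a2 a3 a4 a5] hb; split=> -[x y] hp.
- apply: der_uniq (a4 (x, y)) _.
  apply: (@der_near _ (fun=> 0) _ _ _ (nm (x, y) - r)); rewrite ?subr_gt0//; last exact: der_cst.
  move=> t ht; apply/esym/hb; have := nm_tri (t, y) (x, y) (0, 0).
  rewrite !pm0 nmN => h; have : nm (pm (t, y) (x, y)) < nm (x, y) - r.
    by rewrite nm_lt /= ht subrr normr0 subr_gt0.
  lra.
- apply: der_uniq (a5 (x, y)) _.
  apply: (@der_near _ (fun=> 0) _ _ _ (nm (x, y) - r)); rewrite ?subr_gt0//; last exact: der_cst.
  move=> t ht; apply/esym/hb; have := nm_tri (x, t) (x, y) (0, 0).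
  rewrite !pm0 nmN => h; have : nm (pm (x, t) (x, y)) < nm (x, y) - r.
    by rewrite nm_lt /= ht subrr normr0 subr_gt0 hp.
  lra.
Qed.

Lemma IBPx r F Fx Fy : C1 F Fx Fy -> bs r F -> I Fx = 0.
Proof.
move=> h hb; have [bx _] := bs_der h hb; case: h => a1 a2 a3 a4 a5.
apply: Int_sec; first exact: (L_cc a2 bx).
move=> y; apply: (@int_der_cc R (fun x => F (x, y)) (fun x => Fx (x, y)) r).
- exact: ct_secx.
- by move=> x; exact: a4 (x, y).
- by move=> x hx; apply: hb; apply: lt_le_trans hx (nm1 (x, y)).
Qed.
Lemma IBPy r F Fx Fy : C1 F Fx Fy -> bs r F -> I Fy = 0.
Proof.
move=> h hb; have [_ bx] := bs_der h hb; case: h => a1 a2 a3 a4 a5.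
apply: Int_sec2; first exact: (L_cc a3 bx).
move=> x; apply: (@int_der_cc R (fun y => F (x, y)) (fun y => Fy (x, y)) r).
- exact: ct_secy.
- by move=> y; exact: a5 (x, y).
- by move=> y hx; apply: hb; apply: lt_le_trans hx (nm2 (x, y)).
Qed.

Lemma bs_mono r s F : r <= s -> bs r F -> bs s F.
Proof. by move=> rs h p hp; apply: h; exact: le_lt_trans hp. Qed.

Lemma cc_unif F r (e : R) : ct F -> bs r F -> 0 < e -> exists2 d : R, 0 < d &
  forall p q, nm (pm q p) < d -> `|F q - F p| < e.
Proof.
move=> cF hb e0; have [d d0 hd] := ct_unif (r + 1) cF e0.
exists (Num.min d 1); first by rewrite lt_min d0 ltr01.
move=> p q; rewrite lt_min => /andP[h1 h2]; case: (leP (nm p) (r + 1)) => hp; first exact: hd.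
rewrite !hb ?subrr ?normr0//; first by lra.
by have := nm_tri p q (0, 0); rewrite !pm0; have := nm_tri q p (0, 0); rewrite !pm0 nmN; lra.
Qed.

(** By the mean value theorem and the uniform continuity of [Fx], the first-order remainder is small
    uniformly in [p]. This is what allows differentiation under the integral, for [conv] and later
    for the degree. *)
Lemma C1_unifx F Fx Fy r (e : R) : C1 F Fx Fy -> bs r F -> 0 < e -> exists2 d : R, 0 < d &
  forall p h, `|h| < d -> `|F (p.1 + h, p.2) - F p - h * Fx p| <= e * `|h|.
Proof.
move=> hF hb e0; have [bx _] := bs_der hF hb; case: hF => a1 a2 a3 a4 a5.
have [d d0 hd] := cc_unif a2 bx e0; exists d => // -[x y] h hh /=.
have := @der_lip R (fun t => F (t, y) - Fx (x, y) * t) (fun t => Fx (t, y) - Fx (x, y)) x (x + h) e.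
rewrite addrAC subrr add0r => H.
have -> : F (x + h, y) - F (x, y) - h * Fx (x, y) =
  F (x + h, y) - Fx (x, y) * (x + h) - (F (x, y) - Fx (x, y) * x) by ring.
apply: H => t ht.
  apply: derB; first exact: a4 (t, y).
  by apply: (der_eql (derZ (Fx (x, y)) (der_id t))); rewrite mulr1.
apply/ltW/hd; rewrite nm_lt /= subrr normr0 d0 andbT; exact: le_lt_trans hh.
Qed.
Lemma C1_unify F Fx Fy r (e : R) : C1 F Fx Fy -> bs r F -> 0 < e -> exists2 d : R, 0 < d &
  forall p h, `|h| < d -> `|F (p.1, p.2 + h) - F p - h * Fy p| <= e * `|h|.
Proof.
move=> hF hb e0; have [_ bx] := bs_der hF hb; case: hF => a1 a2 a3 a4 a5.
have [d d0 hd] := cc_unif a3 bx e0; exists d => // -[x y] h hh /=.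
have := @der_lip R (fun t => F (x, t) - Fy (x, y) * t) (fun t => Fy (x, t) - Fy (x, y)) y (y + h) e.
rewrite addrAC subrr add0r => H.
have -> : F (x, y + h) - F (x, y) - h * Fy (x, y) =
  F (x, y + h) - Fy (x, y) * (y + h) - (F (x, y) - Fy (x, y) * y) by ring.
apply: H => t ht.
  apply: derB; first exact: a5 (x, t).
  by apply: (der_eql (derZ (Fy (x, y)) (der_id t))); rewrite mulr1.
by apply/ltW/hd; rewrite nm_lt /= subrr normr0 d0 /=; exact: le_lt_trans hh.
Qed.

(** Local integrability, tested on squares. *)
Definition Ll u := meas u /\ forall r, L (fun p => `|u p| * qi r p).

Lemma Ll_bs u F r : Ll u -> ct F -> bs r F -> L (fun p => u p * F p).
Proof.
move=> [mu hu] cF hb; have [K K0 hK] := bs_bounded cF hb.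
apply: (@L1_le _ _ _ (@PM R) (fun p => K * (`|u p| * qi r p))); last exact: L1Z (hu r).
  by apply: measurable_funM => //; exact: meas_ct.
move=> p; rewrite normrM; case: (leP (nm p) r) => h.
  by rewrite qi1// mulr1 mulrC ler_wpM2r.
by rewrite qi0// hb// normr0 !mulr0.
Qed.

Lemma ct_Ll u : ct u -> Ll u.
Proof.
move=> cu; split; first exact: meas_ct.
move=> r; have [K K0 hK] := ct_bounded r cu.
apply: (@L_bs _ r K); first by apply: measurable_funM; [exact: meas_ct (ct_norm cu)|exact: meas_qi].
  by move=> p h; rewrite qi0// mulr0.
move=> p; case: (leP (nm p) r) => h; first by rewrite qi1// mulr1 normr_id hK.
by rewrite qi0// mulr0 normr0 ltW.
Qed.

Definition conv u F p := I (fun q => u q * F (pm p q)).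

Lemma ct_refl F p : ct F -> ct (fun q => F (pm p q)).
Proof.
move=> h; apply: (ct_comp2 (u := fun q => p.1 - q.1) (v := fun q => p.2 - q.2)) => //.
  by apply: ctB; [exact: ct_cst|exact: ct1].
by apply: ctB; [exact: ct_cst|exact: ct2].
Qed.
Lemma bs_refl F p s : bs s F -> bs (nm p + s) (fun q => F (pm p q)).
Proof.
move=> h q hq; apply: h; have := nm_tri p q (0, 0); rewrite !pm0 nmN; lra.
Qed.
Lemma conv_L u F p s : Ll u -> ct F -> bs s F -> L (fun q => u q * F (pm p q)).
Proof. by move=> hu cF hb; exact: (Ll_bs hu (ct_refl p cF) (bs_refl (p := p) hb)). Qed.

Lemma conv_bound u (F : C -> R) p s K r : Ll u -> ct F -> bs s F -> 0 <= K -> nm p + s <= r ->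
  (forall q, `|F q| <= K) -> `|conv u F p| <= K * I (fun q => `|u q| * qi r q).
Proof.
move=> hu cF hb K0 hr hK; rewrite -IntZ; last by case: hu.
apply: Int_abs_le; [exact: conv_L hu cF hb|by apply: L1Z; case: hu|].
move=> q; rewrite normrM; case: (leP (nm q) r) => h.
  by rewrite qi1// mulr1 mulrC ler_wpM2r.
by rewrite (bs_refl (p := p) hb) ?normr0 ?mulr0 ?qi0 ?mulr0//; exact: le_lt_trans h.
Qed.

Lemma convD u F G p s : Ll u -> ct F -> bs s F -> ct G -> bs s G ->
  conv u (fun q => F q + G q) p = conv u F p + conv u G p.
Proof.
move=> hu cF bF cG bG; rewrite /conv -IntD; [|exact: conv_L bF|exact: conv_L bG].
by apply: Int_ext => q; rewrite mulrDr.
Qed.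
Lemma convZ u F p s (k : R) : Ll u -> ct F -> bs s F ->
  conv u (fun q => k * F q) p = k * conv u F p.
Proof.
move=> hu cF bF; rewrite /conv -IntZ; last exact: conv_L bF.
by apply: Int_ext => q; rewrite mulrCA.
Qed.

Lemma conv_shift u F p c : conv u (fun q => F (pp q c)) p = conv u F (pp p c).
Proof. by apply: Int_ext => q; congr (_ * F _); rewrite /pp /pm /=; congr (_, _); ring. Qed.

Lemma bs_shift F s c : bs s F -> bs (s + nm c) (fun q => F (pp q c)).
Proof.
move=> h q hq; apply: h; have := nmB (pp q c) c; rewrite pmD; lra.
Qed.

Lemma conv_ct u F s : Ll u -> ct F -> bs s F -> ct (conv u F).
Proof.
move=> hu cF hb p e e0.
(* Mass of [u] on a square that holds the support of every kernel centred at [p] and translated by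
   less than 1. *)
pose A := I (fun q => `|u q| * qi (nm p + s + 1) q).
have A0 : 0 <= A by apply: Int_ge0 => q; rewrite mulr_ge0//; case/andP: (qi01 (nm p + s + 1) q).
have [d d0 hd] := cc_unif cF hb (divr_gt0 e0 (ltr_wpDl A0 ltr01)).
exists (Num.min d 1); first by rewrite lt_min d0 ltr01.
move=> q; rewrite lt_min => /andP[q1 q2].
have -> : q = pp p (pm q p) by rewrite ppC ppB.
rewrite -conv_shift; set c := pm q p.
have bF' : bs (s + 1) (fun z => F (pp z c)) by apply: bs_mono (bs_shift hb); rewrite lerD2l ltW.
have bF : bs (s + 1) F by apply: bs_mono hb; rewrite lerDl.
rewrite -[X in _ - X]mul1r -mulNr -(convZ _ _ hu cF bF) -(convD _ hu (ct_shift c cF) bF' (ctZ (-1) cF)); last first.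
  by move=> z hz; rewrite bF// mulr0.
have : `|conv u (fun z => F (pp z c) + -1 * F z) p| <= (e / (A + 1)) * A.
  apply: (@conv_bound _ _ _ (s + 1)) => //.
  - by apply: ctD; [exact: ct_shift|exact: ctZ].
  - by move=> z hz; rewrite bF'// bF// mulr0 addr0.
  - by rewrite divr_ge0 ?ltW// ltr_wpDl.
  - by rewrite addrA.
  - move=> z; rewrite mulN1r; apply/ltW/hd.
    by have -> : pm (pp z c) z = c by rewrite ppC pmD.
move=> h; apply: le_lt_trans h _; rewrite -mulrA gtr_pMr// mulrC ltr_pdivrMr ?mul1r; lra.
Qed.

(** A translate of [conv u F] is a convolution with the translated kernel. Its first-order remainder
    is thus [u] convolved with the remainder of [F], which is uniformly small; all the regularity
    comes from the kernel. *)
Lemma conv_C1 u F Fx Fy s : Ll u -> C1 F Fx Fy -> bs s F ->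
  C1 (conv u F) (conv u Fx) (conv u Fy).
Proof.
move=> hu hF hb; have [bx by_] := bs_der hF hb.
have [a1 a2 a3 a4 a5] := hF.
split; [exact: conv_ct hb|exact: conv_ct bx|exact: conv_ct by_| |].
- move=> p e e0.
  pose A := I (fun q => `|u q| * qi (nm p + s + 1) q).
  have A0 : 0 <= A by apply: Int_ge0 => q; rewrite mulr_ge0//; case/andP: (qi01 (nm p + s + 1) q).
  have e1 : 0 < e / (A + 1) by rewrite divr_gt0// ltr_wpDl.
  have [d d0 hd] := C1_unifx hF hb e1.
  exists (Num.min d 1); first by rewrite lt_min d0 ltr01.
  move=> h; rewrite lt_min => /andP[h1 h2].
  pose c : C := (h, 0).
  have nc : nm c = `|h| by rewrite /nm /= normr0 max_l.
  have bF' : bs (s + 1) (fun z => F (pp z c)) by apply: bs_mono (bs_shift hb); rewrite lerD2l nc ltW.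
  have bF : bs (s + 1) F by apply: bs_mono hb; rewrite lerDl.
  have bFx : bs (s + 1) Fx by apply: bs_mono bx; rewrite lerDl.
  have -> : (p.1 + h, p.2) = pp p c by rewrite /pp /= addr0.
  rewrite -conv_shift.
  have -> : conv u (fun q => F (pp q c)) p - conv u F (p.1, p.2) - h * conv u Fx p =
    conv u (fun z => F (pp z c) + (-1) * F z + (- h) * Fx z) p.
    rewrite (@convD _ _ _ _ (s + 1))//; first rewrite (@convD _ _ _ _ (s + 1))//; first rewrite (@convZ _ _ _ (s + 1))// (@convZ _ _ _ (s + 1))// -surjective_pairing; first by ring.
    - exact: ct_shift.
    - exact: ctZ.
    - by move=> z hz; rewrite bF// mulr0.
    - by apply: ctD; [exact: ct_shift|exact: ctZ].
    - by move=> z hz; rewrite bF'// bF// mulr0 addr0.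
    - exact: ctZ.
    - by move=> z hz; rewrite bFx// mulr0.
  have : `|conv u (fun z => F (pp z c) + -1 * F z + (- h) * Fx z) p| <= (e / (A + 1) * `|h|) * A.
    apply: (@conv_bound _ _ _ (s + 1)) => //.
    - by apply: ctD; [apply: ctD; [exact: ct_shift|exact: ctZ]|exact: ctZ].
    - by move=> z hz; rewrite bF'// bF// bFx// !mulr0 !addr0.
    - by rewrite mulr_ge0// ltW.
    - by rewrite addrA.
    - by move=> z; have := hd z h h1; rewrite /pp /= addr0 mulN1r mulNr.
  move=> H; apply: le_trans H _; rewrite mulrAC ler_wpM2r// -mulrA ler_piMr ?(ltW e0)//.
  by rewrite mulrC ler_pdivrMr ?mul1r ?lerDl// ltr_wpDl.
- move=> p e e0.
  pose A := I (fun q => `|u q| * qi (nm p + s + 1) q).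
  have A0 : 0 <= A by apply: Int_ge0 => q; rewrite mulr_ge0//; case/andP: (qi01 (nm p + s + 1) q).
  have e1 : 0 < e / (A + 1) by rewrite divr_gt0// ltr_wpDl.
  have [d d0 hd] := C1_unify hF hb e1.
  exists (Num.min d 1); first by rewrite lt_min d0 ltr01.
  move=> h; rewrite lt_min => /andP[h1 h2].
  pose c : C := (0, h).
  have nc : nm c = `|h| by rewrite /nm /= normr0 max_r.
  have bF' : bs (s + 1) (fun z => F (pp z c)) by apply: bs_mono (bs_shift hb); rewrite lerD2l nc ltW.
  have bF : bs (s + 1) F by apply: bs_mono hb; rewrite lerDl.
  have bFx : bs (s + 1) Fy by apply: bs_mono by_; rewrite lerDl.
  have -> : (p.1, p.2 + h) = pp p c by rewrite /pp /= addr0.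
  rewrite -conv_shift.
  have -> : conv u (fun q => F (pp q c)) p - conv u F (p.1, p.2) - h * conv u Fy p =
    conv u (fun z => F (pp z c) + (-1) * F z + (- h) * Fy z) p.
    rewrite (@convD _ _ _ _ (s + 1))//; first rewrite (@convD _ _ _ _ (s + 1))//; first rewrite (@convZ _ _ _ (s + 1))// (@convZ _ _ _ (s + 1))// -surjective_pairing; first by ring.
    - exact: ct_shift.
    - exact: ctZ.
    - by move=> z hz; rewrite bF// mulr0.
    - by apply: ctD; [exact: ct_shift|exact: ctZ].
    - by move=> z hz; rewrite bF'// bF// mulr0 addr0.
    - exact: ctZ.
    - by move=> z hz; rewrite bFx// mulr0.
  have : `|conv u (fun z => F (pp z c) + -1 * F z + (- h) * Fy z) p| <= (e / (A + 1) * `|h|) * A.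
    apply: (@conv_bound _ _ _ (s + 1)) => //.
    - by apply: ctD; [apply: ctD; [exact: ct_shift|exact: ctZ]|exact: ctZ].
    - by move=> z hz; rewrite bF'// bF// bFx// !mulr0 !addr0.
    - by rewrite mulr_ge0// ltW.
    - by rewrite addrA.
    - by move=> z; have := hd z h h1; rewrite /pp /= addr0 mulN1r mulNr.
  move=> H; apply: le_trans H _; rewrite mulrAC ler_wpM2r// -mulrA ler_piMr ?(ltW e0)//.
  by rewrite mulrC ler_pdivrMr ?mul1r ?lerDl// ltr_wpDl.
Qed.

End Conv.

Section Mollifier.
Variable R : realType.
Local Notation C := (R * R)%type.
Local Notation M1 := (measurableTypeR R).
Local Notation L := (L1 (@PM R)).
Local Notation I := (Int (@PM R)).
Local Notation meas := (measurable_fun (setT : set (M1 * M1))).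
Implicit Types (F G u v w h : C -> R) (p q c : C) (r s : R).

Definition tens (f g : R -> R) p := f p.1 * g p.2.

Lemma C1_tens (f f' g g' : R -> R) : continuous f' -> continuous g' ->
  (forall x, der f x (f' x)) -> (forall x, der g x (g' x)) ->
  C1 (tens f g) (tens f' g) (tens f g').
Proof.
move=> cf cg df dg.
have h := C1_mul (C1_comp1 cf df (@C1_fst R)) (C1_comp1 cg dg (@C1_snd R)).
by apply: (C1_ext h) => p; rewrite /tens; ring.
Qed.

(** Tensor products are stable under partial derivatives, so smoothness of the mollifier reduces to
    one variable by induction on the list of derivatives. *)
Lemma pds_tens (f g : R -> R) l : smooth1 f -> smooth1 g ->
  exists f' g', [/\ smooth1 f', smooth1 g' & pds l (tens f g) = tens f' g'].
Proof.
move=> sf sg; elim: l => [|b l [f1 [g1 [sf1 sg1 e]]]]; first by exists f, g.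
have [f2 df2 sf2] := smooth1_der sf1; have [g2 dg2 sg2] := smooth1_der sg1.
case: b; [exists f2, g1|exists f1, g2]; split=> //=; rewrite -/(pds l _) e; apply/funext => p; rewrite /pd /tens /=.
  by apply: der_derive1; apply: (der_eql (derM (df2 p.1) (der_cst (g1 p.2) p.1))); ring.
by apply: der_derive1; apply: (der_eql (derM (der_cst (f1 p.1) p.2) (dg2 p.2))); ring.
Qed.

Lemma smooth_tens (f g : R -> R) : smooth1 f -> smooth1 g -> smooth (tens f g).
Proof.
move=> sf sg l; have [f1 [g1 [sf1 sg1 ->]]] := pds_tens l sf sg.
have [f2 df2 sf2] := smooth1_der sf1; have [g2 dg2 sg2] := smooth1_der sg1.
have [c0 _ _ dx dy] := C1_tens (smooth1_cts sf2) (smooth1_cts sg2) df2 dg2.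
split; first exact/ctP.
by move=> [] p; [exact: der_derivable (dx p)|exact: der_derivable (dy p)].
Qed.

Definition bb s p := bump (p.1 / s) * bump (p.2 / s).
Definition Z s := I (bb s).
Definition rho s p := (Z s)^-1 * bb s p.

Lemma bump_scale s : smooth1 (fun x => bump (x / s)).
Proof.
move=> n; rewrite (_ : (fun x => _) = (fun x => bump (s^-1 * x + 0))).
  by apply: Cn_aff; exact: bump_smooth.
by apply/funext => x; rewrite addr0 mulrC.
Qed.
Lemma bb_ct s : ct (bb s).
Proof.
have [f' df sf] := smooth1_der (bump_scale s).
by have [] := C1_tens (smooth1_cts sf) (smooth1_cts sf) df df.
Qed.
Lemma bb_bs s : 0 < s -> bs s (bb s).
Proof.
move=> s0 p; rewrite /nm lt_max /bb => /orP[h|h].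
  by rewrite bump_out ?mul0r// normrM normfV (gtr0_norm s0) ler_pdivlMr// mul1r ltW.
by rewrite mulrC bump_out ?mul0r// normrM normfV (gtr0_norm s0) ler_pdivlMr// mul1r ltW.
Qed.
Lemma bb_ge0 s p : 0 <= bb s p.
Proof. by rewrite mulr_ge0// bump_ge0. Qed.
(** The order [s ^+ 2] is what bounds the gradient of [rho s] by a multiple of [s ^- 3] in
    [rho_grad_bd]. *)
Lemma Z_low : exists2 b : R, 0 < b & forall s, 0 < s -> b * s ^+ 2 <= Z s.
Proof.
have [b0 b00 hb] := bump_low R; exists (b0 ^+ 2); first by rewrite exprn_gt0.
move=> s s0; have -> : b0 ^+ 2 * s ^+ 2 = I (fun p => b0 ^+ 2 * qi (s / 2) p).
  by rewrite IntZ ?Int_qi; [field|lra|exact: L_qi].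
apply: Int_le; [by apply: L1Z; exact: L_qi|exact: L_cc (bb_ct s) (bb_bs s0)|].
move=> p; case: (leP (nm p) (s / 2)) => h; last by rewrite qi0// mulr0 bb_ge0.
rewrite qi1// mulr1 expr2; apply: ler_pM; rewrite ?(ltW b00)//; apply: hb;
  rewrite normrM normfV (gtr0_norm s0) ler_pdivrMr//.
  by apply: le_trans (nm1 p) _; lra.
by apply: le_trans (nm2 p) _; lra.
Qed.
Lemma Z_gt0 s : 0 < s -> 0 < Z s.
Proof.
by move=> s0; have [b b0 h] := Z_low; apply: lt_le_trans (h s s0); rewrite mulr_gt0// exprn_gt0.
Qed.
Lemma rho_ct s : ct (rho s).
Proof. by apply: ctZ; exact: bb_ct. Qed.
Lemma rho_bs s : 0 < s -> bs s (rho s).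
Proof. by move=> s0 p h; rewrite /rho bb_bs// mulr0. Qed.
Lemma rho_ge0 s p : 0 < s -> 0 <= rho s p.
Proof. by move=> s0; rewrite mulr_ge0 ?bb_ge0// invr_ge0 ltW// Z_gt0. Qed.
Lemma rho_even s p q : rho s (pm p q) = rho s (pm q p).
Proof.
rewrite /rho /bb /=; congr (_ * (_ * _)); by rewrite -[in LHS]opprB mulNr bump_even.
Qed.
Lemma Int_rho s : 0 < s -> I (rho s) = 1.
Proof.
move=> s0; rewrite IntZ ?mulVf ?gt_eqF ?Z_gt0//.
exact: L_cc (bb_ct s) (bb_bs s0).
Qed.
Lemma L_rho s p : 0 < s -> L (fun q => rho s (pm p q)).
Proof. by move=> s0; exact: L_cc (ct_refl p (rho_ct s)) (bs_refl (p := p) (rho_bs s0)). Qed.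
Lemma Int_rho_refl s p : 0 < s -> I (fun q => rho s (pm p q)) = 1.
Proof.
move=> s0; rewrite -(Int_rho s0) -(Int_shift (pm (0, 0) p) (L_cc (rho_ct s) (rho_bs s0))).
apply: Int_ext => q; rewrite rho_even; congr rho; rewrite /pp /pm /=; congr (_, _); ring.
Qed.

Lemma rho_jet s : 0 < s -> exists rx ry rxx rxy ryy,
  [/\ C1 (rho s) rx ry, C1 rx rxx rxy, C1 ry rxy ryy, bs s rx & bs s ry].
Proof.
move=> s0; have [f1 d1 s1] := smooth1_der (bump_scale s).
have [f2 d2 s2] := smooth1_der s1.
have h0 := C1_scale (Z s)^-1 (C1_tens (smooth1_cts s1) (smooth1_cts s1) d1 d1).
have h1 := C1_scale (Z s)^-1 (C1_tens (smooth1_cts s2) (smooth1_cts s1) d2 d1).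
have h2 := C1_scale (Z s)^-1 (C1_tens (smooth1_cts s1) (smooth1_cts s2) d1 d2).
have [b1 b2] := bs_der h0 (rho_bs s0).
by do 5 eexists; split; [exact: h0|exact: h1|exact: h2|exact: b1|exact: b2].
Qed.

Lemma rho_test s p : 0 < s -> test_fun (fun q => rho s (pm p q)).
Proof.
move=> s0; split.
  rewrite (_ : (fun q => _) = tens (fun x => (Z s)^-1 * bump ((- s^-1) * x + p.1 / s)) (fun x => bump ((- s^-1) * x + p.2 / s))).
    apply: smooth_tens => n; last by apply: Cn_aff; exact: bump_smooth.
    by apply: CnM; [exact: Cn_cst|apply: Cn_aff; exact: bump_smooth].
  apply/funext => q; rewrite /rho /bb /tens /= mulrA; congr (_ * bump _ * bump _); ring.
exists (nm p + s) => q h; apply: (bs_refl (p := p) (rho_bs s0)).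
by rewrite /nm lt_max; case: h => ->; rewrite ?orbT.
Qed.

(** Local square integrability, tested on squares. *)
Definition L2l u := meas u /\ forall r, L (fun p => u p ^+ 2 * qi r p).

Lemma L2l_Ll u : L2l u -> Ll u.
Proof.
move=> [mu hu]; split=> // r.
apply: (@L1_le _ _ _ (@PM R) (fun p => u p ^+ 2 * qi r p + qi r p)).
- by apply: measurable_funM; [exact: measurableT_comp|exact: meas_qi].
- move=> p; have /andP[q0 q1] := qi01 r p.
  rewrite normrM normr_id (ger0_norm q0) -[X in _ + X]mul1r -mulrDl ler_wpM2r//.
  have e : `|u p| ^+ 2 = u p ^+ 2 by rewrite -normrX ger0_norm ?sqr_ge0.
  by rewrite -e; nra.
- by apply: L1D; [exact: hu|exact: L_qi].
Qed.

Lemma locL2_L2l u : locL2 u -> L2l u.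
Proof.
Transparent PM.
move=> [mu hu]; split=> // r; apply: L1_fin.
- apply: measurable_funM; last exact: meas_qi.
  by apply: measurable_funX.
- by move=> p; rewrite mulr_ge0 ?sqr_ge0//; case/andP: (qi01 r p).
apply: le_lt_trans (hu r); rewrite [leRHS]integral_mkcond.
rewrite le_eqVlt; apply/orP; left; apply/eqP; apply: eq_integral => p _.
rewrite patchE; case: ifPn => [|h].
  by rewrite inE /box /= => -[h1 h2]; rewrite qi1 ?mulr1// nm_le h1.
rewrite qi0 ?mulr0// ltNge; apply: contra h; rewrite nm_le => /andP[h1 h2].
by rewrite inE.
Qed.
Opaque PM.

Lemma weak_I u g phi b : Ll u -> Ll g -> weak_pd b u g -> test_fun phi ->
  L (fun p => u p * pd b phi p) -> L (fun p => g p * phi p) ->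
  I (fun p => u p * pd b phi p) = - I (fun p => g p * phi p).
Proof.
move=> hu hg hw ht h1 h2; have := hw phi ht.
have e (F : C -> R) : (\int[mu2 (R := R)]_p (F p)%:E)%E = (\int[@PM R]_p (F p)%:E)%E by [].
rewrite !e (EInt h1) (EInt h2) -EFinN.
by move=> H; apply: EFin_inj.
Qed.

(** The reflected kernel centred at [p] is a test function; the weak derivative tested against it
    moves the derivative from the kernel to [u]. *)
Lemma weak_conv u g (b : bool) s rx ry p : 0 < s -> Ll u -> Ll g -> weak_pd b u g ->
  C1 (rho s) rx ry -> conv u (if b then rx else ry) p = conv g (rho s) p.
Proof.
move=> s0 hu hg hw hC; have [bx by_] := bs_der hC (rho_bs s0).
case: hC => a1 a2 a3 a4 a5.
have e q : pd b (fun q => rho s (pm p q)) q = - (if b then rx else ry) (pm p q).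
  rewrite /pd; case: b {hw} => /=; apply: der_derive1.
    have := @der_comp _ (fun t => rho s (t, p.2 - q.2)) (fun t => -1 * t + p.1) q.1 (rx (pm p q)) (-1).
    rewrite mulrN1; move=> H; apply: (der_ext _ (H _ (der_aff _ _ _))).
      by move=> y; rewrite /pm /=; congr (rho s (_, _)); ring.
    by rewrite (_ : -1 * q.1 + p.1 = p.1 - q.1); [exact: (a4 (pm p q))|rewrite mulN1r addrC].
  have := @der_comp _ (fun t => rho s (p.1 - q.1, t)) (fun t => -1 * t + p.2) q.2 (ry (pm p q)) (-1).
  rewrite mulrN1; move=> H; apply: (der_ext _ (H _ (der_aff _ _ _))).
    by move=> y; rewrite /pm /=; congr (rho s (_, _)); ring.
  by rewrite (_ : -1 * q.2 + p.2 = p.2 - q.2); [exact: (a5 (pm p q))|rewrite mulN1r addrC].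
have cx : ct (if b then rx else ry) by case: b {e hw}.
have bx' : bs s (if b then rx else ry) by case: b {e hw cx}.
have h1 := conv_L p hu cx bx'.
have h2 := conv_L p hg a1 (rho_bs s0).
have h1' : L (fun q => u q * pd b (fun q => rho s (pm p q)) q).
  by apply: L1_ext (L1N h1) => q; rewrite e mulrN.
have := weak_I hu hg hw (rho_test p s0) h1' h2.
rewrite (@Int_ext _ _ _ (@PM R) _ (fun q => - (u q * (if b then rx else ry) (pm p q)))); last by move=> q; rewrite e mulrN.
by rewrite IntN// => /oppr_inj.
Qed.

Lemma conv_close u s p (e : R) : 0 < s -> Ll u -> (forall q, nm (pm q p) <= s -> `|u q - u p| <= e) ->
  `|conv u (rho s) p - u p| <= e.
Proof.
move=> s0 hu h; have lr := L_rho p s0.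
rewrite -[X in _ - X]mulr1 -(Int_rho_refl p s0) -IntZ// /conv -IntB; [|exact: conv_L (rho_ct s) (rho_bs s0)|exact: L1Z].
rewrite -[e]mulr1 -(Int_rho_refl p s0) -IntZ//.
apply: Int_abs_le; [by apply: L1B; [exact: conv_L (rho_ct s) (rho_bs s0)|exact: L1Z]|exact: L1Z|].
move=> q; rewrite -mulrBl normrM (ger0_norm (rho_ge0 _ s0)).
case: (leP (nm (pm p q)) s) => hq; last by rewrite rho_bs// !mulr0.
by rewrite ler_wpM2r ?rho_ge0// h// nmN.
Qed.

(** With [c] the kernel average of [h] at [p], the integral of [(h q - c) ^+ 2 * rho s (pm p q)] is
    nonnegative; expand, using that the kernel has mass 1. *)
Lemma conv_jensen h s p : 0 < s -> meas h -> L (fun q => h q ^+ 2) ->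
  conv h (rho s) p ^+ 2 <= conv (fun q => h q ^+ 2) (rho s) p.
Proof.
move=> s0 mh h2.
have L2h : L2l h.
  split=> // r; apply: (@L1_le _ _ _ (@PM R) (fun q => h q ^+ 2)) => //.
    by apply: measurable_funM; [exact: measurable_funX|exact: meas_qi].
  move=> q; have /andP[q0 q1] := qi01 r q.
  by rewrite normrM (ger0_norm q0) ger0_norm ?sqr_ge0// ler_piMr// sqr_ge0.
have hl := L2l_Ll L2h.
have hl2 : Ll (fun q => h q ^+ 2).
  split; first exact: measurable_funX.
  move=> r; have := L2h.2 r; apply: L1_ext => q; congr (_ * _).
  by rewrite ger0_norm ?sqr_ge0.
have l1 := conv_L p hl (rho_ct s) (rho_bs s0).
have l2 := conv_L p hl2 (rho_ct s) (rho_bs s0).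
have lr := L_rho p s0.
set c := conv h (rho s) p.
have : 0 <= I (fun q => (h q - c) ^+ 2 * rho s (pm p q)).
  by apply: Int_ge0 => q; rewrite mulr_ge0 ?sqr_ge0 ?rho_ge0.
rewrite (@Int_ext _ _ _ (@PM R) _ (fun q => h q ^+ 2 * rho s (pm p q) - (2 * c) * (h q * rho s (pm p q)) + c ^+ 2 * rho s (pm p q))); last by move=> q; ring.
rewrite IntD; [|by apply: L1B => //; exact: L1Z|exact: L1Z].
rewrite IntB//; last exact: L1Z.
rewrite (IntZ (2 * c) l1) (IntZ (c ^+ 2) lr) (Int_rho_refl p s0) -/(conv h (rho s) p) -/c -/(conv (fun q => h q ^+ 2) (rho s) p).
by nra.
Qed.

Lemma PM_sf : sigma_finite setT (@PM R).
Proof.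
exists (fun n : nat => `[(- n%:R), n%:R]%classic `*` `[(- n%:R), n%:R]%classic).
  apply/esym/seteqP; split=> // q _; have [n hn] : exists n : nat, nm q <= n%:R.
    by exists (Num.bound (nm q)); apply/ltW/archi_boundP/nm_ge0.
  exists n => //; have := nm1 q; have := nm2 q.
  by split; rewrite /= in_itv /= -ler_norml; lra.
move=> n; split; first by apply: measurableX; exact: measurable_itv.
rewrite PME; [|exact: measurable_itv..].
by rewrite !lebesgue_measure_itv /=; case: ifP => _; rewrite ?mul0e ?ltry// -EFinB -EFinM ltry.
Qed.

Lemma conv_Int h s : 0 < s -> L h -> (forall q, 0 <= h q) ->
  L (conv h (rho s)) /\ I (conv h (rho s)) = I h.
Proof.
move=> s0 hL h0; have mh := L1_meas hL.
have hl : Ll h.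
  split=> // r; apply: (@L1_le _ _ _ (@PM R) h) => //.
    by apply: measurable_funM; [exact: measurableT_comp|exact: meas_qi].
  move=> q; have /andP[q0 q1] := qi01 r q.
  by rewrite normrM normr_id (ger0_norm q0) ger0_norm// ler_piMr.
pose T := ((M1 * M1) * (M1 * M1))%type.
pose K (z : T) : \bar R := (h z.2 * rho s (pm z.1 z.2))%:E.
have mK : measurable_fun (setT : set T) K.
  apply/measurable_EFinP; apply: measurable_funM.
    exact: measurableT_comp mh measurable_snd.
  apply: (measurableT_comp (f := rho s) (g := fun z : T => pm z.1 z.2)).
    exact: meas_ct (rho_ct s).
  have m11 : measurable_fun (setT : set T) (fun z : T => z.1.1) by exact: measurableT_comp measurable_fst measurable_fst.
  have m12 : measurable_fun (setT : set T) (fun z : T => z.1.2) by exact: measurableT_comp measurable_snd measurable_fst.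
  have m21 : measurable_fun (setT : set T) (fun z : T => z.2.1) by exact: measurableT_comp measurable_fst measurable_snd.
  have m22 : measurable_fun (setT : set T) (fun z : T => z.2.2) by exact: measurableT_comp measurable_snd measurable_snd.
  by apply: measurable_fun_pair; exact: measurable_funB.
have K0 z : (0 <= K z)%E by rewrite lee_fin mulr_ge0// rho_ge0.
have sf := PM_sf.
pose P2 := @PM R.
have ft : (\int[P2]_p \int[P2]_q K (p, q) = \int[P2]_q \int[P2]_p K (p, q))%E.
  exact: (tonelli_sf sf sf mK K0).
have e1 p : (\int[P2]_q K (p, q) = (conv h (rho s) p)%:E)%E.
  by rewrite /K /=; exact: (EInt (conv_L p hl (rho_ct s) (rho_bs s0))).
have e2 q : (\int[P2]_p K (p, q) = (h q)%:E)%E.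
  have lr := L1Z (h q) (L_rho q s0).
  have E : I (fun p => h q * rho s (pm q p)) = h q.
    by rewrite (IntZ (h q) (L_rho q s0)) (Int_rho_refl q s0) mulr1.
  rewrite -[in RHS]E -(EInt lr); apply: eq_integral => p _.
  by rewrite /K /= rho_even.
have e3 : (\int[@PM R]_p (conv h (rho s) p)%:E = (I h)%:E)%E.
  rewrite -(EInt hL); transitivity (\int[P2]_p \int[P2]_q K (p, q))%E.
    by apply: eq_integral => p _; rewrite e1.
  by rewrite ft; apply: eq_integral => q _; rewrite e2.
have cl : L (conv h (rho s)).
  apply: L1_fin; [exact: meas_ct (conv_ct hl (rho_ct s) (rho_bs s0))| |by rewrite e3 ltry].
  by move=> p; apply: Int_ge0 => q; apply: mulr_ge0; [exact: h0|exact: rho_ge0].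
clear ft e1 e2; split; first exact: cl.
apply: EFin_inj; rewrite -(EInt cl); exact: e3.
Qed.
Opaque PM.

(** Jensen holds pointwise, and by Tonelli mollification preserves the integral of [h ^+ 2]. *)
Lemma conv_contract h s : 0 < s -> meas h -> L (fun q => h q ^+ 2) ->
  L (fun p => conv h (rho s) p ^+ 2) /\
  I (fun p => conv h (rho s) p ^+ 2) <= I (fun q => h q ^+ 2).
Proof.
move=> s0 mh h2.
have [l1 e1] := conv_Int s0 h2 (fun q => sqr_ge0 (h q)).
have j p := conv_jensen p s0 mh h2.
have hl : Ll h.
  apply: L2l_Ll; split=> // r; apply: (@L1_le _ _ _ (@PM R) (fun q => h q ^+ 2)) => //.
    by apply: measurable_funM; [exact: measurable_funX|exact: meas_qi].
  move=> q; have /andP[q0 q1] := qi01 r q.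
  by rewrite normrM (ger0_norm q0) ger0_norm ?sqr_ge0// ler_piMr// sqr_ge0.
have l2 : L (fun p => conv h (rho s) p ^+ 2).
  apply: L1_le l1; first by apply: measurable_funX; exact: meas_ct (conv_ct hl (rho_ct s) (rho_bs s0)).
  by move=> p; rewrite ger0_norm ?sqr_ge0.
by split=> //; rewrite -e1; exact: Int_le.
Qed.

End Mollifier.

(** * Density of continuous functions in L^2 *)

Section SimpleApprox.
Context d (T : measurableType d) (R : realType).
Import HBNNSimple.

Lemma simple_approx (h : T -> R) : measurable_fun setT h -> (forall x, 0 <= h x) ->
  exists f : nat -> T -> R, [/\ forall n x, 0 <= f n x <= h x,
    forall x, f n x @[n --> \oo] --> h x &
    forall n, exists (s : seq R) (E : R -> set T), (forall y, measurable (E y)) /\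
      forall x, f n x = \sum_(y <- s) y * \1_(E y) x].
Proof.
move=> mh h0.
have mhE : measurable_fun setT (EFin \o h) by exact/measurable_EFinP.
pose f := nnsfun_approx measurableT mhE.
have fc x : f n x @[n --> \oo] --> h x.
  have c := @cvg_nnsfun_approx _ _ _ setT measurableT (EFin \o h) mhE (fun x _ => h0 x) x Logic.I.
  exact: (fine_cvg (a := h x) c).
exists (fun n x => f n x); split=> //.
- move=> n x; apply/andP; split; first exact: fun_ge0.
  rewrite -(cvg_lim (@Rhausdorff R) (fc x)).
  apply: (@nondecreasing_cvgn_le R (fun n => f n x)); last by apply/cvg_ex; exists (h x); exact: fc.
  by move=> a b ab; have /lefP := nd_nnsfun_approx measurableT mhE ab; exact.
- move=> n; exists (finmap.enum_fset (fset_set (range (f n)))), (fun y => f n @^-1` [set y]); split.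
    by move=> y; exact: measurable_sfunP.
  by move=> x; rewrite fimfunE fsbig_finite //; try exact: fimfunP.
Qed.

End SimpleApprox.
Section Density.
Variable R : realType.
Local Notation C := (R * R)%type.
Local Notation M1 := (measurableTypeR R).
Local Notation L := (L1 (@PM R)).
Local Notation I := (Int (@PM R)).
Local Notation meas := (measurable_fun (setT : set (M1 * M1))).
Implicit Types (F G u v w h : C -> R) (p q c : C) (r s : R).

(** The indicator is approximated in every weighted L^1 space at once. Quantifying over the weight
    makes the class a sigma-algebra and lets [jac_pos] use the weight given by the Jacobian. *)
Definition apx (E : set C) := measurable (E : set (M1 * M1)) /\
  forall w, L w -> (forall p, 0 <= w p) -> forall e : R, 0 < e ->
  exists phi, [/\ ct phi, (forall p, 0 <= phi p <= 1) &
    I (fun p => `|\1_E p - phi p| * w p) <= e].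

Lemma apx_L (E : set C) phi w : measurable (E : set (M1 * M1)) -> ct phi ->
  (forall p, 0 <= phi p <= 1) -> L w -> (forall p, 0 <= w p) ->
  L (fun p => `|\1_E p - phi p| * w p).
Proof.
move=> mE cphi h01 lw w0; apply: (L1_le _ _ lw).
  apply: measurable_funM; last exact: L1_meas lw.
  apply: measurableT_comp => //; apply: measurable_funB; last exact: meas_ct.
  exact: measurable_indic.
move=> p; rewrite normrM normr_id (ger0_norm (w0 p)) ler_piMl//.
have /andP[a b] := h01 p; rewrite ler_norml indicE; case: (p \in E) => /=; lra.
Qed.

Lemma apx0 : apx set0.
Proof.
split=> // w lw w0 e e0; exists (fun=> 0); split; [exact: ct_cst|by move=> p; rewrite lexx ler01|].
rewrite (@Int_ext _ _ _ (@PM R) _ (fun=> 0)) ?Int0 ?ltW// => p.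
by rewrite indic0 /= subrr normr0 mul0r.
Qed.

Lemma apxC (E : set C) : apx E -> apx (~` E).
Proof.
move=> [mE h]; split; first exact: measurableC.
move=> w lw w0 e e0; have [phi [c1 c2 c3]] := h w lw w0 e e0.
exists (fun p => 1 - phi p); split; first by apply: ctB => //; exact: ct_cst.
  by move=> p; have := c2 p; lra.
apply: le_trans c3; rewrite le_eqVlt; apply/orP; left; apply/eqP; apply: Int_ext => p.
congr (_ * _); rewrite -normrN; congr `| _ |; rewrite !indicE in_setC.
by case: (p \in E) => /=; ring.
Qed.

(** The complement of [f + g - f * g] to 1 is [(1 - f) * (1 - g)], so the combination stays between
    0 and 1 and its error is at most the sum of the two errors. *)
Lemma apxU (E F : set C) : apx E -> apx F -> apx (E `|` F).
Proof.
move=> [mE hE] [mF hF]; split; first exact: measurableU.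
move=> w lw w0 e e0; have e20 : 0 < e / 2 by lra.
have [f [f1 f2 f3]] := hE w lw w0 _ e20; have [g [g1 g2 g3]] := hF w lw w0 _ e20.
have c01 p : 0 <= f p + g p - f p * g p <= 1.
  by have /andP[a b] := f2 p; have /andP[c d] := g2 p; apply/andP; split; (clear -c b a d; nra).
have cc : ct (fun p => f p + g p - f p * g p) by apply: ctB; [exact: ctD|exact: ctM].
exists (fun p => f p + g p - f p * g p); split => //.
have -> : e = e / 2 + e / 2 by lra.
have l1 := apx_L mE f1 f2 lw w0; have l2 := apx_L mF g1 g2 lw w0.
apply: le_trans (lerD f3 g3); rewrite -IntD//; apply: Int_le => //.
- by apply: apx_L => //; exact: measurableU.
- exact: L1D.
move=> p; rewrite -mulrDl ler_wpM2r//.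
have /andP[a b] := f2 p; have /andP[c d] := g2 p.
rewrite !indicE in_setU; case: (p \in E); case: (p \in F) => /=.
- rewrite [X in X <= _]ger0_norm; last by (clear -d b; nra).
  by rewrite !ger0_norm ?subr_ge0//; (clear -d b a; nra).
- rewrite sub0r normrN (ger0_norm c) ger0_norm ?subr_ge0; last by (clear -d b; nra).
  by rewrite ger0_norm ?subr_ge0//; (clear -c b; nra).
- rewrite sub0r normrN (ger0_norm a) ger0_norm ?subr_ge0; last by (clear -d b; nra).
  by rewrite ger0_norm ?subr_ge0//; (clear -d a; nra).
- rewrite !sub0r !normrN (ger0_norm c) (ger0_norm a) ger0_norm; (clear -c a b; nra).
Qed.

(** Finite unions converge to the countable union under the weight [w], by dominated convergence;
    half of [e] is spent there. *)
Lemma apx_bigcup (E : nat -> set C) : (forall n, apx (E n)) -> apx (\bigcup_n E n).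
Proof.
move=> hE; have mU : measurable (\bigcup_n E n : set (M1 * M1)).
  by apply: bigcupT_measurable => n; have [] := hE n.
split=> // w lw w0 e e0; have e20 : 0 < e / 2 by lra.
pose F n := \big[setU/set0]_(i < n) E i.
have aF n : apx (F n).
  by rewrite /F; elim/big_ind: _ => //; [exact: apx0|exact: apxU].
have FE n p : F n p <-> exists2 i, (i < n)%N & E i p.
  rewrite /F -bigcup_mkord; split=> [[i /= hi hp]|[i hi hp]]; exists i => //.
pose G n p := `|\1_(\bigcup_n E n) p - \1_(F n) p| * w p.
have mG n : meas (G n).
  apply: measurable_funM; last exact: L1_meas lw.
  apply: measurableT_comp => //; apply: measurable_funB; apply: measurable_indic => //.
  by have [] := aF n.
have ind01 (A B : set C) p : `|\1_A p - \1_B p| <= 1 :> R.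
  by rewrite !indicE; case: (p \in A); case: (p \in B) => /=;
    rewrite ?subrr ?subr0 ?sub0r ?normrN ?normr0 ?normr1.
have [|||||_ cv] := @Int_cvg _ _ _ (@PM R) G (fun=> 0) w.
- exact: mG.
- exact: measurable_cst.
- exact: lw.
- by move=> n p; rewrite normrM normr_id (ger0_norm (w0 p)) ler_piMl.
- move=> p; apply/cvgrPdist_lt => d d0.
  have [[i _ hi]|hn] := pselect ((\bigcup_n E n) p).
    near=> n; rewrite /G !indicE mem_set; last by exists i.
    rewrite mem_set ?subrr ?normr0 ?mul0r ?subr0 ?normr0//.
    by apply/FE; exists i => //; near: n; exact: nbhs_infty_gt.
  near=> n; rewrite /G !indicE memNset// memNset ?subrr ?normr0 ?mul0r ?subr0 ?normr0//.
  by move=> /FE[i _ hi]; apply: hn; exists i.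
have : \forall n \near \oo, I (G n) <= e / 2.
  have /cvgrPdist_le/(_ _ e20) := cv; rewrite Int0.
  apply: filterS => n; rewrite sub0r normrN; apply: le_trans; exact: ler_norm.
move=> /filter_ex[n hn].
have [mF hF] := aF n; have [f [f1 f2 f3]] := hF w lw w0 _ e20.
exists f; split=> //; have -> : e = e / 2 + e / 2 by lra.
have l1 := apx_L mF f1 f2 lw w0.
have l2 : L (G n).
  apply: (L1_le (mG n) _ lw) => p.
  by rewrite normrM normr_id (ger0_norm (w0 p)) ler_piMl.
apply: le_trans (lerD hn f3); rewrite -IntD//; apply: Int_le => //.
- exact: apx_L.
- exact: L1D.
- by move=> p; rewrite -mulrDl ler_wpM2r//; apply: ler_distD.
Unshelve. all: by end_near. Qed.

Definition clamp (x : R) : R := Num.max 0 (Num.min 1 x).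

Lemma clamp01 x : 0 <= clamp x <= 1.
Proof. by rewrite /clamp le_max lexx /= ge_max ler01 ge_min lexx. Qed.
Lemma clamp_lip x y : `|clamp x - clamp y| <= `|x - y|.
Proof.
rewrite /clamp /Num.max /Num.min.
by case: (ltP 1 x) => h1; case: (ltP 1 y) => h2; rewrite ?ltr01;
  repeat (match goal with |- context[(0 < ?z)%O] => case: (ltP 0 z) => ? end);
  rewrite ler_norml; apply/andP; split; have := ler_norm (x - y); have := ler_norm (- (x - y)); rewrite normrN; lra.
Qed.
Lemma clamp_cts : continuous clamp.
Proof.
move=> x; apply/cvgrPdist_lt => e e0; exists e => //= y /= h.
exact: le_lt_trans (clamp_lip x y) h.
Qed.
Lemma clamp_le0 x : x <= 0 -> clamp x = 0.
Proof. by move=> h; rewrite /clamp max_l// ge_min h orbT. Qed.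
Lemma clamp_ge1 x : 1 <= x -> clamp x = 1.
Proof. by move=> h; rewrite /clamp min_l// max_r. Qed.

Definition stp (n : nat) (t : R) := clamp (n%:R * t).

Lemma stp_cvg t : stp n t @[n --> \oo] --> (((0 < t)%R)%:R : R).
Proof.
apply/cvgrPdist_lt => e e0; case: (ltP 0 t) => h.
  near=> n; rewrite /stp clamp_ge1 ?subrr ?normr0//.
  rewrite -ler_pdivrMr// mul1r; near: n; exact: nbhs_infty_ger.
by near=> n; rewrite /stp clamp_le0 ?subr0 ?normr0// mulr_ge0_le0.
Unshelve. all: by end_near. Qed.

Lemma stp_ct (n : nat) (f : C -> R) (a : R) : ct f -> ct (fun p => stp n (f p - a)).
Proof.
move=> cf; apply: ct_comp1; last by apply: ctB cf (ct_cst a).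
move=> x; have h : n%:R * y @[y --> x] --> n%:R * x by apply: cvgM; [exact: cvg_cst|exact: cvg_id].
exact: (cvg_comp _ _ h (@clamp_cts (n%:R * x))).
Qed.

(** The ramps [stp n] tend to the indicator of strict positivity, so a ramp at [a] times the
    complement of a ramp at [b] tends exactly to the half-open strip. Such strips generate the Borel
    sets. *)
Lemma apx_strip (f : C -> R) a b : ct f -> apx [set p | a < f p <= b].
Proof.
move=> cf; have mE : measurable ([set p | a < f p <= b] : set (M1 * M1)).
  have := meas_ct cf measurableT (measurable_itv `]a, b]); rewrite setTI.
  by congr measurable; apply/seteqP; split=> p /=; rewrite in_itv.
split=> // w lw w0 e e0.
pose phi n p := stp n (f p - a) * (1 - stp n (f p - b)).
have cp n : ct (phi n).
  by apply: ctM; [exact: stp_ct|apply: ctB; [exact: ct_cst|exact: stp_ct]].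
have p01 n p : 0 <= phi n p <= 1.
  rewrite /phi; have /andP[a1 a2] := clamp01 (n%:R * (f p - a)).
  have /andP[b1 b2] := clamp01 (n%:R * (f p - b)).
  by rewrite -!/(stp _ _) in a1 a2 b1 b2; apply/andP; split; nra.
pose G n p := `|\1_[set p | a < f p <= b] p - phi n p| * w p.
have lG n : L (G n) by exact: apx_L.
have [|||||_ cv] := @Int_cvg _ _ _ (@PM R) G (fun=> 0) w.
- by move=> n; exact: L1_meas (lG n).
- exact: measurable_cst.
- exact: lw.
- move=> n p; rewrite normrM normr_id (ger0_norm (w0 p)) ler_piMl//.
  have /andP[x y] := p01 n p; rewrite ler_norml indicE; case: (p \in _) => /=; lra.
- move=> p.
  have c1 : phi n p @[n --> \oo] --> (((0 < f p - a)%R)%:R * (1 - ((0 < f p - b)%R)%:R) : R).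
    apply: cvgM; first exact: stp_cvg.
    by apply: cvgB; [exact: cvg_cst|exact: stp_cvg].
  have c2 : G n p @[n --> \oo] --> `|\1_[set p | a < f p <= b] p - ((0 < f p - a)%R)%:R * (1 - ((0 < f p - b)%R)%:R)| * w p.
    apply: cvgM; last exact: cvg_cst.
    by apply: cvg_norm; apply: cvgB c1; exact: cvg_cst.
  move: c2; rewrite indicE.
  rewrite (_ : _%:R - _ = 0) ?normr0 ?mul0r//.
  rewrite !subr_gt0; case: (ltP b (f p)) => h2; case: (ltP a (f p)) => h1 /=.
  + by rewrite memNset/= ?subrr ?mulr0 ?subr0//= h1 leNgt h2.
  + by rewrite memNset/= ?mul0r ?subr0//= ltNge h1.
  + by rewrite mem_set/= ?subr0 ?mulr1 ?subrr//= h1 h2.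
  + by rewrite memNset/= ?mul0r ?subr0//= ltNge h1.
have : \forall n \near \oo, I (G n) <= e.
  have /cvgrPdist_le/(_ _ e0) := cv; rewrite Int0.
  apply: filterS => n; rewrite sub0r normrN; apply: le_trans; exact: ler_norm.
move=> /filter_ex[n hn]; by exists (phi n).
Qed.

Lemma apx_pre (f : C -> R) (X : set R) : ct f -> measurable (X : set M1) -> apx (f @^-1` X).
Proof.
move=> cf mX.
have sA : sigma_algebra setT [set X : set R | apx (f @^-1` X)].
  split=> /=.
  - by rewrite preimage_set0; exact: apx0.
  - by move=> A hA; rewrite setTD; exact: (apxC hA).
  - by move=> A hA; rewrite preimage_bigcup; exact: apx_bigcup.
apply: (smallest_sub sA _ mX) => _ [[a b] _ <-] /=.
have := apx_strip a b cf; congr apx.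
Qed.

(** The class [apx] is a sigma-algebra that contains the preimages of Borel sets under both
    coordinates, and these generate the product. *)
Lemma apx_all (E : set C) : measurable (E : set (M1 * M1)) -> apx E.
Proof.
move=> mE.
have sA : sigma_algebra setT [set X : set C | apx X].
  split=> /=.
  - exact: apx0.
  - by move=> A hA; rewrite setTD; exact: (apxC hA).
  - by move=> A hA; exact: apx_bigcup.
apply: (smallest_sub sA _ mE) => A [[X mX <-]|[X mX <-]] /=; rewrite setTI.
  by apply: apx_pre => //; exact: ct1.
by apply: apx_pre => //; exact: ct2.
Qed.

Definition cutp r p : R := clamp (r + 1 - `|p.1|) * clamp (r + 1 - `|p.2|).
Lemma cutp_ct r : ct (cutp r).
Proof.
apply: ctM; apply: (ct_comp1 clamp_cts); apply: ctB (ct_cst _) (ct_norm _).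
  exact: ct1.
exact: ct2.
Qed.
Lemma cutp_bs r : bs (r + 1) (cutp r).
Proof.
move=> p; rewrite /nm lt_max /cutp => /orP[h|h]; first by rewrite clamp_le0 ?mul0r//; lra.
by rewrite mulrC clamp_le0 ?mul0r//; lra.
Qed.
Lemma cutp01 r p : 0 <= cutp r p <= 1.
Proof.
rewrite /cutp; have /andP[a1 a2] := clamp01 (r + 1 - `|p.1|).
by have /andP[b1 b2] := clamp01 (r + 1 - `|p.2|); apply/andP; split; nra.
Qed.
Lemma cutp1 r p : nm p <= r -> cutp r p = 1.
Proof. by rewrite nm_le => /andP[a b]; rewrite /cutp !clamp_ge1 ?mulr1//; lra. Qed.

(** Membership in the L^2 closure of the continuous functions of compact support. *)
Definition apf h := [/\ meas h, L (fun p => h p ^+ 2) & forall e : R, 0 < e ->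
  exists phi r, [/\ ct phi, bs r phi & I (fun p => (h p - phi p) ^+ 2) <= e]].

Lemma cc_sq phi r : ct phi -> bs r phi -> L (fun p => phi p ^+ 2).
Proof. by move=> cp hb; apply: (@L_cc _ r); [exact: ctX|move=> p /hb ->; rewrite expr0n]. Qed.

Lemma L1_sqB F G : meas F -> meas G -> L (fun p => F p ^+ 2) -> L (fun p => G p ^+ 2) ->
  L (fun p => (F p - G p) ^+ 2).
Proof.
move=> mF mG lF lG.
have lG' : L (fun p => (0 - G p) ^+ 2) by apply: L1_ext lG => p; ring.
have := L1_sqD mF (measurable_funB (measurable_cst (0 : R)) mG) lF lG'.
by apply: L1_ext => p /=; ring.
Qed.

Lemma apf_indic (E : set C) r : measurable (E : set (M1 * M1)) -> apf (fun p => \1_E p * qi r p).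
Proof.
move=> mE; have mEq : measurable (E `&` [set p | nm p <= r] : set (M1 * M1)).
  apply: measurableI => //.
  have cn : ct (@nm R).
    move=> p e e0; exists e => // q h; apply: le_lt_trans h.
    have h1 := nm_tri q p (0, 0); have h2 := nm_tri p q (0, 0); rewrite !pm0 in h1 h2.
    by rewrite (nmN p) in h1; rewrite ler_norml; apply/andP; split; lra.
  have := meas_ct cn measurableT (measurable_itv `]-oo, r]); rewrite setTI.
  by congr measurable; apply/seteqP; split=> p /=; rewrite in_itv.
have eE p : \1_E p * qi r p = \1_(E `&` [set p | nm p <= r]) p :> R.
  rewrite !indicE in_setI; case: (p \in E) => /=; last by rewrite mul0r.
  rewrite mul1r; case: (leP (nm p) r) => h; first by rewrite qi1// mem_set.
  by rewrite qi0// memNset//= leNgt h.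
have mh : meas (fun p => \1_E p * qi r p) by apply: measurable_funM; [exact: measurable_indic|exact: meas_qi].
have lh : L (fun p => (\1_E p * qi r p) ^+ 2).
  apply: (L1_le _ _ (@L_qi R r)); first exact: measurable_funX.
  move=> p; have /andP[a b] := qi01 r p; rewrite ger0_norm ?sqr_ge0// exprMn indicE.
  case: (p \in E) => /=; rewrite ?expr1n ?mul1r ?expr0n ?mul0r//.
  by rewrite expr2; nra.
split=> // e e0; have [_ /(_ (qi (r + 1)) (@L_qi R _) _ e e0)] := apx_all mEq.
case=> [p|phi [c1 c2 c3]]; first by case/andP: (qi01 (r + 1) p).
exists (fun p => phi p * cutp r p), (r + 1); split.
- by apply: ctM => //; exact: cutp_ct.
- by move=> p hp; rewrite cutp_bs// mulr0.
apply: le_trans c3; apply: Int_le.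
- apply: L1_sqB => //; first by apply: meas_ct; apply: ctM => //; exact: cutp_ct.
  by apply: (cc_sq (r := r + 1)); [apply: ctM => //; exact: cutp_ct|move=> p hp; rewrite cutp_bs// mulr0].
- by apply: apx_L => //; first [exact: L_qi|move=> p; case/andP: (qi01 (r + 1) p)].
move=> p; rewrite eE.
have /andP[a b] := c2 p; have /andP[x y] := cutp01 r p.
case: (leP (nm p) (r + 1)) => h; last first.
  rewrite cutp_bs// mulr0 subr0 qi0// mulr0 indicE memNset ?expr0n//=.
  by move=> [_ /=]; rewrite leNgt; apply/negP/negPn; lra.
rewrite qi1// mulr1; case: (leP (nm p) r) => h2.
  rewrite cutp1// mulr1; set t := _ - phi p.
  have : `|t| <= 1 by rewrite /t ler_norml indicE; case: (_ \in _) => /=; (clear -b a; lra).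
  by move=> h3; rewrite -real_normK ?num_real// expr2 ler_piMl.
rewrite indicE memNset /=; last by move=> [_ /=]; rewrite leNgt h2.
rewrite !sub0r sqrrN normrN (ger0_norm a) expr2.
have : 0 <= phi p * cutp r p <= phi p by apply/andP; split; (clear -x a y; nra).
by move=> /andP[h3 h4]; nra.
Qed.

Lemma apfD h k : apf h -> apf k -> apf (fun p => h p + k p).
Proof.
move=> [mh lh ah] [mk lk ak]; split; [exact: measurable_funD|exact: L1_sqD|].
move=> e e0; have e4 : 0 < e / 4 by lra.
have [f [r [f1 f2 f3]]] := ah _ e4; have [g [s [g1 g2 g3]]] := ak _ e4.
exists (fun p => f p + g p), (Num.max r s); split; first exact: ctD.
  by move=> p; rewrite gt_max => /andP[a b]; rewrite f2// g2// addr0.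
have l1 := L1_sqB mh (meas_ct f1) lh (cc_sq f1 f2).
have l2 := L1_sqB mk (meas_ct g1) lk (cc_sq g1 g2).
have : 2 * I (fun p => (h p - f p) ^+ 2) + 2 * I (fun p => (k p - g p) ^+ 2) <= e by lra.
apply: le_trans; rewrite -!IntZ// -IntD; [|exact: L1Z..].
apply: Int_le; [|by apply: L1D; exact: L1Z|].
  have := L1_sqD (measurable_funB mh (meas_ct f1)) (measurable_funB mk (meas_ct g1)) l1 l2.
  by apply: L1_ext => p /=; congr (_ ^+ 2); ring.
move=> p; have := sqr_ge0 ((h p - f p) - (k p - g p)); nra.
Qed.
Lemma apfZ (a : R) h : apf h -> apf (fun p => a * h p).
Proof.
move=> [mh lh ah]; have lah : L (fun p => (a * h p) ^+ 2).
  by apply: L1_ext (L1Z (a ^+ 2) lh) => p; rewrite exprMn.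
split=> //; first exact: measurable_funM.
move=> e e0; have e1 : 0 < e / (a ^+ 2 + 1) by rewrite divr_gt0// ltr_wpDl ?sqr_ge0.
have [f [r [f1 f2 f3]]] := ah _ e1; exists (fun p => a * f p), r; split; first exact: ctZ.
  by move=> p hp; rewrite f2// mulr0.
rewrite (@Int_ext _ _ _ (@PM R) _ (fun p => a ^+ 2 * (h p - f p) ^+ 2)); last by move=> p; ring.
rewrite IntZ; last exact: L1_sqB mh (meas_ct f1) lh (cc_sq f1 f2).
apply: (le_trans (ler_wpM2l (sqr_ge0 a) f3)); rewrite mulrA ler_pdivrMr ?ltr_wpDl ?sqr_ge0//.
by have := sqr_ge0 a; nra.
Qed.
Lemma apf0 : apf (fun=> 0).
Proof.
split=> //; first by apply: L1_ext (@L10 _ _ _ (@PM R)) => p; rewrite expr0n.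
move=> e e0; exists (fun=> 0), 0; split=> //; first exact: ct_cst.
by rewrite (@Int_ext _ _ _ (@PM R) _ (fun=> 0)) ?Int0 ?ltW// => p; rewrite subrr expr0n.
Qed.
Lemma apf_lim h : meas h -> L (fun p => h p ^+ 2) ->
  (forall e : R, 0 < e -> exists2 k, apf k & I (fun p => (h p - k p) ^+ 2) <= e) -> apf h.
Proof.
move=> mh lh H; split=> // e e0; have e4 : 0 < e / 4 by lra.
have [k [mk lk ak] hk] := H _ e4; have [f [r [f1 f2 f3]]] := ak _ e4.
exists f, r; split=> //.
have l1 := L1_sqB mk (meas_ct f1) lk (cc_sq f1 f2); have l2 := L1_sqB mh mk lh lk.
have : 2 * I (fun p => (h p - k p) ^+ 2) + 2 * I (fun p => (k p - f p) ^+ 2) <= e by lra.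
apply: le_trans; rewrite -!IntZ// -IntD; [|exact: L1Z..].
apply: Int_le; [exact: L1_sqB mh (meas_ct f1) lh (cc_sq f1 f2)|by apply: L1D; exact: L1Z|].
move=> p; have := sqr_ge0 ((h p - k p) - (k p - f p)); (clear; nra).
Qed.

Lemma apf_pos h : meas h -> L (fun p => h p ^+ 2) -> (forall p, 0 <= h p) -> apf h.
Proof.
move=> mh lh h0; apply: apf_lim => // e e0.
have [f [f01 fc fs]] := simple_approx mh h0.
have f0 n p : 0 <= f n p by have /andP[] := f01 n p.
have fle n p : f n p <= h p by have /andP[] := f01 n p.
pose k (n : nat) p := f n p * qi n%:R p.
have ak n : apf (k n).
  have [s [E [mE fE]]] := fs n.
  rewrite (_ : k n = fun p => \sum_(y <- s) (y * (\1_(E y) p * qi n%:R p))); last first.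
    by apply/funext => p; rewrite /k fE mulr_suml; apply: eq_bigr => y _; rewrite mulrA.
  elim: s {fE} => [|y s ih].
    by rewrite (_ : (fun p => _) = fun=> 0); [exact: apf0|apply/funext => p; rewrite big_nil].
  rewrite (_ : (fun p => _) = fun p => y * (\1_(E y) p * qi n%:R p) + \sum_(y <- s) (y * (\1_(E y) p * qi n%:R p))); last by apply/funext => p; rewrite big_cons.
  by apply: apfD => //; apply: apfZ; exact: apf_indic.
have mk n : meas (k n) by case: (ak n).
have kh n p : 0 <= k n p <= h p.
  rewrite /k; have /andP[a b] := qi01 n%:R p; have c := f0 n p; have d := fle n p.
  by apply/andP; split; (clear -c a d b; nra).
have [|||||_ cv] := @Int_cvg _ _ _ (@PM R) (fun n p => (h p - k n p) ^+ 2) (fun=> 0) (fun p => h p ^+ 2).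
- by move=> n; apply: measurable_funX; exact: measurable_funB.
- exact: measurable_cst.
- exact: lh.
- by move=> n p; rewrite ger0_norm ?sqr_ge0//; have /andP[a b] := kh n p; rewrite ler_sqr ?nnegrE; (clear -a b; lra).
- move=> p.
  have : (h p - k n p) ^+ 2 @[n --> \oo] --> (h p - h p * 1) ^+ 2.
    have c1 : k n p @[n --> \oo] --> h p * 1.
      apply: cvgM; first exact: fc.
      apply/cvgrPdist_lt => d d0; near=> n; rewrite qi1 ?subrr ?normr0//.
      by near: n; exact: nbhs_infty_ger.
    rewrite !expr2 (_ : (fun n => (h p - k n p) ^+ 2) = (fun n => (h p - k n p) * (h p - k n p))); last by apply/funext => n; rewrite expr2.
    by apply: cvgM; apply: cvgB c1; exact: cvg_cst.
  by rewrite mulr1 subrr expr0n.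
have : \forall n \near \oo, I (fun p => (h p - k n p) ^+ 2) <= e.
  have /cvgrPdist_le/(_ _ e0) := cv; rewrite Int0.
  apply: filterS => n; rewrite sub0r normrN; apply: le_trans; exact: ler_norm.
by move=> /filter_ex[n hn]; exists (k n).
Unshelve. all: by end_near. Qed.

Lemma L2_dense h : meas h -> L (fun p => h p ^+ 2) -> apf h.
Proof.
move=> mh lh.
have m1 : meas (fun p => Num.max (h p) 0) by exact: measurable_maxr.
have m2 : meas (fun p => Num.max (- h p) 0) by apply: measurable_maxr => //; exact: measurableT_comp.
have mm : forall x : R, Num.max x 0 ^+ 2 <= x ^+ 2.
  move=> x; case: (leP 0 x) => hx; first by [].
  by rewrite expr0n sqr_ge0.
have a1 : apf (fun p => Num.max (h p) 0).
  apply: apf_pos => //; last by move=> p; rewrite le_max lexx orbT.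
  by apply: L1_le lh => [|p]; [exact: measurable_funX|rewrite ger0_norm ?sqr_ge0].
have a2 : apf (fun p => Num.max (- h p) 0).
  apply: apf_pos => //; last by move=> p; rewrite le_max lexx orbT.
  apply: L1_le lh => [|p]; first exact: measurable_funX.
  by rewrite ger0_norm ?sqr_ge0// -[leRHS]sqrrN.
have := apfD a1 (apfZ (-1) a2); congr apf; apply/funext => p.
case: (leP 0 (h p)) => hx.
  by rewrite [X in _ * X]max_r ?mulr0 ?addr0//; lra.
by rewrite max_l ?mulN1r ?opprK ?add0r//; lra.
Qed.

End Density.


(** * Sobolev functions *)

Section Weak.
Variable R : realType.
Local Notation C := (R * R)%type.
Local Notation M1 := (measurableTypeR R).
Local Notation L := (L1 (@PM R)).
Local Notation I := (Int (@PM R)).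
Local Notation meas := (measurable_fun (setT : set (M1 * M1))).
Implicit Types (F G u v w h f g : C -> R) (p q c : C) (r s M : R).

(** Squared L^2 norm on the square of half-side [M]. *)
Definition NQ M f := I (fun p => f p ^+ 2 * qi M p).

Lemma qi_ge0 M p : 0 <= qi M p.
Proof. by case/andP: (qi01 M p). Qed.
Lemma NQ_ge0 M f : 0 <= NQ M f.
Proof. by apply: Int_ge0 => p; rewrite mulr_ge0 ?sqr_ge0 ?qi_ge0. Qed.

Lemma L2l_bd f M (K : C -> R) : L2l f -> meas K -> (exists B, forall p, nm p <= M -> `|K p| <= B) ->
  L (fun p => f p ^+ 2 * K p * qi M p).
Proof.
move=> [mf lf] mK [B hB].
apply: (@L1_le _ _ _ (@PM R) (fun p => `|B| * (f p ^+ 2 * qi M p))); last exact: L1Z.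
  by apply: measurable_funM; [apply: measurable_funM => //; exact: measurable_funX|exact: meas_qi].
move=> p; case: (leP (nm p) M) => h; last by rewrite qi0// !mulr0 normr0.
rewrite qi1// !mulr1 normrM (ger0_norm (sqr_ge0 _)) mulrC ler_wpM2r ?sqr_ge0//.
exact: le_trans (hB p h) (ler_norm B).
Qed.

Lemma L2l_add f g : L2l f -> L2l g -> L2l (fun p => f p + g p).
Proof.
move=> [mf lf] [mg lg]; split; first exact: measurable_funD.
move=> r; apply: (@L1_le _ _ _ (@PM R) (fun p => 2 * (f p ^+ 2 * qi r p) + 2 * (g p ^+ 2 * qi r p))).
- by apply: measurable_funM; [apply: measurable_funX; exact: measurable_funD|exact: meas_qi].
- move=> p; have q0 := qi_ge0 r p; rewrite ger0_norm; last by apply: mulr_ge0; [exact: sqr_ge0|exact: q0].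
  rewrite !mulrA -mulrDl ler_wpM2r//; have := sqr_ge0 (f p - g p); nra.
- by apply: L1D; exact: L1Z.
Qed.
Lemma L2l_ctM f g : ct g -> L2l f -> L2l (fun p => g p * f p).
Proof.
move=> cg [mf lf]; split; first by apply: measurable_funM => //; exact: meas_ct.
move=> r; have [K K0 hK] := ct_bounded r cg.
have := @L2l_bd f r (fun p => g p ^+ 2) (conj mf lf) (measurable_funX 2 (meas_ct cg)) _.
have h : exists B, forall p, nm p <= r -> `|g p ^+ 2| <= B.
  by exists (K ^+ 2) => p /hK h; rewrite normrX lerXn2r ?nnegrE// ltW.
by move=> /(_ h); apply: L1_ext => p; rewrite exprMn; ring.
Qed.
Lemma L2l_ext f g : (forall p, f p = g p) -> L2l f -> L2l g.
Proof. by move=> /funext ->. Qed.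
Lemma L2l_scale (a : R) f : L2l f -> L2l (fun p => a * f p).
Proof. exact: (L2l_ctM (ct_cst a)). Qed.
Lemma L2l_opp f : L2l f -> L2l (fun p => - f p).
Proof. by move=> h; apply: L2l_ext (L2l_scale (-1) h) => p; rewrite mulN1r. Qed.
Lemma L2l_sub f g : L2l f -> L2l g -> L2l (fun p => f p - g p).
Proof. by move=> hf hg; exact: L2l_add hf (L2l_opp hg). Qed.
Lemma L2l_ct f : ct f -> L2l f.
Proof.
move=> cf; split; first exact: meas_ct.
move=> r; have [mf lf] := ct_Ll (ctX 2 cf); apply: L1_ext (lf r) => p.
by rewrite ger0_norm ?sqr_ge0.
Qed.

Lemma L_mul f g (chi : C -> R) r K : L2l f -> L2l g -> meas chi -> bs r chi ->
  (forall p, `|chi p| <= K) -> L (fun p => chi p * (f p * g p)).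
Proof.
move=> [mf lf] [mg lg] mc hb hK.
apply: (@L1_le _ _ _ (@PM R) (fun p => K * (f p ^+ 2 * qi r p + g p ^+ 2 * qi r p))).
- by apply: measurable_funM => //; exact: measurable_funM.
- move=> p; case: (leP (nm p) r) => h; last by rewrite hb// qi0// mul0r normr0 !mulr0 addr0 mulr0.
  rewrite qi1// !mulr1 normrM; apply: ler_pM => //.
  by rewrite ler_norml; apply/andP; split; have := sqr_ge0 (f p - g p); have := sqr_ge0 (f p + g p); nra.
- by apply: L1Z; exact: L1D.
Qed.

(** Young's inequality with a parameter: if [NQ r f] is O(t^2), the pairing is O(t). *)
Lemma I_small f g (chi : C -> R) r K t : 0 < t -> L2l f -> L2l g -> meas chi -> bs r chi ->
  (forall p, `|chi p| <= K) -> `|I (fun p => chi p * (f p * g p))| <= K * (NQ r f / t + t * NQ r g).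
Proof.
move=> t0 hf hg mc hb hK; have [mf lf] := hf; have [mg lg] := hg.
have l2 : L (fun p => K * (t^-1 * (f p ^+ 2 * qi r p) + t * (g p ^+ 2 * qi r p))).
  by apply: L1Z; apply: L1D; exact: L1Z.
have -> : K * (NQ r f / t + t * NQ r g) = I (fun p => K * (t^-1 * (f p ^+ 2 * qi r p) + t * (g p ^+ 2 * qi r p))).
  rewrite IntZ; last by apply: L1D; exact: L1Z.
  by rewrite IntD ?IntZ// ?(mulrC t^-1)//; exact: L1Z.
apply: Int_abs_le => //; first exact: (L_mul hf hg mc hb hK).
move=> p; case: (leP (nm p) r) => h; last by rewrite hb// qi0// mul0r normr0 !mulr0 addr0 mulr0.
rewrite qi1// !mulr1 normrM; apply: ler_pM => //.
have h1 : t * t^-1 = 1 by rewrite mulfV// gt_eqF.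
have ti : 0 < t^-1 by rewrite invr_gt0.
have e1 : t^-1 * f p ^+ 2 + t * g p ^+ 2 - f p * g p = t^-1 * ((f p - t * g p / 2) ^+ 2 + 3 / 4 * (t * g p) ^+ 2) by field; rewrite gt_eqF.
have e2 : t^-1 * f p ^+ 2 + t * g p ^+ 2 + f p * g p = t^-1 * ((f p + t * g p / 2) ^+ 2 + 3 / 4 * (t * g p) ^+ 2) by field; rewrite gt_eqF.
have p1 : 0 <= t^-1 * ((f p - t * g p / 2) ^+ 2 + 3 / 4 * (t * g p) ^+ 2).
  apply: mulr_ge0; [exact: ltW|have a := sqr_ge0 (f p - t * g p / 2); have b := sqr_ge0 (t * g p); (clear -b a; lra)].
have p2 : 0 <= t^-1 * ((f p + t * g p / 2) ^+ 2 + 3 / 4 * (t * g p) ^+ 2).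
  apply: mulr_ge0; [exact: ltW|have a := sqr_ge0 (f p + t * g p / 2); have b := sqr_ge0 (t * g p); (clear -b a; lra)].
by rewrite ler_norml; apply/andP; split; (clear -p2 e2 p1 e1; lra).
Qed.


Lemma NQ_le M f g B : L2l f -> L2l g -> 0 <= B -> (forall p, nm p <= M -> f p ^+ 2 <= B * g p ^+ 2) ->
  NQ M f <= B * NQ M g.
Proof.
move=> [mf lf] [mg lg] B0 h; rewrite /NQ -IntZ//; apply: Int_le => //; first exact: L1Z.
move=> p; case: (leP (nm p) M) => hp; first by rewrite mulrA ler_wpM2r ?qi_ge0 ?h.
by rewrite qi0// !mulr0.
Qed.

Lemma NQ_add M f g : L2l f -> L2l g -> NQ M (fun p => f p + g p) <= 2 * NQ M f + 2 * NQ M g.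
Proof.
move=> hf hg; have [mf lf] := hf; have [mg lg] := hg; have [_ lfg] := L2l_add hf hg.
rewrite /NQ -!IntZ// -IntD; [|exact: L1Z..].
apply: Int_le => //; first by apply: L1D; exact: L1Z.
move=> p; rewrite !mulrA -mulrDl ler_wpM2r ?qi_ge0//; have := sqr_ge0 (f p - g p); nra.
Qed.

Lemma NQ_ext M f g : (forall p, f p = g p) -> NQ M f = NQ M g.
Proof. by move=> /funext ->. Qed.

Lemma NQ_sup M f B : (forall p, nm p <= M -> `|f p| <= B) -> L2l f -> NQ M f <= B ^+ 2 * I (qi M).
Proof.
move=> h [mf lf]; rewrite -IntZ; last exact: L_qi.
apply: Int_le => //; first by apply: L1Z; exact: L_qi.
move=> p; case: (leP (nm p) M) => hp; last by rewrite qi0// !mulr0.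
rewrite ler_wpM2r ?qi_ge0// -real_normK ?num_real// lerXn2r ?nnegrE ?h//.
exact: le_trans (normr_ge0 _) (h p hp).
Qed.

(** On a continuous function of compact support mollification converges uniformly; density and the
    contraction property extend this to L^2. *)
Lemma conv_L2 g M (e : R) : L2l g -> 0 < e -> exists2 s0 : R, 0 < s0 &
  forall s, 0 < s <= s0 -> NQ M (fun p => conv g (rho s) p - g p) <= e.
Proof.
move=> hg e0; have [mg lg] := hg.
(* For [s <= 1] this truncation does not change the mollification on the square of half-side [M]. *)
pose h p := g p * qi (M + 1) p.
have mh : meas h by apply: measurable_funM => //; exact: meas_qi.
have qq p r : qi r p ^+ 2 = qi r p :> R.
  by case: (leP (nm p) r) => hp; rewrite ?(qi1 hp) ?(qi0 hp) ?expr1n ?expr0n.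
have lh : L (fun p => h p ^+ 2) by apply: L1_ext (lg (M + 1)) => p; rewrite /h exprMn qq.
have hll : L2l h.
  split=> // r; apply: (@L1_le _ _ _ (@PM R) (fun p => h p ^+ 2)) => //.
    by apply: measurable_funM; [exact: measurable_funX|exact: meas_qi].
  move=> p; have /andP[q0 q1] := qi01 r p.
  by rewrite normrM (ger0_norm q0) ger0_norm ?sqr_ge0// ler_piMr// sqr_ge0.
have e12 : 0 < e / 12 by lra.
have [_ _ /(_ _ e12)[phi [r [c1 c2 c3]]]] := L2_dense mh lh.
pose B := I (qi M); have B0 : 0 <= B by apply: Int_ge0 => p; exact: qi_ge0.
pose eta := Num.min 1 (e / 12 / (B + 1)).
have eta0 : 0 < eta by rewrite /eta lt_min ltr01 divr_gt0// ltr_wpDl.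
have etaB : eta ^+ 2 * B <= e / 12.
  have h1 : eta <= 1 by rewrite /eta ge_min lexx.
  have h2 : eta * (B + 1) <= e / 12 by rewrite -ler_pdivlMr ?ltr_wpDl// /eta ge_min lexx orbT.
  by nra.
have [d d0 hd] := cc_unif c1 c2 eta0.
exists (Num.min 1 (d / 2)); first by rewrite lt_min ltr01 divr_gt0.
move=> s /andP[s0]; rewrite le_min => /andP[s1 sd].
have hl := L2l_Ll hll; have pl := ct_Ll c1.
pose k p := h p - phi p.
have mk : meas k by apply: measurable_funB => //; exact: meas_ct.
have lk : L (fun p => k p ^+ 2) := L1_sqB mh (meas_ct c1) lh (cc_sq c1 c2).
have kl2 : L2l k by apply: L2l_sub => //; exact: L2l_ct.
have kl := L2l_Ll kl2.
have [lck ick] := conv_contract s0 mk lk.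
have cE p : conv h (rho s) p = conv k (rho s) p + conv phi (rho s) p.
  rewrite /conv -IntD; [|exact: conv_L (rho_ct s) (rho_bs s0)..].
  by apply: Int_ext => q; rewrite /k; ring.
have cgh p : nm p <= M -> conv g (rho s) p = conv h (rho s) p.
  move=> hp; apply: Int_ext => q; case: (leP (nm (pm p q)) s) => hq; last by rewrite rho_bs// !mulr0.
  rewrite /h qi1 ?mulr1//; have := nm_tri p q (0, 0); rewrite !pm0 nmN; (clear -hq hp s1; lra).
have pc p : `|conv phi (rho s) p - phi p| <= eta.
  apply: conv_close => // q hq; apply/ltW/hd; apply: le_lt_trans hq _; (clear -sd d0; lra).
have cck := conv_ct kl (rho_ct s) (rho_bs s0).
have ccp := conv_ct pl (rho_ct s) (rho_bs s0).
have l1 : L2l (conv k (rho s)) := L2l_ct cck.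
have l2 : L2l (fun p => conv phi (rho s) p - phi p) by apply: L2l_ct; exact: ctB.
have cg := conv_ct (L2l_Ll hg) (rho_ct s) (rho_bs s0).
have n1 : NQ M (conv k (rho s)) <= e / 12.
  apply: le_trans c3; apply: le_trans ick; apply: Int_le => //; first by case: l1.
  by move=> p; have /andP[q0 q1] := qi01 M p; rewrite ler_piMr ?sqr_ge0.
have n2 : NQ M (fun p => conv phi (rho s) p - phi p) <= e / 12.
  by apply: le_trans etaB; apply: NQ_sup.
have n3 : NQ M k <= e / 12.
  apply: le_trans c3; apply: Int_le => //; first by case: kl2.
  by move=> p; have /andP[q0 q1] := qi01 M p; rewrite ler_piMr ?sqr_ge0.
have -> : NQ M (fun p => conv g (rho s) p - g p) = NQ M (fun p => (conv k (rho s) p + (conv phi (rho s) p - phi p)) + - k p).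
  apply: Int_ext => p; case: (leP (nm p) M) => hp; last by rewrite qi0// !mulr0.
  rewrite cgh// cE; congr (_ ^+ 2 * _); rewrite /k /h qi1 ?mulr1; last by (clear -hp; lra).
  ring.
have a1 := NQ_add M (L2l_add l1 l2) (L2l_opp kl2); have a2 := NQ_add M l1 l2.
have a3 : NQ M (fun p => - k p) = NQ M k by apply: Int_ext => p; rewrite sqrrN.
rewrite a3 in a1; (clear -a1 a2 n3 n2 n1 e0; lra).
Qed.

(* [W^{1,2}_loc] for a continuous representative, through approximation by [C^1] functions on bounded squares. *)
Definition WS u ux uy := [/\ ct u, L2l ux, L2l uy & forall M (e : R), 0 < e ->
  exists w wx wy, [/\ C1 w wx wy, (forall p, nm p <= M -> `|w p - u p| <= e),
    NQ M (fun p => wx p - ux p) <= e & NQ M (fun p => wy p - uy p) <= e]].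

(** The mollifications of [u] approximate it uniformly on squares by continuity, and their gradients
    are the mollified weak gradient. *)
Lemma weak_WS u ux uy : ct u -> L2l ux -> L2l uy -> weak_pd true u ux -> weak_pd false u uy ->
  WS u ux uy.
Proof.
move=> cu hx hy wx wy; split=> // M e e0.
have [s1 s10 h1] := conv_L2 M hx e0; have [s2 s20 h2] := conv_L2 M hy e0.
have [d d0 hd] := ct_unif M cu e0.
pose s := Num.min (d / 2) (Num.min s1 s2).
have s0 : 0 < s by rewrite !lt_min s10 s20 divr_gt0.
have ss1 : s <= s1 by rewrite /s !ge_min lexx orbT.
have ss2 : s <= s2 by rewrite /s !ge_min lexx !orbT.
have sd : s < d by apply: (@le_lt_trans _ _ (d / 2)); rewrite ?ge_min ?lexx//; lra.
have ul := ct_Ll cu.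
have [rx [ry [rxx [rxy [ryy [j1 j2 j3 j4 j5]]]]]] := rho_jet s0.
have hc := conv_C1 ul j1 (rho_bs s0).
exists (conv u (rho s)), (conv ux (rho s)), (conv uy (rho s)); split.
- apply: (C1_ext hc) => // p.
    exact: (weak_conv p s0 ul (L2l_Ll hx) wx j1).
  exact: (weak_conv p s0 ul (L2l_Ll hy) wy j1).
- by move=> p hp; apply: conv_close => // q hq; apply/ltW/hd => //; exact: le_lt_trans sd.
- by apply: h1; rewrite s0.
- by apply: h2; rewrite s0.
Qed.

Lemma C1_refl F Fx Fy p : C1 F Fx Fy ->
  C1 (fun q => F (pm p q)) (fun q => - Fx (pm p q)) (fun q => - Fy (pm p q)).
Proof.
move=> [a1 a2 a3 a4 a5]; split; [exact: ct_refl|exact: ctN (ct_refl p a2)|exact: ctN (ct_refl p a3)| |].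
- move=> q; have := @der_comp _ (fun t => F (t, p.2 - q.2)) (fun t => -1 * t + p.1) q.1 (Fx (pm p q)) (-1).
  rewrite mulrN1 => H; apply: (der_ext _ (H _ (der_aff _ _ _))).
    by move=> y; rewrite /pm /=; congr (F (_, _)); ring.
  have := a4 (pm p q); rewrite /pm /=; congr der; ring.
- move=> q; have := @der_comp _ (fun t => F (p.1 - q.1, t)) (fun t => -1 * t + p.2) q.2 (Fy (pm p q)) (-1).
  rewrite mulrN1 => H; apply: (der_ext _ (H _ (der_aff _ _ _))).
    by move=> y; rewrite /pm /=; congr (F (_, _)); ring.
  have := a5 (pm p q); rewrite /pm /=; congr der; ring.
Qed.

(** The product of [w] with the reflected kernel has compact support, so its partial derivatives
    integrate to 0. *)
Lemma conv_swap w wx wy F Fx Fy s p : C1 w wx wy -> C1 F Fx Fy -> bs s F ->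
  conv w Fx p = conv wx F p /\ conv w Fy p = conv wy F p.
Proof.
move=> hw hF hb; have [bx by_] := bs_der hF hb.
have hm := C1_mul hw (C1_refl p hF).
have hbm : bs (nm p + s) (fun q => w q * F (pm p q)).
  by move=> q hq; rewrite (bs_refl (p := p) hb) ?mulr0.
have ix := IBPx hm hbm; have iy := IBPy hm hbm.
case: hw => w1 w2 w3 _ _; case: hF => f1 f2 f3 _ _.
split; apply/eqP; rewrite -subr_eq0; apply/eqP; rewrite /conv -IntB.
- rewrite -oppr0 -ix -IntN; last first.
    by apply: L1D; [exact: conv_L (ct_Ll w2) f1 hb|apply: (L1_ext _ (L1N (conv_L p (ct_Ll w1) f2 bx))) => q; rewrite mulrN].
  by apply: Int_ext => q; ring.
- exact: conv_L (ct_Ll w1) f2 bx.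
- exact: conv_L (ct_Ll w2) f1 hb.
- rewrite -oppr0 -iy -IntN; last first.
    by apply: L1D; [exact: conv_L (ct_Ll w3) f1 hb|apply: (L1_ext _ (L1N (conv_L p (ct_Ll w1) f3 by_))) => q; rewrite mulrN].
  by apply: Int_ext => q; ring.
- exact: conv_L (ct_Ll w1) f3 by_.
- exact: conv_L (ct_Ll w3) f1 hb.
Qed.

Definition C2 (z zx zy zxx zxy zyy : C -> R) := [/\ C1 z zx zy, C1 zx zxx zxy & C1 zy zxy zyy].

Lemma C1_C2 w wx wy M (e : R) : C1 w wx wy -> 0 < e -> exists z zx zy zxx zxy zyy,
  C2 z zx zy zxx zxy zyy /\ forall p, nm p <= M ->
   [/\ `|z p - w p| <= e, `|zx p - wx p| <= e & `|zy p - wy p| <= e].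
Proof.
move=> hw e0; have [w1 w2 w3 _ _] := hw.
have [d1 d10 h1] := ct_unif M w1 e0; have [d2 d20 h2] := ct_unif M w2 e0; have [d3 d30 h3] := ct_unif M w3 e0.
pose s := Num.min d1 (Num.min d2 d3) / 2.
have m0 : 0 < Num.min d1 (Num.min d2 d3) by rewrite !lt_min d10 d20.
have s0 : 0 < s by rewrite divr_gt0.
have sm : s < Num.min d1 (Num.min d2 d3) by rewrite /s; lra.
move: sm; rewrite !lt_min => /and3P[sd1 sd2 sd3].
have [rx [ry [rxx [rxy [ryy [j1 j2 j3 j4 j5]]]]]] := rho_jet s0.
have wl := ct_Ll w1; have hb := rho_bs s0.
exists (conv w (rho s)), (conv w rx), (conv w ry), (conv w rxx), (conv w rxy), (conv w ryy).
split; first by split; [exact: conv_C1 wl j1 hb|exact: conv_C1 wl j2 j4|exact: conv_C1 wl j3 j5].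
move=> p hp; have [-> ->] := conv_swap p hw j1 hb.
split; apply: conv_close => //; try exact: ct_Ll; move=> q hq; apply/ltW.
- by apply: h1 => //; exact: le_lt_trans sd1.
- by apply: h2 => //; exact: le_lt_trans sd2.
- by apply: h3 => //; exact: le_lt_trans sd3.
Qed.

Lemma C1_WS w wx wy : C1 w wx wy -> WS w wx wy.
Proof.
move=> h; have [w1 w2 w3 _ _] := h; split; [exact: w1|exact: L2l_ct|exact: L2l_ct|].
move=> M e e0; exists w, wx, wy; split=> //.
- by move=> p _; rewrite subrr normr0 ltW.
- by rewrite /NQ (@Int_ext _ _ _ (@PM R) _ (fun=> 0)) ?Int0 ?ltW// => p; rewrite subrr expr0n mul0r.
- by rewrite /NQ (@Int_ext _ _ _ (@PM R) _ (fun=> 0)) ?Int0 ?ltW// => p; rewrite subrr expr0n mul0r.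
Qed.

(** Identities for Sobolev functions are proved with an error O(t) after approximation to accuracy
    [t ^+ 2], and closed by this remark. *)
Lemma small0 (x A : R) : (forall t, 0 < t <= 1 -> `|x| <= A * t) -> x = 0.
Proof.
move=> h; apply/eqP; rewrite -normr_eq0 eq_le normr_ge0 andbT.
have A0 : 0 <= A by have := h 1; rewrite ltr01 lexx mulr1 => /(_ isT); apply: le_trans.
apply/ler_addgt0Pr => e e0; rewrite add0r.
have t0 : 0 < Num.min 1 (e / (A + 1)) by rewrite lt_min ltr01 divr_gt0// ltr_wpDl.
have := h (Num.min 1 (e / (A + 1))); rewrite t0 ge_min lexx => /(_ isT) /le_trans; apply.
have : Num.min 1 (e / (A + 1)) <= e / (A + 1) by rewrite ge_min lexx orbT.
rewrite ler_pdivlMr ?ltr_wpDl//; nra.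
Qed.

Lemma WS_IBP u ux uy chi cx cy r : WS u ux uy -> C1 chi cx cy -> bs r chi ->
  I (fun p => chi p * ux p) = - I (fun p => cx p * u p) /\
  I (fun p => chi p * uy p) = - I (fun p => cy p * u p).
Proof.
move=> [cu hx hy H] hc hb; have [bx by_] := bs_der hc hb; have [c0 c1 c2 _ _] := hc.
have ux1 := Ll_bs (L2l_Ll hx) c0 hb; have uy1 := Ll_bs (L2l_Ll hy) c0 hb.
have cx1 := Ll_bs (ct_Ll cu) c1 bx; have cy1 := Ll_bs (ct_Ll cu) c2 by_.
have [K K0 hK] := bs_bounded c0 hb; have [Kx Kx0 hKx] := bs_bounded c1 bx; have [Ky Ky0 hKy] := bs_bounded c2 by_.
have one : L2l (fun=> 1 : R) by apply: L2l_ct; exact: ct_cst.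
pose B := I (qi r); pose N1 := NQ r (fun=> 1).
(* One estimate for both coordinates: a gradient error with squared norm at most [t ^+ 2] changes
   each pairing by O(t). *)
have key (chi' cx' : C -> R) (ux' : C -> R) (wx' w : C -> R) (t K' : R) : ct chi' -> ct cx' -> bs r chi' -> bs r cx' ->
   L2l ux' -> ct wx' -> ct w -> (forall p, `|chi' p| <= K') -> (forall p, `|cx' p| <= K') -> 0 < t <= 1 ->
   I (fun p => chi' p * wx' p + cx' p * w p) = 0 ->
   (forall p, nm p <= r -> `|w p - u p| <= t ^+ 2) -> NQ r (fun p => wx' p - ux' p) <= t ^+ 2 ->
   `|I (fun p => chi' p * ux' p) + I (fun p => cx' p * u p)| <= (K' * (1 + N1) + K' * B) * t.
  move=> a1 a2 a3 a4 a5 a6 a7 a8 a9 /andP[t0 t1] e1 e2 e3.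
  have K'0 : 0 <= K' by apply: le_trans (a8 (0, 0)).
  have l1 : L (fun p => chi' p * ux' p) by apply: (L1_ext _ (Ll_bs (L2l_Ll a5) a1 a3)) => p; rewrite mulrC.
  have l2 : L (fun p => cx' p * u p) by apply: (L1_ext _ (Ll_bs (ct_Ll cu) a2 a4)) => p; rewrite mulrC.
  have l3 : L (fun p => chi' p * wx' p) by apply: (L1_ext _ (Ll_bs (ct_Ll a6) a1 a3)) => p; rewrite mulrC.
  have l4 : L (fun p => cx' p * w p) by apply: (L1_ext _ (Ll_bs (ct_Ll a7) a2 a4)) => p; rewrite mulrC.
  rewrite IntD// in e1.
  have d1 : I (fun p => chi' p * ((wx' p - ux' p) * 1)) = I (fun p => chi' p * wx' p) - I (fun p => chi' p * ux' p).
    by rewrite -IntB//; apply: Int_ext => p; ring.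
  have b1 := I_small t0 (L2l_sub (L2l_ct a6) a5) one (meas_ct a1) a3 a8.
  rewrite d1 -/N1 in b1.
  have d2 : `|I (fun p => cx' p * w p) - I (fun p => cx' p * u p)| <= K' * t ^+ 2 * B.
    rewrite -IntB// /B -IntZ; last exact: L_qi.
    apply: Int_abs_le; [exact: L1B|by apply: L1Z; exact: L_qi|].
    move=> p; rewrite -mulrBr normrM; case: (leP (nm p) r) => h.
      by rewrite qi1// mulr1; apply: ler_pM => //; exact: e2.
    by rewrite a4// normr0 mul0r qi0// mulr0.
  have B0 : 0 <= B by apply: Int_ge0 => p; exact: qi_ge0.
  have t2 : NQ r (fun p => wx' p - ux' p) / t <= t by rewrite ler_pdivrMr// -expr2.
  have b1' : `|I (fun p => chi' p * wx' p) - I (fun p => chi' p * ux' p)| <= K' * (1 + N1) * t.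
    apply: le_trans b1 _; rewrite -mulrA ler_wpM2l// mulrDl mul1r (mulrC N1) lerD2r//.
  have b2' : K' * t ^+ 2 * B <= K' * B * t.
    have : 0 <= K' * B by rewrite mulr_ge0.
    by move=> h; rewrite mulrAC ler_wpM2l// expr2 ler_piMr// ltW.
  move: b1' d2; rewrite !ler_norml => /andP[x1 x2] /andP[x3 x4].
  by rewrite mulrDl; clear -e1 x1 x2 x3 x4 b2'; apply/andP; split; lra.
have mx p : `|chi p| <= K + Kx + Ky by apply: (le_trans (hK p)); (clear -Ky0 Kx0; lra).
have mcx p : `|cx p| <= K + Kx + Ky by apply: (le_trans (hKx p)); (clear -Ky0 K0; lra).
have mcy p : `|cy p| <= K + Kx + Ky by apply: (le_trans (hKy p)); (clear -Kx0 K0; lra).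
split; apply/eqP; rewrite -addr_eq0; apply/eqP; apply: small0 => t ht.
  have [w [wx [wy [hw w1 w2 w3]]]] := H r (t ^+ 2) (exprn_gt0 2 (andP ht).1).
  have [q1 q2 q3 _ _] := hw.
  apply: (key chi cx ux wx w t (K + Kx + Ky)) => //.
  have hm := C1_mul hc hw; rewrite -(IBPx (r := r) hm); last by move=> p hp; rewrite hb// mul0r.
  by apply: Int_ext => p; ring.
have [w [wx [wy [hw w1 w2 w3]]]] := H r (t ^+ 2) (exprn_gt0 2 (andP ht).1).
have [q1 q2 q3 _ _] := hw.
apply: (key chi cy uy wy w t (K + Kx + Ky)) => //.
have hm := C1_mul hc hw; rewrite -(IBPy (r := r) hm); last by move=> p hp; rewrite hb// mul0r.
by apply: Int_ext => p; ring.
Qed.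

End Weak.

Section WeakCalculus.
Variable R : realType.
Local Notation C := (R * R)%type.
Local Notation M1 := (measurableTypeR R).
Local Notation L := (L1 (@PM R)).
Local Notation I := (Int (@PM R)).
Local Notation meas := (measurable_fun (setT : set (M1 * M1))).
Implicit Types (F G u v w f g : C -> R) (p q c : C) (r s M : R).

(** The difference of the two products is [- ((f' - f) * g + (g' - g) * f')], and [I_small] applies
    to each term; [NQ r f'] is bounded through [NQ r f]. *)
Lemma bil f f' g g' (chi : C -> R) r K A t : 0 < t <= 1 -> L2l f -> L2l f' -> L2l g -> L2l g' ->
  meas chi -> bs r chi -> (forall p, `|chi p| <= K) ->
  NQ r (fun p => f' p - f p) <= A * t ^+ 2 -> NQ r (fun p => g' p - g p) <= A * t ^+ 2 ->
  `|I (fun p => chi p * (f p * g p)) - I (fun p => chi p * (f' p * g' p))| <=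
     K * (NQ r g + 2 * NQ r f + 4 * A) * t.
Proof.
move=> /andP[t0 t1] hf hf' hg hg' mc hb hK h1 h2.
have K0 : 0 <= K by apply: le_trans (hK (0, 0)).
have df := L2l_sub hf' hf; have dg := L2l_sub hg' hg.
have A0 : 0 <= A * t ^+ 2 := le_trans (NQ_ge0 _ _) h1.
have A1 : 0 <= A by move: A0; rewrite pmulr_lge0// exprn_gt0.
have b1 := I_small t0 df hg mc hb hK; have b2 := I_small t0 dg hf' mc hb hK.
have nf' : NQ r f' <= 2 * A + 2 * NQ r f.
  have := NQ_add r df hf; rewrite (NQ_ext r (g := f')); last by move=> p; rewrite subrK.
  have t2 : t ^+ 2 <= 1 by rewrite expr2; (clear -t1 t0; nra).
  have : A * t ^+ 2 <= A by rewrite ler_piMr.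
  clear -h1; lra.
have e : I (fun p => chi p * (f p * g p)) - I (fun p => chi p * (f' p * g' p)) =
   - (I (fun p => chi p * ((f' p - f p) * g p)) + I (fun p => chi p * ((g' p - g p) * f' p))).
  rewrite -IntD; [|exact: (L_mul df hg mc hb hK)|exact: (L_mul dg hf' mc hb hK)].
  rewrite -IntB; [|exact: (L_mul hf hg mc hb hK)|exact: (L_mul hf' hg' mc hb hK)].
  rewrite -IntN; last by apply: L1D; [exact: (L_mul df hg mc hb hK)|exact: (L_mul dg hf' mc hb hK)].
  by apply: Int_ext => p; ring.
rewrite e normrN; apply: le_trans (ler_normD _ _) _; apply: le_trans (lerD b1 b2) _.
have q1 : NQ r (fun p => f' p - f p) / t <= A * t by rewrite ler_pdivrMr// -mulrA -expr2.
have q2 : NQ r (fun p => g' p - g p) / t <= A * t by rewrite ler_pdivrMr// -mulrA -expr2.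
rewrite -mulrDr -mulrA ler_wpM2l//.
have : t * NQ r f' <= t * (2 * A + 2 * NQ r f) by rewrite ler_pM2l.
clear -q2 q1; lra.
Qed.

Lemma WS_C2 u ux uy M (e : R) : WS u ux uy -> 0 < e -> exists z zx zy zxx zxy zyy,
  [/\ C2 z zx zy zxx zxy zyy, (forall p, nm p <= M -> `|z p - u p| <= e),
    NQ M (fun p => zx p - ux p) <= e & NQ M (fun p => zy p - uy p) <= e].
Proof.
move=> [cu hx hy H] e0.
have e8 : 0 < e / 8 by lra.
have [w [wx [wy [hw w1 w2 w3]]]] := H M _ e8.
pose B := I (qi M); have B0 : 0 <= B by apply: Int_ge0 => p; exact: qi_ge0.
pose t := Num.min 1 (Num.min (e / 2) (e / 4 / (B + 1))).
have t0 : 0 < t by rewrite !lt_min ltr01 !divr_gt0// ltr_wpDl.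
have tB : t ^+ 2 * B <= e / 4.
  have h1 : t <= 1 by rewrite /t ge_min lexx.
  have h2 : t * (B + 1) <= e / 4 by rewrite -ler_pdivlMr ?ltr_wpDl// /t !ge_min lexx !orbT.
  by nra.
have te : t <= e / 2 by rewrite /t !ge_min lexx !orbT.
have [z [zx [zy [zxx [zxy [zyy [hz zz]]]]]]] := C1_C2 M hw t0.
exists z, zx, zy, zxx, zxy, zyy; split=> //.
- move=> p hp; have [a _ _] := zz p hp; have b := w1 p hp.
  have := ler_distD (w p) (z p) (u p); (clear -b a te e0; lra).
- have [[_ cx cy _ _] _ _] := hz; have [_ dx dy _ _] := hw.
  have := NQ_add M (L2l_sub (L2l_ct cx) (L2l_ct dx)) (L2l_sub (L2l_ct dx) hx).
  rewrite (NQ_ext M (g := fun p => zx p - ux p)); last by move=> p; ring.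
  have := @NQ_sup _ M (fun p => zx p - wx p) t _ (L2l_sub (L2l_ct cx) (L2l_ct dx)).
  have h : forall p, nm p <= M -> `|zx p - wx p| <= t by move=> p /zz[].
  by move=> /(_ h); rewrite -/B; (clear -tB w2 e0; lra).
- have [[_ cx cy _ _] _ _] := hz; have [_ dx dy _ _] := hw.
  have := NQ_add M (L2l_sub (L2l_ct cy) (L2l_ct dy)) (L2l_sub (L2l_ct dy) hy).
  rewrite (NQ_ext M (g := fun p => zy p - uy p)); last by move=> p; ring.
  have := @NQ_sup _ M (fun p => zy p - wy p) t _ (L2l_sub (L2l_ct cy) (L2l_ct dy)).
  have h : forall p, nm p <= M -> `|zy p - wy p| <= t by move=> p /zz[].
  by move=> /(_ h); rewrite -/B; (clear -tB w3 e0; lra).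
Qed.

(** In terms of forms, the integral of chi du /\ dv is minus the integral of u dchi /\ dv. With a
    C^1 approximant of [u] and a C^2 approximant of [v], two integrations by parts produce the same
    mixed derivative with opposite signs; [bil] then passes to the limit. *)
Lemma NL u ux uy v vx vy chi cx cy r : WS u ux uy -> WS v vx vy -> C1 chi cx cy -> bs r chi ->
  I (fun p => chi p * (ux p * vy p)) - I (fun p => chi p * (uy p * vx p)) =
  - (I (fun p => cx p * (u p * vy p)) - I (fun p => cy p * (u p * vx p))).
Proof.
move=> hu hv hc hb; have [bx by_] := bs_der hc hb; have [c0 c1 c2 _ _] := hc.
have [cu hux huy Hu] := hu; have [cv hvx hvy Hv] := hv.
have [K0 K00 hK0] := bs_bounded c0 hb; have [Kx Kx0 hKx] := bs_bounded c1 bx; have [Ky Ky0 hKy] := bs_bounded c2 by_.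
pose K := K0 + Kx + Ky.
have k0 p : `|chi p| <= K by apply: (le_trans (hK0 p)); rewrite /K; lra.
have kx p : `|cx p| <= K by apply: (le_trans (hKx p)); rewrite /K; lra.
have ky p : `|cy p| <= K by apply: (le_trans (hKy p)); rewrite /K; lra.
have lu := L2l_ct cu.
pose B := I (qi r); have B0 : 0 <= B by apply: Int_ge0 => p; exact: qi_ge0.
pose A := B + 1.
pose T := K * (NQ r vy + 2 * NQ r ux + 4 * A) + K * (NQ r vx + 2 * NQ r uy + 4 * A) +
  K * (NQ r vy + 2 * NQ r u + 4 * A) + K * (NQ r vx + 2 * NQ r u + 4 * A).
apply/eqP; rewrite -addr_eq0; apply/eqP; apply: (@small0 _ _ T) => t ht.
have t0 : 0 < t by case/andP: ht.
have t1 : t <= 1 by case/andP: ht.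
have t20 : 0 < t ^+ 2 by rewrite exprn_gt0.
have [w [wx [wy [hw w1 w2 w3]]]] := Hu r _ t20.
have [z [zx [zy [zxx [zxy [zyy [[hz hzx hzy] z1 z2 z3]]]]]]] := WS_C2 r hv t20.
have [w_ wx_ wy_ _ _] := hw; have [_ zx_ zy_ _ _] := hz.
have l k : L2l (fun p => k p - k p) -> True by [].
have At : t ^+ 2 <= A * t ^+ 2 by rewrite ler_peMl ?sqr_ge0// /A; (clear -B0; lra).
have nw : NQ r (fun p => w p - u p) <= A * t ^+ 2.
  apply: le_trans (NQ_sup w1 (L2l_sub (L2l_ct w_) lu)) _; rewrite -/B /A.
  have t2 : t ^+ 2 <= 1 by rewrite expr2; (clear -ht; nra).
  have h : (t ^+ 2) ^+ 2 <= t ^+ 2 by rewrite expr2 ler_piMr// sqr_ge0.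
  have := ler_wpM2r B0 h; have := sqr_ge0 t; (clear; lra).
have E1 := bil ht hux (L2l_ct wx_) hvy (L2l_ct zy_) (meas_ct c0) hb k0 (le_trans w2 At) (le_trans z3 At).
have E2 := bil ht huy (L2l_ct wy_) hvx (L2l_ct zx_) (meas_ct c0) hb k0 (le_trans w3 At) (le_trans z2 At).
have E3 := bil ht lu (L2l_ct w_) hvy (L2l_ct zy_) (meas_ct c1) bx kx nw (le_trans z3 At).
have E4 := bil ht lu (L2l_ct w_) hvx (L2l_ct zx_) (meas_ct c2) by_ ky nw (le_trans z2 At).
have m1 := C1_mul (C1_mul hc hw) hzy; have m2 := C1_mul (C1_mul hc hw) hzx.
have b1 : bs r (fun p => chi p * w p * zy p) by move=> p hp; rewrite hb// !mul0r.
have b2 : bs r (fun p => chi p * w p * zx p) by move=> p hp; rewrite hb// !mul0r.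
have i1 := IBPx m1 b1; have i2 := IBPy m2 b2.
have L1' (a b k : C -> R) : ct a -> ct b -> ct k -> bs r k -> L (fun p => k p * (a p * b p)).
  by move=> ca cb ck bk; apply: (@L_cc _ r); [exact: ctM ck (ctM ca cb)|move=> p hp; rewrite bk// mul0r].
have q1 := L1' _ _ _ wx_ zy_ c0 hb; have q2 := L1' _ _ _ wy_ zx_ c0 hb.
have q3 := L1' _ _ _ w_ zy_ c1 bx; have q4 := L1' _ _ _ w_ zx_ c2 by_.
have [_ _ zxy_ _ _] := hzx.
have q5 := L1' _ _ _ w_ zxy_ c0 hb.
have Ex : I (fun p => chi p * (wx p * zy p)) + I (fun p => cx p * (w p * zy p)) + I (fun p => chi p * (w p * zxy p)) = 0.
  rewrite -i1 -IntD// -IntD//; last exact: L1D.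
  by apply: Int_ext => p; ring.
have Ey : I (fun p => chi p * (wy p * zx p)) + I (fun p => cy p * (w p * zx p)) + I (fun p => chi p * (w p * zxy p)) = 0.
  rewrite -i2 -IntD// -IntD//; last exact: L1D.
  by apply: Int_ext => p; ring.
rewrite /T 3!(mulrDl _ _ t).
set a1 := I _ in E1 * ; set b1' := I _ in E1 Ex *.
set a2 := I _ in E2 * ; set b2' := I _ in E2 Ey *.
set a3 := I _ in E3 * ; set b3' := I _ in E3 Ex *.
set a4 := I _ in E4 * ; set b4' := I _ in E4 Ey *.
set q5' := I _ in Ex Ey.
move: E1 E2 E3 E4; set X1 := K * _ * t; set X2 := K * _ * t; set X3 := K * _ * t; set X4 := K * _ * t.
rewrite !ler_norml => /andP[i1' j1] /andP[i2' j2] /andP[i3 j3] /andP[i4 j4].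
clear -i1' i2' i3 i4 j1 j2 j3 j4 Ex Ey; clearbody a1 a2 a3 a4 b1' b2' b3' b4' q5' X1 X2 X3 X4.
by apply/andP; split; (clear -j4 i3 j2 i1' Ey Ex i4 j3 i2' j1; lra).
Qed.

Lemma WS_add u ux uy v vx vy : WS u ux uy -> WS v vx vy ->
  WS (fun p => u p + v p) (fun p => ux p + vx p) (fun p => uy p + vy p).
Proof.
move=> [cu hx hy H] [cv gx gy G]; split; [exact: ctD|exact: L2l_add|exact: L2l_add|].
move=> M e e0; have e4 : 0 < e / 4 by lra.
have [w [wx [wy [hw w1 w2 w3]]]] := H M _ e4; have [z [zx [zy [hz z1 z2 z3]]]] := G M _ e4.
have [_ wx_ wy_ _ _] := hw; have [_ zx_ zy_ _ _] := hz.
exists (fun p => w p + z p), (fun p => wx p + zx p), (fun p => wy p + zy p); split.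
- exact: C1_add.
- move=> p hp; have := w1 p hp; have := z1 p hp; have := ler_normD (w p - u p) (z p - v p).
  have -> : w p - u p + (z p - v p) = w p + z p - (u p + v p) by ring.
  lra.
- have := NQ_add M (L2l_sub (L2l_ct wx_) hx) (L2l_sub (L2l_ct zx_) gx).
  rewrite (NQ_ext M (g := fun p => wx p + zx p - (ux p + vx p))); [(clear -z2 w2; lra)|by move=> p; ring].
- have := NQ_add M (L2l_sub (L2l_ct wy_) hy) (L2l_sub (L2l_ct zy_) gy).
  rewrite (NQ_ext M (g := fun p => wy p + zy p - (uy p + vy p))); [(clear -z3 w3; lra)|by move=> p; ring].
Qed.

Lemma NQ_mul M ux vx u v w z wx zx K (t : R) : 0 < t <= 1 -> 0 <= K ->
  L2l ux -> L2l vx -> ct u -> ct v -> ct w -> ct z -> ct wx -> ct zx ->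
  (forall p, nm p <= M -> `|w p| <= K /\ `|z p| <= K) ->
  (forall p, nm p <= M -> `|w p - u p| <= t /\ `|z p - v p| <= t) ->
  NQ M (fun p => wx p - ux p) <= t -> NQ M (fun p => zx p - vx p) <= t ->
  NQ M (fun p => wx p * z p + w p * zx p - (ux p * v p + u p * vx p)) <=
    4 * (2 * K ^+ 2 + NQ M ux + NQ M vx) * t.
Proof.
move=> /andP[t0 t1] K0 hux hvx cu cv cw cz cwx czx hK ht n1 n2.
have d1 := L2l_sub (L2l_ct cwx) hux; have d2 := L2l_sub (L2l_ct czx) hvx.
have f1 := L2l_ctM cz d1; have f2 := L2l_ctM (ctB cz cv) hux.
have f3 := L2l_ctM cw d2; have f4 := L2l_ctM (ctB cw cu) hvx.
have := NQ_add M (L2l_add f1 f2) (L2l_add f3 f4).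
rewrite (NQ_ext M (g := fun p => wx p * z p + w p * zx p - (ux p * v p + u p * vx p))); last by move=> p; ring.
have a1 := NQ_add M f1 f2; have a2 := NQ_add M f3 f4.
have sq (x B : R) : `|x| <= B -> x ^+ 2 <= B ^+ 2.
  by move=> h; rewrite -real_normK ?num_real// lerXn2r ?nnegrE//; apply: le_trans h.
have b1 : NQ M (fun p => z p * (wx p - ux p)) <= K ^+ 2 * NQ M (fun p => wx p - ux p).
  by apply: NQ_le => //; [exact: sqr_ge0|move=> p /hK[_ h]; rewrite exprMn ler_wpM2r ?sqr_ge0 ?sq].
have b2 : NQ M (fun p => (z p - v p) * ux p) <= t ^+ 2 * NQ M ux.
  by apply: NQ_le => //; [exact: sqr_ge0|move=> p /ht[_ h]; rewrite exprMn ler_wpM2r ?sqr_ge0 ?sq].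
have b3 : NQ M (fun p => w p * (zx p - vx p)) <= K ^+ 2 * NQ M (fun p => zx p - vx p).
  by apply: NQ_le => //; [exact: sqr_ge0|move=> p /hK[h _]; rewrite exprMn ler_wpM2r ?sqr_ge0 ?sq].
have b4 : NQ M (fun p => (w p - u p) * vx p) <= t ^+ 2 * NQ M vx.
  by apply: NQ_le => //; [exact: sqr_ge0|move=> p /ht[h _]; rewrite exprMn ler_wpM2r ?sqr_ge0 ?sq].
have tt : t ^+ 2 <= t by (clear -t1 t0; nra).
have c1 : K ^+ 2 * NQ M (fun p => wx p - ux p) <= K ^+ 2 * t by rewrite ler_wpM2l ?sqr_ge0.
have c3 : K ^+ 2 * NQ M (fun p => zx p - vx p) <= K ^+ 2 * t by rewrite ler_wpM2l ?sqr_ge0.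
have c2 : t ^+ 2 * NQ M ux <= t * NQ M ux by rewrite ler_wpM2r ?NQ_ge0.
have c4 : t ^+ 2 * NQ M vx <= t * NQ M vx by rewrite ler_wpM2r ?NQ_ge0.
clear -a1 a2 b1 b2 b3 b4 c1 c2 c3 c4; lra.
Qed.

(** The members are continuous, hence bounded on squares, which keeps the Leibniz terms square
    integrable. *)
Lemma WS_mul u ux uy v vx vy : WS u ux uy -> WS v vx vy ->
  WS (fun p => u p * v p) (fun p => ux p * v p + u p * vx p) (fun p => uy p * v p + u p * vy p).
Proof.
move=> [cu hx hy H] [cv gx gy G]; split.
- exact: ctM.
- by apply: L2l_add; [apply: L2l_ext (L2l_ctM cv hx) => p; rewrite mulrC|exact: L2l_ctM].
- by apply: L2l_add; [apply: L2l_ext (L2l_ctM cv hy) => p; rewrite mulrC|exact: L2l_ctM].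
move=> M e e0.
have [K1 K10 hK1] := ct_bounded M cu; have [K2 K20 hK2] := ct_bounded M cv.
pose K := K1 + K2 + 1.
have K0 : 0 <= K by rewrite /K; lra.
pose T := 4 * (2 * K ^+ 2 + NQ M ux + NQ M vx) + 4 * (2 * K ^+ 2 + NQ M uy + NQ M vy) + 2 * K.
have T0 : 0 <= T.
  rewrite /T; have := NQ_ge0 M ux; have := NQ_ge0 M vx; have := NQ_ge0 M uy; have := NQ_ge0 M vy.
  have := sqr_ge0 K; lra.
pose t := Num.min 1 (e / (T + 1)).
have t0 : 0 < t by rewrite lt_min ltr01 divr_gt0// ltr_wpDl.
have t1 : t <= 1 by rewrite ge_min lexx.
have tT : T * t <= e.
  have : t * (T + 1) <= e by rewrite -ler_pdivlMr ?ltr_wpDl// /t ge_min lexx orbT.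
  by rewrite mulrDr mulr1 mulrC; lra.
have [w [wx [wy [hw w1 w2 w3]]]] := H M _ t0; have [z [zx [zy [hz z1 z2 z3]]]] := G M _ t0.
have [w_ wx_ wy_ _ _] := hw; have [z_ zx_ zy_ _ _] := hz.
have hK p : nm p <= M -> `|w p| <= K /\ `|z p| <= K.
  move=> hp; have a := w1 p hp; have b := z1 p hp; have a' := hK1 p hp; have b' := hK2 p hp.
  have x := ler_normD (w p - u p) (u p); have y := ler_normD (z p - v p) (v p).
  by rewrite !subrK in x y; rewrite /K; clear -x y a b a' b' t1 K10 K20; split; lra.
have ht p : nm p <= M -> `|w p - u p| <= t /\ `|z p - v p| <= t by move=> hp; split; [exact: w1|exact: z1].
have tb : 0 < t <= 1 by rewrite t0.
have q1 := NQ_mul tb K0 hx gx cu cv w_ z_ wx_ zx_ hK ht w2 z2.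
have q2 := NQ_mul tb K0 hy gy cu cv w_ z_ wy_ zy_ hK ht w3 z3.
have n1 := NQ_ge0 M ux; have n2 := NQ_ge0 M vx; have n3 := NQ_ge0 M uy; have n4 := NQ_ge0 M vy.
have s2 := sqr_ge0 K.
exists (fun p => w p * z p), (fun p => wx p * z p + w p * zx p), (fun p => wy p * z p + w p * zy p); split.
- exact: C1_mul.
- move=> p hp; apply: le_trans tT.
  have -> : w p * z p - u p * v p = w p * (z p - v p) + (w p - u p) * v p by ring.
  have [a b] := hK p hp; have [c d] := ht p hp; have f := hK2 p hp.
  apply: (le_trans (ler_normD _ _)); rewrite !normrM.
  have : `|w p| * `|z p - v p| <= K * t by apply: ler_pM.
  have : `|w p - u p| * `|v p| <= t * K by apply: ler_pM => //; apply: le_trans f _; rewrite /K; clear -K10; lra.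
  have : 2 * K * t <= T * t by rewrite ler_pM2r// /T; clear -n1 n2 n3 n4 s2; lra.
  by clear; lra.
- apply: le_trans q1 _; apply: le_trans tT; rewrite ler_pM2r// /T; clear -n1 n2 n3 n4 s2 K0; lra.
- apply: le_trans q2 _; apply: le_trans tT; rewrite ler_pM2r// /T; clear -n1 n2 n3 n4 s2 K0; lra.
Qed.

Lemma WS_ext u ux uy v vx vy : WS u ux uy -> (forall p, u p = v p) -> (forall p, ux p = vx p) ->
  (forall p, uy p = vy p) -> WS v vx vy.
Proof. by move=> h /funext <- /funext <- /funext <-. Qed.
Lemma WS_cst (k : R) : WS (fun=> k) (fun=> 0) (fun=> 0).
Proof. exact: C1_WS (C1_cst k). Qed.
Lemma WS_scale (k : R) u ux uy : WS u ux uy -> WS (fun p => k * u p) (fun p => k * ux p) (fun p => k * uy p).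
Proof. move=> h; apply: (WS_ext (WS_mul (WS_cst k) h)) => // p; ring. Qed.
Lemma WS_opp u ux uy : WS u ux uy -> WS (fun p => - u p) (fun p => - ux p) (fun p => - uy p).
Proof. by move=> h; apply: (WS_ext (WS_scale (-1) h)) => p; rewrite mulN1r. Qed.
Lemma WS_sub u ux uy v vx vy : WS u ux uy -> WS v vx vy ->
  WS (fun p => u p - v p) (fun p => ux p - vx p) (fun p => uy p - vy p).
Proof. by move=> h1 h2; exact: WS_add h1 (WS_opp h2). Qed.

Lemma cts_seg (h : R -> R) K : continuous h -> exists2 B, 0 < B & forall x, `|x| <= K -> `|h x| <= B.
Proof.
move=> ch; have c : ct (fun p : C => h p.1) := ct_comp1 ch (@ct1 R).
have [B B0 hB] := ct_bounded K c; exists B => // x hx.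
by apply: (hB (x, 0)); rewrite nm_le /= normr0 hx; apply: le_trans hx.
Qed.
Lemma cts_unif (h : R -> R) K (e : R) : continuous h -> 0 < e -> exists2 d, 0 < d &
  forall x y, `|x| <= K -> `|y - x| < d -> `|h y - h x| < e.
Proof.
move=> ch e0; have c : ct (fun p : C => h p.1) := ct_comp1 ch (@ct1 R).
have [d d0 hd] := ct_unif K c e0; exists d => // x y hx hy.
apply: (hd (x, 0) (y, 0)); first by rewrite nm_le /= normr0 hx; apply: le_trans hx.
by rewrite nm_lt /= subrr normr0 hy.
Qed.

(** The error splits into [h' (w p) * (wx p - ux p)], controlled by a bound on [h'], and
    [(h' (w p) - h' (u p)) * ux p], controlled by its uniform continuity on the bounded range. *)
Lemma WS_comp1 (h h' : R -> R) u ux uy : continuous h' -> (forall x, der h x (h' x)) ->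
  WS u ux uy -> WS (fun p => h (u p)) (fun p => h' (u p) * ux p) (fun p => h' (u p) * uy p).
Proof.
move=> ch' dh [cu hx hy H].
have ch : continuous h by move=> x; exact: der_cts (dh x).
have cu' := ct_comp1 ch' cu.
split; [exact: ct_comp1|exact: L2l_ctM|exact: L2l_ctM|].
move=> M e e0; have [K K0 hK] := ct_bounded M cu.
have [B B0 hB] := cts_seg (K + 1) ch'.
pose N := NQ M ux + NQ M uy; have N0 : 0 <= N by rewrite /N addr_ge0 ?NQ_ge0.
pose om := Num.min 1 (e / 4 / (N + 1)).
have om0 : 0 < om by rewrite lt_min ltr01 !divr_gt0// ltr_wpDl.
have om1 : om <= 1 by rewrite ge_min lexx.
have omN : om ^+ 2 * N <= e / 4.
  have : om * (N + 1) <= e / 4 by rewrite -ler_pdivlMr ?ltr_wpDl// /om ge_min lexx orbT.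
  nra.
have [d1 d10 hd1] := cts_unif K ch e0; have [d2 d20 hd2] := cts_unif K ch' om0.
pose t := Num.min (Num.min 1 (e / 4 / B ^+ 2)) (Num.min d1 d2 / 2).
have t0 : 0 < t.
  by rewrite !lt_min ltr01 !divr_gt0 ?exprn_gt0// lt_min d10.
have t1 : t <= 1 by rewrite !ge_min lexx.
have tB : B ^+ 2 * t <= e / 4.
  by rewrite mulrC -ler_pdivlMr ?exprn_gt0// /t !ge_min lexx !orbT.
have m0 : 0 < Num.min d1 d2 by rewrite lt_min d10.
have td : t < Num.min d1 d2.
  have : t <= Num.min d1 d2 / 2 by rewrite /t ge_min lexx orbT.
  clear -m0; lra.
move: td; rewrite lt_min => /andP[td1 td2].
have [w [wx [wy [hw w1 w2 w3]]]] := H M _ t0; have [w_ wx_ wy_ _ _] := hw.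
have sq (x D : R) : `|x| <= D -> x ^+ 2 <= D ^+ 2.
  by move=> hD; rewrite -real_normK ?num_real// lerXn2r ?nnegrE//; apply: le_trans hD.
have key (wx' ux' : C -> R) : ct wx' -> L2l ux' -> NQ M (fun p => wx' p - ux' p) <= t -> NQ M ux' <= N ->
  NQ M (fun p => h' (w p) * wx' p - h' (u p) * ux' p) <= e.
  move=> cw hu n1 n2.
  have cw' := ct_comp1 ch' w_.
  have f1 := L2l_ctM cw' (L2l_sub (L2l_ct cw) hu); have f2 := L2l_ctM (ctB cw' cu') hu.
  have := NQ_add M f1 f2.
  rewrite (NQ_ext M (g := fun p => h' (w p) * wx' p - h' (u p) * ux' p)); last by move=> p; ring.
  have b1 : NQ M (fun p => h' (w p) * (wx' p - ux' p)) <= B ^+ 2 * NQ M (fun p => wx' p - ux' p).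
    apply: NQ_le => //; [exact: L2l_sub (L2l_ct cw) hu|exact: sqr_ge0|move=> p hp].
    rewrite exprMn ler_wpM2r ?sqr_ge0// sq// hB//.
    have := w1 p hp; have := hK p hp; have := ler_normD (w p - u p) (u p); rewrite subrK; clear -t1; lra.
  have b2 : NQ M (fun p => (h' (w p) - h' (u p)) * ux' p) <= om ^+ 2 * NQ M ux'.
    apply: NQ_le => //; [exact: sqr_ge0|move=> p hp].
    rewrite exprMn ler_wpM2r ?sqr_ge0// sq//; apply/ltW/hd2; first exact: hK.
    by apply: le_lt_trans td2; exact: w1.
  have c1 : B ^+ 2 * NQ M (fun p => wx' p - ux' p) <= B ^+ 2 * t by rewrite ler_wpM2l ?sqr_ge0.
  have c2 : om ^+ 2 * NQ M ux' <= om ^+ 2 * N by rewrite ler_wpM2l ?sqr_ge0.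
  clear -b1 b2 c1 c2 n1 n2 tB omN N0; lra.
exists (fun p => h (w p)), (fun p => h' (w p) * wx p), (fun p => h' (w p) * wy p); split.
- exact: C1_comp1.
- by move=> p hp; apply/ltW/hd1; [exact: hK|apply: le_lt_trans td1; exact: w1].
- by apply: key => //; rewrite /N lerDl NQ_ge0.
- by apply: key => //; rewrite /N lerDr NQ_ge0.
Qed.

Lemma L2l_shift c f : L2l f -> L2l (fun p => f (pp p c)).
Proof.
move=> [mf lf].
have mfs : meas (fun p => f (pp p c)) := measurableT_comp mf (meas_shift c).
split=> // r; apply: (@L1_le _ _ _ (@PM R) (fun p => f (pp p c) ^+ 2 * qi (r + nm c) (pp p c))).
- by apply: measurable_funM; [exact: measurable_funX|exact: meas_qi].
- move=> p; rewrite normrM (ger0_norm (sqr_ge0 _)) ler_wpM2l ?sqr_ge0// ger0_norm ?qi_ge0//.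
  case: (leP (nm p) r) => h; last by rewrite qi0// qi_ge0.
  by rewrite !qi1//; have := nmD p c; lra.
- exact: (L_shift c (lf (r + nm c))).
Qed.

Lemma NQ_shift c f M : L2l f -> NQ M (fun p => f (pp p c)) <= NQ (M + nm c) f.
Proof.
move=> hf; have [mf lf] := hf; rewrite /NQ -(Int_shift c (lf (M + nm c))).
apply: Int_le; [by case: (L2l_shift c hf)|exact: (L_shift c (lf _))|].
move=> p; rewrite ler_wpM2l ?sqr_ge0//.
case: (leP (nm p) M) => h; last by rewrite qi0// qi_ge0.
by rewrite !qi1//; have := nmD p c; lra.
Qed.

Lemma WS_shift c u ux uy : WS u ux uy ->
  WS (fun p => u (pp p c)) (fun p => ux (pp p c)) (fun p => uy (pp p c)).
Proof.
move=> [cu hx hy H]; split; [exact: ct_shift|exact: L2l_shift|exact: L2l_shift|].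
move=> M e e0; have [w [wx [wy [hw w1 w2 w3]]]] := H (M + nm c) _ e0.
have [w_ wx_ wy_ _ _] := hw.
exists (fun p => w (pp p c)), (fun p => wx (pp p c)), (fun p => wy (pp p c)); split.
- exact: C1_shift.
- by move=> p hp; apply: w1; have := nmD p c; lra.
- exact: le_trans (NQ_shift c M (L2l_sub (L2l_ct wx_) hx)) w2.
- exact: le_trans (NQ_shift c M (L2l_sub (L2l_ct wy_) hy)) w3.
Qed.

End WeakCalculus.

(** * Pointwise derivatives against weak derivatives *)

Section PointwiseDerivative.
Variable R : realType.
Local Notation C := (R * R)%type.
Local Notation M1 := (measurableTypeR R).
Local Notation L := (L1 (@PM R)).
Local Notation I := (Int (@PM R)).
Local Notation meas := (measurable_fun (setT : set (M1 * M1))).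
Implicit Types (F G u v w f g : C -> R) (p q c : C) (r s M : R).

(** The normalisation contributes [s ^- 2] by [Z_low], and the one derivative a further [s^-1]. *)
Lemma rho_grad_bd : exists2 K : R, 0 < K & forall s rx ry, 0 < s -> C1 (rho s) rx ry ->
  forall p, `|rx p| <= K / s ^+ 3 /\ `|ry p| <= K / s ^+ 3.
Proof.
have [b b0 hb] := Z_low R.
have [d1 hd1 sd1] := smooth1_der (@bump_smooth R).
have [B1 B10 hB1] := cts_seg 1 (smooth1_cts (@bump_smooth R)).
have [B2 B20 hB2] := cts_seg 1 (smooth1_cts sd1).
exists (B1 * B2 / b); first by rewrite divr_gt0// mulr_gt0.
move=> s rx ry s0 hC p.
have [bx by_] := bs_der hC (rho_bs s0).
have K0 : 0 <= B1 * B2 / b / s ^+ 3.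
  by apply: divr_ge0; [apply: divr_ge0; [apply: mulr_ge0|]; exact: ltW|apply: exprn_ge0; exact: ltW].
have [hp|hp] := ltP s (nm p); first by rewrite bx// by_// normr0.
have [h1 h2] : `|p.1 / s| <= 1 /\ `|p.2 / s| <= 1.
  move: hp; rewrite nm_le => /andP[? ?].
  by rewrite !normrM normfV (gtr0_norm s0) !ler_pdivrMr// !mul1r.
have [_ _ _ hx hy] := hC.
have Zs := hb s s0.
have Z0 := Z_gt0 s0.
have dsc x : der (fun t : R => t / s) x s^-1.
  by apply: (der_ext (f := fun y => s^-1 * y + 0)); [move=> y; ring|exact: der_aff].
have ex : rx p = (Z s)^-1 * (d1 (p.1 / s) * s^-1) * bump (p.2 / s).
  apply: (der_uniq (hx p)); rewrite /rho /bb /=.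
  apply: (der_ext (f := fun t => ((Z s)^-1 * bump (p.2 / s)) * bump (t / s))); first by move=> y; ring.
  apply: (der_eql (derZ _ (der_comp (hd1 _) (dsc p.1)))); ring.
have ey : ry p = (Z s)^-1 * (d1 (p.2 / s) * s^-1) * bump (p.1 / s).
  apply: (der_uniq (hy p)); rewrite /rho /bb /=.
  apply: (der_ext (f := fun t => ((Z s)^-1 * bump (p.1 / s)) * bump (t / s))); first by move=> y; ring.
  apply: (der_eql (derZ _ (der_comp (hd1 _) (dsc p.2)))); ring.
have main (x y : R) : `|x| <= 1 -> `|y| <= 1 -> `|(Z s)^-1 * (d1 x * s^-1) * bump y| <= B1 * B2 / b / s ^+ 3.
  move=> hx1 hy1; have {}hB1 := hB1 y hy1; move: (bump y) hB1 => by1 hB1.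
  have iZ : (Z s)^-1 <= (b * s ^+ 2)^-1 by rewrite lef_pV2// posrE ?mulr_gt0// exprn_gt0.
  have -> : B1 * B2 / b / s ^+ 3 = (b * s ^+ 2)^-1 * (B2 * s^-1) * B1 by field; rewrite !gt_eqF.
  rewrite !normrM !normfV (gtr0_norm s0) (gtr0_norm Z0).
  apply: ler_pM => //.
    apply: mulr_ge0; [|apply: mulr_ge0]; rewrite ?invr_ge0//; exact: ltW.
  apply: ler_pM => //; first by rewrite invr_ge0 ltW.
    by apply: mulr_ge0; rewrite ?invr_ge0// ltW.
  by apply: ler_wpM2r; [rewrite invr_ge0 ltW|exact: hB2].
by rewrite ex ey; split; apply: main.
Qed.

(** Differentiability at the single point [c], with differential [(a, b)]. *)
Definition jet u c a b := forall e : R, 0 < e -> exists2 d : R, 0 < d & forall q, nm (pm q c) < d ->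
  `|u q - u c - (a * (q.1 - c.1) + b * (q.2 - c.2))| <= e * nm (pm q c).

Lemma C1_aff (k a b : R) c : C1 (fun q => k + (a * (q.1 - c.1) + b * (q.2 - c.2))) (fun=> a) (fun=> b).
Proof.
apply: (C1_ext (C1_add (C1_cst k) (C1_add (C1_scale a (C1_sub (@C1_fst R) (C1_cst c.1))) (C1_scale b (C1_sub (@C1_snd R) (C1_cst c.2)))))).
- by [].
- by move=> p /=; ring.
- by move=> p /=; ring.
Qed.

(* Subtracting the affine jet leaves a remainder [o(s)] on the support of the
   kernel, while the gradient of the kernel is [O(s^-3)] on an area [O(s^2)]. *)
Lemma jet_conv u ux uy c a b : WS u ux uy -> jet u c a b ->
  forall e : R, 0 < e -> exists2 d : R, 0 < d & forall s, 0 < s < d ->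
    `|conv ux (rho s) c - a| <= e /\ `|conv uy (rho s) c - b| <= e.
Proof.
move=> hu hj e e0; have [K K0 hK] := rho_grad_bd.
have e1 : 0 < e / (4 * K) by rewrite divr_gt0// mulr_gt0.
have [d d0 hd] := hj _ e1; exists d => // s /andP[s0 sd].
have [rx [ry [_ [_ [_ [hr _ _ bx by_]]]]]] := rho_jet s0.
have hw := WS_sub hu (C1_WS (C1_aff (u c) a b c)).
have hc := C1_refl c hr.
have hb := bs_refl (p := c) (rho_bs s0).
have [E1 E2] := WS_IBP hw hc hb.
have [_ lx ly _] := hu.
have cr := @ct_refl R _ c (rho_ct s).
have I1 := Int_rho_refl c s0.
have Lc := L_rho c s0.
have X (k : R) (g : C -> R) : L2l g -> I (fun q => rho s (pm c q) * (g q - k)) = conv g (rho s) c - k.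
  move=> hg; rewrite /conv -[k in RHS]mulr1 -I1 -IntZ// -IntB//.
  - by apply: Int_ext => q; ring.
  - exact: (Ll_bs (L2l_Ll hg) cr hb).
  - exact: L1Z.
rewrite X// in E1; rewrite X// in E2; rewrite E1 E2 !normrN.
have cU : ct (fun q => u q - (u c + (a * (q.1 - c.1) + b * (q.2 - c.2)))) by case: hw.
have key (kx : C -> R) : ct kx -> bs s kx -> (forall p, `|kx p| <= K / s ^+ 3) ->
   `|I (fun q => - kx (pm c q) * (u q - (u c + (a * (q.1 - c.1) + b * (q.2 - c.2)))))| <= e.
  move=> ck bk hk.
  have Lq : L (fun q => qi s (pm q c)) by exact: (L_shift (- c.1, - c.2) (L_qi s)).
  have Iq : I (fun q => qi s (pm q c)) = 4 * s ^+ 2.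
    by rewrite -(Int_qi (ltW s0)) -(Int_shift (- c.1, - c.2) (L_qi s)).
  have -> : e = I (fun q => (e / (4 * s ^+ 2)) * qi s (pm q c)).
    by rewrite IntZ// Iq divfK// gt_eqF// mulr_gt0// exprn_gt0.
  apply: Int_abs_le.
  - apply: (@L_cc _ (nm c + s)).
      apply: ctM; last exact: cU.
      by apply: ctN; exact: ct_refl.
    by move=> p hp; rewrite (bs_refl bk hp) oppr0 mul0r.
  - exact: L1Z.
  move=> q; rewrite normrM normrN; have [hq|hq] := ltP s (nm (pm c q)).
    by rewrite bk// normr0 mul0r qi0 ?mulr0// nmN.
  rewrite qi1 ?mulr1; last by rewrite nmN.
  have hq' : nm (pm q c) < d by rewrite nmN; apply: le_lt_trans sd.
  have h := hd q hq'; rewrite opprD addrA.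
  have -> : e / (4 * s ^+ 2) = K / s ^+ 3 * (e / (4 * K) * s) by field; rewrite !gt_eqF.
  apply: ler_pM => //; apply: le_trans h _.
  by apply: ler_wpM2l; [exact: ltW|rewrite nmN].
have [_ cx cy _ _] := hr.
by split; apply: key => // p; have [] := hK s rx ry s0 hr p.
Qed.

(** On [D] the mollifications tend to 0 pointwise, while they tend to [g] in L^2 on squares. A
    bounded function of their difference to [g] therefore has integrals tending both to that of
    [k (g p)] over [D] and to 0; this replaces Lebesgue points. *)
Lemma conv0_ae g (D : set C) : L2l g -> measurable (D : set (M1 * M1)) ->
  (forall c, D c -> forall e : R, 0 < e -> exists2 d : R, 0 < d & forall s, 0 < s < d -> `|conv g (rho s) c| <= e) ->
  {ae @PM R, forall p, D p -> g p = 0}.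
Proof.
move=> hg mD H.
(* [k] is bounded by 1, which gives domination, and by [t ^+ 2], which compares its integral with
   [NQ]; it vanishes only at 0. *)
pose k (t : R) := t ^+ 2 * (1 + t ^+ 2)^-1.
have k1 (t : R) : 0 < 1 + t ^+ 2 by apply: ltr_wpDr; [exact: sqr_ge0|].
have k01 (t : R) : 0 <= k t <= 1.
  have := sqr_ge0 t; have := k1 t => a b; rewrite /k; apply/andP; split; first by rewrite divr_ge0// ltW.
  by rewrite ler_pdivrMr// mul1r; lra.
have kle (t : R) : k t <= t ^+ 2.
  by rewrite /k ler_pdivrMr//; have := sqr_ge0 t; nra.
have kc : continuous k.
  move=> t; have [l hl] : exists l, der k t l; last exact: der_cts hl.
  eexists; apply: derM; first exact: (derX 1 (der_id t)).
  apply: (der_comp (f := fun y => y^-1)); first by apply: der_inv; rewrite gt_eqF.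
  by apply: derD; [exact: der_cst|exact: (derX 1 (der_id t))].
have mk : measurable_fun (setT : set M1) k by apply: continuous_measurable_fun.
pose s n : R := n.+1%:R^-1.
have s0 n : 0 < s n by rewrite invr_gt0.
pose G n := conv g (rho (s n)).
have hl := L2l_Ll hg.
have cG n : ct (G n) by exact: conv_ct hl (rho_ct _) (rho_bs (s0 n)).
have mg : meas g by case: hg.
have mI : meas (\1_D : C -> R) by exact: measurable_indic.
have I01 p : 0 <= (\1_D p : R) <= 1 by rewrite indicE; case: (_ \in _); rewrite /= ?lexx ?ler01.
have sc : s n @[n --> \oo] --> 0 by exact: cvg_harmonic.
have snd' (d : R) : 0 < d -> \forall n \near \oo, s n < d.
  move=> d0; move/cvgrPdist_lt : sc => /(_ _ d0); apply: filterS => n.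
  by rewrite sub0r normrN gtr0_norm.
have ball (m : nat) : {ae @PM R, forall p, k (g p) * (\1_D p * qi m%:R p) = 0}.
  have bnd (t : R) p : 0 <= k t * (\1_D p * qi m%:R p) <= qi m%:R p.
    have /andP[a b] := k01 t; have /andP[a' b'] := I01 p; have /andP[a'' b''] := qi01 m%:R p.
    apply/andP; split; first by apply: mulr_ge0 => //; exact: mulr_ge0.
    by rewrite mulrA ler_piMl// mulr_ile1.
  have mm (h : C -> R) : meas h -> meas (fun p => k (h p) * (\1_D p * qi m%:R p)).
    move=> mh; apply: measurable_funM; first exact: measurableT_comp mk mh.
    by apply: measurable_funM => //; exact: meas_qi.
  have [|||||Lh cv] := @Int_cvg _ _ _ (@PM R) (fun n p => k (G n p - g p) * (\1_D p * qi m%:R p))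
      (fun p => k (g p) * (\1_D p * qi m%:R p)) (qi m%:R).
  - by move=> n; apply: (mm (fun p => G n p - g p)); apply: measurable_funB => //; exact: meas_ct.
  - exact: mm.
  - exact: L_qi.
  - by move=> n p; have /andP[a b] := bnd (G n p - g p) p; rewrite ger0_norm.
  - move=> p; have [Dp|nD] := pselect (D p); last first.
      rewrite (_ : \1_D p = 0 :> R); last by rewrite indicE memNset.
      by rewrite mul0r mulr0; apply: cvg_near_cst; apply: nearW => n; rewrite mulr0.
    apply: cvgMl; have -> : k (g p) = k (0 - g p) by rewrite /k sub0r sqrrN.
    suff c0 : (G x p - g p) @[x --> \oo] --> 0 - g p by exact: (cvg_comp _ _ c0 (kc _)).
    apply: cvgB; last exact: cvg_cst.
    apply/cvgrPdist_le => e e0; have [d d0 hd] := H p Dp e e0.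
    near=> n; rewrite sub0r normrN; apply: hd; rewrite s0 /=; near: n; exact: snd'.
  apply: Int_ge0_eq0 => //; first by move=> p; have /andP[] := bnd (g p) p.
  apply/ler_addgt0Pl => e e0; rewrite addr0.
  apply: (cvgr_to_le cv).
  have [d d0 hd] := conv_L2 m%:R hg e0.
  have := snd' _ d0; apply: filterS => n hn.
  have h := hd (s n); rewrite s0 (ltW hn) in h; have {}h := h isT.
  have hG : L2l (fun p => G n p - g p) by apply: L2l_sub => //; exact: L2l_ct.
  apply: le_trans h; apply: Int_le.
  - apply: (@L1_le _ _ _ (@PM R) (qi m%:R)); [|by move=> p; have /andP[a b] := bnd (G n p - g p) p; rewrite ger0_norm|exact: L_qi].
    by apply: (mm (fun p => G n p - g p)); apply: measurable_funB => //; exact: meas_ct.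
  - by case: hG.
  move=> p; have /andP[a b] := k01 (G n p - g p); have /andP[a' b'] := I01 p; have /andP[a'' b''] := qi01 m%:R p.
  rewrite mulrA ler_wpM2r//; apply: le_trans (kle _).
  by rewrite ler_piMr.
have := ae_foralln ball; apply: filterS => p hp Dp.
have := hp (Num.bound (nm p)).
rewrite qi1 ?mulr1; last by apply/ltW/archi_boundP/nm_ge0.
rewrite (_ : \1_D p = 1 :> R); last by rewrite indicE mem_set.
rewrite mulr1 /k => /eqP; rewrite mulf_eq0 invr_eq0 (gt_eqF (k1 _)) orbF sqrf_eq0.
by move/eqP.
Unshelve. all: by end_near.
Qed.

End PointwiseDerivative.


(** * Orientation *)

Section Cutoffs.
Variable R : realType.
Local Notation C := (R * R)%type.
Implicit Types (t x : R) (p : C).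

Definition sqpos t : R := Num.max t 0 ^+ 2.

Lemma pos_cts : continuous (fun t : R => Num.max t 0).
Proof. by move=> t; apply: continuous_max; [exact: cvg_id|exact: cvg_cst]. Qed.


Lemma sqpos_der t : der sqpos t (2 * Num.max t 0).
Proof.
move=> e e0; exists e => // h he; apply: (@le_trans _ _ (h ^+ 2)); last first.
  by rewrite -[h ^+ 2]real_normK ?num_real// expr2 ler_wpM2r// ltW.
rewrite /sqpos ler_norml.
case: (leP t 0) => h1; case: (leP (t + h) 0) => h2;
  rewrite ?(max_r h1) ?(max_r h2) ?(max_l (ltW h1)) ?(max_l (ltW h2)) !expr2; apply/andP; split; nra.
Qed.

(** A C^1 transition from 0 to 1: the two truncated squares never vanish together, and each has a
    continuous derivative. *)
Definition step t : R := sqpos t / (sqpos t + sqpos (1 - t)).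

Lemma step_den t : 0 < sqpos t + sqpos (1 - t).
Proof.
have [h|h] := lerP t 0.
  have h1 : 0 <= 1 - t by lra.
  have h2 : 0 < 1 - t by lra.
  by rewrite /sqpos (max_r h) (max_l h1) expr0n/= add0r exprn_gt0.
by rewrite ltr_pwDl// /sqpos ?(max_l (ltW h)) ?exprn_gt0// sqr_ge0.
Qed.

Lemma step0 t : t <= 0 -> step t = 0.
Proof. by move=> h; rewrite /step /sqpos max_r// expr0n mul0r. Qed.

Lemma step1 t : 1 <= t -> step t = 1.
Proof.
move=> h; rewrite /step [sqpos (1 - t)]/sqpos max_r; last by lra.
by rewrite expr0n/= addr0 divff// /sqpos max_l ?expf_neq0//; lra.
Qed.

Lemma step01 t : 0 <= step t <= 1.
Proof.
have d := step_den t; have a : 0 <= sqpos t by exact: sqr_ge0.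
have b : 0 <= sqpos (1 - t) by exact: sqr_ge0.
by rewrite /step ler_pdivrMr// mul1r lerDl b andbT divr_ge0// ltW.
Qed.

Lemma step_der : exists2 d : R -> R, continuous d & (forall t, der step t (d t)) /\
  (exists2 B, 0 < B & forall t, `|d t| <= B) /\ forall t, 1 <= t \/ t <= 0 -> d t = 0.
Proof.
pose P t := Num.max t 0.
pose D t := sqpos t + sqpos (1 - t).
pose D' t := 2 * P t - 2 * P (1 - t).
pose d t := 2 * P t / D t - sqpos t * D' t / D t ^+ 2.
have dD t : der D t (D' t).
  apply: derD; first exact: sqpos_der.
  have h := der_comp (f := sqpos) (g := fun t => -1 * t + 1) (sqpos_der (-1 * t + 1)) (der_aff (-1) 1 t).
  apply: (der_ext (f := fun t => sqpos (-1 * t + 1))); first by move=> y; congr sqpos; ring.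
  by apply: (der_eql h); rewrite /P (_ : -1 * t + 1 = 1 - t); ring.
have dst t : der step t (d t).
  have Dn : D t != 0 by rewrite gt_eqF// step_den.
  have h := derM (sqpos_der t) (der_comp (der_inv Dn) (dD t)).
  by apply: (der_eql h); rewrite /d /P; field.
have Pc : continuous P by exact: pos_cts.
have sqc : continuous sqpos by move=> t; exact: der_cts (sqpos_der t).
have Dc : continuous D by move=> t; exact: der_cts (dD t).
have P1c : continuous (fun t => P (1 - t)).
  move=> t; apply: (continuous_comp (f := fun t => 1 - t) (g := P)); last exact: Pc.
  by apply: cvgB; [exact: cvg_cst|exact: cvg_id].
have dc : continuous d.
  move=> t; have Dn : D t != 0 by rewrite gt_eqF// step_den.
  have a1 : (fun t => 2 * P t) x @[x --> t] --> 2 * P t by apply: cvgMr; exact: Pc.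
  have a2 : (fun t => 2 * P (1 - t)) x @[x --> t] --> 2 * P (1 - t) by apply: cvgMr; exact: P1c.
  apply: cvgB.
    apply: cvgM; first exact: a1.
    by apply: cvgV => //; exact: Dc.
  apply: cvgM; first by apply: cvgM; [exact: sqc|apply: cvgB; [exact: a1|exact: a2]].
  apply: cvgV; first by rewrite expf_neq0.
  by rewrite expr2; apply: cvgM; exact: Dc.
have d0 t : 1 <= t \/ t <= 0 -> d t = 0.
  case=> h; have h2 := h.
    have Dn : D t != 0 by rewrite gt_eqF// step_den.
    have E : D t = P t ^+ 2 by rewrite /D /sqpos (max_r (_ : 1 - t <= 0)) ?expr0n/= ?addr0//; lra.
    have E' : D' t = 2 * P t by rewrite /D' {2}/P max_r; lra.
    have Pn : P t != 0 by move: Dn; rewrite E expf_eq0.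
    by rewrite /d E E' /sqpos -/(P t); field.
  have E : P t = 0 by rewrite /P max_r.
  by rewrite /d /sqpos -/(P t) E; ring.
exists d => //; split=> //; split=> //.
have [B B0 hB] := cts_seg 1 dc; exists B => // t.
have [h|h] := leP `|t| 1; first exact: hB.
have hh : 1 <= t \/ t <= 0 by move: h; rewrite ltr_normr => /orP[h|h]; [left; lra|right; lra].
by rewrite (d0 _ hh) normr0 ltW.
Qed.

(** The constant [B] serves all scales. The derivatives vanish on the two bounding squares as well,
    so the differential lives in the open frame, the set that the four rectangles of [srr] cover. *)
Lemma cutoff : exists2 B : R, 0 < B & forall M : R, 0 < M -> exists X Xx Xy,
  [/\ C1 X Xx Xy, bs (2 * M) X, (forall p, 0 <= X p <= 1), (forall p, nm p <= M -> X p = 1) &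
    [/\ (forall p, `|Xx p| <= B / M), (forall p, `|Xy p| <= B / M) &
     (forall p, nm p <= M \/ 2 * M <= nm p -> Xx p = 0 /\ Xy p = 0)]].
Proof.
have [d dc [dd [[B B0 hB] d0]]] := step_der.
exists (2 * B); first by rewrite mulr_gt0.
move=> M M0; have iM : 0 < M^-1 by rewrite invr_gt0.
pose sg t := step (- M^-1 * t + 2) * step (M^-1 * t + 2).
pose sg' t := d (- M^-1 * t + 2) * (- M^-1) * step (M^-1 * t + 2) + step (- M^-1 * t + 2) * (d (M^-1 * t + 2) * M^-1).
have dsg t : der sg t (sg' t).
  by apply: derM; apply: der_comp (dd _) (der_aff _ _ _).
have sc : continuous step by move=> t; exact: der_cts (dd t).
have ac (k : R) : continuous (fun t : R => k * t + 2).
  by move=> t; exact: der_cts (der_aff k 2 t).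
have cc (g : R -> R) (k : R) : continuous g -> continuous (fun t => g (k * t + 2)).
  by move=> gc t; apply: (continuous_comp (f := fun t => k * t + 2) (g := g)); [exact: ac|exact: gc].
have sgc : continuous sg'.
  move=> t; apply: cvgD.
    apply: cvgM; last by apply: (cc step).
    by apply: cvgM; [exact: (cc d)|exact: cvg_cst].
  apply: cvgM; first by apply: (cc step).
  by apply: cvgM; [exact: (cc d)|exact: cvg_cst].
have sg01 t : 0 <= sg t <= 1.
  have /andP[a b] := step01 (- M^-1 * t + 2); have /andP[a' b'] := step01 (M^-1 * t + 2).
  by rewrite /sg mulr_ge0// mulr_ile1.
have in1 t : `|t| <= M -> 1 <= - M^-1 * t + 2 /\ 1 <= M^-1 * t + 2.
  move=> h; have : `|M^-1 * t| <= 1 by rewrite normrM gtr0_norm// mulrC ler_pdivrMr// mul1r.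
  by rewrite ler_norml mulNr => /andP[? ?]; split; lra.
have sg1 t : `|t| <= M -> sg t = 1 by move=> /in1[a b]; rewrite /sg !step1// mulr1.
have sg10 t : `|t| <= M -> sg' t = 0.
  by move=> /in1[a b]; rewrite /sg' !d0; [ring|left|left].
have sg0 t : 2 * M < `|t| -> sg t = 0.
  move=> h; have : 2 < `|M^-1 * t| by rewrite normrM gtr0_norm// mulrC ltr_pdivlMr.
  rewrite /sg lter_normr => /orP[a|a]; first by rewrite [step (- _ * _ + _)]step0 ?mul0r//; lra.
  by rewrite [X in _ * X]step0 ?mulr0//; lra.
have sg0' t : 2 * M <= `|t| -> sg t = 0 /\ sg' t = 0.
  move=> h; have : 2 <= `|M^-1 * t| by rewrite normrM gtr0_norm// mulrC ler_pdivlMr.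
  rewrite /sg /sg' ler_normr => /orP[a|a].
    have z : - M^-1 * t + 2 <= 0 by lra.
    by rewrite (step0 z) (d0 _ (or_intror z)); split; ring.
  have z : M^-1 * t + 2 <= 0 by lra.
  by rewrite (step0 z) (d0 _ (or_intror z)); split; ring.
have bd (x y S T : R) : `|x| <= B -> `|y| <= B -> 0 <= S <= 1 -> 0 <= T <= 1 ->
    `|x * (- M^-1) * S + T * (y * M^-1)| <= 2 * B / M.
  move=> hx hy /andP[a b] /andP[a' b'].
  apply: le_trans (ler_normD _ _) _; rewrite !normrM normrN (gtr0_norm iM) (ger0_norm a) (ger0_norm a').
  have h1 : `|x| / M * S <= B / M.
    rewrite -[leRHS]mulr1; apply: ler_pM => //; first by rewrite divr_ge0// ltW.
    by apply: ler_wpM2r => //; exact: ltW.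
  have h2 : T * (`|y| / M) <= B / M.
    rewrite -[leRHS]mul1r; apply: ler_pM => //; first by rewrite divr_ge0// ltW.
    by apply: ler_wpM2r => //; exact: ltW.
  have -> : 2 * B / M = B / M + B / M by ring.
  exact: lerD.
have sgb t : `|sg' t| <= 2 * B / M by apply: bd => //; exact: step01.
exists (tens sg sg), (tens sg' sg), (tens sg sg'); split.
- exact: C1_tens.
- by move=> p; rewrite /tens /nm lt_max => /orP[h|h]; rewrite (sg0 _ h) ?mul0r ?mulr0.
- move=> p; rewrite /tens; have /andP[a b] := sg01 p.1; have /andP[a' b'] := sg01 p.2.
  by rewrite mulr_ge0// mulr_ile1.
- by move=> p; rewrite nm_le /tens => /andP[a b]; rewrite !sg1// mulr1.
split.
- move=> p; have /andP[a' b'] := sg01 p.2; rewrite /tens normrM (ger0_norm a').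
  by apply: le_trans (sgb p.1); rewrite ler_piMr.
- move=> p; have /andP[a' b'] := sg01 p.1; rewrite /tens normrM (ger0_norm a').
  by apply: le_trans (sgb p.2); rewrite ler_piMl.
- move=> p [|]; first by rewrite nm_le /tens => /andP[a b]; rewrite !sg10// mul0r mulr0.
  by rewrite /tens /nm le_max => /orP[/sg0'[-> ->]|/sg0'[-> ->]]; rewrite !(mul0r, mulr0).
Qed.

End Cutoffs.

Lemma ae_imp d (T : measurableType d) (R : realType) (m : {measure set T -> \bar R}) (P Q : T -> Prop) :
  {ae m, forall x, P x} -> (forall x, P x -> Q x) -> {ae m, forall x, Q x}.
Proof. by move=> h hPQ; apply: filterS h. Qed.

Section Orientation.
Variable R : realType.
Local Notation C := (R * R)%type.
Local Notation M1 := (measurableTypeR R).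
Local Notation L := (L1 (@PM R)).
Local Notation I := (Int (@PM R)).
Local Notation meas := (measurable_fun (setT : set (M1 * M1))).
Implicit Types (F G u v w f g : C -> R) (p q c y : C) (r s M : R).

(** The product form lets the pullback of the mollifier be differentiated one component at a time,
    by [WS_comp1] and [WS_mul]. *)
Lemma rho_tens s : exists a a' b b' : R -> R,
  [/\ continuous a', continuous b', (forall x, der a x (a' x)), (forall x, der b x (b' x)) &
   [/\ rho s = tens a b, C1 (rho s) (tens a' b) (tens a b') & 0 < s -> bs s (tens a' b) /\ bs s (tens a b')]].
Proof.
have [b' hb sb] := smooth1_der (bump_scale s).
have e : rho s = tens (fun x => (Z s)^-1 * bump (x / s)) (fun x => bump (x / s)).
  by apply/funext => p; rewrite /rho /bb /tens mulrA.
have da x : der (fun x => (Z s)^-1 * bump (x / s)) x ((Z s)^-1 * b' x) by exact: derZ.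
have ca : continuous (fun x => (Z s)^-1 * b' x) by move=> x; apply: cvgMr; exact: smooth1_cts.
have h := C1_tens ca (smooth1_cts sb) da hb.
exists (fun x => (Z s)^-1 * bump (x / s)), (fun x => (Z s)^-1 * b' x), (fun x => bump (x / s)), b'; split=> //.
  exact: smooth1_cts.
split=> //; first by rewrite [in X in C1 X]e.
by move=> s0; apply: (bs_der h); rewrite -e; exact: rho_bs.
Qed.

Section Map.
Variables (u ux uy v vx vy : C -> R) (g : C -> C).
Hypotheses (hu : WS u ux uy) (hv : WS v vx vy).
Hypotheses (cg1 : ct (fun q => (g q).1)) (cg2 : ct (fun q => (g q).2)).
Hypotheses (fK : forall p, g (u p, v p) = p) (gK : forall q, (u (g q), v (g q)) = q).
Let f p : C := (u p, v p).
Let J p := ux p * vy p - uy p * vx p.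

Lemma proper_map r : exists2 M, 0 < M & forall p, nm (u p, v p) <= r -> nm p <= M.
Proof.
have [K1 K10 h1] := ct_bounded r cg1; have [K2 K20 h2] := ct_bounded r cg2.
exists (K1 + K2); first exact: addr_gt0.
move=> p hp; have := h1 _ hp; have := h2 _ hp; rewrite fK nm_le => a b; apply/andP; split; lra.
Qed.

Lemma L_jac M : L (fun p => J p * qi M p).
Proof.
have [_ hux huy _] := hu; have [_ hvx hvy _] := hv.
have q1 p : `|qi M p| <= 1 by have /andP[a b] := qi01 M p; rewrite ger0_norm.
have bq : bs M (@qi R M) by move=> p; exact: qi0.
have l1 := L_mul hux hvy (meas_qi M) bq q1; have l2 := L_mul huy hvx (meas_qi M) bq q1.
by apply: (L1_ext _ (L1B l1 l2)) => p; rewrite /J; ring.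
Qed.

(* [a'(u) b(v) J = d(a(u) b(v)) /\ dv] is exact with compact support, by properness. *)
Lemma jac_exact (a a' b b' : R -> R) r M : continuous a' -> continuous b' ->
  (forall x, der a x (a' x)) -> (forall x, der b x (b' x)) -> bs r (tens a b) ->
  bs r (tens a' b) -> bs r (tens a b') ->
  (forall p, nm (u p, v p) <= r -> nm p <= M) -> 0 < M ->
  I (fun p => tens a' b (u p, v p) * (J p * qi M p)) = 0 /\
  I (fun p => tens a b' (u p, v p) * (J p * qi M p)) = 0.
Proof.
move=> ca' cb' da db hb hb1 hb2 hM M0.
have hU := WS_mul (WS_comp1 ca' da hu) (WS_comp1 cb' db hv).
have [B B0 /(_ _ M0)[X [Xx [Xy [hX bX X01 X1 [_ _ Xz]]]]]] := cutoff R.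
have n1 := NL hU hv hX bX; have n2 := NL hU hu hX bX.
have z p : Xx p * (a (u p) * b (v p)) = 0 /\ Xy p * (a (u p) * b (v p)) = 0.
  have [h|h] := leP (nm (u p, v p)) r; first by have [-> ->] := Xz p (or_introl (hM p h)); rewrite !mul0r.
  by have := hb _ h; rewrite /tens /= => ->; rewrite !mulr0.
have r1 (k : C -> R) : I (fun p => Xx p * (a (u p) * b (v p) * k p)) = 0.
  by rewrite -(@Int0 _ _ _ (@PM R)); apply: Int_ext => p; have [a1 _] := z p; rewrite mulrA a1 mul0r.
have r2 (k : C -> R) : I (fun p => Xy p * (a (u p) * b (v p) * k p)) = 0.
  by rewrite -(@Int0 _ _ _ (@PM R)); apply: Int_ext => p; have [_ a1] := z p; rewrite mulrA a1 mul0r.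
rewrite !r1 !r2 !subr0 oppr0 in n1 n2.
have [_ hUx hUy _] := hU; have [_ hux huy _] := hu; have [_ hvx hvy _] := hv.
have X1' p : `|X p| <= 1 by have /andP[x y] := X01 p; rewrite ger0_norm.
have [cX _ _ _ _] := hX; have mX := meas_ct cX.
rewrite -IntB in n1; [|exact: (L_mul hUx hvy mX bX X1')|exact: (L_mul hUy hvx mX bX X1')].
rewrite -IntB in n2; [|exact: (L_mul hUx huy mX bX X1')|exact: (L_mul hUy hux mX bX X1')].
have zz p (k : C -> R) : bs r k -> X p * k (u p, v p) = k (u p, v p) * qi M p.
  move=> hk; have [h|h] := leP (nm (u p, v p)) r; last by rewrite hk// mulr0 mul0r.
  by rewrite X1 ?qi1 ?mulr1 ?mul1r//; exact: hM.
split.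
  rewrite -[RHS]n1; apply: Int_ext => p; rewrite mulrCA mulrC -[X in X * _ = _]zz// /J /tens /=; ring.
rewrite -[RHS]oppr0 -[in RHS]n2 -IntN.
  apply: Int_ext => p; rewrite mulrCA mulrC -[X in X * _ = _]zz// /J /tens /=; ring.
by apply: L1B; [exact: (L_mul hUx huy mX bX X1')|exact: (L_mul hUy hux mX bX X1')].
Qed.

Lemma ct_f : ct u /\ ct v. Proof. by have [? _ _ _] := hu; have [? _ _ _] := hv. Qed.

Lemma L_ctw (k w : C -> R) K : ct k -> L w -> (forall p, `|k p| <= K) -> L (fun p => k p * w p).
Proof.
move=> ck lw hK; apply: (@L1_le _ _ _ (@PM R) (fun p => K * `|w p|)).
- by apply: measurable_funM; [exact: meas_ct|exact: (L1_meas lw)].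
- by move=> p; rewrite normrM ler_wpM2r.
- by apply: L1Z; exact: L1_abs.
Qed.

Lemma ct_rhof s y : ct (fun p => rho s (pm (u p, v p) y)).
Proof.
have [cu cv] := ct_f.
by apply: (ct_comp2 (u := fun p => u p - y.1) (v := fun p => v p - y.2) _ _ (rho_ct s)); apply: ctB => //; exact: ct_cst.
Qed.

Lemma rho_bd s : 0 < s -> exists2 K, 0 < K & forall p : C, `|rho s p| <= K.
Proof. by move=> s0; apply: bs_bounded (rho_ct s) (rho_bs s0). Qed.

(* The degree over [y] of the map [(u, v)], mollified at scale [s]: the integral of the Jacobian against a point mass pulled back from [y]. *)
Definition deg s M y := I (fun p => rho s (pm (u p, v p) y) * (J p * qi M p)).

(** Differentiation in [y] falls on the kernel, and the integral of a pulled-back derivative against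
    the Jacobian is 0 by [jac_exact]. The bound on [M] makes the square contain the whole preimage
    of the support. *)
Lemma deg_der s M r y : 0 < s -> nm y <= r -> 0 < M ->
  (forall p, nm (u p, v p) <= r + s -> nm p <= M) ->
  der (fun t => deg s M (t, y.2)) y.1 0 /\ der (fun t => deg s M (y.1, t)) y.2 0.
Proof.
move=> s0 hy M0 hM.
have [a [a' [b [b' [ca' cb' da db [erho hC /(_ s0)[hbx hby]]]]]]] := rho_tens s.
have lw := L_jac M; have [cu cv] := ct_f.
set w := (fun p => J p * qi M p) in lw.
have sh (k : C -> R) : bs s k -> bs (r + s) (fun p => k (pm p y)).
  move=> hk p hp; apply: hk; have := nmD (pm p y) y; rewrite ppB; lra.
have dsh (k k' : R -> R) (c x : R) : (forall x, der k x (k' x)) -> der (fun t => k (t - c)) x (k' (x - c)).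
  by move=> dk; exact: (der_shiftarg (dk _)).
have csh (k : R -> R) (c : R) : continuous k -> continuous (fun t => k (t - c)).
  move=> ck t; apply: (continuous_comp (f := fun t => t - c) (g := k)); last exact: ck.
  by apply: cvgB; [exact: cvg_id|exact: cvg_cst].
have hb := rho_bs s0; rewrite erho in hb.
have [Ex Ey] := @jac_exact (fun t => a (t - y.1)) (fun t => a' (t - y.1)) (fun t => b (t - y.2)) (fun t => b' (t - y.2))
  (r + s) M (csh _ _ ca') (csh _ _ cb') (fun x => dsh _ _ _ _ da) (fun x => dsh _ _ _ _ db)
  (sh _ hb) (sh _ hbx) (sh _ hby) hM M0.
have Tb (k : C -> R) : ct k -> bs s k -> L (fun p => k (pm (u p, v p) y) * w p).
  move=> ck bk; have [K _ hK] := bs_bounded ck bk.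
  apply: (L_ctw (K := K)) => //.
  by apply: (ct_comp2 (u := fun p => u p - y.1) (v := fun p => v p - y.2) _ _ ck); apply: ctB => //; exact: ct_cst.
have lr z : L (fun p => rho s (pm (u p, v p) z) * w p).
  by have [K _ hK] := rho_bd s0; apply: (L_ctw (K := K)) => //; exact: ct_rhof.
pose W := I (fun p => `|w p|).
have W0 : 0 <= W by apply: Int_ge0.
have [_ cx cy _ _] := hC.
(* One argument for both coordinates: the increment of the kernel is [- h * k] up to a uniform
   error, and the pulled-back integral of [k] vanishes. *)
have fin (z : R -> C) (k : C -> R) (t : R) : z t = y -> ct k -> bs s k -> I (fun p => k (pm (u p, v p) y) * w p) = 0 ->
  (forall e : R, 0 < e -> exists2 d : R, 0 < d & forall p h, `|h| < d ->
    `|rho s (pm p (z (t + h))) - rho s (pm p y) + h * k (pm p y)| <= e * `|h|) ->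
  der (fun t => deg s M (z t)) t 0.
  move=> zt ck bk k0 H e e0.
  have e1 : 0 < e / (W + 1) by rewrite divr_gt0// ltr_wpDl.
  have [d d0 hd] := H _ e1; exists d => // h hh; rewrite mulr0 subr0 zt /deg -/w.
  have lk := Tb _ ck bk.
  rewrite -IntB//.
  have -> : I (fun p => rho s (pm (u p, v p) (z (t + h))) * w p - rho s (pm (u p, v p) y) * w p) =
     I (fun p => (rho s (pm (u p, v p) (z (t + h))) - rho s (pm (u p, v p) y) + h * k (pm (u p, v p) y)) * w p).
    rewrite -[LHS]addr0 -[X in _ + X](mulr0 h) -k0 -IntZ// -IntD//; last exact: L1Z.
      by apply: Int_ext => p; ring.
    exact: L1B.
  have -> : e * `|h| = (e / (W + 1) * `|h|) * (W + 1) by field; rewrite gt_eqF// ltr_wpDl.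
  apply: (@le_trans _ _ (e / (W + 1) * `|h| * W)); last first.
    by apply: ler_wpM2l; [apply: mulr_ge0 => //; exact: ltW|rewrite lerDl].
  rewrite /W -IntZ; last exact: L1_abs.
  apply: Int_abs_le.
  - apply: (L1_ext _ (L1D (L1B (lr (z (t + h))) (lr y)) (L1Z h lk))) => p; ring.
  - by apply: L1Z; exact: L1_abs.
  by move=> p; rewrite normrM ler_wpM2r//; exact: hd.
split.
- apply: (fin (fun t => (t, y.2)) (tens a' b)) => //; first by case: (y).
  move=> e e0; have [d d0 hd] := C1_unifx hC (rho_bs s0) e0; exists d => // p h hh.
  have := hd (pm p y) (- h); rewrite normrN => /(_ hh); rewrite /pm /= => hx.
  apply: le_trans hx; rewrite le_eqVlt; apply/orP; left; apply/eqP; congr `|_|.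
  by rewrite opprD addrA mulNr opprK.
- apply: (fin (fun t => (y.1, t)) (tens a b')) => //; first by case: (y).
  move=> e e0; have [d d0 hd] := C1_unify hC (rho_bs s0) e0; exists d => // p h hh.
  have := hd (pm p y) (- h); rewrite normrN => /(_ hh); rewrite /pm /= => hx.
  apply: le_trans hx; rewrite le_eqVlt; apply/orP; left; apply/eqP; congr `|_|.
  by rewrite opprD addrA mulNr opprK.
Qed.

Lemma deg_const s M r y z : 0 < s -> nm y <= r -> nm z <= r -> 0 < M ->
  (forall p, nm (u p, v p) <= 3 * r + s -> nm p <= M) -> deg s M y = deg s M z.
Proof.
move=> s0 hy hz M0 hM.
have y1 := le_trans (nm1 y) hy; have y2 := le_trans (nm2 y) hy.
have z1 := le_trans (nm1 z) hz; have z2 := le_trans (nm2 z) hz.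
have r0 := le_trans (nm_ge0 y) hy.
(* [der_lip] asks for the derivative on all of [|x - a| <= |b - a|], an interval symmetric about
   [a]; hence the radius [3 * r]. *)
have bd (a b x : R) : `|a| <= r -> `|b| <= r -> `|x - a| <= `|b - a| -> `|x| <= 3 * r.
  move=> ha hb h; move: ha hb; rewrite ![`|_| <= r]ler_norml => /andP[? ?] /andP[? ?].
  have : `|b - a| <= 2 * r by rewrite ler_norml; apply/andP; split; lra.
  move=> h2; have := le_trans h h2; rewrite !ler_norml => /andP[? ?]; apply/andP; split; lra.
have bd0 (x : R) : `|x| <= r -> `|x| <= 3 * r by move=> h; apply: (le_trans h); lra.
transitivity (deg s M (z.1, y.2)).
  apply/eqP; rewrite -subr_eq0 -normr_eq0 eq_le normr_ge0 andbT.
  have := @der_lip R (fun t => deg s M (t, y.2)) (fun=> 0) z.1 y.1 0.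
  rewrite mul0r -surjective_pairing; apply=> [x hx|x _]; last by rewrite normr0.
  have hn : nm (x, y.2) <= 3 * r by rewrite nm_le /= (bd _ _ _ z1 y1 hx) bd0.
  exact: (deg_der s0 hn M0 hM).1.
apply/eqP; rewrite -subr_eq0 -normr_eq0 eq_le normr_ge0 andbT.
have := @der_lip R (fun t => deg s M (z.1, t)) (fun=> 0) z.2 y.2 0.
rewrite mul0r -surjective_pairing; apply=> [x hx|x _]; last by rewrite normr0.
have hn : nm (z.1, x) <= 3 * r by rewrite nm_le /= bd0// (bd _ _ _ z2 y2 hx).
exact: (deg_der s0 hn M0 hM).2.
Qed.

Lemma rho_push_ct s (w : C -> R) : 0 < s -> (forall y, L (fun p => rho s (pm (u p, v p) y) * w p)) -> L w ->
  ct (fun q => I (fun p => rho s (pm (u p, v p) q) * w p)).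
Proof.
move=> s0 lrw lw.
pose W := I (fun p => `|w p|).
have W0 : 0 <= W by apply: Int_ge0.
move=> q e e0; have e1' : 0 < e / (W + 1) by rewrite divr_gt0// ltr_wpDl.
have [d d0 hd] := cc_unif (rho_ct s) (rho_bs s0) e1'.
exists d => // z hz; rewrite -IntB//.
have -> : e = (e / (W + 1)) * (W + 1) by field; rewrite gt_eqF// ltr_wpDl.
apply: (@le_lt_trans _ _ (e / (W + 1) * W)); last by rewrite ltr_pM2l// ltrDl.
rewrite /W -IntZ; last exact: L1_abs.
apply: Int_abs_le.
- exact: L1B.
- by apply: L1Z; exact: L1_abs.
move=> p; rewrite -mulrBl normrM; apply: ler_wpM2r => //.
apply/ltW/hd; rewrite /pm /=.
have -> : (u p - z.1 - (u p - q.1), v p - z.2 - (v p - q.2)) = (q.1 - z.1, q.2 - z.2) by congr (_, _); ring.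
by move: hz; rewrite nmN.
Qed.

(** This is Tonelli, hence the nonnegative weight; the signed Jacobian is fed in through its
    positive and negative parts. *)
Lemma deg_swap (b w : C -> R) s r : 0 < s -> ct b -> bs r b -> (forall p, 0 <= b p) ->
  L w -> (forall p, 0 <= w p) ->
  [/\ L (fun p => conv b (rho s) (u p, v p) * w p),
   L (fun y => b y * I (fun p => rho s (pm (u p, v p) y) * w p)) &
   I (fun p => conv b (rho s) (u p, v p) * w p) = I (fun y => b y * I (fun p => rho s (pm (u p, v p) y) * w p))].
Proof.
move=> s0 cb bb_ b0 lw w0; have [cu cv] := ct_f; have mw := L1_meas lw.
have [B B0 hB] := bs_bounded cb bb_; have [K K0 hK] := rho_bd s0.
have lb := L_cc cb bb_.
have lbw p : L (fun q => b q * rho s (pm (u p, v p) q)) by exact: conv_L (ct_Ll cb) (rho_ct s) (rho_bs s0).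
have lrw y : L (fun p => rho s (pm (u p, v p) y) * w p).
  by apply: (L_ctw (K := K)) => //; exact: ct_rhof.
have lc : L (fun p => conv b (rho s) (u p, v p) * w p).
  have cc : ct (fun p => conv b (rho s) (u p, v p)).
    by apply: (ct_comp2 (u := u) (v := v)) => //; exact: conv_ct (ct_Ll cb) (rho_ct s) (rho_bs s0).
  apply: (L_ctw (K := B)) => // p; rewrite /conv.
  rewrite -[B]mulr1 -(Int_rho_refl (u p, v p) s0) -IntZ; last exact: L_rho.
  apply: Int_abs_le; [exact: lbw|by apply: L1Z; exact: L_rho|].
  move=> q; rewrite normrM [X in _ * X]ger0_norm ?rho_ge0//.
  by apply: ler_wpM2r; [exact: rho_ge0|exact: hB].
pose T := ((M1 * M1) * (M1 * M1))%type.
pose H (z : T) : R := b z.2 * (rho s (pm (u z.1, v z.1) z.2) * w z.1).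
have mH : measurable_fun (setT : set T) H.
  apply: measurable_funM; first exact: measurableT_comp (meas_ct cb) measurable_snd.
  apply: measurable_funM; last exact: measurableT_comp mw measurable_fst.
  apply: (measurableT_comp (f := rho s) (g := fun z : T => pm (u z.1, v z.1) z.2)).
    exact: meas_ct (rho_ct s).
  apply: measurable_fun_pair; apply: measurable_funB.
  - exact: measurableT_comp (meas_ct cu) measurable_fst.
  - exact: measurableT_comp measurable_fst measurable_snd.
  - exact: measurableT_comp (meas_ct cv) measurable_fst.
  - exact: measurableT_comp measurable_snd measurable_snd.
have H0 z : (0 <= (H z)%:E)%E.
  by rewrite lee_fin; apply: mulr_ge0; [exact: b0|apply: mulr_ge0; [exact: rho_ge0|exact: w0]].
have mE : measurable_fun (setT : set T) (fun z => (H z)%:E) by exact/measurable_EFinP.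
pose P2 := @PM R.
have ft : (\int[P2]_p \int[P2]_q (H (p, q))%:E = \int[P2]_q \int[P2]_p (H (p, q))%:E)%E.
  exact: (tonelli_sf (@PM_sf R) (@PM_sf R) mE H0).
have e1 p : (\int[P2]_q (H (p, q))%:E = (conv b (rho s) (u p, v p) * w p)%:E)%E.
  have l := L1Z (w p) (lbw p).
  rewrite mulrC /conv -(IntZ _ (lbw p)) -(EInt l).
  by apply: eq_integral => q _; rewrite /H /=; congr EFin; ring.
have e2 q : (\int[P2]_p (H (p, q))%:E = (b q * I (fun p => rho s (pm (u p, v p) q) * w p))%:E)%E.
  have l := L1Z (b q) (lrw q).
  rewrite -(IntZ _ (lrw q)) -(EInt l).
  by apply: eq_integral => p _; rewrite /H /=.
have e3 : (\int[P2]_q (b q * I (fun p => rho s (pm (u p, v p) q) * w p))%:E =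
    (I (fun p => conv b (rho s) (u p, v p) * w p))%:E)%E.
  rewrite -(EInt lc); transitivity (\int[P2]_q \int[P2]_p (H (p, q))%:E)%E.
    by apply: eq_integral => q _; rewrite e2.
  by rewrite -ft; apply: eq_integral => p _; rewrite e1.
have cF := rho_push_ct s0 lrw lw.
have l2 : L (fun y => b y * I (fun p => rho s (pm (u p, v p) y) * w p)).
  apply: L1_fin.
  - by apply: measurable_funM; [exact: meas_ct|exact: meas_ct].
  - move=> q; apply: mulr_ge0; [exact: b0|apply: Int_ge0 => p].
    by apply: mulr_ge0; [exact: rho_ge0|exact: w0].
  - by rewrite e3 ltry.
clear ft e1 e2; split=> //; apply: EFin_inj; rewrite -e3; exact: (EInt l2).
Qed.

(** With [b] equal to [eta] composed with the inverse map, [eta] is nearly the mollified [b] at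
    [(u p, v p)], so the integral is nearly that of [b y * deg s M y]. The degree is the same at
    every [y] involved and nonnegative at the image of [c], where only points near [c]
    contribute. *)
Lemma jac_pos_int c d (eta : C -> R) r : 0 < d -> {ae @PM R, forall p, nm (pm p c) < d -> 0 <= J p} ->
  ct eta -> bs r eta -> (forall p, 0 <= eta p) -> 0 <= I (fun p => eta p * J p).
Proof.
move=> d0 hJ ce be e0; have [cu cv] := ct_f.
pose b y := eta (g y).
have cb : ct b by apply: (ct_ext (F := fun y => eta ((g y).1, (g y).2))); [move=> p; rewrite -surjective_pairing|exact: ct_comp2].
have [Ku _ hKu] := ct_bounded r cu; have [Kv _ hKv] := ct_bounded r cv.
pose r1 := Num.max (Ku + Kv) (nm (u c, v c)).
have r10 : 0 <= r1 by rewrite le_max nm_ge0 orbT.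
have bb_ : bs r1 b.
  move=> y; rewrite gt_max => /andP[hy _]; apply: be; rewrite ltNge; apply/negP => h.
  have a1 := hKu _ h; have a2 := hKv _ h.
  have := nm_ge0 (g y); have := gK y => E hg.
  move: hy; rewrite -E ltNge nm_le /= => /negP; apply; apply/andP; split; [have := le_trans (normr_ge0 _) a2|have := le_trans (normr_ge0 _) a1]; (clear -a1 gK fK cg2 cg1 hv hu a2; lra).
have [M M0 hM] := proper_map (3 * r1 + 1).
have bM : bs M eta.
  move=> p hp; have [h|h] := leP (nm (u p, v p)) r1.
    by have := hM p; have : nm (u p, v p) <= 3 * r1 + 1 by [(clear -h r10 gK fK cg2 cg1 hv hu hp; lra)]; move=> h1 /(_ h1); (clear -h r10 gK fK cg2 cg1 hv hu hp; lra).
  by have := bb_ _ h; rewrite /b fK.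
pose w p := J p * qi M p; have lw := L_jac M.
have -> : I (fun p => eta p * J p) = I (fun p => eta p * w p).
  apply: Int_ext => p; rewrite /w; have [h|h] := leP (nm p) M; first by rewrite qi1// mulr1.
  by rewrite bM// !mul0r.
(* Continuity of the inverse: a kernel of scale below [s1] at the image of [c] only sees points
   where [J] is nonnegative. *)
have [s1 s10 hs1] : exists2 s1 : R, 0 < s1 & forall p, nm (pm (u p, v p) (u c, v c)) < s1 -> nm (pm p c) < d.
  have [d1 d10 h1] := cg1 (u c, v c) d0; have [d2 d20 h2] := cg2 (u c, v c) d0.
  exists (Num.min d1 d2); first by rewrite lt_min d10.
  move=> p; rewrite lt_min => /andP[a1 a2]; have := h1 _ a1; have := h2 _ a2.
  by rewrite !fK nm_lt => -> ->.
have degpos s y : 0 < s -> s < s1 -> s <= 1 -> nm y <= r1 -> 0 <= deg s M y.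
  move=> s0 ss s1' hy.
  rewrite (@deg_const s M r1 y (u c, v c)) //.
  - rewrite /deg -(@Int0 _ _ _ (@PM R)); apply: Int_le_ae; [exact: L10| |].
      by have [K _ hK] := rho_bd s0; apply: (L_ctw (K := K)) => //; exact: ct_rhof.
    apply: (ae_imp hJ) => p hp; have [h|h] := ltP (nm (pm (u p, v p) (u c, v c))) s1.
      apply: mulr_ge0; first exact: rho_ge0.
      by apply: mulr_ge0; [apply: hp; exact: hs1|exact: qi_ge0].
    by rewrite (rho_bs s0) ?mul0r//; exact: lt_le_trans h.
  - by rewrite /r1 le_max lexx orbT.
  - move=> p h; apply: hM; lra.
pose w1 p := Num.max (w p) 0; pose w2 p := Num.max (- w p) 0.
have ww p : w p = w1 p - w2 p by rewrite /w1 /w2; case: (lerP (w p) 0); case: (lerP (- w p) 0); (clear -gK fK cg2 cg1 hv hu; lra).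
have mw := L1_meas lw.
have lw1 : L w1.
  apply: (@L1_le _ _ _ (@PM R) (fun p => `|w p|)); last exact: L1_abs.
    by apply: measurable_maxr => //; exact: measurable_cst.
  by move=> p; rewrite /w1; case: (lerP (w p) 0); rewrite ?normr0.
have lw2 : L w2.
  apply: (@L1_le _ _ _ (@PM R) (fun p => `|w p|)); last exact: L1_abs.
    by apply: measurable_maxr; [exact: measurableT_comp|exact: measurable_cst].
  by move=> p; rewrite /w2; case: (lerP (- w p) 0); rewrite ?normr0 ?normrN.
have w10 p : 0 <= w1 p by rewrite le_max lexx orbT.
have w20 p : 0 <= w2 p by rewrite le_max lexx orbT.
have b0 y : 0 <= b y by exact: e0.
pose W := I (fun p => `|w p|).
have W0 : 0 <= W by apply: Int_ge0.
have [Be _ hBe] := bs_bounded ce be.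
have lew : L (fun p => eta p * w p) by apply: (L_ctw (K := Be)).
rewrite -oppr_le0; apply/ler_addgt0Pl => e e0'; rewrite addr0.
have e1 : 0 < e / (W + 1) by rewrite divr_gt0// ltr_wpDl.
have [d1 d10 hd1] := cc_unif cb bb_ e1.
pose s := Num.min (1/2) (Num.min (d1 / 2) (s1 / 2)).
have s0 : 0 < s by rewrite !lt_min; apply/andP; split; [lra|by rewrite !divr_gt0].
have sA : s <= 1 by rewrite /s ge_min; apply/orP; left; lra.
have sB : s < d1 by rewrite /s !gt_min; apply/orP; right; apply/orP; left; (clear -d10 gK fK cg2 cg1 hv hu; lra).
have sC : s < s1 by rewrite /s !gt_min; apply/orP; right; apply/orP; right; (clear -s10 gK fK cg2 cg1 hv hu; lra).
have [la1 lb1 E1] := deg_swap s0 cb bb_ b0 lw1 w10.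
have [la2 lb2 E2] := deg_swap s0 cb bb_ b0 lw2 w20.
have cmp : I (fun p => conv b (rho s) (u p, v p) * w2 p) <= I (fun p => conv b (rho s) (u p, v p) * w1 p).
  rewrite E1 E2; apply: Int_le => // y; have [h|h] := leP (nm y) r1; last by rewrite bb_// !mul0r.
  apply: ler_wpM2l; first exact: b0.
  have [K _ hK] := rho_bd s0.
  have lr k : L k -> L (fun p => rho s (pm (u p, v p) y) * k p) by move=> lk; apply: (L_ctw (K := K)) => //; exact: ct_rhof.
  rewrite -subr_ge0 -IntB; [|exact: lr|exact: lr].
  have := degpos s y s0 sC sA h; rewrite /deg; congr (_ <= _); apply: Int_ext => p.
  by rewrite -mulrBr -ww.
have close : `|I (fun p => (conv b (rho s) (u p, v p) * w1 p - conv b (rho s) (u p, v p) * w2 p)) - I (fun p => eta p * w p)| <= e.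
  rewrite -IntB//; last exact: L1B.
  apply: (@le_trans _ _ (e / (W + 1) * W)); last first.
    by rewrite mulrAC ler_pdivrMr ?ltr_wpDl// ler_wpM2l ?ltW// ltrDl.
  rewrite /W -IntZ; last exact: L1_abs.
  apply: Int_abs_le.
  - by apply: L1B => //; exact: L1B.
  - by apply: L1Z; exact: L1_abs.
  move=> p; rewrite -mulrBr -ww -mulrBl normrM; apply: ler_wpM2r => //.
  have -> : eta p = b (u p, v p) by rewrite /b fK.
  apply: conv_close => //; first exact: ct_Ll.
  by move=> q hq; apply/ltW/hd1; exact: le_lt_trans hq sB.
rewrite IntB// in close; apply: le_trans _ (le_trans (ler_norm _) close).
by rewrite -[leLHS]add0r lerD2r subr_ge0.
Qed.

(** The indicator of the set where [J] is negative is approximated by continuous functions in a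
    weight dominating the truncated Jacobian. Against these the integral of [J] is nonnegative, so
    the integral of [- J] over the set is at most the error. *)
Lemma jac_pos c d : 0 < d -> {ae @PM R, forall p, nm (pm p c) < d -> 0 <= J p} ->
  {ae @PM R, forall p, 0 <= J p}.
Proof.
move=> d0 hJ.
have mJ : meas J.
  have [_ [m1 _] [m2 _] _] := hu; have [_ [m3 _] [m4 _] _] := hv.
  by apply: measurable_funB; exact: measurable_funM.
pose E := [set p : C | J p < 0].
have mE : measurable (E : set (M1 * M1)).
  by rewrite (_ : E = J @^-1` `]-oo, 0[%classic); [rewrite -[_ @^-1` _]setTI; exact: mJ|apply/seteqP; split=> p /=; rewrite in_itv].
have key (M : R) : {ae @PM R, forall p, \1_E p * cutp M p * - J p = 0}.
  have lq := L_jac (M + 1); have lw := L1_abs lq.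
  set w := (fun p => `|J p * qi (M + 1) p|) in lw.
  have cj phi : ct phi -> (forall p, 0 <= phi p <= 1) -> L (fun p => phi p * cutp M p * J p).
    move=> cp p01; apply: (@L1_ext _ _ _ (@PM R) (fun p => (phi p * cutp M p) * (J p * qi (M + 1) p))).
      move=> p; have [h|h] := leP (nm p) (M + 1); first by rewrite qi1// mulr1.
      by rewrite (cutp_bs h) !mulr0 !mul0r.
    apply: (L_ctw (K := 1)) => //; first by apply: ctM => //; exact: cutp_ct.
    move=> p; have /andP[a1 a2] := p01 p; have /andP[a3 a4] := cutp01 M p.
    by rewrite ger0_norm; [exact: mulr_ile1|exact: mulr_ge0].
  have lE : L (fun p => \1_E p * cutp M p * - J p).
    apply: (@L1_le _ _ _ (@PM R) w) => //.
      apply: measurable_funM; last exact: measurableT_comp.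
      by apply: measurable_funM; [exact: measurable_indic|exact: meas_ct (cutp_ct M)].
    move=> p; have := @cutp_bs R M p; have /andP[] := cutp01 M p; move: (cutp M p) => k a3 a4 hk.
    rewrite /w !normrM normrN; have [h|h] := leP (nm p) (M + 1).
      rewrite qi1// normr1 mulr1 ler_piMl//.
      rewrite (ger0_norm a3); apply: mulr_ile1 => //; rewrite indicE; case: (_ \in _); rewrite /= ?normr1 ?normr0//.
    by rewrite hk// normr0 mulr0 mul0r; apply: mulr_ge0.
  apply: Int_ge0_eq0 => //.
    move=> p; have /andP[a3 a4] := cutp01 M p; rewrite indicE.
    case: (asboolP (E p)) => hp; [rewrite mem_set// mul1r|rewrite memNset// !mul0r//].
    by apply: mulr_ge0 => //; rewrite oppr_ge0 ltW.
  apply/ler_addgt0Pl => e e0; rewrite addr0.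
  have [phi [cp p01 hp]] := (apx_all mE).2 w lw (fun p => normr_ge0 _) e e0.
  have lphi := cj phi cp p01.
  have pos : 0 <= I (fun p => phi p * cutp M p * J p).
    apply: (jac_pos_int d0 hJ (r := M + 1)); first by apply: ctM => //; exact: cutp_ct.
      by move=> p h; rewrite (cutp_bs h) mulr0.
    by move=> p; have /andP[a1 a2] := p01 p; have /andP[a3 a4] := cutp01 M p; exact: mulr_ge0.
  apply: le_trans hp.
  have : I (fun p => \1_E p * cutp M p * - J p) + I (fun p => phi p * cutp M p * J p) <= I (fun p => `|\1_E p - phi p| * w p).
    rewrite -IntD//; apply: Int_le.
    - exact: L1D.
    - exact: (apx_L mE cp p01 lw (fun p => normr_ge0 _)).
    move=> p; have -> : \1_E p * cutp M p * - J p + phi p * cutp M p * J p = - ((\1_E p - phi p) * (cutp M p * J p)) by ring.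
    apply: le_trans (ler_norm _) _; rewrite normrN normrM; apply: ler_wpM2l => //.
    have := @cutp_bs R M p; have /andP[] := cutp01 M p; move: (cutp M p) => k a3 a4 hk.
    rewrite /w !normrM; have [h|h] := leP (nm p) (M + 1).
      by rewrite qi1// normr1 mulr1 ler_piMl// ger0_norm.
    by rewrite hk// normr0 mul0r; apply: mulr_ge0.
  lra.
have := ae_foralln (fun n : nat => key n%:R); apply: filterS => p hp.
have := hp (Num.bound (nm p)); rewrite cutp1; last by apply/ltW/archi_boundP/nm_ge0.
rewrite mulr1 indicE leNgt; case: (asboolP (E p)) => hE; last by move=> _; exact/negP.
by rewrite mem_set// mul1r => h; move: hE; rewrite /E /= => h2; lra.
Qed.

End Map.
End Orientation.


(** * The frame Poincare inequality *)

Section Rectangles.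
Variable R : realType.
Local Notation C := (R * R)%type.
Local Notation M1 := (measurableTypeR R).
Local Notation L := (L1 (@PM R)).
Local Notation I := (Int (@PM R)).
Local Notation meas := (measurable_fun (setT : set (M1 * M1))).
Local Notation l1 := (L1 (@lebesgue_measure R)).
Local Notation i1 := (Int (@lebesgue_measure R)).
Implicit Types (F G U : C -> R) (a b c d s t x : R) (h : R -> R) (p : C).

Lemma frac_lt (e W : R) : 0 < e -> 0 <= W -> e / (W + 1) * W < e.
Proof.
move=> e0 W0; have W1 : 0 < W + 1 by rewrite ltr_wpDl.
by rewrite mulrAC ltr_pdivrMr// ltr_pM2l// ltrDl.
Qed.

Definition ii a b t : R := ((a < t < b)%R)%:R.

Lemma iiE a b : ii a b = \1_(`]a, b[%classic) :> (R -> R).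
Proof.
apply/funext => t; rewrite indicE /ii; congr (nat_of_bool _)%:R.
by apply/idP/idP; rewrite inE /= in_itv.
Qed.

Lemma meas_ii a b : measurable_fun (setT : set M1) (ii a b).
Proof. by rewrite iiE; apply: measurable_indic; exact: measurable_itv. Qed.

Lemma ii01 a b t : 0 <= ii a b t <= 1.
Proof. by rewrite /ii; case: (_ < _ < _); rewrite ?lexx ?ler01. Qed.

Lemma ii_ge0 a b t : 0 <= ii a b t. Proof. by have /andP[] := ii01 a b t. Qed.

Lemma ii_sq a b t : ii a b t ^+ 2 = ii a b t.
Proof. by rewrite /ii; case: (_ < _ < _); rewrite ?expr1n ?expr0n. Qed.


Lemma ii_int a b h : measurable_fun (setT : set M1) h ->
  (\int[@lebesgue_measure R]_t (h t * ii a b t)%:E = \int[@lebesgue_measure R]_(t in `]a, b[) (h t)%:E)%E.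
Proof.
move=> mh; rewrite [RHS]integral_mkcond; apply: eq_integral => t _.
by rewrite iiE patchE indicE; case: (t \in _); rewrite /= ?mulr1 ?mulr0.
Qed.

Lemma EInt_ii a b : (\int[@lebesgue_measure R]_t (ii a b t)%:E = lebesgue_measure `]a, b[%classic)%E.
Proof. by rewrite iiE integral_indic// setIT. Qed.

Lemma l1_ii a b : l1 (ii a b).
Proof.
apply: L1_fin; [exact: meas_ii|exact: ii_ge0|].
by rewrite EInt_ii lebesgue_measure_itv /=; case: ifP => _; rewrite ?ltry// -EFinB ltry.
Qed.

Lemma Int_ii a b : a <= b -> i1 (ii a b) = b - a.
Proof.
move=> ab; apply: EFin_inj; rewrite -EInt; last exact: l1_ii.
rewrite EInt_ii lebesgue_measure_itv /=.
by case: ltP => h; [rewrite -EFinB|congr EFin; apply/eqP; rewrite eq_sym subr_eq0 eq_le -!lee_fin h lee_fin].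
Qed.

Lemma l1_bd (h : R -> R) a b (K : R) : measurable_fun (setT : set M1) h -> (forall t, a < t < b -> `|h t| <= K) ->
  l1 (fun t => h t * ii a b t).
Proof.
move=> mh hK; apply: (@L1_le _ _ _ (@lebesgue_measure R) (fun t => K * ii a b t)).
- by apply: measurable_funM => //; exact: meas_ii.
- move=> t; rewrite normrM (ger0_norm (ii_ge0 _ _ _)) /ii.
  by case: (boolP (a < t < b)) => ht; rewrite ?mulr0// !mulr1; exact: hK.
- by apply: L1Z; exact: l1_ii.
Qed.

Lemma cts_bd h a b : continuous h -> exists2 K, 0 < K & forall t, a < t < b -> `|h t| <= K.
Proof.
move=> ch; have [K K0 hK] := cts_seg (`|a| + `|b|) ch; exists K => // t /andP[h1 h2]; apply: hK.
rewrite ler_norml; have := ler_norm (- a); have := ler_norm b; rewrite normrN.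
by have := normr_ge0 a; have := normr_ge0 b => *; apply/andP; split; lra.
Qed.

Lemma l1_cts h a b : continuous h -> l1 (fun t => h t * ii a b t).
Proof.
move=> ch; have [K _ hK] := cts_bd a b ch; apply: (l1_bd (K := K)) => //.
exact: continuous_measurable_fun.
Qed.

Lemma ftc_ii (h h' : R -> R) a b : a <= b -> continuous h' -> (forall x, der h x (h' x)) ->
  i1 (fun t => h' t * ii a b t) = h b - h a.
Proof.
move=> ab ch dh; apply: EFin_inj; rewrite -EInt; last exact: l1_cts.
have mh : measurable_fun (setT : set M1) h' by exact: continuous_measurable_fun.
rewrite ii_int// -(ftc ab ch dh) (@integral_itv_bndoo R a b _ true false)//.
by apply/measurable_EFinP; exact: measurable_funS mh.
Qed.

(** Fundamental theorem of calculus, then Cauchy-Schwarz against the indicator of the segment. *)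
Lemma seg_osc (h h' : R -> R) a b s t : continuous h' -> (forall x, der h x (h' x)) ->
  a <= s <= b -> a <= t <= b -> (h s - h t) ^+ 2 <= (b - a) * i1 (fun x => h' x ^+ 2 * ii a b x).
Proof.
move=> ch dh; wlog st : s t / s <= t => [W hs ht|].
  have [st|/ltW ts] := leP s t; first exact: W.
  by rewrite -[_ ^+ 2]sqrrN opprB; exact: W.
move=> /andP[as_ sb] /andP[at_ tb].
have E := ftc_ii st ch dh; have mi := meas_ii.
have mh : measurable_fun (setT : set M1) h' by exact: continuous_measurable_fun.
have ch2 : continuous (fun x => h' x ^+ 2) by move=> x; exact: (cvgM (ch x) (ch x)).
have sub x : ii s t x * ii a b x = ii s t x.
  rewrite /ii; case: (boolP (s < x < t)) => [/andP[h1 h2]|_]; rewrite ?mul0r// mul1r.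
  by rewrite (_ : a < x < b)//; apply/andP; split; [exact: le_lt_trans h1|exact: lt_le_trans tb].
have lA : l1 (fun x => (h' x * ii a b x) ^+ 2).
  by apply: L1_ext (l1_cts a b ch2) => x; rewrite exprMn ii_sq.
have lB : l1 (fun x => ii s t x ^+ 2) by apply: L1_ext (l1_ii s t) => x; rewrite ii_sq.
have := Int_CS (measurable_funM mh (mi a b)) (mi s t) lA lB.
rewrite (@Int_ext _ _ _ (@lebesgue_measure R) _ (fun x => h' x * ii s t x)); last first.
  by move=> x /=; rewrite -mulrA [ii a b x * _]mulrC sub.
rewrite E (@Int_ext _ _ _ (@lebesgue_measure R) (fun x => ii s t x ^+ 2) (ii s t)); last exact: ii_sq.
rewrite Int_ii// (@Int_ext _ _ _ (@lebesgue_measure R) _ (fun x => h' x ^+ 2 * ii a b x)); last by move=> x /=; rewrite exprMn ii_sq.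
set N := i1 _; have N0 : 0 <= N by apply: Int_ge0 => x; apply: mulr_ge0; [exact: sqr_ge0|exact: ii_ge0].
move=> h1; rewrite -[_ ^+ 2]sqrrN opprB; apply: (le_trans h1).
by rewrite mulrC ler_wpM2r//; lra.
Qed.

Definition rr a b c d p : R := ii a b p.1 * ii c d p.2.

Lemma rr01 a b c d p : 0 <= rr a b c d p <= 1.
Proof.
by have /andP[? ?] := ii01 a b p.1; have /andP[? ?] := ii01 c d p.2; rewrite /rr mulr_ge0//= mulr_ile1.
Qed.

Lemma meas_rr a b c d : meas (rr a b c d).
Proof.
by apply: measurable_funM; [exact: measurableT_comp (meas_ii a b) measurable_fst|exact: measurableT_comp (meas_ii c d) measurable_snd].
Qed.

Lemma rr_in a b c d p : rr a b c d p != 0 -> a < p.1 < b /\ c < p.2 < d.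
Proof.
by rewrite /rr /ii mulf_eq0 negb_or; case: (a < _ < b); case: (c < _ < d); rewrite ?eqxx//= ?andbF.
Qed.

Lemma rr_bs a b c d : bs (`|a| + `|b| + `|c| + `|d|) (rr a b c d).
Proof.
move=> p hp; apply/eqP; apply: contraTT hp => /rr_in[/andP[h1 h2] /andP[h3 h4]]; rewrite -leNgt nm_le !ler_norml.
have := ler_norm (- a); have := ler_norm b; have := ler_norm (- c); have := ler_norm d; rewrite !normrN.
have := normr_ge0 a; have := normr_ge0 b; have := normr_ge0 c; have := normr_ge0 d => *.
by apply/andP; split; apply/andP; split; lra.
Qed.

Lemma L_rr G a b c d : ct G -> L (fun p => G p * rr a b c d p).
Proof.
move=> cG; have [K K0 hK] := ct_bounded (`|a| + `|b| + `|c| + `|d|) cG.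
apply: (L_bs (r := `|a| + `|b| + `|c| + `|d|) (K := K)).
- by apply: measurable_funM; [exact: meas_ct|exact: meas_rr].
- by move=> p /(@rr_bs a b c d) ->; rewrite mulr0.
- move=> p; have /andP[r0 r1] := rr01 a b c d p; rewrite normrM (ger0_norm r0).
  have [h|h] := leP (nm p) (`|a| + `|b| + `|c| + `|d|); last by rewrite (rr_bs h) mulr0 ltW.
  by apply: le_trans (hK p h); rewrite ler_piMr.
Qed.

Transparent PM.
Lemma rr_fubini G a b c d : ct G -> (forall p, 0 <= G p) ->
  let g := fun x => i1 (fun t => G (x, t) * ii c d t) in
  l1 (fun x => g x * ii a b x) /\ I (fun p => G p * rr a b c d p) = i1 (fun x => g x * ii a b x).
Proof.
move=> cG G0 g; have lG := L_rr a b c d cG; have mG := L1_meas lG.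
have sec x : l1 (fun t => G (x, t) * ii c d t) by apply: l1_cts; exact: ct_secy.
have mE : measurable_fun (setT : set (M1 * M1)) (fun p => (G p * rr a b c d p)%:E) by exact/measurable_EFinP.
have E0 p : (0 <= (G p * rr a b c d p)%:E)%E.
  by rewrite lee_fin; apply: mulr_ge0 => //; have /andP[] := rr01 a b c d p.
have inn x : (\int[@lebesgue_measure R]_t (G (x, t) * rr a b c d (x, t))%:E = (g x * ii a b x)%:E)%E.
  have l := L1Z (ii a b x) (sec x).
  rewrite mulrC /g -(IntZ _ (sec x)) -(EInt l); apply: eq_integral => t _.
  by rewrite /rr /=; congr EFin; ring.
have fub := @fubini_tonelli1 _ _ M1 M1 R (@lebesgue_measure R) (@lebesgue_measure R) _ mE E0.
have mg0 := @measurable_fun_fubini_tonelli_F _ _ M1 M1 R (@lebesgue_measure R) _ mE E0.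
have EI : (\int[@lebesgue_measure R]_x (g x * ii a b x)%:E = (I (fun p => G p * rr a b c d p))%:E)%E.
  by rewrite -(EInt lG) /PM fub; apply: eq_integral => x _; rewrite /fubini_F inn.
have lg : l1 (fun x => g x * ii a b x).
  apply: L1_fin; last by rewrite EI ltry.
    apply/measurable_EFinP; apply: (eq_measurable_fun _ _ mg0).
    by move=> x _; rewrite /fubini_F inn.
  move=> x; apply: mulr_ge0; last exact: ii_ge0.
  by apply: Int_ge0 => t; apply: mulr_ge0; [exact: G0|exact: ii_ge0].
split=> //; apply: EFin_inj; rewrite -EI; exact: (EInt lg).
Qed.

Lemma Int_swap F : meas F -> (forall p, 0 <= F p) -> L F ->
  L (fun p => F (p.2, p.1)) /\ I (fun p => F (p.2, p.1)) = I F.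
Proof.
move=> mF F0 lF; have E0 p : (0 <= (F p)%:E)%E by rewrite lee_fin.
have mE : measurable_fun (setT : set (M1 * M1)) (fun p => (F p)%:E) by exact/measurable_EFinP.
have mF' : meas (fun p => F (p.2, p.1)).
  by apply: (measurableT_comp (f := F) (g := fun p : M1 * M1 => (p.2, p.1))) => //; apply: measurable_fun_pair.
have mE' : measurable_fun (setT : set (M1 * M1)) (fun p => (F (p.2, p.1))%:E) by exact/measurable_EFinP.
have f1 := @fubini_tonelli1 _ _ M1 M1 R (@lebesgue_measure R) (@lebesgue_measure R) _ mE' (fun p => E0 (p.2, p.1)).
have f2 := @fubini_tonelli2 _ _ M1 M1 R (@lebesgue_measure R) (@lebesgue_measure R) _ mE E0.
have E : (\int[@PM R]_p (F (p.2, p.1))%:E = \int[@PM R]_p (F p)%:E)%E by rewrite /PM f1 f2.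
have l : L (fun p => F (p.2, p.1)).
  by apply: L1_fin => //; rewrite E (EInt lF) ltry.
by split=> //; apply: EFin_inj; rewrite -(EInt l) -(EInt lF).
Qed.
Opaque PM.

(** If every vertical line exceeded the average, integrating over [x] would exceed the total; the
    margin [e] makes the contradiction strict. *)
Lemma good_line G a b c d (e : R) : a < b -> ct G -> (forall p, 0 <= G p) -> 0 < e ->
  exists2 x, a <= x <= b & (b - a) * i1 (fun t => G (x, t) * ii c d t) <= I (fun p => G p * rr a b c d p) + e.
Proof.
move=> ab cG G0 e0; have [lg E] := rr_fubini a b c d cG G0.
apply: contrapT => H; set T := I _ in H E.
have : T + e <= T; last by rewrite gerDl leNgt e0.
rewrite [X in _ <= X]E; have ba : 0 < b - a by rewrite subr_gt0.
have -> : T + e = i1 (fun x => (T + e) / (b - a) * ii a b x).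
  by rewrite IntZ ?Int_ii ?ltW// ?divfK ?gt_eqF//; exact: l1_ii.
apply: Int_le => //; first by apply: L1Z; exact: l1_ii.
move=> x; rewrite /ii; case: (boolP (a < x < b)) => [/andP[h1 h2]|_]; rewrite ?mulr0// !mulr1.
rewrite leNgt; apply/negP => hx; apply: H; exists x; first by rewrite !ltW.
by rewrite mulrC -ler_pdivlMr// ltW.
Qed.

(** The energy of the horizontal line through [p] does not depend on [p.1], so integrating it over
    the rectangle only multiplies the energy by the width. *)
Lemma rr_lines G a b c d : a < b -> ct G -> (forall p, 0 <= G p) ->
  let N := fun p => i1 (fun t => G (t, p.2) * ii a b t) in
  L (fun p => N p * rr a b c d p) /\ I (fun p => N p * rr a b c d p) = (b - a) * I (fun p => G p * rr a b c d p).
Proof.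
move=> ab cG G0 N.
pose G' p := G (p.2, p.1).
have cG' : ct G' by apply: (ct_comp2 (u := snd) (v := fst)); [exact: ct2|exact: ct1|exact: cG].
pose g y := i1 (fun t => G' (y, t) * ii a b t).
have [lg E] : l1 (fun y => g y * ii c d y) /\ I (fun p => G' p * rr c d a b p) = i1 (fun y => g y * ii c d y).
  exact: rr_fubini c d a b cG' (fun p => G0 _).
have sec y : l1 (fun t => G (t, y) * ii a b t) by apply: l1_cts; exact: ct_secx.
have Nb p : N p = g p.2 by [].
have g0 y : 0 <= g y by apply: Int_ge0 => t; apply: mulr_ge0; [exact: G0|exact: ii_ge0].
have cN : ct N.
  have [K K0 hK] := cts_bd a b (@cst_continuous _ _ (1 : R)).
  move=> p e e0; have ba : 0 < b - a by rewrite subr_gt0.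
  have e1 : 0 < e / (b - a + 1) by rewrite divr_gt0// ltr_wpDr// ltW.
  have [dl dl0 hd] := @ct_unif R G (`|a| + `|b| + `|p.2| + 1) _ cG e1.
  exists dl => // q hq; rewrite /N -IntB; [|exact: sec|exact: sec].
  apply: (@le_lt_trans _ _ (e / (b - a + 1) * (b - a))); last by apply: frac_lt => //; exact: ltW.
  rewrite -[X in _ <= _ * X](Int_ii (ltW ab)) -IntZ; last exact: l1_ii.
  apply: Int_abs_le; [by apply: L1B; exact: sec|by apply: L1Z; exact: l1_ii|].
  move=> t; rewrite -mulrBl normrM (ger0_norm (ii_ge0 _ _ _)).
  rewrite /ii; case: (boolP (a < t < b)) => [/andP[h1 h2]|_]; rewrite ?mulr0// !mulr1.
  apply/ltW/(hd (t, p.2)); last first.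
    have : `|q.2 - p.2| <= nm (pm q p) by exact: (nm2 (pm q p)).
    by move=> h3; rewrite nm_lt /= subrr normr0 (le_lt_trans h3 hq) (le_lt_trans (nm_ge0 _) hq).
  rewrite nm_le /= ler_norml; have := ler_norm (- a); have := ler_norm b; rewrite normrN.
  have := normr_ge0 a; have := normr_ge0 b; have := normr_ge0 p.2 => *.
  by apply/andP; split; [apply/andP; split; lra|lra].
split; first exact: L_rr.
pose N' p := N (p.2, p.1).
have cN' : ct N' by apply: (ct_comp2 (u := snd) (v := fst)); [exact: ct2|exact: ct1|exact: cN].
have N0 p : 0 <= N p by exact: g0.
have r0 a' b' c' d' p : 0 <= rr a' b' c' d' p by have /andP[] := rr01 a' b' c' d' p.
pose h y := i1 (fun t => N' (y, t) * ii a b t).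
have [lh E2] : l1 (fun y => h y * ii c d y) /\ I (fun p => N' p * rr c d a b p) = i1 (fun y => h y * ii c d y).
  exact: rr_fubini c d a b cN' (fun p => N0 _).
have hg y : h y = (b - a) * g y.
  rewrite /h (@Int_ext _ _ _ (@lebesgue_measure R) _ (fun t => g y * ii a b t)) => [|t]; last by rewrite /N' Nb.
  by rewrite IntZ ?Int_ii ?ltW// 1?mulrC//; exact: l1_ii.
have sw F : ct F -> (forall p, 0 <= F p) -> I (fun p => F p * rr a b c d p) = I (fun p => F (p.2, p.1) * rr c d a b p).
  move=> cF F0; have lF := L_rr a b c d cF.
  have [] := Int_swap (L1_meas lF) (fun p => mulr_ge0 (F0 p) (r0 _ _ _ _ _)) lF.
  by move=> _ <-; apply: Int_ext => p; rewrite /rr /=; ring.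
rewrite (sw _ cN N0) (sw _ cG G0) -/G' E -IntZ//.
transitivity (i1 (fun y => h y * ii c d y)); first exact: E2.
by apply: Int_ext => y; rewrite hg; ring.
Qed.

Lemma Int_rr a b c d : a <= b -> c <= d -> I (rr a b c d) = (b - a) * (d - c).
Proof.
move=> ab cd; have [_ E] := rr_fubini a b c d (ct_cst 1) (fun _ => ler01).
rewrite (@Int_ext _ _ _ (@PM R) _ (fun p => 1 * rr a b c d p)) ?E => [|p]; last by rewrite mul1r.
have i1r : i1 (fun t => 1 * ii c d t) = d - c by rewrite -(Int_ii cd); apply: Int_ext => t; exact: mul1r.
rewrite (@Int_ext _ _ _ (@lebesgue_measure R) _ (fun x => (d - c) * ii a b x)) => [|x]; last by rewrite i1r.
by rewrite IntZ ?Int_ii 1?mulrC//; exact: l1_ii.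
Qed.

Lemma L_rr1 a b c d : L (rr a b c d).
Proof. by apply: L1_ext (L_rr a b c d (ct_cst 1)) => p; rewrite mul1r. Qed.

Lemma rr_ge0 a b c d p : 0 <= rr a b c d p. Proof. by have /andP[] := rr01 a b c d p. Qed.

Lemma sq_split (x y z : R) : (x - z) ^+ 2 <= 2 * (x - y) ^+ 2 + 2 * (y - z) ^+ 2.
Proof. by have := sqr_ge0 (x - y - (y - z)); rewrite !expr2; nra. Qed.

(** From a point go horizontally to a good vertical line, then along it to [(x, y)]. The horizontal
    legs average to the energy of [Ux], and the good line pays for the vertical ones. The second
    clause compares values on that line and links adjacent rectangles. *)
Lemma rect_x U Ux Uy a b c d (e : R) : C1 U Ux Uy -> a < b -> c < d -> 0 < e ->
  exists2 x, a <= x <= b &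
    (forall y, c <= y <= d -> I (fun p => (U p - U (x, y)) ^+ 2 * rr a b c d p) <=
      2 * (b - a) ^+ 2 * I (fun p => Ux p ^+ 2 * rr a b c d p) +
      2 * (d - c) ^+ 2 * (I (fun p => Uy p ^+ 2 * rr a b c d p) + e)) /\
    forall y y', c <= y <= d -> c <= y' <= d ->
      (b - a) * (U (x, y) - U (x, y')) ^+ 2 <= (d - c) * (I (fun p => Uy p ^+ 2 * rr a b c d p) + e).
Proof.
move=> [cU cx cy dx dy] ab cd e0.
have ba : 0 < b - a by rewrite subr_gt0.
have dc : 0 < d - c by rewrite subr_gt0.
have [x hx gl] := good_line c d ab (ctX 2 cy) (fun p => sqr_ge0 (Uy p)) e0.
pose N p := i1 (fun t => Ux (t, p.2) ^+ 2 * ii a b t).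
have [lN EN] : L (fun p => N p * rr a b c d p) /\ I (fun p => N p * rr a b c d p) = (b - a) * I (fun p => Ux p ^+ 2 * rr a b c d p).
  exact: (rr_lines c d ab (ctX 2 cx) (fun p => sqr_ge0 (Ux p))).
set n0 := i1 _ in gl; have n00 : 0 <= n0 by apply: Int_ge0 => t; apply: mulr_ge0; [exact: sqr_ge0|exact: ii_ge0].
have vert y y' : c <= y <= d -> c <= y' <= d -> (U (x, y) - U (x, y')) ^+ 2 <= (d - c) * n0.
  by move=> hy hy'; exact: (@seg_osc (fun t => U (x, t)) (fun t => Uy (x, t)) c d y y' (@ct_secy R x _ cy) (fun t => dy (x, t)) hy hy').
exists x => //; split=> [y hy|y y' hy hy']; last first.
  by have := vert y y' hy hy'; (clear -gl cd ab; nra).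
set Iy := I _ in gl *.
apply: (@le_trans _ _ (I (fun p => 2 * (b - a) * (N p * rr a b c d p) + 2 * (d - c) * n0 * rr a b c d p))).
  apply: Int_le.
  - by apply: L_rr; apply: ctX; apply: ctB => //; exact: ct_cst.
  - by apply: L1D; apply: L1Z => //; exact: L_rr1.
  move=> p; have [->|/rr_in[/andP[p1 p2] /andP[p3 p4]]] := eqVneq (rr a b c d p) 0; first by rewrite !mulr0 addr0.
  have h1 : (U p - U (x, p.2)) ^+ 2 <= (b - a) * N p.
    have := seg_osc (h := fun t => U (t, p.2)) (s := p.1) (t := x) (@ct_secx R p.2 _ cx) (fun t => dx (t, p.2)) _ hx.
    by rewrite -surjective_pairing; apply; rewrite !ltW.
  have h2 : (U (x, p.2) - U (x, y)) ^+ 2 <= (d - c) * n0 by apply: vert => //; rewrite !ltW.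
  have := sq_split (U p) (U (x, p.2)) (U (x, y)).
  have := rr_ge0 a b c d p; move: (rr a b c d p) (N p) h1 => k n h1 k0 h3.
  have -> : 2 * (b - a) * (n * k) + 2 * (d - c) * n0 * k = (2 * ((b - a) * n) + 2 * ((d - c) * n0)) * k by ring.
  by apply: ler_wpM2r => //; (clear -h3 h1 h2; lra).
rewrite IntD; [|by apply: L1Z|by apply: L1Z; exact: L_rr1].
rewrite !IntZ//; last exact: L_rr1.
rewrite (Int_rr (ltW ab) (ltW cd)) EN.
set Ix := I _.
have -> : 2 * (b - a) * ((b - a) * Ix) = 2 * (b - a) ^+ 2 * Ix by ring.
have -> : 2 * (d - c) * n0 * ((b - a) * (d - c)) = 2 * (d - c) ^+ 2 * ((b - a) * n0) by ring.
by apply: lerD => //; apply: ler_wpM2l => //; apply: mulr_ge0 => //; exact: sqr_ge0.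
Qed.

Lemma C1_swap U Ux Uy : C1 U Ux Uy -> C1 (fun p => U (p.2, p.1)) (fun p => Uy (p.2, p.1)) (fun p => Ux (p.2, p.1)).
Proof.
move=> [c1 c2 c3 d1 d2]; split.
- by apply: (ct_comp2 (u := snd) (v := fst)) => //; [exact: ct2|exact: ct1].
- by apply: (ct_comp2 (u := snd) (v := fst)) => //; [exact: ct2|exact: ct1].
- by apply: (ct_comp2 (u := snd) (v := fst)) => //; [exact: ct2|exact: ct1].
- by move=> p; exact: (d2 (p.2, p.1)).
- by move=> p; exact: (d1 (p.2, p.1)).
Qed.

Lemma rr_swap F a b c d : ct F -> (forall p, 0 <= F p) ->
  I (fun p => F (p.2, p.1) * rr c d a b p) = I (fun p => F p * rr a b c d p).
Proof.
move=> cF F0; have lF := L_rr a b c d cF.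
have [] := Int_swap (L1_meas lF) (fun p => mulr_ge0 (F0 p) (rr_ge0 _ _ _ _ _)) lF.
by move=> _ <-; apply: Int_ext => p; rewrite /rr /=; ring.
Qed.

Lemma rect_y U Ux Uy a b c d (e : R) : C1 U Ux Uy -> a < b -> c < d -> 0 < e ->
  exists2 y, c <= y <= d &
    (forall x, a <= x <= b -> I (fun p => (U p - U (x, y)) ^+ 2 * rr a b c d p) <=
      2 * (d - c) ^+ 2 * I (fun p => Uy p ^+ 2 * rr a b c d p) +
      2 * (b - a) ^+ 2 * (I (fun p => Ux p ^+ 2 * rr a b c d p) + e)) /\
    forall x x', a <= x <= b -> a <= x' <= b ->
      (d - c) * (U (x, y) - U (x', y)) ^+ 2 <= (b - a) * (I (fun p => Ux p ^+ 2 * rr a b c d p) + e).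
Proof.
move=> hU ab cd e0; have [cU cx cy _ _] := hU.
have [y hy [H1 H2]] := rect_x (C1_swap hU) cd ab e0.
have sx := @rr_swap _ a b c d (ctX 2 cx) (fun p => sqr_ge0 (Ux p)).
have sy := @rr_swap _ a b c d (ctX 2 cy) (fun p => sqr_ge0 (Uy p)).
rewrite sx sy in H1; rewrite sx in H2.
exists y => //; split=> // x hx.
have cUm : ct (fun p => (U p - U (x, y)) ^+ 2) by apply: ctX; apply: ctB => //; exact: ct_cst.
by have := H1 x hx; rewrite (@rr_swap _ a b c d cUm (fun p => sqr_ge0 _)).
Qed.

(* The open frame [r < nm p < 2 r] is covered by four rectangles; [srr] counts
   how many of them contain a point. *)
Definition srr r p : R := rr r (2 * r) (- (2 * r)) (2 * r) p + rr (- (2 * r)) (- r) (- (2 * r)) (2 * r) p +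
  rr (- (2 * r)) (2 * r) r (2 * r) p + rr (- (2 * r)) (2 * r) (- (2 * r)) (- r) p.
Definition fr r p : R := qi (2 * r) p - qi r p.

Lemma fr_ge0 r p : 0 < r -> 0 <= fr r p.
Proof.
move=> r0; rewrite /fr; have [h|h] := leP (nm p) r; last by rewrite (qi0 h) subr0 qi_ge0.
by rewrite !qi1 ?subrr//; lra.
Qed.

Lemma rr_fr r a b c d p : 0 < r -> (forall p, a < p.1 < b -> c < p.2 < d -> r < nm p <= 2 * r) -> rr a b c d p <= fr r p.
Proof.
move=> r0 H; have [->|/rr_in[h1 h2]] := eqVneq (rr a b c d p) 0; first exact: fr_ge0.
have /andP[h3 h4] := H _ h1 h2; rewrite /fr qi1// (qi0 h3) subr0.
by have /andP[] := rr01 a b c d p.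
Qed.

Lemma rrs_fr r p : 0 < r -> [/\ rr r (2 * r) (- (2 * r)) (2 * r) p <= fr r p,
  rr (- (2 * r)) (- r) (- (2 * r)) (2 * r) p <= fr r p,
  rr (- (2 * r)) (2 * r) r (2 * r) p <= fr r p & rr (- (2 * r)) (2 * r) (- (2 * r)) (- r) p <= fr r p].
Proof.
move=> r0; split; apply: rr_fr => // q /andP[h1 h2] /andP[h3 h4]; rewrite nm_le /nm lt_max;
  apply/andP; (split; [apply/orP|apply/andP; split; rewrite ler_norml; apply/andP; split; lra]).
- by left; rewrite lter_normr h1.
- by left; rewrite lter_normr; apply/orP; right; lra.
- by right; rewrite lter_normr h3.
- by right; rewrite lter_normr; apply/orP; right; lra.
Qed.

Lemma srr_ge1 r p : 0 < r -> r < nm p < 2 * r -> 1 <= srr r p.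
Proof.
move=> r0 /andP[]; rewrite /nm lt_max gt_max !ltr_norml => h /andP[/andP[h1 h2] /andP[h3 h4]].
have g := rr_ge0; rewrite /srr.
have G1 := g r (2 * r) (- (2 * r)) (2 * r) p; have G2 := g (- (2 * r)) (- r) (- (2 * r)) (2 * r) p.
have G3 := g (- (2 * r)) (2 * r) r (2 * r) p; have G4 := g (- (2 * r)) (2 * r) (- (2 * r)) (- r) p.
have one a b c d : a < p.1 < b -> c < p.2 < d -> rr a b c d p = 1 by rewrite /rr /ii => -> ->; rewrite mulr1.
have b1 : - (2 * r) < p.1 < 2 * r by rewrite h1 h2.
have b2 : - (2 * r) < p.2 < 2 * r by rewrite h3 h4.
move: h; rewrite !lter_normr => /orP[/orP[h|h]|/orP[h|h]].
- have E : r < p.1 < 2 * r by rewrite h h2.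
  by have := one _ _ _ _ E b2; (clear -G4 G3 G2; lra).
- have E : - (2 * r) < p.1 < - r by rewrite h1; lra.
  by have := one _ _ _ _ E b2; (clear -G4 G3 G1; lra).
- have E : r < p.2 < 2 * r by rewrite h h4.
  by have := one _ _ _ _ b1 E; (clear -G4 G2 G1; lra).
- have E : - (2 * r) < p.2 < - r by rewrite h3; lra.
  by have := one _ _ _ _ b1 E; (clear -G3 G2 G1; lra).
Qed.

Lemma L_srr r F : ct F -> L (fun p => F p * srr r p).
Proof.
move=> cF; apply: (@L1_ext _ _ _ (@PM R) (fun p => F p * rr r (2 * r) (- (2 * r)) (2 * r) p +
  F p * rr (- (2 * r)) (- r) (- (2 * r)) (2 * r) p + F p * rr (- (2 * r)) (2 * r) r (2 * r) p +
  F p * rr (- (2 * r)) (2 * r) (- (2 * r)) (- r) p)); first by move=> p; rewrite /srr; ring.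
by apply: L1D; [apply: L1D; [apply: L1D|]|]; exact: L_rr.
Qed.

Lemma L_fr r F : L2l F -> L (fun p => F p ^+ 2 * fr r p).
Proof.
move=> [mF hF]; apply: (L1_ext _ (L1B (hF (2 * r)) (hF r))) => p; rewrite /fr; ring.
Qed.

(** The good lines of adjacent rectangles cross in the corners of the frame. The reference value is
    taken at the crossing [(x1, y1)] of the right and top lines; the left and bottom rectangles are
    referred to it along the top and right lines. *)
Lemma frame_poincare U Ux Uy r (e : R) : C1 U Ux Uy -> 0 < r -> 0 < e ->
  exists m : R, I (fun p => (U p - m) ^+ 2 * srr r p) <=
    268 * r ^+ 2 * (I (fun p => Ux p ^+ 2 * fr r p) + I (fun p => Uy p ^+ 2 * fr r p) + e).
Proof.
move=> hU r0 e0; have [cU cx cy _ _] := hU.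
have r1 : r < 2 * r by lra.
have r2 : - (2 * r) < 2 * r by lra.
have r3 : - (2 * r) < - r by lra.
have inP z : r <= z <= 2 * r -> - (2 * r) <= z <= 2 * r by move=> /andP[? ?]; apply/andP; split; lra.
have inN z : - (2 * r) <= z <= - r -> - (2 * r) <= z <= 2 * r by move=> /andP[? ?]; apply/andP; split; lra.
have w1 : 2 * r - r = r by ring.
have w2 : - r - - (2 * r) = r by ring.
have w3 : 2 * r - - (2 * r) = 4 * r by ring.
have rs : 0 <= r ^+ 2 by exact: sqr_ge0.
have four (a b : R) : r * a <= 4 * r * b -> a <= 4 * b.
  by move=> h; rewrite -(ler_pM2l r0) mulrA [r * 4]mulrC.
(* The rectangles have sides [r] and [4 * r], and 34 = 2 + 2 * 16. *)
have bnd (E k a b : R) : k <= 2 * r ^+ 2 * a + 2 * (4 * r) ^+ 2 * b -> a <= E -> b <= E -> k <= 34 * r ^+ 2 * E.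
  move=> h ha hb; have g1 := ler_wpM2l rs ha; have g2 := ler_wpM2l rs hb.
  have e1 : 2 * r ^+ 2 * a = 2 * (r ^+ 2 * a) by ring.
  have e2 : 2 * (4 * r) ^+ 2 * b = 32 * (r ^+ 2 * b) by ring.
  have e3 : 34 * r ^+ 2 * E = 34 * (r ^+ 2 * E) by ring.
  by rewrite e3; rewrite e1 e2 in h; (clear -h g2 g1; lra).
(* Changing the reference value gives 100 = 2 * 34 + 8 * 4, the area being [4 * r ^+ 2]; in total
   268 = 34 + 100 + 34 + 100. *)
have shift E a b c d (z m : R) : (b - a) * (d - c) = 4 * r ^+ 2 -> a <= b -> c <= d -> I (fun p => (U p - z) ^+ 2 * rr a b c d p) <= 34 * r ^+ 2 * E ->
   (z - m) ^+ 2 <= 4 * E -> I (fun p => (U p - m) ^+ 2 * rr a b c d p) <= 100 * r ^+ 2 * E.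
  move=> ar ab cd h1 h2.
  have cm k : ct (fun p => (U p - k) ^+ 2) by apply: ctX; apply: ctB => //; exact: ct_cst.
  apply: (@le_trans _ _ (I (fun p => 2 * ((U p - z) ^+ 2 * rr a b c d p) + 8 * E * rr a b c d p))).
    apply: Int_le.
    - exact: L_rr.
    - by apply: L1D; apply: L1Z; [exact: L_rr|exact: L_rr1].
    move=> p; have := sq_split (U p) z m; have := rr_ge0 a b c d p; move: (rr a b c d p) => k k0 h3.
    rewrite mulrA -mulrDl; apply: ler_wpM2r => //; (clear -h3 h2; lra).
  rewrite IntD; [|by apply: L1Z; exact: L_rr|by apply: L1Z; exact: L_rr1].
  rewrite !IntZ ?Int_rr// ?ar; [|exact: L_rr1|exact: L_rr].
  have -> : 8 * E * (4 * r ^+ 2) = 32 * r ^+ 2 * E by ring.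
  clear -h1; lra.
have [x1 hx1 [A1 A2]] := rect_x hU r1 r2 e0.
have [x2 hx2 [B1 B2]] := rect_x hU r3 r2 e0.
have [y1 hy1 [D1 D2]] := rect_y hU r2 r1 e0.
have [y2 hy2 [F1 F2]] := rect_y hU r2 r3 e0.
have up (k : C -> R) : ct k -> [/\ I (fun p => k p ^+ 2 * rr r (2 * r) (- (2 * r)) (2 * r) p) <= I (fun p => k p ^+ 2 * fr r p),
  I (fun p => k p ^+ 2 * rr (- (2 * r)) (- r) (- (2 * r)) (2 * r) p) <= I (fun p => k p ^+ 2 * fr r p),
  I (fun p => k p ^+ 2 * rr (- (2 * r)) (2 * r) r (2 * r) p) <= I (fun p => k p ^+ 2 * fr r p) &
  I (fun p => k p ^+ 2 * rr (- (2 * r)) (2 * r) (- (2 * r)) (- r) p) <= I (fun p => k p ^+ 2 * fr r p)].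
  move=> ck; have lk := L_fr r (L2l_ct ck); have ck2 := ctX 2 ck.
  by split; (apply: Int_le => //; [exact: L_rr|]) => p; apply: ler_wpM2l; rewrite ?sqr_ge0//; have [] := rrs_fr p r0.
have [ux1 ux2 ux3 ux4] := up _ cx; have [uy1 uy2 uy3 uy4] := up _ cy.
set X := I (fun p => Ux p ^+ 2 * fr r p) in ux1 ux2 ux3 ux4 *.
set Y := I (fun p => Uy p ^+ 2 * fr r p) in uy1 uy2 uy3 uy4 *.
have X0 : 0 <= X by apply: Int_ge0 => p; apply: mulr_ge0; [exact: sqr_ge0|exact: fr_ge0].
have Y0 : 0 <= Y by apply: Int_ge0 => p; apply: mulr_ge0; [exact: sqr_ge0|exact: fr_ge0].
set E := X + Y + e.
have [EX EXe EY EYe] : [/\ X <= E, X + e <= E, Y <= E & Y + e <= E].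
  by rewrite /E; clear -X0 Y0 e0; split; lra.
rewrite w1 w3 in A1 A2 D1 D2; rewrite w2 w3 in B1 B2 F1 F2.
have in1 := inP _ hy1; have in2 := inP _ hx1; have in3 := inN _ hx2; have in4 := inN _ hy2.
have {}A1 := bnd E _ _ _ (A1 _ in1) (le_trans ux1 EX) (le_trans (lerD uy1 (lexx e)) EYe).
have {}B1 := bnd E _ _ _ (B1 _ in1) (le_trans ux2 EX) (le_trans (lerD uy2 (lexx e)) EYe).
have {}D1 := bnd E _ _ _ (D1 _ in2) (le_trans uy3 EY) (le_trans (lerD ux3 (lexx e)) EXe).
have {}F1 := bnd E _ _ _ (F1 _ in2) (le_trans uy4 EY) (le_trans (lerD ux4 (lexx e)) EXe).
have {}D2 := four _ _ (D2 _ _ in3 in2); have {}A2 := four _ _ (A2 _ _ in4 in1).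
clear B2 F2.
have {}A2 : (U (x1, y2) - U (x1, y1)) ^+ 2 <= 4 * E.
  by apply: (le_trans A2); rewrite ler_pM2l//; exact: (le_trans (lerD uy1 (lexx e)) EYe).
have {}D2 : (U (x2, y1) - U (x1, y1)) ^+ 2 <= 4 * E.
  by apply: (le_trans D2); rewrite ler_pM2l//; exact: (le_trans (lerD ux3 (lexx e)) EXe).
exists (U (x1, y1)); set m := U (x1, y1) in A1 D1 A2 D2 *.
have {}B1 : I (fun p => (U p - m) ^+ 2 * rr (- (2 * r)) (- r) (- (2 * r)) (2 * r) p) <= 100 * r ^+ 2 * E.
  by apply: shift B1 D2; [rewrite w2 w3; ring|exact: ltW|exact: ltW].
have {}F1 : I (fun p => (U p - m) ^+ 2 * rr (- (2 * r)) (2 * r) (- (2 * r)) (- r) p) <= 100 * r ^+ 2 * E.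
  by apply: shift F1 A2; [rewrite w2 w3; ring|exact: ltW|exact: ltW].
have cm : ct (fun p => (U p - m) ^+ 2) by apply: ctX; apply: ctB => //; exact: ct_cst.
have l a b c d := L_rr a b c d cm.
rewrite (@Int_ext _ _ _ (@PM R) _ (fun p => (U p - m) ^+ 2 * rr r (2 * r) (- (2 * r)) (2 * r) p +
  (U p - m) ^+ 2 * rr (- (2 * r)) (- r) (- (2 * r)) (2 * r) p + (U p - m) ^+ 2 * rr (- (2 * r)) (2 * r) r (2 * r) p +
  (U p - m) ^+ 2 * rr (- (2 * r)) (2 * r) (- (2 * r)) (- r) p)); last by move=> p; rewrite /srr; ring.
rewrite !IntD; [|exact: l|exact: l|by apply: L1D; exact: l|exact: l|by apply: L1D; [apply: L1D|]; exact: l|exact: l].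
have -> : 268 * r ^+ 2 * E = 34 * r ^+ 2 * E + 100 * r ^+ 2 * E + 34 * r ^+ 2 * E + 100 * r ^+ 2 * E by ring.
by apply: lerD; [apply: lerD; [apply: lerD|]|].
Qed.

End Rectangles.


(** * Energy decay *)

Section Energy.
Variable R : realType.
Local Notation C := (R * R)%type.
Local Notation M1 := (measurableTypeR R).
Local Notation L := (L1 (@PM R)).
Local Notation I := (Int (@PM R)).
Local Notation meas := (measurable_fun (setT : set (M1 * M1))).
Implicit Types (F G : C -> R) (p q c : C) (r s M : R).

Lemma srr_ge0 r p : 0 <= srr r p.
Proof. by rewrite /srr; do 3?apply: addr_ge0; exact: rr_ge0. Qed.

Lemma srr_le r p : 0 < r -> srr r p <= 4 * fr r p.
Proof. by move=> r0; have [a b c d] := rrs_fr p r0; rewrite /srr; lra. Qed.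

Lemma meas_srr r : meas (srr r).
Proof.
by apply: measurable_funD; [apply: measurable_funD; [apply: measurable_funD|]|]; exact: meas_rr.
Qed.

Lemma Int_srr r : 0 < r -> I (srr r) = 16 * r ^+ 2.
Proof.
move=> r0; have l := @L_rr1 R; rewrite /srr !IntD//; do ?[by apply: L1D; do ?[exact: l|apply: L1D]].
rewrite !Int_rr; try lra.
Qed.

Lemma srr_bs r : 0 < r -> bs (2 * r) (srr r).
Proof.
move=> r0 p hp; apply/eqP; rewrite eq_le srr_ge0 andbT; apply: le_trans (srr_le p r0) _.
by rewrite /fr !qi0 ?subrr ?mulr0//; lra.
Qed.

Lemma L_sq_srr r F : 0 < r -> L2l F -> L (fun p => F p ^+ 2 * srr r p).
Proof.
move=> r0 [mF hF]; apply: (@L1_le _ _ _ (@PM R) (fun p => 4 * (F p ^+ 2 * qi (2 * r) p))).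
- by apply: measurable_funM; [exact: measurable_funX|exact: meas_srr].
- move=> p; rewrite ger0_norm; last by apply: mulr_ge0; [exact: sqr_ge0|exact: srr_ge0].
  rewrite mulrCA; apply: ler_wpM2l; first exact: sqr_ge0.
  apply: le_trans (srr_le p r0) _; rewrite ler_pM2l// /fr; have := qi_ge0 r p; lra.
- exact: L1Z.
Qed.

Lemma fr_le_qi r p : fr r p <= qi (2 * r) p.
Proof. by rewrite /fr; have := qi_ge0 r p; lra. Qed.


Lemma Int_fr_add r F G : 0 < r -> L2l F -> L2l G ->
  I (fun p => (F p + G p) ^+ 2 * fr r p) <= 2 * I (fun p => F p ^+ 2 * fr r p) + 2 * NQ (2 * r) G.
Proof.
move=> r0 hF hG; have lF := L_fr r hF; have [mG lG] := hG; rewrite /NQ -!IntZ// -IntD; [|exact: L1Z|exact: L1Z].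
apply: Int_le; [by apply: L_fr; exact: L2l_add|by apply: L1D; exact: L1Z|].
move=> p; have h := sq_split (F p) 0 (- G p); rewrite opprK subr0 add0r in h.
have f0 := fr_ge0 p r0; have f1 := fr_le_qi r p.
have g := ler_wpM2l (sqr_ge0 (G p)) f1; have h2 := ler_wpM2r f0 h; lra.
Qed.

Lemma WS_poincare : exists2 A : R, 4 <= A & forall U Ux Uy r (e : R), WS U Ux Uy -> 0 < r -> 0 < e ->
  exists m : R, I (fun p => (U p - m) ^+ 2 * srr r p) <=
    A * r ^+ 2 * (I (fun p => Ux p ^+ 2 * fr r p) + I (fun p => Uy p ^+ 2 * fr r p) + e).
Proof.
(* 1072 = 4 * 268: one factor 2 for approximating the function, one for its gradient. *)
exists 1072; first by rewrite ler_nat.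
move=> U Ux Uy r e [cU lx ly H] r0 e0.
pose t := Num.min 1 (e / 8); have t0 : 0 < t by rewrite lt_min ltr01; lra.
have t1 : t <= 1 by rewrite ge_min lexx.
have te : t <= e / 8 by rewrite ge_min lexx orbT.
have [w [wx [wy [hw w1 w2 w3]]]] := H (2 * r) _ t0.
have e2 : 0 < e / 2 by lra.
have [m hm] := frame_poincare hw r0 e2; exists m.
have [cw cwx cwy _ _] := hw.
have gx : I (fun p => wx p ^+ 2 * fr r p) <= 2 * I (fun p => Ux p ^+ 2 * fr r p) + 2 * t.
  have := Int_fr_add r0 lx (L2l_sub (L2l_ct cwx) lx).
  rewrite (@Int_ext _ _ _ (@PM R) _ (fun p => wx p ^+ 2 * fr r p)) => [|p]; last by rewrite addrC subrK.
  by move: w2; clear; lra.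
have gy : I (fun p => wy p ^+ 2 * fr r p) <= 2 * I (fun p => Uy p ^+ 2 * fr r p) + 2 * t.
  have := Int_fr_add r0 ly (L2l_sub (L2l_ct cwy) ly).
  rewrite (@Int_ext _ _ _ (@PM R) _ (fun p => wy p ^+ 2 * fr r p)) => [|p]; last by rewrite addrC subrK.
  by move: w3; clear; lra.
have cm (F : C -> R) : ct F -> ct (fun p => F p - m) by move=> cF; apply: ctB => //; exact: ct_cst.
have st : I (fun p => (U p - m) ^+ 2 * srr r p) <= 2 * I (fun p => (w p - m) ^+ 2 * srr r p) + 2 * t * (16 * r ^+ 2).
  have ls : L (srr r) by apply: (L1_ext _ (L_srr r (ct_cst 1))) => p; rewrite mul1r.
  have lw := L_srr r (ctX 2 (cm _ cw)).
  rewrite -(Int_srr r0) -!IntZ// -IntD; [|exact: L1Z|exact: L1Z].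
  apply: Int_le; [exact: L_srr (ctX 2 (cm _ cU))|by apply: L1D; exact: L1Z|].
  move=> p; have s0 := srr_ge0 r p.
  have [h|h] := leP (nm p) (2 * r); last by rewrite (srr_bs r0 h) !mulr0 addr0.
  have h2 : (U p - w p) ^+ 2 <= t.
    have := w1 p h; rewrite distrC -real_normK ?num_real// => h2.
    apply: (@le_trans _ _ (t * t)); first by rewrite expr2; apply: ler_pM.
    by rewrite ler_piMr// ltW.
  have h3 := sq_split (U p) (w p) m.
  have := ler_wpM2r s0 (le_trans h3 (lerD (ler_wpM2l (ler0n _ 2) h2) (lexx _))); (clear; lra).
apply: (le_trans st); move: hm gx gy te; clear - r0 e0.
have r2 : 0 <= r ^+ 2 := sqr_ge0 r.
set X := I _; set Y := I (fun p => wy p ^+ 2 * _); set X' := I _; set Y' := I _; set W := I _ => hm gx gy te.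
have h1 : 268 * r ^+ 2 * (X' + Y + e / 2) <= r ^+ 2 * (268 * (2 * Y' + 2 * t + 2 * W + 2 * t + e / 2)).
  by rewrite -mulrA mulrCA; apply: ler_wpM2l => //; lra.
have h2 := ler_wpM2l r2 te; have h3 : 0 <= r ^+ 2 * e by apply: mulr_ge0 => //; exact: ltW.
move: hm h1 h2 h3; clear; move: (r ^+ 2) => k; lra.
Qed.

Lemma form_pt (m x y B r k l s : R) : 0 < r -> 0 <= B -> `|k| <= B / r -> `|l| <= B / r -> 1 <= s ->
  `|k * (m * y) - l * (m * x)| <= B * (r ^- 2 * (m ^+ 2 * s)) + B / 2 * (x ^+ 2 * s + y ^+ 2 * s).
Proof.
move=> r0 B0 hk hl s1.
have am (z h : R) : `|h| <= B / r -> `|h * (m * z)| <= B / 2 * (r ^- 2 * m ^+ 2 + z ^+ 2).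
  move=> hh; rewrite !normrM; apply: (@le_trans _ _ (B / r * (`|m| * `|z|))).
    by apply: ler_wpM2r => //; apply: mulr_ge0.
  have -> : B / r * (`|m| * `|z|) = B * ((r^-1 * `|m|) * `|z|) by ring.
  have -> : B / 2 * (r ^- 2 * m ^+ 2 + z ^+ 2) = B * (((r^-1 * `|m|) ^+ 2 + `|z| ^+ 2) / 2).
    by rewrite exprMn !real_normK ?num_real// exprVn; ring.
  apply: ler_wpM2l => //; move: (r^-1 * `|m|) `|z| => a b.
  by have := sqr_ge0 (a - b); rewrite sqrrB; clear; lra.
have h1 := am y _ hk; have h2 := am x _ hl.
have h3 : 0 <= B * (r ^- 2 * m ^+ 2) by apply: mulr_ge0 => //; apply: mulr_ge0; rewrite ?invr_ge0 sqr_ge0.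
have h4 : 0 <= B * (x ^+ 2 + y ^+ 2) by apply: mulr_ge0 => //; apply: addr_ge0; exact: sqr_ge0.
apply: le_trans (ler_normB _ _) _; apply: le_trans (lerD h1 h2) _.
have -> : B * (r ^- 2 * (m ^+ 2 * s)) + B / 2 * (x ^+ 2 * s + y ^+ 2 * s) = (B * (r ^- 2 * m ^+ 2) + B * (x ^+ 2 + y ^+ 2) / 2) * s by field; rewrite gt_eqF.
apply: (@le_trans _ _ (B * (r ^- 2 * m ^+ 2) + B * (x ^+ 2 + y ^+ 2) / 2)); last by rewrite ler_peMr// addr_ge0// divr_ge0.
by rewrite le_eqVlt; apply/orP; left; apply/eqP; field; rewrite gt_eqF.
Qed.

Lemma form_num A r B (e W X1 Y1 A1 A2 D1 D2 : R) : 4 <= A -> 0 < r -> 0 <= B -> 0 < e ->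
  W <= A * r ^+ 2 * (X1 + Y1 + e / (A * B + 1)) -> A1 <= 4 * A2 -> D1 <= 4 * D2 -> 0 <= A2 -> 0 <= D2 ->
  B * (r ^- 2 * W) + B / 2 * (A1 + D1) <= A * B * (X1 + Y1 + A2 + D2) + e.
Proof.
move=> A4 r0 B0 e0 hm hx hy vx0 vy0.
have A0 : 0 <= A by apply: le_trans A4.
have r2 : 0 < r ^+ 2 by rewrite exprn_gt0.
have h1 : r ^- 2 * W <= A * (X1 + Y1 + e / (A * B + 1)) by rewrite mulrC ler_pdivrMr// mulrAC.
have h2 : A * B * (e / (A * B + 1)) <= e by rewrite mulrC ltW// frac_lt// mulr_ge0.
have h3 := ler_wpM2l B0 h1.
have h4 : B / 2 * (A1 + D1) <= B / 2 * (4 * A2 + 4 * D2) by apply: ler_wpM2l; [rewrite divr_ge0|exact: lerD].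
have h5 : 0 <= B * A2 by exact: mulr_ge0.
have h6 : 0 <= B * D2 by exact: mulr_ge0.
have h7 := ler_wpM2r h5 A4; have h8 := ler_wpM2r h6 A4.
clear -h8 h7 h6 h5 h4 h3 h2; lra.
Qed.

(* A 1-form [dX] supported in a frame pairs [U] and [V] through [dX /\ dV], which
   only sees [U] modulo constants. *)
Lemma frame_form : exists2 A : R, 0 < A & forall U Ux Uy V Vx Vy X Xx Xy r B, WS U Ux Uy -> WS V Vx Vy -> 0 < r -> 0 <= B ->
  C1 X Xx Xy -> bs (2 * r) X -> (forall p, `|Xx p| <= B / r) -> (forall p, `|Xy p| <= B / r) ->
  (forall p, nm p <= r \/ 2 * r <= nm p -> Xx p = 0 /\ Xy p = 0) ->
  `|I (fun p => Xx p * (U p * Vy p)) - I (fun p => Xy p * (U p * Vx p))| <=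
  A * B * (I (fun p => Ux p ^+ 2 * fr r p) + I (fun p => Uy p ^+ 2 * fr r p) +
              I (fun p => Vx p ^+ 2 * fr r p) + I (fun p => Vy p ^+ 2 * fr r p)).
Proof.
have [A A4 HA] := WS_poincare; have A0 : 0 < A by apply: lt_le_trans A4.
exists A => // U Ux Uy V Vx Vy X Xx Xy r B hU hV r0 B0 hX bX bx by_ z.
have B1 : 0 < A * B + 1 by apply: ltr_wpDl; [apply: mulr_ge0; [exact: ltW|exact: B0]|exact: ltr01].
have [cU lUx lUy _] := hU; have [_ lVx lVy _] := hV.
have [cX cXx cXy _ _] := hX; have [bXx bXy] := bs_der hX bX.
apply/ler_addgt0Pr => e e0.
have e1 : 0 < e / (A * B + 1) := divr_gt0 e0 B1.
have [m hm] := HA _ _ _ _ _ hU r0 e1.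
have inv : I (fun p => Xx p * (m * Vy p)) - I (fun p => Xy p * (m * Vx p)) = 0.
  have := NL (WS_cst m) hV hX bX.
  have zz (k : C -> R) : I (fun p => X p * (0 * k p)) = 0.
    by rewrite -[RHS](@Int0 _ _ _ (@PM R)); apply: Int_ext => p; rewrite mul0r mulr0.
  by rewrite !zz subr0 => h; apply/eqP; rewrite -oppr_eq0 -h.
have lm (k h : C -> R) (cx : C -> R) : L2l k -> L2l h -> ct cx -> bs (2 * r) cx -> L (fun p => cx p * (k p * h p)).
  by move=> lk lh cc bc; have [K _ hK] := bs_bounded cc bc; exact: (L_mul lk lh (meas_ct cc) bc hK).
have lU := L2l_ct cU; have lc := L2l_ct (ct_cst m).
rewrite -[X in `|X|]subr0 -inv opprB addrA.
have -> : I (fun p => Xx p * (U p * Vy p)) - I (fun p => Xy p * (U p * Vx p)) + I (fun p => Xy p * (m * Vx p)) -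
   I (fun p => Xx p * (m * Vy p)) = I (fun p => Xx p * ((U p - m) * Vy p) - Xy p * ((U p - m) * Vx p)).
  have lUm := L2l_sub lU lc.
  rewrite [RHS]IntB; [|exact: lm|exact: lm].
  have E1 : I (fun p => Xx p * ((U p - m) * Vy p)) = I (fun p => Xx p * (U p * Vy p)) - I (fun p => Xx p * (m * Vy p)).
    by rewrite -IntB; [apply: Int_ext => p; ring|exact: lm|exact: (lm (fun=> m))].
  have E2 : I (fun p => Xy p * ((U p - m) * Vx p)) = I (fun p => Xy p * (U p * Vx p)) - I (fun p => Xy p * (m * Vx p)).
    by rewrite -IntB; [apply: Int_ext => p; ring|exact: lm|exact: (lm (fun=> m))].
  by rewrite E1 E2; ring.
have lUm := L2l_sub lU lc.
have lS := L_sq_srr r0 lUm; have lsx := L_sq_srr r0 lVx; have lsy := L_sq_srr r0 lVy.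
apply: (@le_trans _ _ (I (fun p => B * (r ^- 2 * ((U p - m) ^+ 2 * srr r p)) + B / 2 * (Vx p ^+ 2 * srr r p + Vy p ^+ 2 * srr r p)))).
  apply: Int_abs_le.
  - by apply: L1B; exact: lm.
  - by apply: L1D; apply: L1Z; [apply: L1Z|apply: L1D].
  move=> p; have s0 := srr_ge0 r p.
  have rh0 : 0 <= B * (r ^- 2 * ((U p - m) ^+ 2 * srr r p)) + B / 2 * (Vx p ^+ 2 * srr r p + Vy p ^+ 2 * srr r p).
    have a1 : 0 <= (U p - m) ^+ 2 * srr r p by apply: mulr_ge0 => //; exact: sqr_ge0.
    have a2 : 0 <= Vx p ^+ 2 * srr r p by apply: mulr_ge0 => //; exact: sqr_ge0.
    have a3 : 0 <= Vy p ^+ 2 * srr r p by apply: mulr_ge0 => //; exact: sqr_ge0.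
    apply: addr_ge0; first by apply: mulr_ge0 => //; apply: mulr_ge0 => //; rewrite invr_ge0 sqr_ge0.
    by apply: mulr_ge0; [rewrite divr_ge0|exact: addr_ge0].
  have [h|h] := leP (nm p) r; first by have [-> ->] := z p (or_introl h); rewrite !mul0r subrr normr0.
  have [h'|h'] := leP (2 * r) (nm p); first by have [-> ->] := z p (or_intror h'); rewrite !mul0r subrr normr0.
  by apply: form_pt => //; apply: srr_ge1 => //; rewrite h h'.
rewrite IntD; [|by apply: L1Z; exact: L1Z|by apply: L1Z; exact: L1D].
rewrite !IntZ//; [|exact: L1D|exact: L1Z].
rewrite IntD//.
have sf (k : C -> R) : L2l k -> I (fun p => k p ^+ 2 * srr r p) <= 4 * I (fun p => k p ^+ 2 * fr r p).
  move=> lk; rewrite -IntZ; last exact: L_fr.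
  apply: Int_le; [exact: L_sq_srr|by apply: L1Z; exact: L_fr|].
  by move=> p; rewrite mulrCA; apply: ler_wpM2l; [exact: sqr_ge0|exact: srr_le].
have hx := sf _ lVx; have hy := sf _ lVy.
have vx0 : 0 <= I (fun p => Vx p ^+ 2 * fr r p) by apply: Int_ge0 => p; apply: mulr_ge0; [exact: sqr_ge0|exact: fr_ge0].
have vy0 : 0 <= I (fun p => Vy p ^+ 2 * fr r p) by apply: Int_ge0 => p; apply: mulr_ge0; [exact: sqr_ge0|exact: fr_ge0].
exact: (form_num A4 r0 B0 e0 hm hx hy vx0 vy0).
Qed.

(** Squared Hilbert-Schmidt norm of the differential of [(U, V)], of which [en] is the integral
    between two squares. *)
Definition gsq (Ux Uy Vx Vy : C -> R) p := Ux p ^+ 2 + Uy p ^+ 2 + Vx p ^+ 2 + Vy p ^+ 2.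
Definition en (Ux Uy Vx Vy : C -> R) (a b : R) := I (fun p => gsq Ux Uy Vx Vy p * (qi b p - qi a p)).

Lemma gsq_ge0 Ux Uy Vx Vy p : 0 <= gsq Ux Uy Vx Vy p.
Proof. by rewrite /gsq; do 3?apply: addr_ge0; exact: sqr_ge0. Qed.

Lemma qi_mono a b p : a <= b -> qi a p <= qi b p.
Proof.
move=> ab; have [h|h] := leP (nm p) a; last by rewrite (qi0 h) qi_ge0.
by rewrite !qi1//; exact: le_trans ab.
Qed.

Lemma L_gsq Ux Uy Vx Vy a b : L2l Ux -> L2l Uy -> L2l Vx -> L2l Vy ->
  L (fun p => gsq Ux Uy Vx Vy p * (qi b p - qi a p)).
Proof.
move=> [_ h1] [_ h2] [_ h3] [_ h4].
have l r : L (fun p => Ux p ^+ 2 * qi r p + Uy p ^+ 2 * qi r p + Vx p ^+ 2 * qi r p + Vy p ^+ 2 * qi r p).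
  by apply: L1D => //; apply: L1D => //; exact: L1D.
by apply: (L1_ext _ (L1B (l b) (l a))) => p; rewrite /gsq; ring.
Qed.

Lemma en_ge0 Ux Uy Vx Vy a b : a <= b -> 0 <= en Ux Uy Vx Vy a b.
Proof.
move=> ab; apply: Int_ge0 => p; apply: mulr_ge0; first exact: gsq_ge0.
by rewrite subr_ge0; exact: qi_mono.
Qed.

Lemma en_fr Ux Uy Vx Vy r : L2l Ux -> L2l Uy -> L2l Vx -> L2l Vy ->
  I (fun p => Ux p ^+ 2 * fr r p) + I (fun p => Uy p ^+ 2 * fr r p) +
  I (fun p => Vx p ^+ 2 * fr r p) + I (fun p => Vy p ^+ 2 * fr r p) = en Ux Uy Vx Vy r (2 * r).
Proof.
move=> h1 h2 h3 h4; have l := L_fr r.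
rewrite -!IntD; do ?[exact: l|apply: L1D].
by apply: Int_ext => p; rewrite /gsq /fr; ring.
Qed.

Lemma en_split Ux Uy Vx Vy (a b d : R) : L2l Ux -> L2l Uy -> L2l Vx -> L2l Vy ->
  en Ux Uy Vx Vy a d = en Ux Uy Vx Vy a b + en Ux Uy Vx Vy b d.
Proof.
move=> h1 h2 h3 h4; rewrite /en -IntD; [|exact: L_gsq|exact: L_gsq].
by apply: Int_ext => p; ring.
Qed.

Lemma young8 (a b w : R) : b ^+ 2 <= 2 * w -> `|2 * (a * b)| <= 8^-1 * a ^+ 2 + 16 * w.
Proof.
move=> h; have sa := sqr_ge0 (a - 8 * b); have sb := sqr_ge0 (a + 8 * b).
by rewrite ler_norml; move: h sa sb; rewrite !expr2 => *; apply/andP; split; lra.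
Qed.

Section Pair.
Variables (u ux uy v vx vy : C -> R) (r : R).
Hypotheses (hu : WS u ux uy) (hv : WS v vx vy) (r0 : 0 < r).
Hypothesis hJ : {ae @PM R, forall p, r < nm p -> gsq ux uy vx vy p <= 4 * (ux p * vy p - uy p * vx p)}.
Let G := gsq ux uy vx vy.

Lemma L_ctbs (k f g : C -> R) b : ct k -> bs b k -> L2l f -> L2l g -> L (fun p => k p * (f p * g p)).
Proof. by move=> ck bk lf lg; have [K _ hK] := bs_bounded ck bk; exact: (L_mul lf lg (meas_ct ck) bk hK). Qed.

Lemma L_gsq_ct (k : C -> R) b : ct k -> bs b k -> L (fun p => G p * k p).
Proof.
move=> ck bk; have [_ lux luy _] := hu; have [_ lvx lvy _] := hv.
have l f := L_ctbs ck bk (f := f) (g := f).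
apply: (L1_ext _ (L1D (L1D (L1D (l _ lux lux) (l _ luy luy)) (l _ lvx lvx)) (l _ lvy lvy))) => p.
by rewrite /G /gsq; ring.
Qed.

(** Bounded distortion replaces the energy density by the Jacobian, whose integral against [phi] is
    by [NL] a term that lives where the differential of [phi] does. *)
Lemma en_form phi px py b M : 2 * r <= M -> C1 phi px py -> bs b phi -> (forall p, 0 <= phi p) ->
  (forall p, nm p <= r -> phi p = 0) -> (forall p, 2 * r <= nm p -> nm p <= M -> phi p = 1) ->
  en ux uy vx vy (2 * r) M <= I (fun p => G p * phi p) /\
  I (fun p => G p * phi p) <= 4 * `|I (fun p => px p * (u p * vy p)) - I (fun p => py p * (u p * vx p))|.
Proof.
move=> rM hp bp p0 pr p1; have [_ lux luy _] := hu; have [_ lvx lvy _] := hv.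
have [cp _ _ _ _] := hp; have lG := L_gsq_ct cp bp.
split.
  apply: Int_le => //; first exact: L_gsq.
  move=> p; apply: ler_wpM2l; first exact: gsq_ge0.
  have [h|h] := leP (nm p) (2 * r); first by rewrite !qi1 ?subrr//; exact: le_trans rM.
  rewrite (qi0 h) subr0; have [h'|h'] := leP (nm p) M; last by rewrite qi0.
  by rewrite qi1// p1// ltW.
have l1 := L_ctbs cp bp lux lvy; have l2 := L_ctbs cp bp luy lvx.
have -> : I (fun p => px p * (u p * vy p)) - I (fun p => py p * (u p * vx p)) =
   - (I (fun p => phi p * (ux p * vy p)) - I (fun p => phi p * (uy p * vx p))) by rewrite (NL hu hv hp bp) opprK.
rewrite normrN -IntB//; apply: (@le_trans _ _ (I (fun p => 4 * (phi p * (ux p * vy p) - phi p * (uy p * vx p))))).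
  apply: Int_le_ae => //; first by apply: L1Z; exact: L1B.
  apply: (ae_imp hJ) => p h; have [hr|hr] := leP (nm p) r; first by rewrite pr// !mul0r subrr !mulr0.
  by have := ler_wpM2r (p0 p) (h hr); rewrite -/G; lra.
by rewrite IntZ; [rewrite ler_pM2l// ler_norm|exact: L1B].
Qed.


Section Cuts.
Variables (B M : R) (X Xx Xy Y Yx Yy : C -> R).
Hypotheses (B0 : 0 < B) (M0 : 2 * r <= M).
Hypotheses (hX : C1 X Xx Xy) (bX : bs (2 * r) X) (X01 : forall p, 0 <= X p <= 1) (X1 : forall p, nm p <= r -> X p = 1)
  (bXx : forall p, `|Xx p| <= B / r) (bXy : forall p, `|Xy p| <= B / r)
  (Xz : forall p, nm p <= r \/ 2 * r <= nm p -> Xx p = 0 /\ Xy p = 0).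
Hypotheses (hY : C1 Y Yx Yy) (bY : bs (2 * M) Y) (Y01 : forall p, 0 <= Y p <= 1) (Y1 : forall p, nm p <= M -> Y p = 1)
  (bYx : forall p, `|Yx p| <= B / M) (bYy : forall p, `|Yy p| <= B / M)
  (Yz : forall p, nm p <= M \/ 2 * M <= nm p -> Yx p = 0 /\ Yy p = 0).
Let psi p := Y p - X p.
Let psix p := Yx p - Xx p.
Let psiy p := Yy p - Xy p.

Lemma psi_C1 : C1 psi psix psiy. Proof. exact: C1_sub. Qed.
Lemma M_gt0 : 0 < M. Proof. by move: r0 M0; lra. Qed.

Lemma psi_bs : bs (2 * M) psi.
Proof. by move=> p hp; rewrite /psi bY// bX ?subrr//; move: M0 r0 hp; lra. Qed.

Lemma psi01 p : 0 <= psi p <= 1.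
Proof.
have /andP[a b] := X01 p; have /andP[c' d] := Y01 p; rewrite /psi.
have [h|h] := leP (nm p) (2 * r); last by rewrite bX// subr0 c' d.
by rewrite Y1 ?(le_trans h)//; move: a b; move=> a b; apply/andP; split; lra.
Qed.

Lemma psi0 p : nm p <= r -> psi p = 0.
Proof. by move=> h; rewrite /psi X1// Y1 ?subrr//; move: h M0 r0; lra. Qed.

Lemma psi1 p : 2 * r <= nm p -> nm p <= M -> psi p = 1.
Proof.
move=> h1 h2; rewrite /psi Y1//; suff -> : X p = 0 by rewrite subr0.
have [h|h] := ltP (2 * r) (nm p); first exact: bX.
have cX : ct X by case: hX.
(* Support in the square of half-side [2 * r] gives zeros strictly outside only; on its boundary,
   continuity along the ray through [p] concludes. *)
apply/eqP/negP => /negP X0; have e0 : 0 < `|X p| by rewrite normr_gt0.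
have [d d0 hd] := cX p _ e0.
have pn : 0 < nm p by move: h1 r0; lra.
pose k := 1 + d / (2 * nm p); have k1 : 1 < k by rewrite ltrDl divr_gt0// mulr_gt0.
pose q : C := (k * p.1, k * p.2).
have nq : nm q = k * nm p.
  by rewrite /nm /q /= !normrM (gtr0_norm (lt_trans ltr01 k1)) -maxr_pMr// ltW// (lt_trans ltr01).
have : `|X q - X p| < `|X p|.
  apply: hd; have -> : pm q p = ((k - 1) * p.1, (k - 1) * p.2) by rewrite /pm /q /=; congr (_, _); ring.
  have k10 : 0 < k - 1 by rewrite subr_gt0.
  rewrite /nm /= !normrM (gtr0_norm k10) -maxr_pMr; last exact: ltW.
  rewrite -/(nm p) /k addrC addKr -[X in _ < X]divr1 invfM mulrA mulfVK ?gt_eqF//.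
  by rewrite ltr_pM2l// ltf_pV2 ?posrE// ltr1n.
rewrite (bX (p := q)); first by rewrite sub0r normrN ltxx.
by rewrite nq; apply: (le_lt_trans h1); rewrite ltr_pMl.
Qed.

(** The cut-off is squared so that its differential keeps a factor [psi], which Young's inequality
    absorbs into half of the energy. The rest is scale invariant, a squared gradient of order
    [r ^- 2] over an area of order [r ^+ 2]. *)
Lemma caccioppoli_cut (s1 s2 : R) : 0 <= s1 -> 0 <= s2 ->
  (forall p, r <= nm p -> nm p <= 2 * r -> `|u p| <= s1) ->
  (forall p, M <= nm p -> nm p <= 2 * M -> `|u p| <= s2) ->
  en ux uy vx vy (2 * r) M <= (64 * B) ^+ 2 * (s1 ^+ 2 + s2 ^+ 2).
Proof.
move=> s10 s20 hs1 hs2; have [cu lux luy _] := hu; have [_ lvx lvy _] := hv.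
have hpsi := psi_C1; have hphi := C1_mul hpsi hpsi; have bpsi := psi_bs.
have bphi : bs (2 * M) (fun p => psi p * psi p) by move=> p hp; rewrite bpsi// mul0r.
have phi0 p : 0 <= psi p * psi p by rewrite -expr2 sqr_ge0.
have [E1 E2] := en_form M0 hphi bphi phi0 (fun p h => etrans (congr2 *%R (psi0 h) (psi0 h)) (mul0r _))
  (fun p h h' => etrans (congr2 *%R (psi1 h h') (psi1 h h')) (mul1r _)).
apply: (le_trans E1); set W := I _ in E1 E2 *.
have [cpsi cpx cpy _ _] := hpsi; have [bpx bpy] := bs_der hpsi bpsi.
have cphi : ct (fun p => psi p * psi p) by exact: ctM.
have lw := L_gsq_ct cphi bphi.
have lq M' := @L_qi R M'.
pose D p := s1 ^+ 2 * (B / r) ^+ 2 * qi (2 * r) p + s2 ^+ 2 * (B / M) ^+ 2 * qi (2 * M) p.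
have M00 := M_gt0.
have sqle (x y : R) : `|x| <= y -> x ^+ 2 <= y ^+ 2.
  by move=> h; rewrite -[x ^+ 2]real_normK ?num_real// !expr2; apply: ler_pM.
have part (k : C -> R) (a : R) (s : R) : 0 < a -> (forall p, `|k p| <= B / a) -> (forall p, nm p <= a \/ 2 * a <= nm p -> k p = 0) ->
   (forall p, a <= nm p -> nm p <= 2 * a -> `|u p| <= s) -> forall p, u p ^+ 2 * k p ^+ 2 <= s ^+ 2 * (B / a) ^+ 2 * qi (2 * a) p.
  move=> a0 bk zk hs p; have [h|h] := leP (nm p) a.
    by rewrite zk; [rewrite expr0n mulr0; apply: mulr_ge0; [apply: mulr_ge0; exact: sqr_ge0|exact: qi_ge0]|left].
  have [h'|h'] := leP (2 * a) (nm p).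
    by rewrite zk; [rewrite expr0n mulr0; apply: mulr_ge0; [apply: mulr_ge0; exact: sqr_ge0|exact: qi_ge0]|right].
  rewrite qi1 ?mulr1; last exact: ltW.
  by apply: ler_pM; [exact: sqr_ge0|exact: sqr_ge0|apply: sqle; apply: hs; exact: ltW|exact: sqle].
have bd (kX kY : C -> R) : (forall p, u p ^+ 2 * kX p ^+ 2 <= s1 ^+ 2 * (B / r) ^+ 2 * qi (2 * r) p) ->
  (forall p, u p ^+ 2 * kY p ^+ 2 <= s2 ^+ 2 * (B / M) ^+ 2 * qi (2 * M) p) -> forall p, u p ^+ 2 * (kY p - kX p) ^+ 2 <= 2 * D p.
  move=> h1 h2 p; have := h1 p; have := h2 p; rewrite /D; move: (_ * _ * qi _ p) (_ * _ * qi _ p) => z1 z2 g2 g1.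
  have h := sq_split (kY p) 0 (kX p); rewrite subr0 sub0r sqrrN in h.
  have := ler_wpM2l (sqr_ge0 (u p)) h; move: g1 g2; (clear -Yz bYy bYx Y1 Y01 bY hY Xz bXy bXx X1 X01 bX hX M0 B0 hJ r0 hv hu; lra).
have bx := bd _ _ (part _ _ _ r0 bXx (fun p h => (Xz h).1) hs1) (part _ _ _ M00 bYx (fun p h => (Yz h).1) hs2).
have by_ := bd _ _ (part _ _ _ r0 bXy (fun p h => (Xz h).2) hs1) (part _ _ _ M00 bYy (fun p h => (Yz h).2) hs2).
have lD : L D by apply: L1D; apply: L1Z.
have ID : I D = 16 * B ^+ 2 * (s1 ^+ 2 + s2 ^+ 2).
  rewrite IntD; [|exact: L1Z|exact: L1Z]; rewrite !IntZ// !Int_qi; [|by rewrite mulr_ge0// ltW|by rewrite mulr_ge0// ltW].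
  by field; rewrite !gt_eqF.
(* After absorption the energy is at most [256 * I D], and [I D] carries [16 * B ^+ 2]; 256 * 16 =
   64 ^ 2. *)
have half : 4 * `|I (fun p => (psix p * psi p + psi p * psix p) * (u p * vy p)) - I (fun p => (psiy p * psi p + psi p * psiy p) * (u p * vx p))| <=
   W / 2 + 128 * I D.
  have cA : ct (fun p => psix p * psi p + psi p * psix p) by apply: ctD; exact: ctM.
  have cB : ct (fun p => psiy p * psi p + psi p * psiy p) by apply: ctD; exact: ctM.
  have bA : bs (2 * M) (fun p => psix p * psi p + psi p * psix p) by move=> p hp; rewrite bpsi// mulr0 mul0r addr0.
  have bB : bs (2 * M) (fun p => psiy p * psi p + psi p * psiy p) by move=> p hp; rewrite bpsi// mulr0 mul0r addr0.
  have lA := L_ctbs cA bA (L2l_ct cu) lvy; have lB := L_ctbs cB bB (L2l_ct cu) lvx.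
  rewrite -IntB//.
  have -> : W / 2 + 128 * I D = 4 * I (fun p => 8^-1 * (G p * (psi p * psi p)) + 32 * D p).
    rewrite (IntD (L1Z 8^-1 lw) (L1Z 32 lD)) (IntZ 8^-1 lw) (IntZ 32 lD) -/W; by field.
  rewrite ler_pM2l//; apply: Int_abs_le; [exact: L1B|by apply: L1D; exact: L1Z|].
  move=> p; have := bx p; have := by_ p; rewrite -/(psix p) -/(psiy p).
  have /andP[p0 p1] := psi01 p; rewrite /G /gsq; move: (psi p) p0 p1 => k k0 k1 hy hx.
  have am (x y z : R) : z ^+ 2 * x ^+ 2 <= 2 * D p -> `|(x * k + k * x) * (z * y)| <= 8^-1 * (y ^+ 2 * (k * k)) + 16 * D p.
    move=> h; have -> : (x * k + k * x) * (z * y) = 2 * ((k * y) * (z * x)) by ring.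
    have h2 : (z * x) ^+ 2 <= 2 * D p by rewrite exprMn.
    have -> : y ^+ 2 * (k * k) = (k * y) ^+ 2 by ring.
    move: (k * y) (z * x) h2 => a b h2; move: (D p) h2 => w h2.
    exact: young8.
  have h1 := am _ (vy p) _ hx; have h2 := am _ (vx p) _ hy.
  apply: le_trans (ler_normB _ _) _; apply: (le_trans (lerD h1 h2)).
  have q1 : 0 <= ux p ^+ 2 * (k * k) by apply: mulr_ge0; rewrite -?expr2; exact: sqr_ge0.
  have q2 : 0 <= uy p ^+ 2 * (k * k) by apply: mulr_ge0; rewrite -?expr2; exact: sqr_ge0.
  rewrite -subr_ge0 (_ : _ - _ = 8^-1 * (ux p ^+ 2 * (k * k)) + 8^-1 * (uy p ^+ 2 * (k * k))); last by ring.
  by apply: addr_ge0; apply: mulr_ge0.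
have := le_trans E2 half; rewrite ID; move: half E1 E2 => _ _ _; clearbody W; (clear -Yz bYy bYx Y1 Y01 bY hY Xz bXy bXx X1 X01 bX hX M0 B0 hJ r0 hv hu; lra).
Qed.

Variables (A : R) (A0 : 0 < A).
Hypothesis HA : forall U Ux Uy V Vx Vy X Xx Xy r B, WS U Ux Uy -> WS V Vx Vy -> 0 < r -> 0 <= B ->
  C1 X Xx Xy -> bs (2 * r) X -> (forall p, `|Xx p| <= B / r) -> (forall p, `|Xy p| <= B / r) ->
  (forall p, nm p <= r \/ 2 * r <= nm p -> Xx p = 0 /\ Xy p = 0) ->
  `|I (fun p => Xx p * (U p * Vy p)) - I (fun p => Xy p * (U p * Vx p))| <=
  A * B * (I (fun p => Ux p ^+ 2 * fr r p) + I (fun p => Uy p ^+ 2 * fr r p) +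
              I (fun p => Vx p ^+ 2 * fr r p) + I (fun p => Vy p ^+ 2 * fr r p)).

(** At the inner end the term is now bounded by the energy of the frame itself, through
    [frame_form], and not by the supremum of [u]; only the outer end uses the supremum [s2], which
    is later sent to 0. *)
Lemma hole_cut (s2 : R) : 0 <= s2 -> (forall p, M <= nm p -> nm p <= 2 * M -> `|u p| <= s2) ->
  en ux uy vx vy (2 * r) M <= 4 * (A * (2 * B)) * en ux uy vx vy r (2 * r) + 4 * B * s2 * (32 + en ux uy vx vy M (2 * M)).
Proof.
move=> s20 hs2; have [cu lux luy _] := hu; have [_ lvx lvy _] := hv.
have hpsi := psi_C1; have hphi := C1_mul hpsi hpsi; have bpsi := psi_bs.
have bphi : bs (2 * M) (fun p => psi p * psi p) by move=> p hp; rewrite bpsi// mul0r.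
have phi0 p : 0 <= psi p * psi p by rewrite -expr2 sqr_ge0.
have [E1 E2] := en_form M0 hphi bphi phi0 (fun p h => etrans (congr2 *%R (psi0 h) (psi0 h)) (mul0r _))
  (fun p h h' => etrans (congr2 *%R (psi1 h h') (psi1 h h')) (mul1r _)).
apply: (le_trans E1); apply: (le_trans E2).
have M00 := M_gt0.
(* Since [Y] is 1 on the support of [X], the square of [Y - X] is [Y ^+ 2 - Z], which separates the
   two ends. The gradient of [Z] is [2 * (1 - X)] times that of [X]. *)
pose Z p := 2 * X p - X p * X p.
have hZ : C1 Z (fun p => 2 * Xx p - (Xx p * X p + X p * Xx p)) (fun p => 2 * Xy p - (Xy p * X p + X p * Xy p)).
  by apply: C1_sub; [exact: C1_scale|exact: C1_mul].
have bZ : bs (2 * r) Z by move=> p hp; rewrite /Z bX// !mulr0 subr0.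
have zb (k : C -> R) : (forall p, `|k p| <= B / r) -> forall p, `|2 * k p - (k p * X p + X p * k p)| <= 2 * B / r.
  move=> hk p; have -> : 2 * k p - (k p * X p + X p * k p) = 2 * ((1 - X p) * k p) by ring.
  rewrite normrM ger0_norm// -mulrA ler_pM2l//; apply: le_trans (hk p); rewrite normrM ler_piMl//.
  by have /andP[a b] := X01 p; rewrite ger0_norm ?subr_ge0// lerBlDr lerDl.
have zz p : nm p <= r \/ 2 * r <= nm p -> 2 * Xx p - (Xx p * X p + X p * Xx p) = 0 /\ 2 * Xy p - (Xy p * X p + X p * Xy p) = 0.
  by move=> /Xz[-> ->]; rewrite !(mulr0, mul0r, addr0, subr0).
have B20 : 0 <= 2 * B by rewrite mulr_ge0// ltW.
have T2 := HA hu hv r0 B20 hZ bZ (zb _ bXx) (zb _ bXy) zz.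
rewrite en_fr// in T2.
have [cX cXx cXy _ _] := hX; have [cY cYx cYy _ _] := hY.
have [bYx' bYy'] := bs_der hY bY.
have lu := L2l_ct cu.
have idn (kX kY : C -> R) : (forall p, nm p <= r \/ 2 * r <= nm p -> kX p = 0) -> (forall p, nm p <= M \/ 2 * M <= nm p -> kY p = 0) ->
   forall p, (kY p - kX p) * psi p + psi p * (kY p - kX p) = 2 * (Y p * kY p) - (2 * kX p - (kX p * X p + X p * kX p)).
  move=> zX zY p; rewrite /psi; have [h|h] := leP (nm p) (2 * r).
    have hM := le_trans h M0; rewrite Y1// zY; [ring|by left].
  rewrite bX// zX; [ring|right; exact: ltW].
have idx := idn _ _ (fun p h => (Xz h).1) (fun p h => (Yz h).1).
have idy := idn _ _ (fun p h => (Xz h).2) (fun p h => (Yz h).2).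
have cW (k : C -> R) : ct k -> ct (fun p => 2 * (Y p * k p)) by move=> ck; apply: ctZ; exact: ctM.
have bW (k : C -> R) : bs (2 * M) (fun p => 2 * (Y p * k p)) by move=> p hp; rewrite bY// mul0r mulr0.
have lYx := L_ctbs (cW _ cYx) (bW Yx) lu lvy; have lYy := L_ctbs (cW _ cYy) (bW Yy) lu lvx.
have cV (k : C -> R) : ct k -> ct (fun p => 2 * k p - (k p * X p + X p * k p)).
  by move=> ck; apply: ctB; [exact: ctZ|apply: ctD; exact: ctM].
have [bZx bZy] := bs_der hZ bZ.
have lXx := L_ctbs (cV _ cXx) bZx lu lvy; have lXy := L_ctbs (cV _ cXy) bZy lu lvx.
have E (kX kY w : C -> R) : (forall p, (kY p - kX p) * psi p + psi p * (kY p - kX p) = 2 * (Y p * kY p) - (2 * kX p - (kX p * X p + X p * kX p))) ->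
  L (fun p => 2 * (Y p * kY p) * (u p * w p)) -> L (fun p => (2 * kX p - (kX p * X p + X p * kX p)) * (u p * w p)) ->
  I (fun p => ((kY p - kX p) * psi p + psi p * (kY p - kX p)) * (u p * w p)) =
  I (fun p => 2 * (Y p * kY p) * (u p * w p)) - I (fun p => (2 * kX p - (kX p * X p + X p * kX p)) * (u p * w p)).
  by move=> h l1 l2; rewrite -IntB//; apply: Int_ext => p; rewrite h; ring.
rewrite (E _ _ _ idx lYx lXx) (E _ _ _ idy lYy lXy).
have T1 : `|I (fun p => 2 * (Y p * Yx p) * (u p * vy p)) - I (fun p => 2 * (Y p * Yy p) * (u p * vx p))| <= B * s2 * (32 + en ux uy vx vy M (2 * M)).
  rewrite -IntB//.
  have lf : L (fun p => fr M p) by apply: L1B; exact: L_qi.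
  have lG := L_gsq M (2 * M) lux luy lvx lvy.
  have If : I (fun p => fr M p) <= 16 * M ^+ 2.
    have -> : 16 * M ^+ 2 = I (qi (2 * M) : C -> R) by rewrite Int_qi ?mulr_ge0 ?ltW//; ring.
    by apply: Int_le => //; [exact: L_qi|move=> p; exact: fr_le_qi].
  apply: (@le_trans _ _ (I (fun p => B * s2 * (2 * M ^- 2 * fr M p + G p * (qi (2 * M) p - qi M p))))); last first.
    have lA : L (fun p => 2 * M ^- 2 * fr M p + G p * (qi (2 * M) p - qi M p)) by apply: L1D => //; exact: L1Z.
    rewrite IntZ//; apply: ler_wpM2l; first by rewrite mulr_ge0// ltW.
    rewrite IntD//; last exact: L1Z.
    rewrite IntZ// -/(en _ _ _ _ _ _) lerD2r.
    have -> : 32 = 2 * M ^- 2 * (16 * M ^+ 2) :> R by field; rewrite gt_eqF.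
    by apply: ler_wpM2l => //; rewrite mulr_ge0// invr_ge0 sqr_ge0.
  apply: Int_abs_le; [exact: L1B|by apply: L1Z; apply: L1D => //; exact: L1Z|].
  move=> p; have f0 := fr_ge0 p M00; rewrite -/(fr M p) -mulrDl.
  have g0 : 0 <= B * s2 * ((2 * M ^- 2 + G p) * fr M p).
    apply: mulr_ge0; first by rewrite mulr_ge0// ltW.
    apply: mulr_ge0 => //; apply: addr_ge0; [|exact: gsq_ge0].
    by rewrite mulr_ge0// invr_ge0 sqr_ge0.
  have [h|h] := leP (nm p) M; first by have [-> ->] := Yz (or_introl h); rewrite !(mulr0, mul0r) subrr normr0.
  have [h'|h'] := leP (2 * M) (nm p); first by have [-> ->] := Yz (or_intror h'); rewrite !(mulr0, mul0r) subrr normr0.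
  have -> : fr M p = 1 by rewrite /fr qi1 ?qi0 ?subr0// ltW.
  rewrite mulr1; have /andP[y0 y1] := Y01 p.
  have am (k y : R) : `|k| <= B / M -> `|2 * (Y p * k) * (u p * y)| <= B * s2 * (M ^- 2 + y ^+ 2).
    move=> hk; rewrite !normrM (ger0_norm y0) [`|2|]ger0_norm//.
    have hu' := hs2 p (ltW h) (ltW h').
    apply: (@le_trans _ _ (2 * (1 * (B / M)) * (s2 * `|y|))).
      apply: ler_pM; [by rewrite mulr_ge0// mulr_ge0|by rewrite mulr_ge0| |by apply: ler_wpM2r].
      by rewrite ler_pM2l//; apply: ler_pM.
    have -> : 2 * (1 * (B / M)) * (s2 * `|y|) = B * s2 * (2 * (M^-1 * `|y|)) by ring.
    apply: ler_wpM2l; first by rewrite mulr_ge0// ltW.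
    rewrite -exprVn -[y ^+ 2]real_normK ?num_real//; move: (M^-1) `|y| => a b.
    by rewrite -subr_ge0 (_ : _ - _ = (a - b) ^+ 2) ?sqr_ge0//; ring.
  have h1 := am _ (vy p) (bYx p); have h2 := am _ (vx p) (bYy p).
  apply: le_trans (ler_normB _ _) _; apply: (le_trans (lerD h1 h2)); rewrite -mulrDr.
  apply: ler_wpM2l; first by rewrite mulr_ge0// ltW.
  rewrite /G /gsq -subr_ge0 (_ : _ - _ = ux p ^+ 2 + uy p ^+ 2); last by ring.
  by rewrite addr_ge0 ?sqr_ge0.
move: T1 T2; set a := I _; set b := I _; set c0 := I _; set d := I _ => T1 T2.
have -> : a - c0 - (b - d) = (a - b) - (c0 - d) by ring.
apply: (@le_trans _ _ (4 * (`|a - b| + `|c0 - d|))); first by rewrite ler_pM2l// ler_normB.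
clear -T2 T1 HA A0 Yz bYy bYx Y1 Y01 bY hY Xz bXy bXx X1 X01 bX hX M0 B0 hJ r0 hv hu; lra.
Qed.

End Cuts.
End Pair.

(* [WS] away from the origin, where the inverse of a homeomorphism fixing [0] has its pole. *)
Definition EWS (U Ux Uy : C -> R) := forall d : R, 0 < d -> exists w wx wy, WS w wx wy /\
  forall p, d <= nm p -> [/\ w p = U p, wx p = Ux p & wy p = Uy p].

Lemma en_ext Ux Uy Vx Vy ux uy vx vy (a b : R) :
  (forall p, a <= nm p -> [/\ ux p = Ux p, uy p = Uy p, vx p = Vx p & vy p = Vy p]) -> a <= b ->
  en ux uy vx vy a b = en Ux Uy Vx Vy a b.
Proof.
move=> h ab; apply: Int_ext => p; have [hp|hp] := leP (nm p) a.
  by rewrite !qi1 ?subrr ?mulr0//; exact: le_trans ab.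
by have [e1 e2 e3 e4] := h p (ltW hp); rewrite /gsq e1 e2 e3 e4.
Qed.

(** With x and y the energies outside two consecutive squares, the frame energy is x - y, so
    [hole_cut] reads y <= A1 (x - y) up to an error, that is y <= A1 / (1 + A1) x. The error tends
    to 0 with [U] as the outer square grows. [caccioppoli_cut] starts the induction. *)
Lemma en_decay : exists A th : R, [/\ 0 < A, 0 < th & th < 1] /\
  forall U Ux Uy V Vx Vy r0 s1, EWS U Ux Uy -> EWS V Vx Vy ->
  {ae @PM R, forall p, 0 < nm p -> gsq Ux Uy Vx Vy p <= 4 * (Ux p * Vy p - Uy p * Vx p)} ->
  (forall e : R, 0 < e -> exists M, forall p, M <= nm p -> `|U p| <= e) ->
  0 < r0 -> 0 <= s1 -> (forall p, r0 / 2 <= nm p -> nm p <= r0 -> `|U p| <= s1) ->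
  forall k : nat, en Ux Uy Vx Vy (2 ^+ k * r0) (2 ^+ k.+1 * r0) <= th ^+ k * (A * s1 ^+ 2).
Proof.
have [B B0 cut] := cutoff R; have [A0 A00 HA] := frame_form.
pose A1 := 4 * (A0 * (2 * B)); have A10 : 0 < A1 by rewrite /A1 !mulr_gt0.
pose A := (64 * B) ^+ 2; have A_0 : 0 < A by rewrite exprn_gt0// mulr_gt0.
exists A, (A1 / (1 + A1)); split.
  by split=> //; [rewrite divr_gt0 ?addr_gt0|rewrite ltr_pdivrMr ?addr_gt0// mul1r ltrDr].
set th := A1 / (1 + A1).
have th0 : 0 < th by rewrite divr_gt0 ?addr_gt0.
have th1 : th <= 1 by rewrite ler_pdivrMr ?addr_gt0// mul1r lerDr.
move=> U Ux Uy V Vx Vy r0 s1 hU hV hJ hd r00 s10 hs k.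
(* The first cut-off lives between [r0 / 2] and [r0], where the bound [s1] holds. *)
have d0 : 0 < r0 / 2 by rewrite divr_gt0.
have [u [ux [uy [hu eu]]]] := hU _ d0; have [v [vx [vy [hv ev]]]] := hV _ d0.
have eqs p : r0 / 2 <= nm p -> [/\ ux p = Ux p, uy p = Uy p, vx p = Vx p & vy p = Vy p].
  by move=> h; have [_ a b] := eu p h; have [_ c' d] := ev p h.
have tw j : 1 <= 2 ^+ j :> R by apply: exprn_ege1; rewrite ler1n.
have rj j : 0 < 2 ^+ j * r0 by rewrite mulr_gt0// exprn_gt0.
have r0j j : r0 <= 2 ^+ j * r0 by rewrite ler_peMl// ltW.
have half j : r0 / 2 <= 2 ^+ j * r0 by apply: le_trans (r0j j); rewrite ler_pdivrMr// ler_peMr ?ler1n// ltW.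
have dbl j : 2 * (2 ^+ j * r0) = 2 ^+ j.+1 * r0 by rewrite exprS mulrA.
rewrite -(@en_ext Ux Uy Vx Vy ux uy vx vy); last 2 first.
- by move=> p h; apply: eqs; exact: le_trans (half k) h.
- by rewrite -dbl ler_peMl ?ler1n// ltW.
pose e_ := en ux uy vx vy.
have lu : [/\ L2l ux, L2l uy, L2l vx & L2l vy] by have [_ ? ? _] := hu; have [_ ? ? _] := hv.
have [lux luy lvx lvy] := lu.
have spl a b d : e_ a d = e_ a b + e_ b d by exact: en_split.
have hJ' (r : R) : r0 / 2 <= r -> {ae @PM R, forall p, r < nm p -> gsq ux uy vx vy p <= 4 * (ux p * vy p - uy p * vx p)}.
  move=> hr; apply: (ae_imp hJ) => p h hp.
  have hp2 := le_trans hr (ltW hp).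
  have [e1 e2 e3 e4] := eqs p hp2; rewrite /gsq e1 e2 e3 e4; apply: h; exact: lt_le_trans d0 hp2.
have uU p : r0 / 2 <= nm p -> u p = U p by move=> /eu[].
have cacc M s2 : r0 <= M -> 0 <= s2 -> (forall p, M <= nm p -> `|U p| <= s2) -> e_ r0 M <= A * (s1 ^+ 2 + s2 ^+ 2).
  move=> rM s20 hM.
  have MM : 2 * (r0 / 2) <= M by rewrite mulrC divfK.
  have M0 : 0 < M by apply: lt_le_trans rM.
  have [X [Xx [Xy [hX bX X01 X1 [bXx bXy Xz]]]]] := cut _ d0.
  have [Y [Yx [Yy [hY bY Y01 Y1 [bYx bYy Yz]]]]] := cut _ M0.
  have E2 : 2 * (r0 / 2) = r0 by rewrite mulrC divfK.
  have i1 p : r0 / 2 <= nm p -> nm p <= 2 * (r0 / 2) -> `|u p| <= s1.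
    by move=> h1 h2; rewrite uU//; apply: hs => //; rewrite -E2.
  have i2 p : M <= nm p -> nm p <= 2 * M -> `|u p| <= s2.
    move=> h1 h2; rewrite uU; first exact: hM.
    by apply: le_trans h1; apply: le_trans rM; rewrite ler_pdivrMr// ler_peMr ?ler1n// ltW.
  have := caccioppoli_cut hu hv d0 (hJ' _ (lexx _)) MM hX bX X01 X1 bXx bXy Xz hY bY Y01 Y1 bYx bYy Yz s10 s20 i1 i2.
  by rewrite E2.
have hole j M s2 : 2 ^+ j.+1 * r0 <= M -> 0 <= s2 -> (forall p, M <= nm p -> `|U p| <= s2) ->
   e_ (2 ^+ j.+1 * r0) M <= A1 * e_ (2 ^+ j * r0) (2 ^+ j.+1 * r0) + 4 * B * s2 * (32 + e_ M (2 * M)).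
  rewrite -dbl => rM s20 hM.
  have M0 : 0 < M by apply: lt_le_trans rM; rewrite mulr_gt0.
  have [X [Xx [Xy [hX bX X01 X1 [bXx bXy Xz]]]]] := cut _ (rj j).
  have [Y [Yx [Yy [hY bY Y01 Y1 [bYx bYy Yz]]]]] := cut _ M0.
  apply: (hole_cut hu hv (rj j) (hJ' _ (half j)) B0 rM hX bX X01 X1 bXx bXy Xz hY bY Y01 Y1 bYx bYy Yz HA) => //.
  move=> p h1 h2; rewrite uU; [exact: hM|].
  by apply: le_trans h1; apply: le_trans rM; apply: le_trans (half j) _; rewrite ler_peMl ?ler1n// ltW.
pose E1 := 4 * B * (32 + A * (s1 ^+ 2 + 1)).
have E10 : 0 <= E1.
  by apply: mulr_ge0; [rewrite mulr_ge0// ltW|apply: addr_ge0 => //; apply: mulr_ge0; [exact: ltW|rewrite addr_ge0// sqr_ge0]].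
apply/ler_addgt0Pr => t t0.
have kn0 : 0 <= A + E1 * k%:R by apply: addr_ge0; [exact: ltW|exact: mulr_ge0].
(* Chosen so that the initial error and the [k] errors of the induction add up to at most [t]. *)
pose e := Num.min 1 (t / (A + E1 * k%:R + 1)).
have e0 : 0 < e by rewrite lt_min ltr01 divr_gt0// ltr_wpDl.
have e1 : e <= 1 by rewrite ge_min lexx.
have et : e * (A + E1 * k%:R) <= t.
  have : e <= t / (A + E1 * k%:R + 1) by rewrite ge_min lexx orbT.
  by move=> /(ler_wpM2r kn0) h; apply: (le_trans h); apply/ltW/frac_lt.
have eE0 : 0 <= e * E1 by apply: mulr_ge0 => //; exact: ltW.
have [M' hM'] := hd _ e0.
pose M := Num.max M' (2 ^+ k.+1 * r0).
have hM p : M <= nm p -> `|U p| <= e by rewrite ge_max => /andP[h _]; exact: hM'.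
have MR : 2 ^+ k.+1 * r0 <= M by rewrite le_max lexx orbT.
have rM : r0 <= M by apply: le_trans MR.
have M0 : 0 < M by apply: lt_le_trans rM.
have esq : e ^+ 2 <= e by rewrite expr2 ler_piMl// ltW.
have c1 := cacc M e rM (ltW e0) hM.
have c2 : e_ M (2 * M) <= A * (s1 ^+ 2 + 1).
  have M2 : M <= 2 * M by rewrite ler_peMl ?ler1n// ltW.
  have := cacc (2 * M) e (le_trans rM M2) (ltW e0) (fun p h => hM p (le_trans M2 h)).
  rewrite (spl r0 M (2 * M)) => h; have : 0 <= e_ r0 M by exact: en_ge0.
  have h2 : A * (s1 ^+ 2 + e ^+ 2) <= A * (s1 ^+ 2 + 1).
    by apply: ler_wpM2l; [exact: ltW|rewrite lerD2l; exact: le_trans e1].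
  by move: h h2; move: (e_ r0 M) (e_ M (2 * M)) => x y h h2 h3; clear -h h2 h3; lra.
(* The outer square [M] is fixed before the induction, beyond the last frame, so that the same error
   bound serves every step. *)
have ind j : (j <= k)%N -> e_ (2 ^+ j * r0) M <= th ^+ j * (A * s1 ^+ 2 + A * e) + e * E1 * j%:R.
  elim: j => [_|j IH jk].
    rewrite !expr0 !mul1r mulr0 addr0; apply: (le_trans c1); rewrite -mulrDr; apply: ler_wpM2l; first exact: ltW.
    by rewrite lerD2l.
  have := IH (ltnW jk); set P := 2 ^+ j * r0; set Q := 2 ^+ j.+1 * r0.
  have QM : Q <= M by apply: le_trans MR; rewrite ler_pM2r// ler_eXn2l ?ltr1n//; exact: ltnW.
  have := hole j M e QM (ltW e0) hM; rewrite -/P -/Q.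
  have -> : e_ P Q = e_ P M - e_ Q M by rewrite (spl P Q M) addrK.
  have h4 : 4 * B * e * (32 + e_ M (2 * M)) <= e * E1.
    have -> : e * E1 = 4 * B * e * (32 + A * (s1 ^+ 2 + 1)) by rewrite /E1; ring.
    by apply: ler_wpM2l; [apply: mulr_ge0; [rewrite mulr_ge0// ltW|exact: ltW]|rewrite lerD2l].
  move: (e_ P M) (e_ Q M) (4 * B * e * _) h4 => x y w h4 hw hx.
  have A11 : 0 < 1 + A1 by rewrite addr_gt0.
  have h5 : y <= th * x + e * E1.
    have : (1 + A1) * y <= A1 * x + e * E1 by clear -h4 hw hx; lra.
    move=> h; rewrite -(ler_pM2l A11); apply: (le_trans h).
    have -> : (1 + A1) * (th * x + e * E1) = A1 * x + (1 + A1) * (e * E1) by rewrite /th; field; rewrite gt_eqF.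
    by rewrite lerD2l; apply: ler_peMl => //; rewrite lerDl; exact: ltW.
  apply: (le_trans h5); have h6 := ler_wpM2l (ltW th0) hx.
  have h7 : th * (e * E1 * j%:R) <= e * E1 * j%:R by apply: ler_piMl => //; apply: mulr_ge0.
  have -> : th ^+ j.+1 * (A * s1 ^+ 2 + A * e) + e * E1 * j.+1%:R = th * (th ^+ j * (A * s1 ^+ 2 + A * e)) + e * E1 * j%:R + e * E1.
    by rewrite -natr1 exprS; ring.
  have e9 : th * (th ^+ j * (A * s1 ^+ 2 + A * e) + e * E1 * j%:R) = th * (th ^+ j * (A * s1 ^+ 2 + A * e)) + th * (e * E1 * j%:R) by ring.
  rewrite e9 in h6; rewrite lerD2r; apply: (le_trans h6); by rewrite lerD2l.
have := ind k (leqnn k).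
have -> : e_ (2 ^+ k * r0) M = e_ (2 ^+ k * r0) (2 ^+ k.+1 * r0) + e_ (2 ^+ k.+1 * r0) M by exact: spl.
have pos : 0 <= e_ (2 ^+ k.+1 * r0) M by exact: en_ge0.
rewrite -/e_; move: pos; move: (e_ _ _) (e_ _ M) => x y pos h.
have thk : th ^+ k <= 1 by apply: exprn_ile1 => //; exact: ltW.
have h8 : th ^+ k * (A * e) <= A * e by rewrite ler_piMl// mulr_ge0 ?ltW.
move: h8 pos h; rewrite mulrDr; move: et; rewrite mulrDr; clear; lra.
Qed.

End Energy.


(** * The Cauchy formula *)

Section Kernel.
Variable R : realType.
Local Notation C := (R * R)%type.
Local Notation M1 := (measurableTypeR R).
Local Notation L := (L1 (@PM R)).
Local Notation I := (Int (@PM R)).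
Implicit Types (F G : C -> R) (p q c : C) (r s t : R).

(* A positive C^1 function equal to [t] for [t >= s]; its inverse [rcp s] replaces
   [1 / t] near the pole. *)
Definition rden s t : R := t + sqpos (s - t) / s.
Definition rden' s t : R := 1 - 2 * Num.max (s - t) 0 / s.
Definition rcp s t : R := (rden s t)^-1.
Definition rcp' s t : R := - rden' s t / rden s t ^+ 2.

Lemma rden_ge s t : 0 < s -> t <= rden s t.
Proof. by move=> s0; rewrite /rden lerDl divr_ge0// ?sqr_ge0// ltW. Qed.

Lemma rden_big s t : s <= t -> rden s t = t.
Proof. by move=> h; rewrite /rden /sqpos max_r ?expr0n/= ?mul0r ?addr0// subr_le0. Qed.

Lemma rden_small s t : 0 < s -> t <= s -> rden s t = s - t + t ^+ 2 / s.
Proof. by move=> s0 h; rewrite /rden /sqpos max_l ?subr_ge0//; field; rewrite gt_eqF. Qed.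

Lemma rden_gt0 s t : 0 < s -> 0 < rden s t.
Proof.
move=> s0; have [h|h] := leP s t; first by rewrite rden_big//; exact: lt_le_trans h.
rewrite rden_small ?ltW//; apply: ltr_wpDr; last by rewrite subr_gt0.
by rewrite divr_ge0 ?sqr_ge0// ltW.
Qed.

Lemma rcp_big s t : s <= t -> rcp s t = t^-1. Proof. by move=> h; rewrite /rcp rden_big. Qed.

Lemma rcp'_big s t : s <= t -> rcp' s t = - t ^- 2.
Proof. by move=> h; rewrite /rcp' rden_big// /rden' max_r ?subr_le0// mulr0 mul0r subr0 mulNr mul1r. Qed.

Lemma rcp_ge0 s t : 0 < s -> 0 <= rcp s t.
Proof. by move=> s0; rewrite invr_ge0 ltW// rden_gt0. Qed.

Lemma rcp_le s t : 0 < s -> 0 < t -> rcp s t <= t^-1.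
Proof. by move=> s0 t0; rewrite lef_pV2 ?posrE ?rden_gt0// rden_ge. Qed.

Lemma rden_der s t : 0 < s -> der (rden s) t (rden' s t).
Proof.
move=> s0; have h := der_comp (f := sqpos (R := R)) (g := fun t => -1 * t + s) (sqpos_der (-1 * t + s)) (der_aff (-1) s t).
have h2 := derD (der_id t) (derZ s^-1 h).
apply: (der_ext (f := fun y => y + s^-1 * sqpos (-1 * y + s))).
  by move=> y; have e : -1 * y + s = s - y by [ring]; rewrite /rden e mulrC.
by apply: (der_eql h2); rewrite /rden' (_ : -1 * t + s = s - t); ring.
Qed.

Lemma rcp_der s t : 0 < s -> der (rcp s) t (rcp' s t).
Proof.
move=> s0; have n0 : rden s t != 0 by rewrite gt_eqF// rden_gt0.
by apply: (der_eql (der_comp (der_inv n0) (rden_der t s0))); rewrite /rcp'; field.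
Qed.

Lemma rcp'_cts s : 0 < s -> continuous (rcp' s).
Proof.
move=> s0 t; have n0 : rden s t != 0 by rewrite gt_eqF// rden_gt0.
have cm : (fun t => Num.max (s - t) 0) x @[x --> t] --> Num.max (s - t) 0.
  have c1 : continuous (fun t : R => s - t) by move=> z; apply: cvgB; [exact: cvg_cst|exact: cvg_id].
  exact: (cvg_comp _ _ (c1 t) (@pos_cts R (s - t))).
have cd : rden' s x @[x --> t] --> rden' s t.
  by apply: cvgB; [exact: cvg_cst|apply: cvgM; [apply: cvgM; [exact: cvg_cst|exact: cm]|exact: cvg_cst]].
have cD : rden s x @[x --> t] --> rden s t by exact: der_cts (rden_der t s0).
apply: cvgM; first by apply: cvgN.
by apply: cvgV; [rewrite expf_neq0|exact: (cvgM cD cD)].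
Qed.

Definition nn p : R := p.1 ^+ 2 + p.2 ^+ 2.

Lemma nn_ge p : nm p ^+ 2 <= nn p.
Proof.
by rewrite /nn /nm; case: (leP `|p.1| `|p.2|) => _; rewrite real_normK ?num_real// ?lerDr ?lerDl sqr_ge0.
Qed.

Lemma nn_le p : nn p <= 2 * nm p ^+ 2.
Proof.
have h (x : R) : `|x| <= nm p -> x ^+ 2 <= nm p ^+ 2.
  by move=> hx; rewrite -[x ^+ 2]real_normK ?num_real// !expr2; apply: ler_pM.
by have := h _ (nm1 p); have := h _ (nm2 p); rewrite /nn; lra.
Qed.

Lemma nn_ge0 p : 0 <= nn p. Proof. by rewrite /nn addr_ge0// sqr_ge0. Qed.

Lemma nn_gt0 p : 0 < nm p -> 0 < nn p.
Proof. by move=> h; apply: lt_le_trans (nn_ge p); rewrite exprn_gt0. Qed.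

(* [kk1 + i kk2] regularises the Cauchy kernel [1 / z]; [hh / 2] is its dbar-derivative, an approximate point mass. *)
Definition kk1 s p := p.1 * rcp s (nn p).
Definition kk2 s p := - p.2 * rcp s (nn p).
Definition kk1x s p := rcp s (nn p) + 2 * p.1 ^+ 2 * rcp' s (nn p).
Definition kk1y s p := 2 * p.1 * p.2 * rcp' s (nn p).
Definition kk2x s p := - (2 * p.1 * p.2 * rcp' s (nn p)).
Definition kk2y s p := - (rcp s (nn p) + 2 * p.2 ^+ 2 * rcp' s (nn p)).

Lemma C1_nn : C1 nn (fun p => 2 * p.1) (fun p => 2 * p.2).
Proof.
have a := C1_mul (@C1_fst R) (@C1_fst R); have b := C1_mul (@C1_snd R) (@C1_snd R).
apply: (C1_ext (C1_add a b)) => p /=; rewrite ?/nn; ring.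
Qed.

Lemma C1_rcp s : 0 < s -> C1 (fun p => rcp s (nn p)) (fun p => rcp' s (nn p) * (2 * p.1)) (fun p => rcp' s (nn p) * (2 * p.2)).
Proof. by move=> s0; apply: C1_comp1 C1_nn; [exact: rcp'_cts|move=> x; exact: rcp_der]. Qed.

Lemma C1_kk1 s : 0 < s -> C1 (kk1 s) (kk1x s) (kk1y s).
Proof.
by move=> s0; apply: (C1_ext (C1_mul (@C1_fst R) (C1_rcp s0))) => p; rewrite ?/kk1 ?/kk1x ?/kk1y /=; ring.
Qed.

Lemma C1_kk2 s : 0 < s -> C1 (kk2 s) (kk2x s) (kk2y s).
Proof.
by move=> s0; apply: (C1_ext (C1_mul (C1_opp (@C1_snd R)) (C1_rcp s0))) => p; rewrite ?/kk2 ?/kk2x ?/kk2y /=; ring.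
Qed.

Definition hh s p := 2 * (rcp s (nn p) + nn p * rcp' s (nn p)).

Lemma kk_dbar s p : kk1x s p - kk2y s p = hh s p /\ kk1y s p + kk2x s p = 0.
Proof. by rewrite /kk1x /kk2y /kk1y /kk2x /hh /nn; split; ring. Qed.

Lemma kk_bd s p : 0 < s -> 0 < nm p -> `|kk1 s p| <= (nm p)^-1 /\ `|kk2 s p| <= (nm p)^-1.
Proof.
move=> s0 p0; have n0 := nn_gt0 p0; have r0 := rcp_ge0 (nn p) s0.
have r1 : rcp s (nn p) <= (nm p ^+ 2)^-1.
  by apply: le_trans (rcp_le s0 n0) _; rewrite lef_pV2 ?posrE ?exprn_gt0// nn_ge.
have e : nm p * (nm p ^+ 2)^-1 = (nm p)^-1 by field; rewrite gt_eqF.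
by rewrite /kk1 /kk2 !normrM normrN !(ger0_norm r0) -e; split; apply: ler_pM => //; [exact: nm1|exact: nm2].
Qed.

Lemma hh_big s p : 0 < s -> s <= nn p -> hh s p = 0.
Proof.
move=> s0 h; have n0 : nn p != 0 by rewrite gt_eqF// (lt_le_trans s0).
by rewrite /hh rcp_big// rcp'_big//; field.
Qed.

Lemma hh_small s p : 0 < s -> nn p <= s -> hh s p = 2 * (s ^+ 2 - nn p ^+ 2) / (s * rden s (nn p) ^+ 2).
Proof.
move=> s0 h; have d0 := rden_gt0 (nn p) s0.
have e : rden s (nn p) - nn p * rden' s (nn p) = (s ^+ 2 - nn p ^+ 2) / s.
  by rewrite rden_small// /rden' max_l ?subr_ge0//; field; rewrite gt_eqF.
have -> : hh s p = 2 * ((rden s (nn p) - nn p * rden' s (nn p)) / rden s (nn p) ^+ 2).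
  by rewrite /hh /rcp /rcp'; field; rewrite gt_eqF.
by rewrite e; field; rewrite !gt_eqF.
Qed.

Lemma hh_ge0 s p : 0 < s -> 0 <= hh s p.
Proof.
move=> s0; have [h|h] := leP s (nn p); first by rewrite hh_big.
rewrite (hh_small s0 (ltW h)); apply: divr_ge0.
  by rewrite mulr_ge0// subr_ge0 !expr2; apply: ler_pM; rewrite ?nn_ge0// ltW.
by rewrite mulr_ge0 ?sqr_ge0// ltW.
Qed.

(** With [s = 4 * r ^+ 2], on this square [nn p <= s / 2] and [rden s (nn p) <= s], so [hh] is at
    least [2 * (3 / 4) * s^-1], which is [3 / (8 * r ^+ 2)]. *)
Lemma hh_low r p : 0 < r -> 3 / (8 * r ^+ 2) * qi r p <= hh (4 * r ^+ 2) p.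
Proof.
move=> r0; have r2 : 0 < r ^+ 2 by rewrite exprn_gt0.
have s0 : 0 < 4 * r ^+ 2 by rewrite mulr_gt0.
have [h|h] := leP (nm p) r; last by rewrite qi0// mulr0 hh_ge0.
rewrite qi1// mulr1.
have n1 : nn p <= 2 * r ^+ 2.
  by apply: le_trans (nn_le p) _; rewrite ler_pM2l// !expr2; apply: ler_pM => //; exact: nm_ge0.
have n2 : nn p <= 4 * r ^+ 2 by lra.
rewrite hh_small//; have d0 := rden_gt0 (nn p) s0; have n0 := nn_ge0 p.
have d1 : rden (4 * r ^+ 2) (nn p) <= 4 * r ^+ 2.
  rewrite rden_small//; have : nn p ^+ 2 / (4 * r ^+ 2) <= nn p by rewrite ler_pdivrMr// expr2 ler_wpM2l.
  lra.
have d2 : rden (4 * r ^+ 2) (nn p) ^+ 2 <= (4 * r ^+ 2) ^+ 2.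
  by rewrite !expr2 -!expr2; rewrite !(expr2 (rden _ _)) (expr2 (4 * _)); apply: ler_pM => //; exact: ltW.
have n4 : nn p ^+ 2 <= (2 * r ^+ 2) ^+ 2 by rewrite (expr2 (nn p)) (expr2 (2 * _)); apply: ler_pM.
rewrite ler_pdivlMr; last by rewrite mulr_gt0// exprn_gt0.
have -> : 3 / (8 * r ^+ 2) * (4 * r ^+ 2 * rden (4 * r ^+ 2) (nn p) ^+ 2) = 3 / 2 * rden (4 * r ^+ 2) (nn p) ^+ 2.
  by field; rewrite gt_eqF.
have e1 : (4 * r ^+ 2) ^+ 2 = 4 * (2 * r ^+ 2) ^+ 2 by ring.
move: d2 n4; rewrite e1; move: (rden _ _ ^+ 2) (nn p ^+ 2) ((2 * r ^+ 2) ^+ 2) => x y z; lra.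
Qed.

Lemma hh_out r p : 0 < r -> 2 * r <= nm p -> hh (4 * r ^+ 2) p = 0.
Proof.
move=> r0 h; apply: hh_big; first by rewrite mulr_gt0// exprn_gt0.
apply: le_trans (nn_ge p); have -> : 4 * r ^+ 2 = (2 * r) * (2 * r) by ring.
by rewrite expr2; apply: ler_pM => //; rewrite mulr_ge0// ltW.
Qed.

Lemma hh_ct s : 0 < s -> ct (hh s).
Proof.
move=> s0; have [cn _ _ _ _] := C1_nn; have [cr _ _ _ _] := C1_rcp s0.
apply: ctZ; apply: ctD => //; apply: ctM => //; apply: (ct_comp1 _ cn); exact: rcp'_cts.
Qed.

(** The total mass is in fact 2 pi; the lower bound 1 is enough, as the mass is divided out at the
    end of [cauchy_bound]. *)
Lemma Int_hh r c : 0 < r -> L (fun p => hh (4 * r ^+ 2) (pm p c)) /\ 1 <= I (fun p => hh (4 * r ^+ 2) (pm p c)).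
Proof.
move=> r0; have s0 : 0 < 4 * r ^+ 2 by rewrite mulr_gt0// exprn_gt0.
have lh : L (hh (4 * r ^+ 2)).
  by apply: (L_cc (r := 2 * r)); [exact: hh_ct|move=> p hp; apply: hh_out => //; exact: ltW].
split; first exact: (L_shift (- c.1, - c.2) lh).
rewrite (Int_shift (- c.1, - c.2) lh).
apply: (@le_trans _ _ (I (fun p => 3 / (8 * r ^+ 2) * qi r p))).
  rewrite IntZ; last exact: L_qi.
  rewrite Int_qi ?ltW//; have -> : 3 / (8 * r ^+ 2) * (4 * r ^+ 2) = 3 / 2 by field; rewrite gt_eqF.
  lra.
by apply: Int_le => //; [by apply: L1Z; exact: L_qi|move=> p; exact: hh_low].
Qed.

End Kernel.

Lemma four_products (R : realDomainType) (x y k l w z b f g : R) : `|x| <= b -> `|y| <= b -> `|k| <= f -> `|l| <= f -> `|w| <= g -> `|z| <= g ->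
      `|(x * k - y * l) * w - (y * k + x * l) * z| <= 4 * (b * (f * g)).
Proof.
move=> hx hy hk hl hw hz.
have t3 (i j m : R) : `|i| <= b -> `|j| <= f -> `|m| <= g -> `|i * j * m| <= b * (f * g).
  by move=> h1 h2 h3; rewrite !normrM -mulrA; apply: ler_pM => //; apply: ler_pM.
have -> : (x * k - y * l) * w - (y * k + x * l) * z = x * k * w - y * l * w - y * k * z - x * l * z by ring.
apply: le_trans (ler_normB _ _) _; apply: le_trans (lerD (ler_normB _ _) (lexx _)) _.
apply: le_trans (lerD (lerD (ler_normB _ _) (lexx _)) (lexx _)) _.
have := t3 x k w hx hk hw; have := t3 y l w hy hl hw; have := t3 y k z hy hk hz; have := t3 x l z hx hl hz; lra.
Qed.

Section CauchyFormula.
Variable R : realType.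
Local Notation C := (R * R)%type.
Local Notation M1 := (measurableTypeR R).
Local Notation L := (L1 (@PM R)).
Local Notation I := (Int (@PM R)).
Implicit Types (F G : C -> R) (p q c : C) (r s t : R).

(** Real part of Green's formula: for a kernel K = k + i l, the integral of K dbar(u + i v) is minus
    that of (u + i v) dbar K. *)
Lemma cauchy_id (u ux uy v vx vy k kx ky l lx ly : C -> R) b : WS u ux uy -> WS v vx vy ->
  C1 k kx ky -> C1 l lx ly -> bs b k -> bs b l ->
  I (fun p => k p * (ux p - vy p) - l p * (uy p + vx p)) =
  - I (fun p => (kx p - ly p) * u p - (ky p + lx p) * v p).
Proof.
move=> hu hv hk hl bk bl.
have [a1 a2] := WS_IBP hu hk bk; have [a3 a4] := WS_IBP hu hl bl.
have [b1 b2] := WS_IBP hv hk bk; have [b3 b4] := WS_IBP hv hl bl.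
have [bkx bky] := bs_der hk bk; have [blx bly] := bs_der hl bl.
have [cu lux luy _] := hu; have [cv lvx lvy _] := hv.
have [ck ckx cky _ _] := hk; have [cl clx cly _ _] := hl.
have l1 (f g : C -> R) : L2l f -> ct g -> bs b g -> L (fun p => g p * f p).
  by move=> lf cg bg; apply: (L1_ext _ (Ll_bs (L2l_Ll lf) cg bg)) => p; rewrite mulrC.
have lu := L2l_ct cu; have lv := L2l_ct cv.
have e1 : I (fun p => k p * (ux p - vy p) - l p * (uy p + vx p)) =
   I (fun p => k p * ux p) - I (fun p => k p * vy p) - I (fun p => l p * uy p) - I (fun p => l p * vx p).
  rewrite -!IntB; [apply: Int_ext => p; ring|..]; do ?[apply: L1B]; exact: l1.
have e2 : I (fun p => (kx p - ly p) * u p - (ky p + lx p) * v p) =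
   I (fun p => kx p * u p) - I (fun p => ly p * u p) - I (fun p => ky p * v p) - I (fun p => lx p * v p).
  rewrite -!IntB; [apply: Int_ext => p; ring|..]; do ?[apply: L1B]; exact: l1.
by rewrite e1 e2 a1 b2 a4 b3; ring.
Qed.

Lemma L_Int_sum (F : nat -> C -> R) n : (forall k, L (F k)) ->
  L (fun p => \sum_(k < n) F k p) /\ I (fun p => \sum_(k < n) F k p) = \sum_(k < n) I (F k).
Proof.
move=> h; elim: n => [|n [IH1 IH2]].
  rewrite big_ord0; have e : (fun p : C => \sum_(k < 0) F k p) = (fun=> 0) by apply/funext => p; rewrite big_ord0.
  by rewrite e; split; [exact: L10|exact: Int0].
have e : (fun p : C => \sum_(k < n.+1) F k p) = (fun p => \sum_(k < n) F k p + F n p) by apply/funext => p; rewrite big_ord_recr.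
by rewrite e big_ord_recr /= -IH2; split; [exact: L1D|exact: IntD].
Qed.

Lemma dyadic_frame r0 n p : 2 * r0 < nm p -> nm p <= 2 ^+ n.+1 * r0 ->
  exists2 k : nat, (k < n)%N & 2 ^+ k.+1 * r0 < nm p /\ nm p <= 2 ^+ k.+2 * r0.
Proof.
move=> h1; elim: n => [|n IH] h2; first by move: h2; rewrite expr1 leNgt h1.
have [/IH[k kn hk]|h] := leP (nm p) (2 ^+ n.+1 * r0); first by exists k => //; exact: ltnW.
by exists n.
Qed.

Lemma geo_sum (th : R) n : 0 <= th -> th < 1 -> \sum_(k < n) th ^+ k <= (1 - th)^-1.
Proof.
move=> h0 h1; have d0 : 0 < 1 - th by rewrite subr_gt0.
rewrite -[leRHS]mul1r ler_pdivlMr//.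
suff -> : (\sum_(k < n) th ^+ k) * (1 - th) = 1 - th ^+ n by rewrite gerBl exprn_ge0.
elim: n => [|n IH]; first by rewrite big_ord0 mul0r expr0 subrr.
by rewrite big_ord_recr /= mulrDl IH exprS; ring.
Qed.

Section Bound.
Variables (U Ux Uy V Vx Vy : C -> R) (r0 N th : R).
Hypotheses (hU : EWS U Ux Uy) (hV : EWS V Vx Vy) (r00 : 0 < r0) (N0 : 0 < N) (th0 : 0 < th) (th1 : th < 1).
Let P p := Ux p - Vy p.
Let Q p := Uy p + Vx p.
Hypothesis near0 : forall e : R, 0 < e -> exists2 d : R, 0 < d & forall p, 0 < nm p -> nm p < d ->
  `|U p| <= e / nm p /\ `|V p| <= e / nm p.
Hypothesis decay : forall e : R, 0 < e -> exists M, forall p, M <= nm p -> `|U p| <= e /\ `|V p| <= e.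
Hypothesis holo : {ae @PM R, forall p, 0 < nm p -> nm p <= 2 * r0 -> P p = 0 /\ Q p = 0}.
Hypothesis frames : forall k : nat,
  I (fun p => (P p ^+ 2 + Q p ^+ 2) * (qi (2 ^+ k.+2 * r0) p - qi (2 ^+ k.+1 * r0) p)) <= (th ^+ k * N) ^+ 2.

Lemma pow2_gt0 k : 0 < 2 ^+ k * r0. Proof. by rewrite mulr_gt0// exprn_gt0. Qed.

Lemma frame_area r : 0 < r -> I (fun p => qi (2 * r) p - qi r p) <= 16 * r ^+ 2.
Proof.
move=> r0'; have h1 := ltW r0'; have h2 : 0 <= 2 * r by rewrite mulr_ge0.
rewrite IntB; [|exact: L_qi|exact: L_qi]; rewrite !Int_qi//.
by have := sqr_ge0 r; lra.
Qed.

(** On the frame of index j the kernel is at most 2 / [rh j], the root of the area is of order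
    [rh j], and the dbar-derivative has L^2 norm at most [lam j]. Each frame thus contributes
    O([lam j]), a geometric series. *)
Lemma cauchy_tail (k l : C -> R) n s (w ux uy v vx vy : C -> R) b : 0 < s -> WS w ux uy -> WS v vx vy ->
  (forall p, s <= nm p -> [/\ ux p = Ux p & uy p = Uy p]) -> (forall p, s <= nm p -> [/\ vx p = Vx p & vy p = Vy p]) ->
  ct k -> ct l -> bs b k -> bs b l -> b <= 2 ^+ n.+1 * r0 -> s <= 2 * r0 ->
  (forall p, nm p <= s -> k p = 0 /\ l p = 0) ->
  (forall p, 2 * r0 <= nm p -> `|k p| <= 2 / nm p /\ `|l p| <= 2 / nm p) ->
  `|I (fun p => k p * (ux p - vy p) - l p * (uy p + vx p))| <= 33 * N / (1 - th).
Proof.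
move=> s0 hw hv eu ev ck cl bk bl bn sr kl0 kl.
have [_ lux luy _] := hw; have [_ lvx lvy _] := hv.
pose lam j := N * th ^+ j.
have lam0 j : 0 < lam j by rewrite mulr_gt0// exprn_gt0.
have l1 (f g : C -> R) : L2l f -> ct g -> bs b g -> L (fun p => g p * f p).
  by move=> lf cg bg; apply: (L1_ext _ (Ll_bs (L2l_Ll lf) cg bg)) => p; rewrite mulrC.
have lP := L2l_sub lux lvy; have lQ := L2l_add luy lvx.
have lin := L1B (l1 _ _ lP ck bk) (l1 _ _ lQ cl bl).
pose PQ p := (ux p - vy p) ^+ 2 + (uy p + vx p) ^+ 2.
pose rh j : R := 2 ^+ j.+1 * r0.
have rh0 j : 0 < rh j by exact: pow2_gt0.
have rhS j : rh j.+1 = 2 * rh j by rewrite /rh exprS mulrA.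
have rh_ge j : 2 * r0 <= rh j.
  by rewrite /rh ler_pM2r// exprS ler_peMr// exprn_ege1// ler1n.
(* Young's inequality balanced at [lam j]: the kernel part integrates to at most 2 * 16 [lam j] and
   the energy part to [lam j], whence 33. *)
pose G j p := 2 * lam j / rh j ^+ 2 * (qi (rh j.+1) p - qi (rh j) p) + (lam j)^-1 * (PQ p * (qi (rh j.+1) p - qi (rh j) p)).
have lPQ j : L (fun p => PQ p * (qi (rh j.+1) p - qi (rh j) p)).
  have [_ hP] := lP; have [_ hQ] := lQ.
  apply: (L1_ext _ (L1B (L1D (hP (rh j.+1)) (hQ (rh j.+1))) (L1D (hP (rh j)) (hQ (rh j))))) => p.
  by rewrite /PQ; ring.
have lq j : L (fun p => qi (rh j.+1) p - qi (rh j) p) by apply: L1B; exact: L_qi.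
have lG j : L (G j) by apply: L1D; exact: L1Z.
have IG j : I (G j) <= 33 * N * th ^+ j.
  rewrite (IntD (L1Z _ (lq j)) (L1Z _ (lPQ j))) !IntZ//.
  have a1 : I (fun p => qi (rh j.+1) p - qi (rh j) p) <= 16 * rh j ^+ 2 by rewrite rhS; exact: frame_area.
  have a2 : I (fun p => PQ p * (qi (rh j.+1) p - qi (rh j) p)) <= lam j ^+ 2.
    rewrite (@Int_ext _ _ _ (@PM R) _ (fun p => (P p ^+ 2 + Q p ^+ 2) * (qi (2 ^+ j.+2 * r0) p - qi (2 ^+ j.+1 * r0) p))).
      by apply: le_trans (frames j) _; rewrite /lam mulrC.
    move=> p; rewrite -/(rh j) -/(rh j.+1); have [h|h] := leP (nm p) (rh j).
      by rewrite !qi1 ?subrr ?mulr0// rhS; apply: le_trans h _; rewrite ler_peMl ?ler1n// ltW.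
    have sp : s <= nm p by apply: le_trans (ltW h); apply: le_trans (rh_ge j).
    by have [e1 e2] := eu p sp; have [e3 e4] := ev p sp; rewrite /PQ /P /Q e1 e2 e3 e4.
  have l0 := lam0 j; have r2 : 0 < rh j ^+ 2 by rewrite exprn_gt0.
  have c0 : 0 <= 2 * lam j / rh j ^+ 2 by rewrite divr_ge0 ?ltW// mulr_gt0.
  have b1 := ler_wpM2l c0 a1.
  have b2 : (lam j)^-1 * I (fun p => PQ p * (qi (rh j.+1) p - qi (rh j) p)) <= lam j.
    by rewrite mulrC ler_pdivrMr// -expr2.
  have e : 2 * lam j / rh j ^+ 2 * (16 * rh j ^+ 2) = 32 * lam j by field; rewrite gt_eqF.
  rewrite e in b1; apply: (le_trans (lerD b1 b2)).
  by rewrite -[X in _ <= X * _]/(33 * N) -mulrA -/(lam j); move: (lam j) => x; (clear -frames holo decay near0 th1 th0 N0 r00 hV hU; lra).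
have [lS IS] := L_Int_sum n lG.
apply: (@le_trans _ _ (I (fun p => \sum_(j < n) G j p))); last first.
  rewrite IS; apply: (@le_trans _ _ (\sum_(j < n) 33 * N * th ^+ j)); first by apply: ler_sum => j _; exact: IG.
  by rewrite -mulr_sumr; apply: ler_wpM2l; [rewrite mulr_ge0// ltW|apply: geo_sum => //; exact: ltW].
apply: le_trans (Int_abs lin) _; apply: Int_le_ae => //; first exact: L1_abs.
have G0 j p : 0 <= G j p.
  have q0 : 0 <= qi (rh j.+1) p - qi (rh j) p.
    by rewrite subr_ge0; apply: qi_mono; rewrite rhS ler_peMl ?ler1n// ltW.
  apply: addr_ge0; first by apply: mulr_ge0 => //; rewrite divr_ge0 ?sqr_ge0// mulr_ge0// ltW.
  by apply: mulr_ge0; [rewrite invr_ge0 ltW|apply: mulr_ge0 => //; apply: addr_ge0; exact: sqr_ge0].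
have S0 p : 0 <= \sum_(j < n) G j p by apply: sumr_ge0 => j _.
apply: (ae_imp holo) => p hp.
have [h|h] := leP (nm p) s; first by have [-> ->] := kl0 p h; rewrite !mul0r subrr normr0.
have [e1 e2] := eu p (ltW h); have [e3 e4] := ev p (ltW h).
have [h2|h2] := leP (nm p) (2 * r0).
  have [p1 p2] := hp (lt_trans s0 h) h2.
  by move: p1 p2; rewrite /P /Q -e1 -e2 -e3 -e4 => -> ->; rewrite !mulr0 subrr normr0.
have [h3|h3] := leP (nm p) b; last by rewrite bk// bl// !mul0r subrr normr0.
have [j jn [j1 j2]] := dyadic_frame h2 (le_trans h3 bn).
apply: (@le_trans _ _ (G j p)); last first.
  by rewrite (bigD1 (Ordinal jn))//= lerDl sumr_ge0.
have -> : G j p = 2 * lam j / rh j ^+ 2 + (lam j)^-1 * PQ p.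
  by rewrite /G /rh qi1// qi0// subr0 !mulr1.
have [k1 k2] := kl p (ltW h2).
have am (x y : R) : `|x| <= 2 / nm p -> `|x * y| <= lam j / rh j ^+ 2 + (lam j)^-1 * y ^+ 2.
  move=> hx; rewrite normrM; apply: (@le_trans _ _ (2 / rh j * `|y|)).
    apply: ler_wpM2r => //; apply: (le_trans hx); rewrite ler_pM2l// lef_pV2 ?posrE//; first exact: ltW.
    exact: lt_trans s0 h.
  rewrite -[y ^+ 2]real_normK ?num_real//; move: `|y| => z.
  have l0 := lam0 j; have rr0 := rh0 j; move: (lam j) (rh j) l0 rr0 => a d a0 d0.
  rewrite -subr_ge0; have -> : a / d ^+ 2 + a^-1 * z ^+ 2 - 2 / d * z = (a / d - z) ^+ 2 / a by field; rewrite !gt_eqF.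
  by rewrite divr_ge0 ?sqr_ge0// ltW.
apply: le_trans (ler_normB _ _) _; apply: (le_trans (lerD (am _ _ k1) (am _ _ k2))).
by rewrite le_eqVlt; apply/orP; left; apply/eqP; rewrite /PQ; ring.
Qed.

End Bound.

(** The growth condition [near0] leaves no residue at the origin and [decay] no contribution at
    infinity. What remains is the dbar-derivative against the Cauchy kernel centred at [c], which is
    [cauchy_tail]. *)
Lemma cauchy_bound (U Ux Uy V Vx Vy : C -> R) (r0 N th : R) c :
  EWS U Ux Uy -> EWS V Vx Vy -> 0 < r0 -> 0 < N -> 0 < th -> th < 1 ->
  (forall e : R, 0 < e -> exists2 d : R, 0 < d & forall p, 0 < nm p -> nm p < d -> `|U p| <= e / nm p /\ `|V p| <= e / nm p) ->
  (forall e : R, 0 < e -> exists M, forall p, M <= nm p -> `|U p| <= e /\ `|V p| <= e) ->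
  {ae @PM R, forall p, 0 < nm p -> nm p <= 2 * r0 -> Ux p - Vy p = 0 /\ Uy p + Vx p = 0} ->
  (forall k : nat, I (fun p => ((Ux p - Vy p) ^+ 2 + (Uy p + Vx p) ^+ 2) * (qi (2 ^+ k.+2 * r0) p - qi (2 ^+ k.+1 * r0) p)) <= (th ^+ k * N) ^+ 2) ->
  0 < nm c -> nm c <= r0 -> `|U c| <= 33 * N / (1 - th).
Proof.
move=> hU hV r00 N0 th0 th1 near0 decay holo frames c0 cr; set T := 33 * N / (1 - th).
have [B B0 cut] := cutoff R.
apply/ler_addgt0Pr => e e0; set a := nm c in c0 cr *.
(* Each of the two cut-off zones contributes 8 * 16 * B e / BB, so BB = 512 B makes their sum e /
   2. *)
have [BB [BB0 BBe]] : exists BB : R, 0 < BB /\ BB = 8 * (8 * (8 * B)).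
  by exists (8 * (8 * (8 * B))); split=> //; do 3?apply: mulr_gt0.
have e1 : 0 < a * e / BB by rewrite divr_gt0// mulr_gt0.
have e2 : 0 < e / BB by rewrite divr_gt0.
have [d d0 hd] := near0 _ e1; have [M1' hM1] := decay _ e2.
(* The cut-off around the origin stays where [near0] applies and well away from [c]. *)
pose s := Num.min (d / 4) (a / 8).
have s0 : 0 < s by rewrite lt_min !divr_gt0.
have sd : 2 * s < d by have : s <= d / 4 by [rewrite ge_min lexx]; move: d0; (clear; lra).
have sa : s <= a / 8 by rewrite ge_min lexx orbT.
have [n Mn] : exists n : nat, M1' <= 2 ^+ n.+2 * r0.
  exists (Num.bound `|M1' / r0|); rewrite -ler_pdivrMr//.
  apply: le_trans (ler_norm _) _; apply: le_trans (ltW (archi_boundP (normr_ge0 _))) _.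
  rewrite -natrX ler_nat; apply: leq_trans (ltnW (ltn_expl _ (isT : (1 < 2)%N))) _.
  by rewrite leq_exp2l// -addn2 leq_addr.
pose M := 2 ^+ n.+2 * r0.
have M0 : 0 < M by rewrite mulr_gt0// exprn_gt0.
have Mr : 4 * r0 <= M.
  rewrite ler_pM2r// (_ : 4 = 2 ^+ 2); last by rewrite expr2; ring.
  by apply: ler_weXn2l => //; rewrite ler1n.
have M2s : 2 * s <= M by (clear -Mr sa cr r00; lra).
have [X [Xx [Xy [hX bX X01 X1 [bXx bXy Xz]]]]] := cut _ s0.
have [Y [Yx [Yy [hY bY Y01 Y1 [bYx bYy Yz]]]]] := cut _ M0.
have [u [ux [uy [hu eu]]]] := hU _ s0; have [v [vx [vy [hv ev]]]] := hV _ s0.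
pose psi p := Y p - X p; pose psx p := Yx p - Xx p; pose psy p := Yy p - Xy p.
have hpsi : C1 psi psx psy by exact: C1_sub.
have bpsi : bs (2 * M) psi by apply: (@psi_bs R s s0 M X Y).
have psi01' p : 0 <= psi p <= 1 by apply: (@psi01 R s M X Y).
have psi0' p : nm p <= s -> psi p = 0 by apply: (@psi0 R s s0 M X Y).
have psi1' p : 2 * s <= nm p -> nm p <= M -> psi p = 1 by apply: (@psi1 R s s0 M X Xx Xy Y).
have cu : ct u by case: hu.
have e4 : 0 < e / 4 by rewrite divr_gt0.
have [d3 d30 hd3] := cu c _ e4.
(* On the approximate point mass around [c] the function [u] varies by less than [e / 4], and both
   cut-offs are constant. *)
pose rh := Num.min (d3 / 4) (a / 16).
have rh0 : 0 < rh by rewrite lt_min !divr_gt0.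
have rhd : 2 * rh < d3 by have : rh <= d3 / 4 by [rewrite ge_min lexx]; move: d30; clear; lra.
have rha : 2 * rh <= a / 8 by have : rh <= a / 16 by [rewrite ge_min lexx orbT]; clear; lra.
pose sg := 4 * rh ^+ 2; have sg0 : 0 < sg by rewrite mulr_gt0// exprn_gt0.
pose k1 p := kk1 sg (pm p c); pose k2 p := kk2 sg (pm p c).
have hk1 : C1 k1 (fun p => kk1x sg (pm p c)) (fun p => kk1y sg (pm p c)) := C1_shift (- c.1, - c.2) (C1_kk1 sg0).
have hk2 : C1 k2 (fun p => kk2x sg (pm p c)) (fun p => kk2y sg (pm p c)) := C1_shift (- c.1, - c.2) (C1_kk2 sg0).
have hK := C1_mul hpsi hk1; have hL := C1_mul hpsi hk2.
have bK : bs (2 * M) (fun p => psi p * k1 p) by move=> p hp; rewrite bpsi// mul0r.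
have bL : bs (2 * M) (fun p => psi p * k2 p) by move=> p hp; rewrite bpsi// mul0r.
have E0 := cauchy_id hu hv hK hL bK bL.
have [cK _ _ _ _] := hK; have [cL _ _ _ _] := hL.
have E1 : `|I (fun p => psi p * k1 p * (ux p - vy p) - psi p * k2 p * (uy p + vx p))| <= T.
  apply: (cauchy_tail (n := n.+2) (s := s) (w := u) (v := v) (b := 2 * M) r00 N0 th0 th1 holo frames) => //.
  - by move=> p /eu[].
  - by move=> p /ev[].
  - by rewrite /M exprS mulrA.
  - by move: sa cr r00; rewrite -/a; clear; lra.
  - by move=> p /psi0' ->; rewrite !mul0r.
  move=> p hp; have pn : 0 < nm p by apply: lt_le_trans hp; rewrite mulr_gt0.
  have hn : nm p / 2 <= nm (pm p c).
    have := nmD (pm p c) c; rewrite ppB -/a; move: hp cr; clear; lra.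
  have hn0 : 0 < nm (pm p c) by apply: lt_le_trans hn; rewrite divr_gt0.
  have [b1 b2] := kk_bd sg0 hn0; have /andP[q0 q1] := psi01' p.
  have hi : (nm (pm p c))^-1 <= 2 / nm p by rewrite -[2 / _]invf_div lef_pV2 ?posrE// divr_gt0.
  by split; rewrite normrM (ger0_norm q0) -[leRHS]mul1r; apply: ler_pM => //; exact: le_trans hi.
rewrite E0 normrN in E1; clear E0.
pose H p := hh sg (pm p c).
pose EE p := (psx p * k1 p - psy p * k2 p) * u p - (psy p * k1 p + psx p * k2 p) * v p.
have dec : I (fun p => (psx p * k1 p + psi p * kk1x sg (pm p c) - (psy p * k2 p + psi p * kk2y sg (pm p c))) * u p -
   (psy p * k1 p + psi p * kk1y sg (pm p c) + (psx p * k2 p + psi p * kk2x sg (pm p c))) * v p) =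
   I (fun p => psi p * (H p * u p) + EE p).
  apply: Int_ext => p; have [h1 h2] := kk_dbar sg (pm p c).
  have -> : kk1x sg (pm p c) = H p + kk2y sg (pm p c) by rewrite /H -h1 subrK.
  have -> : kk1y sg (pm p c) = - kk2x sg (pm p c) by apply/eqP; rewrite -addr_eq0 h2.
  by rewrite /EE; ring.
rewrite dec in E1.
have cv : ct v by case: hv.
have [cpsi cpx cpy _ _] := hpsi; have [bpx bpy] := bs_der hpsi bpsi.
have [ck1 _ _ _ _] := hk1; have [ck2 _ _ _ _] := hk2.
have cH : ct H := ct_shift (- c.1, - c.2) (hh_ct sg0).
have lH : L (fun p => psi p * (H p * u p)).
  by apply: (L_cc (r := 2 * M)); [apply: ctM => //; exact: ctM|move=> p hp; rewrite bpsi// mul0r].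
have cE : ct EE := ctB (ctM (ctB (ctM cpx ck1) (ctM cpy ck2)) cu) (ctM (ctD (ctM cpy ck1) (ctM cpx ck2)) cv).
have bE : bs (2 * M) EE by move=> p hp; rewrite /EE bpx// bpy// !mul0r addr0 subrr !mul0r subrr.
have lE := L_cc cE bE.
rewrite IntD// in E1.
(* [EE] collects the terms with the differential of the cut-off, supported near the origin and near
   infinity. *)
have smallE : `|I EE| <= e / 2.
  pose D p := 8 * (B / s) * (a^-1 * (a * e / BB / s)) * qi (2 * s) p + 8 * (B / M) * (M^-1 * (e / BB)) * qi (2 * M) p.
  have lD : L D by apply: L1D; apply: L1Z; exact: L_qi.
  have -> : e / 2 = I D.
    rewrite (IntD (L1Z _ (L_qi (2 * s))) (L1Z _ (L_qi (2 * M)))) !IntZ; try exact: L_qi.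
    rewrite !Int_qi; [|by rewrite mulr_ge0// ltW|by rewrite mulr_ge0// ltW].
    by rewrite BBe; field; rewrite !gt_eqF.
  apply: Int_abs_le => // p.
  have z1 : 0 <= 8 * (B / s) * (a^-1 * (a * e / BB / s)).
    by do ?[apply: mulr_ge0 => //]; rewrite ?invr_ge0; exact: ltW.
  have z2 : 0 <= 8 * (B / M) * (M^-1 * (e / BB)).
    by do ?[apply: mulr_ge0 => //]; rewrite ?invr_ge0; exact: ltW.
  have D0 : 0 <= D p by apply: addr_ge0; apply: mulr_ge0 => //; exact: qi_ge0.
  have zero : psx p = 0 -> psy p = 0 -> `|EE p| <= D p.
    by move=> h1 h2; rewrite /EE h1 h2 !mul0r addr0 subrr !mul0r subrr normr0.
  have [h|h] := leP (nm p) s.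
    have [x1 x2] := Xz p (or_introl h).
    have hM : nm p <= M by apply: le_trans M2s; apply: le_trans h _; move: s0; clear; lra.
    have [y1 y2] := Yz p (or_introl hM).
    by apply: zero; rewrite /psx /psy ?x1 ?x2 ?y1 ?y2 subrr.
  have [h'|h'] := ltP (nm p) (2 * s).
    have hM : nm p <= M by apply: le_trans M2s; exact: ltW.
    have [y1 y2] := Yz p (or_introl hM).
    have pn : 0 < nm p by apply: lt_trans h.
    have [q1 q2] := hd p pn (lt_trans h' sd).
    have [u1 _ _] := eu p (ltW h); have [v1 _ _] := ev p (ltW h).
    have hn : a / 2 <= nm (pm p c).
      have := nmD (pm c p) p; rewrite ppB -/a nmN; move: h' sa c0; clear; lra.
    have hn0 : 0 < nm (pm p c) by apply: lt_le_trans hn; rewrite divr_gt0.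
    have [b1 b2] := kk_bd sg0 hn0.
    have hi : (nm (pm p c))^-1 <= 2 / a by rewrite -[2 / _]invf_div lef_pV2 ?posrE// divr_gt0.
    have hq (x : R) : `|x| <= a * e / BB / nm p -> `|x| <= a * e / BB / s.
      move=> hx; apply: (le_trans hx); apply: ler_wpM2l; first exact: ltW.
      by rewrite lef_pV2 ?posrE//; exact: ltW.
    have := @four_products R (psx p) (psy p) (k1 p) (k2 p) (u p) (v p) (B / s) (2 / a) (a * e / BB / s).
    rewrite -/(EE p) u1 v1 => h4; apply: (le_trans (h4 _ _ _ _ _ _)).
    - by rewrite /psx y1 sub0r normrN.
    - by rewrite /psy y2 sub0r normrN.
    - exact: le_trans hi.
    - exact: le_trans hi.
    - exact: hq.
    - exact: hq.
    rewrite /D qi1 ?mulr1; last exact: ltW.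
    have t1 : 0 <= 8 * (B / M) * (M^-1 * (e / BB)) * qi (2 * M) p by apply: mulr_ge0 => //; exact: qi_ge0.
    have -> : 8 * (B / s) * (a^-1 * (a * e / BB / s)) = 4 * (B / s * (2 / a * (a * e / BB / s))).
      by field; rewrite !gt_eqF.
    by rewrite lerDl.
  have [x1 x2] := Xz p (or_intror h').
  have [hM|hM] := leP (nm p) M.
    by have [y1 y2] := Yz p (or_introl hM); apply: zero; rewrite /psx /psy ?x1 ?x2 ?y1 ?y2 subrr.
  have [hM2|hM2] := leP (2 * M) (nm p).
    by have [y1 y2] := Yz p (or_intror hM2); apply: zero; rewrite /psx /psy ?x1 ?x2 ?y1 ?y2 subrr.
  have [q1 q2] := hM1 p (le_trans Mn (ltW hM)).
  have [u1 _ _] := eu p (ltW h); have [v1 _ _] := ev p (ltW h).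
  have hn : M / 2 <= nm (pm p c).
    have := nmD (pm p c) c; rewrite ppB -/a; move: hM cr Mr r00; clear; lra.
  have hn0 : 0 < nm (pm p c) by apply: lt_le_trans hn; rewrite divr_gt0.
  have [b1 b2] := kk_bd sg0 hn0.
  have hi : (nm (pm p c))^-1 <= 2 / M by rewrite -[2 / _]invf_div lef_pV2 ?posrE// divr_gt0.
  have := @four_products R (psx p) (psy p) (k1 p) (k2 p) (u p) (v p) (B / M) (2 / M) (e / BB).
  rewrite -/(EE p) u1 v1 => h4; apply: (le_trans (h4 _ _ _ _ _ _)).
  - by rewrite /psx x1 subr0.
  - by rewrite /psy x2 subr0.
  - exact: le_trans hi.
  - exact: le_trans hi.
  - exact: q1.
  - exact: q2.
  rewrite /D [qi (2 * M) p]qi1 ?mulr1; last exact: ltW.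
  have t1 : 0 <= 8 * (B / s) * (a^-1 * (a * e / BB / s)) * qi (2 * s) p by apply: mulr_ge0 => //; exact: qi_ge0.
  have -> : 8 * (B / M) * (M^-1 * (e / BB)) = 4 * (B / M * (2 / M * (e / BB))) by field; rewrite !gt_eqF.
  by rewrite lerDr.
have [lh ih] := Int_hh c rh0; rewrite -/sg -/H in lh ih.
have close : `|I (fun p => psi p * (H p * u p)) - u c * I H| <= e / 4 * I H.
  rewrite -!IntZ// -IntB//; last exact: L1Z.
  apply: Int_abs_le; [by apply: L1B => //; exact: L1Z|exact: L1Z|].
  move=> p; have [h|h] := leP (2 * rh) (nm (pm p c)).
    by rewrite /H hh_out// !(mulr0, mul0r) subrr normr0.
  have hp : a - a / 8 <= nm p.
    by have := nmD (pm c p) p; rewrite ppB -/a nmN; move: h rha; clear; lra.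
  have hp2 : nm p <= 2 * a.
    by have := nmD (pm p c) c; rewrite ppB -/a; move: h rha c0; clear; lra.
  rewrite psi1' ?mul1r; [|by move: hp sa c0; clear; lra|by move: hp2 cr Mr c0; clear; lra].
  rewrite [u c * _]mulrC -mulrBr normrM mulrC; have h0 := hh_ge0 (pm p c) sg0.
  rewrite -/(H p) in h0; rewrite (ger0_norm h0); apply: ler_wpM2r => //.
  by apply/ltW/hd3; exact: lt_trans rhd.
have cs : s <= nm c by rewrite -/a; move: sa c0; clear; lra.
have [uc _ _] := eu c cs; rewrite uc in close.
move: E1 smallE close ih; move: (I _) (I EE) (I H) => x y z.
rewrite -/T; move: (U c) => w E1 smallE close ih.
(* [z] is the mass of the approximate point mass; as it is at least 1, dividing by it does not
   increase the error. *)
have z0 : 0 < z by apply: lt_le_trans ih.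
have h1 : `|w| * z <= T + e / 2 + e / 4 * z.
  have -> : `|w| * z = `|w * z| by rewrite normrM (gtr0_norm z0).
  have := ler_normB (x + y) y; rewrite addrK => h2.
  have := ler_normB x (x - w * z); rewrite opprB addrC subrK => h3.
  by move: h2 h3 E1 smallE close; clear; lra.
have T0 : 0 <= T + e / 2 by apply: le_trans (normr_ge0 (x + y)) _; move: E1 e0; clear; lra.
have h2 : T + e / 2 <= (T + e / 2) * z by rewrite ler_peMr.
have : `|w| * z <= (T + e / 2 + e / 4) * z by rewrite mulrDl; move: h1 h2; clear; lra.
by rewrite ler_pM2r// => h3; move: h3 e0; clear; lra.
Qed.

End CauchyFormula.

(** * Inverses of maps fixing the origin *)

Section Inversion.
Variable R : realType.
Local Notation C := (R * R)%type.
Local Notation M1 := (measurableTypeR R).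
Local Notation L := (L1 (@PM R)).
Local Notation I := (Int (@PM R)).
Implicit Types (p q c : C) (r s t : R) (u v : C -> R).

(** Real part of 1 / (u + i v); [iV] is the imaginary part. The primed versions are quotient rules,
    used for either coordinate. *)
Definition iU u v p := u p / (u p ^+ 2 + v p ^+ 2).
Definition iV u v p := - v p / (u p ^+ 2 + v p ^+ 2).
Definition iU' u u' v v' p := u' p / (u p ^+ 2 + v p ^+ 2) -
  u p * (2 * (u p * u' p + v p * v' p)) / (u p ^+ 2 + v p ^+ 2) ^+ 2.
Definition iV' u u' v v' p := - v' p / (u p ^+ 2 + v p ^+ 2) +
  v p * (2 * (u p * u' p + v p * v' p)) / (u p ^+ 2 + v p ^+ 2) ^+ 2.

(** Away from the origin the squared modulus is at least some [s], so the reciprocal may be replaced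
    by the C^1 function [rcp s], to which the chain rule applies. *)
Lemma inv_EWS u ux uy v vx vy : WS u ux uy -> WS v vx vy ->
  (forall d : R, 0 < d -> exists2 s : R, 0 < s & forall p, d <= nm p -> s <= u p ^+ 2 + v p ^+ 2) ->
  EWS (iU u v) (iU' u ux v vx) (iU' u uy v vy) /\ EWS (iV u v) (iV' u ux v vx) (iV' u uy v vy).
Proof.
move=> hu hv hs.
have hm s : 0 < s -> WS (fun p => rcp s (u p * u p + v p * v p))
   (fun p => rcp' s (u p * u p + v p * v p) * (ux p * u p + u p * ux p + (vx p * v p + v p * vx p)))
   (fun p => rcp' s (u p * u p + v p * v p) * (uy p * u p + u p * uy p + (vy p * v p + v p * vy p))).
  by move=> s0; apply: WS_comp1 (WS_add (WS_mul hu hu) (WS_mul hv hv)); [exact: rcp'_cts|move=> x; exact: rcp_der].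
split=> d d0; have [s s0 h] := hs d d0.
- exists (fun p => u p * rcp s (u p * u p + v p * v p)); do 2 eexists; split; first exact: WS_mul hu (hm s s0).
  move=> p hp; have hp2 := h p hp; have t0 : u p ^+ 2 + v p ^+ 2 != 0 by rewrite gt_eqF//; exact: lt_le_trans hp2.
  by rewrite -!expr2 rcp_big// rcp'_big// /iU /iU'; split=> //; field.
- exists (fun p => - (v p * rcp s (u p * u p + v p * v p))); do 2 eexists; split; first exact: WS_opp (WS_mul hv (hm s s0)).
  move=> p hp; have hp2 := h p hp; have t0 : u p ^+ 2 + v p ^+ 2 != 0 by rewrite gt_eqF//; exact: lt_le_trans hp2.
  by rewrite -!expr2 rcp_big// rcp'_big// /iV /iV'; split=> //; field.
Qed.

(* [1 / (u + i v)] has complex derivatives those of [u + i v] divided by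
   [- (u + i v) ^ 2]. *)
Lemma inv_alg u ux uy v vx vy p : let t := u p ^+ 2 + v p ^+ 2 in
  [/\ gsq (iU' u ux v vx) (iU' u uy v vy) (iV' u ux v vx) (iV' u uy v vy) p = gsq ux uy vx vy p / t ^+ 2,
   (iU' u ux v vx p - iV' u uy v vy p) ^+ 2 + (iU' u uy v vy p + iV' u ux v vx p) ^+ 2 =
     ((ux p - vy p) ^+ 2 + (uy p + vx p) ^+ 2) / t ^+ 2 &
   iU' u ux v vx p * iV' u uy v vy p - iU' u uy v vy p * iV' u ux v vx p = (ux p * vy p - uy p * vx p) / t ^+ 2].
Proof.
move=> t; rewrite /gsq /iU' /iV' -/t; have [t0|t0] := eqVneq t 0.
  by rewrite t0 expr0n/= invr0; split; ring.
have et : t = u p ^+ 2 + v p ^+ 2 by [].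
move: t0; rewrite et => t0.
by split; field.
Qed.

Lemma nm_cmul (a b : R) p : nm (a * p.1 - b * p.2, b * p.1 + a * p.2) <= 2 * (nm (a, b) * nm p).
Proof.
have h (x y z w : R) : `|x| <= nm (a, b) -> `|y| <= nm (a, b) -> `|z| <= nm p -> `|w| <= nm p -> `|x * z| + `|y * w| <= 2 * (nm (a, b) * nm p).
  by move=> h1 h2 h3 h4; rewrite !normrM -[2]/(1 + 1) mulrDl !mul1r; apply: lerD; apply: ler_pM.
have h1 := nm1 (a, b); have h2 := nm2 (a, b); have h3 := nm1 p; have h4 := nm2 p.
rewrite nm_le /=; apply/andP; split.
  by apply: le_trans (ler_normB _ _) _; apply: h.
by apply: le_trans (ler_normD _ _) _; apply: h.
Qed.

(** The Euclidean modulus is multiplicative; the factor 2 is the cost of comparing it with the sup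
    norm. *)
Lemma nm_cmul_ge (a b : R) p : nm (a, b) * nm p / 2 <= nm (a * p.1 - b * p.2, b * p.1 + a * p.2).
Proof.
set q : C := (a * p.1 - b * p.2, b * p.1 + a * p.2); have q0 := nm_ge0 q; have a0 := nm_ge0 (a, b); have p0 := nm_ge0 p.
rewrite leNgt; apply/negP => h.
have e : nn q = nn (a, b) * nn p by rewrite /nn /q /=; ring.
have h1 := nn_le q; have h2 := nn_ge (a, b); have h3 := nn_ge p.
have h4 : (nm (a, b) * nm p) ^+ 2 <= nn q by rewrite e exprMn; apply: ler_pM => //; exact: sqr_ge0.
have h5 : nm q ^+ 2 < (nm (a, b) * nm p / 2) ^+ 2 by rewrite ltr_pXn2r// nnegrE divr_ge0// mulr_ge0.
have e4 : (nm (a, b) * nm p / 2) ^+ 2 = (nm (a, b) * nm p) ^+ 2 / 4 by field.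
rewrite e4 in h5; have := sqr_ge0 (nm q); have := sqr_ge0 (nm (a, b) * nm p).
move: h1 h4 h5; clear; lra.
Qed.

(** The pair [(p.1 / nn p, p.2 / nn p)] is the conjugate of 1 / p, and 1 / p - 1 / q = (q - p) / (p
    q); the constant 4 comes from the sup norm. *)
Lemma cdiv_bd p q : 0 < nm p -> 0 < nm q ->
  `|p.1 / nn p - q.1 / nn q| <= 4 * nm (pm q p) / (nm p * nm q) /\
  `|p.2 / nn p - q.2 / nn q| <= 4 * nm (pm q p) / (nm p * nm q).
Proof.
move=> p0 q0; have n1 := nn_gt0 p0; have n2 := nn_gt0 q0.
pose Y : C := (p.1 * q.1 - p.2 * q.2, p.2 * q.1 + p.1 * q.2).
have hY : nm Y <= 2 * (nm p * nm q) by have := nm_cmul p.1 p.2 q; rewrite -surjective_pairing.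
have pq : 0 < nm p * nm q by exact: mulr_gt0.
have key (x y : R) : `|x * Y.1 + y * Y.2| <= 4 * nm (pm q p) * (nm p * nm q) -> `|(x * Y.1 + y * Y.2) / (nn p * nn q)| <= 4 * nm (pm q p) / (nm p * nm q).
  move=> h; rewrite normrM normfV [`|nn p * _|]ger0_norm; last by rewrite mulr_ge0// nn_ge0.
  rewrite ler_pdivrMr; last exact: mulr_gt0.
  apply: (le_trans h); rewrite -[X in _ <= X]mulrA; apply: ler_wpM2l; first by rewrite mulr_ge0// nm_ge0.
  rewrite [leRHS]mulrC ler_pdivlMr// -expr2 exprMn; apply: ler_pM; [exact: sqr_ge0|exact: sqr_ge0|exact: nn_ge|exact: nn_ge].
have bd (x y : R) : `|x| <= nm (pm q p) -> `|y| <= nm (pm q p) -> `|x * Y.1 + y * Y.2| <= 4 * nm (pm q p) * (nm p * nm q).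
  move=> hx hy; apply: le_trans (ler_normD _ _) _; rewrite !normrM.
  have t (z w : R) : `|z| <= nm (pm q p) -> `|w| <= nm Y -> `|z| * `|w| <= nm (pm q p) * (2 * (nm p * nm q)).
    by move=> h1 h2; apply: ler_pM => //; exact: le_trans hY.
  by have := t _ _ hx (nm1 Y); have := t _ _ hy (nm2 Y); lra.
have h1 := nm1 (pm q p); have h2 := nm2 (pm q p).
have -> : p.1 / nn p - q.1 / nn q = ((pm q p).1 * Y.1 + (pm q p).2 * Y.2) / (nn p * nn q).
  by rewrite /nn /pm /Y /=; field; rewrite -!/(nn _) !gt_eqF.
have -> : p.2 / nn p - q.2 / nn q = (- (pm q p).2 * Y.1 + (pm q p).1 * Y.2) / (nn p * nn q).
  by rewrite /nn /pm /Y /=; field; rewrite -!/(nn _) !gt_eqF.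
by split; apply: key; apply: bd; rewrite ?normrN.
Qed.

Lemma EWS_sub U Ux Uy V Vx Vy : EWS U Ux Uy -> EWS V Vx Vy ->
  EWS (fun p => U p - V p) (fun p => Ux p - Vx p) (fun p => Uy p - Vy p :> R).
Proof.
move=> h1 h2 d d0; have [u [ux [uy [a1 a2]]]] := h1 d d0; have [v [vx [vy [b1 b2]]]] := h2 d d0.
do 3 eexists; split; first exact: WS_sub a1 b1.
by move=> p hp; have [-> -> ->] := a2 p hp; have [-> -> ->] := b2 p hp.
Qed.

Lemma EWS_opp U Ux Uy : EWS U Ux Uy -> EWS (fun p => - U p) (fun p => - Ux p) (fun p => - Uy p :> R).
Proof.
move=> h1 d d0; have [u [ux [uy [a1 a2]]]] := h1 d d0.
do 3 eexists; split; first exact: WS_opp a1.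
by move=> p hp; have [-> -> ->] := a2 p hp.
Qed.

(* The Cauchy bound is applied to [1 / (u + i v)] minus its pole. *)
Lemma inverse_bound : exists K b0 : R, [/\ 0 < K, 0 < b0 &
  forall u ux uy v vx vy (a b r0 be : R), WS u ux uy -> WS v vx vy -> u (0, 0) = 0 -> v (0, 0) = 0 ->
  (forall d : R, 0 < d -> exists2 h : R, 0 < h & forall p, nm (u p, v p) < h -> nm p < d) ->
  (forall k : R, exists M : R, forall p, nm (u p, v p) <= k -> nm p <= M) ->
  0 < r0 -> 0 < be -> be <= b0 -> 0 < nm (a, b) -> jet u (0, 0) a (- b) -> jet v (0, 0) b a ->
  {ae @PM R, forall p, gsq ux uy vx vy p <= 4 * (ux p * vy p - uy p * vx p)} ->
  {ae @PM R, forall p, (ux p - vy p) ^+ 2 + (uy p + vx p) ^+ 2 <= be ^+ 2 * gsq ux uy vx vy p} ->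
  {ae @PM R, forall p, nm p <= 2 * r0 -> ux p - vy p = 0 /\ uy p + vx p = 0} ->
  forall c, nm c <= r0 ->
    nm (u c - (a * c.1 - b * c.2), v c - (b * c.1 + a * c.2)) <= K * be * nm (a, b) * nm c].
Proof.
have [A [th2 [[A0 t20 t21] dec]]] := en_decay R.
(* Energies decay like powers of [th2], hence L^2 norms like powers of [th]. *)
pose th := Num.sqrt th2; have th0 : 0 < th by rewrite sqrtr_gt0.
have thE : th ^+ 2 = th2 by rewrite sqr_sqrtr// ltW.
have th1 : th < 1 by rewrite -(ltr_pXn2r (_ : 0 < 2)%N) ?nnegrE ?ltW// thE expr1n.
pose sA := Num.sqrt A; have sA0 : 0 < sA by rewrite sqrtr_gt0.
have sAE : sA ^+ 2 = A by rewrite sqr_sqrtr// ltW.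
have [C1_ [C10 C1E]] : exists C1_ : R, 0 < C1_ /\ C1_ = 33 / (1 - th) * sA.
  by exists (33 / (1 - th) * sA); split=> //; apply: mulr_gt0 => //; rewrite divr_gt0// subr_gt0.
have [C3 [C30 C3E]] : exists C3 : R, 0 < C3 /\ C3 = 12 * C1_ by exists (12 * C1_); split=> //; exact: mulr_gt0.
(* The threshold for [be] makes [C1_ * be] at most 1/2, so that the bootstrap contracts, and
   [C3 * be] at most 1/8, so that the final inversion is stable. *)
exists (8 * (16 * C3)), (8 * (C1_ + C3))^-1; split; first by do 2?apply: mulr_gt0.
  by rewrite invr_gt0 mulr_gt0// addr_gt0.
move=> u ux uy v vx vy a b r0 be hu hv u0 v0 inj prop r00 be0 beb nD ju jv hJ hbe hol c cr.
set D := nm (a, b) in nD *.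
have b1 : C1_ * be <= 2^-1 /\ C3 * be <= 8^-1.
  have h : be * (8 * (C1_ + C3)) <= 1 by rewrite -ler_pdivlMr ?mul1r ?mulr_gt0 ?addr_gt0.
  have h1 : 0 < C1_ * be by exact: mulr_gt0.
  have h2 : 0 < C3 * be by exact: mulr_gt0.
  by clear -h h1 h2; split; lra.
have [b1a b1b] := b1.
have hs (d : R) : 0 < d -> exists2 s : R, 0 < s & forall p, d <= nm p -> s <= u p ^+ 2 + v p ^+ 2.
  move=> d0; have [h h0 hh] := inj d d0; exists (h ^+ 2); first by rewrite exprn_gt0.
  move=> p hp; apply: (@le_trans _ _ (nn (u p, v p))); last by [].
  apply: le_trans (nn_ge _); rewrite ler_pXn2r ?nnegrE ?nm_ge0 ?(ltW h0)//.
  by rewrite leNgt; apply/negP => /hh; rewrite ltNge hp.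
pose f p : C := (u p, v p).
have fpos p : 0 < nm p -> 0 < nm (f p).
  move=> p0; have [s s0 h] := hs _ p0; have := h p (lexx _).
  rewrite lt0r nm_ge0 andbT; apply: contraTneq => /nm_eq0 [-> ->].
  by rewrite !expr0n/= addr0 leNgt s0.
have [eU eV] := inv_EWS hu hv hs.
pose lu p := a * p.1 - b * p.2; pose lv p := b * p.1 + a * p.2.
pose l p : C := (lu p, lv p).
have nl p : nm (l p) <= 2 * (D * nm p) by exact: nm_cmul.
have nl2 p : D * nm p / 2 <= nm (l p) by exact: nm_cmul_ge.
have lpos p : 0 < nm p -> 0 < nm (l p) by move=> p0; apply: lt_le_trans (nl2 p); rewrite divr_gt0// mulr_gt0.
have hlu : WS lu (fun=> a) (fun=> - b).
  apply: (WS_ext (C1_WS (C1_sub (C1_scale a (@C1_fst R)) (C1_scale b (@C1_snd R))))) => p; rewrite /lu /=; ring.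
have hlv : WS lv (fun=> b) (fun=> a).
  apply: (WS_ext (C1_WS (C1_add (C1_scale b (@C1_fst R)) (C1_scale a (@C1_snd R))))) => p; rewrite /lv /=; ring.
have hls (d : R) : 0 < d -> exists2 s : R, 0 < s & forall p, d <= nm p -> s <= lu p ^+ 2 + lv p ^+ 2.
  move=> d0; exists ((D * d / 2) ^+ 2); first by rewrite exprn_gt0// divr_gt0// mulr_gt0.
  move=> p hp; apply: (@le_trans _ _ (nn (l p))); last by [].
  apply: le_trans (nn_ge _); rewrite ler_pXn2r ?nnegrE ?nm_ge0//; last by rewrite divr_ge0// mulr_ge0// ltW.
  by apply: le_trans (nl2 p); rewrite ler_pM2r// ler_pM2l.
have [eA eB] := inv_EWS hlu hlv hls.
have eR := EWS_sub eU eA; have eS := EWS_sub eV eB.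
set RU := fun p => iU u v p - iU lu lv p in eR; set RV := fun p => iV u v p - iV lu lv p in eS.
have iUV_bd p : 0 < nm p -> `|iU u v p| <= (nm (f p))^-1 /\ `|iV u v p| <= (nm (f p))^-1.
  move=> p0; have f0 := fpos p p0.
  have q (x : R) : `|x| <= nm (f p) -> `|x / nn (f p)| <= (nm (f p))^-1.
    move=> hx; rewrite normrM normfV [`|nn _|]ger0_norm ?nn_ge0// ler_pdivrMr ?nn_gt0//.
    by apply: (le_trans hx); rewrite mulrC ler_pdivlMr// -expr2 nn_ge.
  by split; apply: q; rewrite ?normrN; [exact: (nm1 (f p))|exact: (nm2 (f p))].
have R_bd p : 0 < nm p -> `|RU p| <= 4 * nm (pm (l p) (f p)) / (nm (f p) * nm (l p)) /\
    `|RV p| <= 4 * nm (pm (l p) (f p)) / (nm (f p) * nm (l p)).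
  move=> p0; have [h1 h2] := cdiv_bd (fpos p p0) (lpos p p0); split; first exact: h1.
  rewrite /RV /iV; have -> : - v p / (u p ^+ 2 + v p ^+ 2) - - lv p / (lu p ^+ 2 + lv p ^+ 2) = - ((f p).2 / nn (f p) - (l p).2 / nn (l p)).
    by rewrite /nn /=; ring.
  by rewrite normrN.
(* [f] and its linear part agree to first order at 0, and both have modulus of order [D * nm p];
   their inverses thus differ by o(1 / |p|). *)
have near0 (e : R) : 0 < e -> exists2 d : R, 0 < d & forall p, 0 < nm p -> nm p < d ->
    `|RU p| <= e / nm p /\ `|RV p| <= e / nm p.
  move=> e0; pose e' := Num.min (D / 4) (e * D ^+ 2 / 32).
  have e'0 : 0 < e' by rewrite lt_min; apply/andP; split; rewrite divr_gt0// mulr_gt0// exprn_gt0.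
  have [d1 d10 h1] := ju _ e'0; have [d2 d20 h2] := jv _ e'0.
  exists (Num.min d1 d2); first by rewrite lt_min d10.
  move=> p p0; rewrite lt_min => /andP[p1 p2].
  have := h1 p; have := h2 p; rewrite !pm0 u0 v0 !subr0 => /(_ p2) g2 /(_ p1) g1.
  have dl : nm (pm (l p) (f p)) <= e' * nm p.
    rewrite nmN nm_le /=; apply/andP; split; first by apply: le_trans g1; rewrite /lu mulNr.
    by apply: le_trans g2; rewrite /lv.
  have e'1 : e' <= D / 4 by rewrite ge_min lexx.
  have e'2 : e' <= e * D ^+ 2 / 32 by rewrite ge_min lexx orbT.
  have fl : D * nm p / 4 <= nm (f p).
    have := nmD (pm (l p) (f p)) (f p); rewrite ppB; have := nl2 p; have := ler_wpM2r (ltW p0) e'1.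
    by clear -dl; lra.
  have Dp : 0 < D * nm p by exact: mulr_gt0.
  have fin : 4 * nm (pm (l p) (f p)) / (nm (f p) * nm (l p)) <= e / nm p.
    have m0 : 0 < nm (f p) * nm (l p) by rewrite mulr_gt0 ?fpos ?lpos.
    rewrite ler_pdivrMr//; apply: (@le_trans _ _ (e / nm p * (D * nm p / 4 * (D * nm p / 2)))); last first.
      apply: ler_wpM2l; first by rewrite divr_ge0 ?ltW.
      by apply: ler_pM => //; rewrite divr_ge0// ltW.
    have -> : e / nm p * (D * nm p / 4 * (D * nm p / 2)) = 4 * (e * D ^+ 2 / 32 * nm p) by field; rewrite gt_eqF.
    rewrite ler_pM2l//; apply: (le_trans dl); apply: ler_wpM2r => //; exact: ltW.
  by have [q1 q2] := R_bd p p0; split; [exact: le_trans fin|exact: le_trans fin].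
have fbig (e : R) : 0 < e -> exists2 M : R, 0 < M & forall p, M <= nm p -> (nm (f p))^-1 <= e.
  move=> e0; have [M hM] := prop e^-1; exists (`|M| + 1); first by rewrite ltr_wpDl.
  move=> p hp; have k : e^-1 < nm (f p).
    rewrite ltNge; apply/negP => /hM h; by have := le_trans hp (le_trans h (ler_norm _)); rewrite gerDl ler10.
  by rewrite -[e]invrK lef_pV2 ?posrE ?invr_gt0//; [exact: ltW|apply: lt_trans k; rewrite invr_gt0].
have decU (e : R) : 0 < e -> exists M, forall p, M <= nm p -> `|iU u v p| <= e.
  move=> e0; have [M M0 hM] := fbig e e0; exists M => p hp.
  by have [h1 _] := iUV_bd p (lt_le_trans M0 hp); apply: le_trans h1 (hM p hp).
have A_bd p : 0 < nm p -> `|iU lu lv p| <= 2 / (D * nm p) /\ `|iV lu lv p| <= 2 / (D * nm p).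
  move=> p0; have f0 := lpos p p0.
  have q (x : R) : `|x| <= nm (l p) -> `|x / nn (l p)| <= 2 / (D * nm p).
    move=> hx; apply: (@le_trans _ _ ((nm (l p))^-1)).
      rewrite normrM normfV [`|nn _|]ger0_norm ?nn_ge0// ler_pdivrMr ?nn_gt0//.
      by apply: (le_trans hx); rewrite mulrC ler_pdivlMr// -expr2 nn_ge.
    by rewrite -[2 / _]invf_div lef_pV2 ?posrE// divr_gt0// mulr_gt0.
  by split; apply: q; rewrite ?normrN; [exact: (nm1 (l p))|exact: (nm2 (l p))].
have decR (e : R) : 0 < e -> exists M, forall p, M <= nm p -> `|RU p| <= e /\ `|RV p| <= e.
  move=> e0; have e20 : 0 < e / 2 by rewrite divr_gt0.
  have [M M0 hM] := fbig _ e20; exists (Num.max M (4 / (D * e))) => p; rewrite ge_max => /andP[h1 h2].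
  have p0 := lt_le_trans M0 h1; have [i1 i2] := iUV_bd p p0; have [a1 a2] := A_bd p p0.
  have h3 : 2 / (D * nm p) <= e / 2.
    have De : 0 < D * e by exact: mulr_gt0.
    have Dp : 0 < D * nm p by exact: mulr_gt0.
    rewrite (ler_pdivrMr _ _ Dp); move: h2; rewrite (ler_pdivrMr _ _ De); clear; lra.
  have h4 := hM p h1.
  by split; (apply: le_trans (ler_normB _ _) _); [move: i1 a1|move: i2 a2]; clear -h3 h4; lra.
have hJF : {ae @PM R, forall p, 0 < nm p -> gsq (iU' u ux v vx) (iU' u uy v vy) (iV' u ux v vx) (iV' u uy v vy) p <=
   4 * (iU' u ux v vx p * iV' u uy v vy p - iU' u uy v vy p * iV' u ux v vx p)}.
  apply: (ae_imp hJ) => p h _; have [-> _ ->] := inv_alg u ux uy v vx vy p.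
  by rewrite mulrA ler_wpM2r// invr_ge0 sqr_ge0.
have PQA p : (iU' lu (fun=> a) lv (fun=> b) p - iV' lu (fun=> - b) lv (fun=> a) p) = 0 /\
   (iU' lu (fun=> - b) lv (fun=> a) p + iV' lu (fun=> a) lv (fun=> b) p) = 0.
  have [_ h _] := inv_alg lu (fun=> a) (fun=> - b) lv (fun=> b) (fun=> a) p.
  move: h; rewrite subrr addNr !expr0n/= addr0 mul0r => /eqP.
  by rewrite paddr_eq0 ?sqr_ge0// !sqrf_eq0 => /andP[/eqP-> /eqP->].
(* Bound for the inverse of the linear part on the frame between [r0 / 2] and [r0]. *)
pose K0 := 4 / (D * r0); have K00 : 0 < K0 by rewrite divr_gt0// mulr_gt0.
pose valid s := forall p, r0 / 2 <= nm p -> nm p <= r0 -> `|iU u v p| <= s.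
have A_bd2 p : r0 / 2 <= nm p -> `|iU lu lv p| <= K0 /\ `|iV lu lv p| <= K0.
  move=> hp; have p0 : 0 < nm p by apply: lt_le_trans hp; rewrite divr_gt0.
  have h : 2 / (D * nm p) <= K0.
    have -> : K0 = 2 / (D * (r0 / 2)) by rewrite /K0; field; rewrite !gt_eqF.
    rewrite ler_pM2l// lef_pV2 ?posrE; [by rewrite ler_pM2l|exact: mulr_gt0|by apply: mulr_gt0 => //; rewrite divr_gt0].
  by have [h1 h2] := A_bd p p0; split; [exact: le_trans h|exact: le_trans h].
(* The energy decay bounds the frames in terms of [s], distortion inserts the factor [be], and the
   Cauchy bound turns this into a pointwise bound on the remainder. *)
have Rbound s : 0 < s -> valid s -> forall p, 0 < nm p -> nm p <= r0 -> `|RU p| <= C1_ * be * s /\ `|RV p| <= C1_ * be * s.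
  move=> s0 vs p p0 pr.
  have hen := dec _ _ _ _ _ _ r0 s eU eV hJF decU r00 (ltW s0) vs.
  pose N := be * sA * s; have N0 : 0 < N by rewrite !mulr_gt0.
  have E : 33 * N / (1 - th) = C1_ * be * s by rewrite C1E /N; ring.
  pose Px q := iU' u ux v vx q - iU' lu (fun=> a) lv (fun=> b) q; pose Py q := iU' u uy v vy q - iU' lu (fun=> - b) lv (fun=> a) q.
  pose Qx q := iV' u ux v vx q - iV' lu (fun=> a) lv (fun=> b) q; pose Qy q := iV' u uy v vy q - iV' lu (fun=> - b) lv (fun=> a) q.
  have eP q : Px q - Qy q = iU' u ux v vx q - iV' u uy v vy q.
    by have [h _] := PQA q; move/eqP: h; rewrite subr_eq0 => /eqP h; rewrite /Px /Qy h; ring.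
  have eQ q : Py q + Qx q = iU' u uy v vy q + iV' u ux v vx q.
    by have [_ h] := PQA q; move/eqP: h; rewrite addr_eq0 => /eqP h; rewrite /Py /Qx h; ring.
  have holo : {ae @PM R, forall q, 0 < nm q -> nm q <= 2 * r0 -> Px q - Qy q = 0 /\ Py q + Qx q = 0}.
    apply: (ae_imp hol) => q h _ hq; have [h1 h2] := h hq; rewrite eP eQ.
    have [_ h3 _] := inv_alg u ux uy v vx vy q; move: h3; rewrite h1 h2 !expr0n/= addr0 mul0r => /eqP.
    by rewrite paddr_eq0 ?sqr_ge0// !sqrf_eq0 => /andP[/eqP-> /eqP->].
  have frames (k : nat) : I (fun q => ((Px q - Qy q) ^+ 2 + (Py q + Qx q) ^+ 2) * (qi (2 ^+ k.+2 * r0) q - qi (2 ^+ k.+1 * r0) q)) <= (th ^+ k * N) ^+ 2.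
    have rk0 : 0 < 2 ^+ k.+1 * r0 by rewrite mulr_gt0// exprn_gt0.
    have rkS : 2 ^+ k.+1 * r0 <= 2 ^+ k.+2 * r0 by rewrite [2 ^+ k.+2]exprS -mulrA ler_peMl ?ler1n// ltW.
    have [w [wx [wy [[_ lwx lwy _] ew]]]] := eU _ rk0; have [z [zx [zy [[_ lzx lzy _] ez]]]] := eV _ rk0.
    have lG := L_gsq (2 ^+ k.+1 * r0) (2 ^+ k.+2 * r0) lwx lwy lzx lzy.
    have eqs q : 2 ^+ k.+1 * r0 <= nm q -> [/\ wx q = iU' u ux v vx q, wy q = iU' u uy v vy q, zx q = iV' u ux v vx q & zy q = iV' u uy v vy q].
      by move=> hq; have [_ ? ?] := ew q hq; have [_ ? ?] := ez q hq.
    have := hen k.+1; rewrite -(en_ext eqs rkS) => hk.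
    have off q : nm q < 2 ^+ k.+1 * r0 -> qi (2 ^+ k.+2 * r0) q - qi (2 ^+ k.+1 * r0) q = 0 :> R.
      by move=> hq; rewrite !qi1 ?subrr//; [exact: ltW|apply: le_trans rkS; exact: ltW].
    have lPQ : L (fun q => ((Px q - Qy q) ^+ 2 + (Py q + Qx q) ^+ 2) * (qi (2 ^+ k.+2 * r0) q - qi (2 ^+ k.+1 * r0) q)).
      have [_ m1] := L2l_sub lwx lzy; have [_ m2] := L2l_add lwy lzx.
      apply: (L1_ext _ (L1B (L1D (m1 (2 ^+ k.+2 * r0)) (m2 (2 ^+ k.+2 * r0))) (L1D (m1 (2 ^+ k.+1 * r0)) (m2 (2 ^+ k.+1 * r0))))) => q.
      have [hq|hq] := leP (2 ^+ k.+1 * r0) (nm q).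
        by have [-> -> -> ->] := eqs q hq; rewrite eP eQ; ring.
      by rewrite (off q hq) mulr0 -[LHS]/(_ * _ + _ * _ - _) -mulrDl -mulrDl -mulrBr (off q hq) mulr0.
    apply: (@le_trans _ _ (I (fun q => be ^+ 2 * (gsq wx wy zx zy q * (qi (2 ^+ k.+2 * r0) q - qi (2 ^+ k.+1 * r0) q))))).
      apply: Int_le_ae => //; first exact: L1Z.
      apply: (ae_imp hbe) => q h; have [hq|hq] := ltP (nm q) (2 ^+ k.+1 * r0); first by rewrite off// !mulr0.
      have [w1 w2 z1 z2] := eqs q hq; rewrite eP eQ mulrA; apply: ler_wpM2r; first by rewrite subr_ge0; exact: qi_mono.
      have [g1 -> _] := inv_alg u ux uy v vx vy q.
      rewrite /gsq w1 w2 z1 z2 -/(gsq _ _ _ _ q) g1 mulrA; apply: ler_wpM2r => //.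
      by rewrite invr_ge0 sqr_ge0.
    rewrite IntZ// -/(en _ _ _ _ _ _).
    apply: (@le_trans _ _ (be ^+ 2 * (th2 ^+ k.+1 * (A * s ^+ 2)))); first by apply: ler_wpM2l; [exact: sqr_ge0|].
    have -> : (th ^+ k * N) ^+ 2 = be ^+ 2 * (th2 ^+ k * (A * s ^+ 2)).
      have ek : th2 ^+ k = (th ^+ k) ^+ 2 by rewrite -thE -!exprM mulnC.
      by rewrite ek /N -[A]sAE; ring.
    apply: ler_wpM2l; first exact: sqr_ge0.
    apply: ler_wpM2r; first by rewrite mulr_ge0 ?sqr_ge0// ltW.
    by rewrite exprS ler_piMl ?exprn_ge0 ?ltW.
  have F1 := cauchy_bound eR eS r00 N0 th0 th1 near0 decR holo frames p0 pr.
  (* Multiplying by - i turns [(RU, RV)] into [(RV, - RU)], which satisfies the same hypotheses; the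
     Cauchy bound then controls [RV]. *)
  have near0' (e : R) : 0 < e -> exists2 d : R, 0 < d & forall q, 0 < nm q -> nm q < d ->
      `|RV q| <= e / nm q /\ `|- RU q| <= e / nm q.
    by move=> /near0[d d0 h]; exists d => // q q0 qd; have [] := h q q0 qd; rewrite normrN.
  have decR' (e : R) : 0 < e -> exists M, forall q, M <= nm q -> `|RV q| <= e /\ `|- RU q| <= e.
    by move=> /decR[M h]; exists M => q hq; have [] := h q hq; rewrite normrN.
  have holo' : {ae @PM R, forall q, 0 < nm q -> nm q <= 2 * r0 -> Qx q - - Py q = 0 /\ Qy q + - Px q = 0}.
    apply: (ae_imp holo) => q h q0 hq; have [h1 h2] := h q0 hq; rewrite opprK addrC h2; split=> //.
    by rewrite -opprB h1 oppr0.
  have frames' (k : nat) : I (fun q => ((Qx q - - Py q) ^+ 2 + (Qy q + - Px q) ^+ 2) * (qi (2 ^+ k.+2 * r0) q - qi (2 ^+ k.+1 * r0) q)) <= (th ^+ k * N) ^+ 2.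
    by apply: le_trans (frames k); rewrite le_eqVlt; apply/orP; left; apply/eqP; apply: Int_ext => q; ring.
  have F2 := cauchy_bound eS (EWS_opp eR) r00 N0 th0 th1 near0' decR' holo' frames' p0 pr.
  by rewrite E in F1 F2.
(* Bootstrap: a bound [s] on the frame yields the bound [K0 + s / 2]. The starting bound [s0]
   depends on [f]; its contribution is halved at each step. *)
have improve s : 0 < s -> valid s -> valid (K0 + s / 2).
  move=> s0 vs p h1 h2; have p0 : 0 < nm p by apply: lt_le_trans h1; rewrite divr_gt0.
  have [r1 _] := Rbound s s0 vs p p0 h2; have [a1 _] := A_bd2 p h1.
  have -> : iU u v p = iU lu lv p + RU p by rewrite /RU addrC subrK.
  apply: le_trans (ler_normD _ _) _; apply: lerD => //; apply: (le_trans r1).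
  by rewrite mulrC ler_pM2l.
have [s0 s00 vs0] : exists2 s0 : R, 0 < s0 & valid s0.
  have d0 : 0 < r0 / 2 by rewrite divr_gt0.
  have [h h0 hh] := inj _ d0; exists h^-1; first by rewrite invr_gt0.
  move=> p h1 h2; have p0 : 0 < nm p by apply: lt_le_trans h1.
  have [i1 _] := iUV_bd p p0; apply: (le_trans i1); rewrite lef_pV2 ?posrE ?fpos//.
  by rewrite leNgt; apply/negP => /hh; rewrite ltNge h1.
have iter n : valid (2 * K0 + s0 / 2 ^+ n) .
  elim: n => [|n IH] p h1 h2.
    by apply: le_trans (vs0 p h1 h2) _; rewrite expr0 divr1 lerDr mulr_ge0// ltW.
  have sp : 0 < 2 * K0 + s0 / 2 ^+ n by apply: addr_gt0; [exact: mulr_gt0|apply: divr_gt0 => //; exact: exprn_gt0].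
  apply: le_trans (improve _ sp IH p h1 h2) _; rewrite le_eqVlt; apply/orP; left; apply/eqP.
  by rewrite exprS; field; rewrite expf_neq0.
(* Finitely many steps bring the part due to [s0] below [K0]; from here on the bound no longer
   depends on [f] beyond [D]. *)
have v3 : valid (3 * K0).
  pose n := Num.bound (s0 / K0); move=> p h1 h2; apply: le_trans (iter n p h1 h2) _.
  have hn : s0 / K0 <= 2 ^+ n.
    apply: le_trans (ltW (archi_boundP _)) _; first by rewrite divr_ge0 ?ltW.
    by rewrite -natrX ler_nat ltnW// ltn_expl.
  have : s0 / 2 ^+ n <= K0 by rewrite ler_pdivrMr ?exprn_gt0// mulrC -ler_pdivrMr.
  clear; lra.
have K30 : 0 < 3 * K0 by rewrite mulr_gt0.
have [c0|c0] := leP (nm c) 0.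
  have -> : c = (0, 0) by apply: nm_eq0; apply/eqP; rewrite eq_le c0 nm_ge0.
  rewrite u0 v0 /= !mulr0 subrr addr0 subr0.
  have -> : nm ((0 : R), (0 : R)) = 0 by rewrite /nm /= normr0 maxxx.
  by rewrite mulr0.
have [rb1 rb2] := Rbound _ K30 v3 c c0 cr.
have lc := lpos c c0; have fc := fpos c c0.
(* Conjugated inverses of the linear part and of [f] at [c]. Inverting once more returns to [f]: a
   difference of order [be / (D * r0)] becomes one of order [be * D * nm c], because
   [nm c <= r0]. *)
pose FA : C := (iU lu lv c, - iV lu lv c); pose FF : C := (iU u v c, - iV u v c).
have invn (z : C) : 0 < nm z -> forall w : C, w = (z.1 / nn z, z.2 / nn z) -> [/\ nn w = (nn z)^-1, z = (w.1 / nn w, w.2 / nn w) & (2 * nm z)^-1 <= nm w].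
  move=> z0 w ->; have n0 := nn_gt0 z0.
  have e : nn (z.1 / nn z, z.2 / nn z) = (nn z)^-1.
    by rewrite {1}/nn /= -[nn z]/(z.1 ^+ 2 + z.2 ^+ 2); field; rewrite -/(nn z) gt_eqF.
  split=> //.
    rewrite e /= invrK; case: (z) n0 => x y n0 /=; congr (_, _); field; rewrite gt_eqF//.
  have e2 : nm (z.1 / nn z, z.2 / nn z) = nm z / nn z.
    rewrite /nm /= !normrM normfV [`|nn z|]ger0_norm ?nn_ge0// -maxr_pMl ?invr_ge0 ?nn_ge0//.
  rewrite e2 ler_pdivlMr// mulrC ler_pdivrMr ?mulr_gt0//.
  by have := nn_le z; rewrite expr2; clear; lra.
have fAe : FA = ((l c).1 / nn (l c), (l c).2 / nn (l c)) by rewrite /FA /iU /iV /= mulNr opprK.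
have fFe : FF = ((f c).1 / nn (f c), (f c).2 / nn (f c)) by rewrite /FF /iU /iV /= mulNr opprK.
have [_ lE lA] := invn _ lc _ fAe; have [_ fE lF] := invn _ fc _ fFe.
have dFA : nm (pm FA FF) <= C3 * be / (D * r0).
  have E : C1_ * be * (3 * K0) = C3 * be / (D * r0) by rewrite C3E /K0; ring.
  rewrite -E nmN nm_le /=; apply/andP; split; first exact: rb1.
  have -> : - iV u v c - - iV lu lv c = - RV c by rewrite /RV; ring.
  by rewrite normrN; exact: rb2.
have Dc : 0 < D * nm c by exact: mulr_gt0.
have lA2 : (4 * (D * nm c))^-1 <= nm FA.
  apply: le_trans lA; rewrite lef_pV2 ?posrE ?mulr_gt0//; have := nl c; clear -Dc; lra.
(* The two inverses differ by at most half the lower bound for [FA], so [FF] keeps a lower bound of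
   the same order. *)
have small : C3 * be / (D * r0) <= (8 * (D * nm c))^-1.
  rewrite [leRHS]invfM; apply: ler_pM => //; first by apply: mulr_ge0; exact: ltW.
    by rewrite invr_ge0 mulr_ge0// ltW.
  by rewrite lef_pV2 ?posrE ?mulr_gt0// ler_pM2l.
have e48 : (4 * (D * nm c))^-1 = 2 * (8 * (D * nm c))^-1 by field; rewrite !gt_eqF.
have lF2 : (8 * (D * nm c))^-1 <= nm FF.
  have := nmD (pm FA FF) FF; rewrite ppB; move: dFA small lA2; rewrite e48; clear; lra.
have i8 : 0 < (8 * (D * nm c))^-1 by rewrite invr_gt0 mulr_gt0.
have FA0 : 0 < nm FA by apply: lt_le_trans lA2; rewrite invr_gt0 mulr_gt0.
have FF0 : 0 < nm FF by apply: lt_le_trans lF2.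
have [g1 g2] := cdiv_bd FF0 FA0.
have tot : 4 * nm (pm FA FF) / (nm FF * nm FA) <= 8 * (16 * C3) * be * D * nm c.
  rewrite ler_pdivrMr ?mulr_gt0//.
  apply: (@le_trans _ _ (8 * (16 * C3) * be * D * nm c * ((8 * (D * nm c))^-1 * (4 * (D * nm c))^-1))); last first.
    apply: ler_wpM2l; first by do ?[apply: mulr_ge0 => //]; exact: ltW.
    by apply: ler_pM => //; rewrite invr_ge0 mulr_ge0// ltW.
  have -> : 8 * (16 * C3) * be * D * nm c * ((8 * (D * nm c))^-1 * (4 * (D * nm c))^-1) = 4 * (C3 * be / (D * nm c)).
    by field; rewrite !gt_eqF.
  rewrite ler_pM2l//; apply: (le_trans dFA); apply: ler_wpM2l; first by apply: mulr_ge0; exact: ltW.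
  by rewrite lef_pV2 ?posrE ?mulr_gt0// ler_pM2l.
rewrite nm_le; apply/andP; split; apply: le_trans tot.
  by apply: le_trans g1; have := congr1 fst fE; have := congr1 fst lE; rewrite /= => <- <-.
by apply: le_trans g2; have := congr1 snd fE; have := congr1 snd lE; rewrite /= => <- <-.
Qed.

End Inversion.

Lemma ae_and d (T : measurableType d) (R : realType) (m : {measure set T -> \bar R}) (P Q : T -> Prop) :
  {ae m, forall x, P x} -> {ae m, forall x, Q x} -> {ae m, forall x, P x /\ Q x}.
Proof. by move=> hP hQ; apply: filterS2 hP hQ => x. Qed.

(** * Distortion and Cauchy-Riemann equations for quasiconformal maps *)

Section PlaneMaps.
Variable R : realType.
Local Notation C := (R * R)%type.
Local Notation M1 := (measurableTypeR R).
Local Notation I := (Int (@PM R)).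
Implicit Types (p q c z w h D : C) (f : C -> C).

Lemma enorm_ge0 p : 0 <= enorm p. Proof. exact: sqrtr_ge0. Qed.

Lemma enorm2 p : enorm p ^+ 2 = p.1 ^+ 2 + p.2 ^+ 2.
Proof. by rewrite sqr_sqrtr// addr_ge0// sqr_ge0. Qed.

Lemma enorm_le p (k : R) : 0 <= k -> p.1 ^+ 2 + p.2 ^+ 2 <= k ^+ 2 -> enorm p <= k.
Proof. by move=> k0 h; rewrite -(ler_pXn2r (_ : 0 < 2)%N) ?nnegrE ?enorm_ge0// enorm2. Qed.

Lemma enorm_cmul p q : enorm (cmul p q) = enorm p * enorm q.
Proof.
rewrite /enorm -sqrtrM; last by rewrite addr_ge0// sqr_ge0.
by congr Num.sqrt; rewrite /cmul /=; ring.
Qed.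

Lemma enormD p q : enorm (pp p q) <= enorm p + enorm q.
Proof.
apply: enorm_le; first by rewrite addr_ge0// enorm_ge0.
have e1 := enorm2 p; have e2 := enorm2 q; have a0 := enorm_ge0 p; have b0 := enorm_ge0 q.
suff : p.1 * q.1 + p.2 * q.2 <= enorm p * enorm q by move=> h; rewrite [leRHS]sqrrD {}e1 {}e2 /pp /=; move: (enorm p * enorm q) h => k h; nra.
have [h|h] := lerP (p.1 * q.1 + p.2 * q.2) 0; first by apply: le_trans h _; exact: mulr_ge0.
rewrite -(ler_pXn2r (_ : 0 < 2)%N) ?nnegrE ?mulr_ge0 ?(ltW h)// exprMn e1 e2.
have := sqr_ge0 (p.1 * q.2 - p.2 * q.1); nra.
Qed.

Lemma nm_enorm p : nm p <= enorm p.
Proof.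
rewrite nm_le; apply/andP; split; rewrite -(ler_pXn2r (_ : 0 < 2)%N) ?nnegrE ?enorm_ge0// enorm2 real_normK ?num_real//.
  by rewrite lerDl sqr_ge0.
by rewrite lerDr sqr_ge0.
Qed.

Lemma enorm_nm p : enorm p <= 2 * nm p.
Proof.
apply: enorm_le; first by rewrite mulr_ge0// nm_ge0.
by apply: le_trans (nn_le p) _; rewrite exprMn ler_wpM2r ?sqr_ge0// expr2 ler_peMl// ler1n.
Qed.

Lemma enorm_opp p : enorm (- p.1, - p.2) = enorm p.
Proof. by rewrite /enorm /= !sqrrN. Qed.

Lemma enormC p q : enorm (pm p q) = enorm (pm q p).
Proof. by rewrite -enorm_opp /pm /= !opprB. Qed.

Lemma enormB p q : enorm (pm p q) <= enorm p + enorm q.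
Proof. by rewrite -(enorm_opp q); exact: (enormD p (- q.1, - q.2)). Qed.

Lemma enorm_tri p q c : enorm (pm p q) <= enorm (pm p c) + enorm (pm c q).
Proof. by apply: le_trans _ (enormD _ _); rewrite /pm /pp /= !addrA !subrK. Qed.

Lemma enorm_eq0 p : enorm p = 0 -> p = (0, 0).
Proof. by move=> h; apply: nm_eq0; apply/eqP; rewrite eq_le nm_ge0 -h nm_enorm. Qed.

Lemma enorm0 : enorm ((0, 0) : C) = 0.
Proof. by apply/eqP; rewrite eq_le enorm_ge0 andbT; apply: enorm_le => //=; rewrite expr0n /= addr0. Qed.

Definition cjet f z D := jet (fun p => (f p).1) z D.1 (- D.2) /\ jet (fun p => (f p).2) z D.2 D.1.

Lemma conf_jet f z : conformal_on (@unit_disk R) f -> nn z < 1 -> exists D, cjet f z D.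
Proof.
move=> hf hz; have [w hw] := hf z hz; exists w.
have key e : 0 < e -> exists2 d : R, 0 < d & forall q, nm (pm q z) < d ->
    nm (pm (pm (f q) (f z)) (cmul w (pm q z))) <= e * nm (pm q z).
  move=> e0; have e20 : 0 < e / 2 by rewrite divr_gt0.
  have wA : nbhs w [set q : C | nm (pm q w) < e / 2] by apply/nbhs_nmP; exists (e / 2).
  have /nbhs_nmP[d d0 hd] := hw _ wA.
  exists d => // q hq; have [E|nE] := eqVneq (pm q z) (0, 0).
    have : q = z by move: E; rewrite /pm [q]surjective_pairing [z]surjective_pairing /= => -[/subr0_eq -> /subr0_eq ->].
    move=> ->; rewrite /pm /cmul /= !subrr !mulr0 !subrr addr0 subrr.
    by rewrite /nm /= normr0 maxxx mulr0.
  have hq' : nm (pm (pm q z) (0, 0)) < d by rewrite /pm /= !subr0.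
  have := hd _ hq' nE; rewrite /=.
  have E1 : z.1 + (q.1 - z.1) = q.1 by ring.
  have E2 : z.2 + (q.2 - z.2) = q.2 by ring.
  rewrite E1 E2 -!surjective_pairing.
  have h0 : 0 < (q.1 - z.1) ^+ 2 + (q.2 - z.2) ^+ 2.
    rewrite lt_neqAle addr_ge0 ?sqr_ge0// andbT; apply: contraNneq nE => /esym/eqP.
    by rewrite paddr_eq0 ?sqr_ge0// !sqrf_eq0 /pm => /andP[/eqP-> /eqP->].
  set a := cmul _ _ => ha.
  have aE : cmul a (pm q z) = pm (f q) (f z).
    rewrite /a /cmul /cinv /pm /=.
    by congr pair; field; rewrite gt_eqF.
  rewrite -aE (_ : pm _ _ = cmul (pm a w) (pm q z)); last by rewrite /pm /cmul /=; congr pair; ring.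
  have := nm_cmul (pm a w).1 (pm a w).2 (pm q z).
  rewrite -surjective_pairing (_ : (_ - _, _) = cmul (pm a w) (pm q z)); last by rewrite /cmul; congr pair; ring.
  move=> hh; apply: le_trans hh _; have := nm_ge0 (pm q z) => n0; (clear -n0 ha; nra).
split=> e /key[d d0 hd]; exists d => // q /hd; rewrite nm_le => /andP[h1 h2].
  by apply: le_trans _ h1; rewrite /pm /cmul /= mulNr.
by apply: le_trans _ h2; rewrite /pm /cmul /= (addrC (_.2 * _)).
Qed.

Lemma conv_sub u v s p : 0 < s -> Ll u -> Ll v -> conv (fun q => u q - v q) (rho s) p = conv u (rho s) p - conv v (rho s) p.
Proof.
move=> s0 hu hv; rewrite /conv -IntB; last 2 first.
- by apply: conv_L => //; [exact: rho_ct|exact: rho_bs].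
- by apply: conv_L => //; [exact: rho_ct|exact: rho_bs].
by apply: Int_ext => q; rewrite mulrBl.
Qed.

(** By [jet_conv] the mollified weak gradients tend to the pointwise derivative at every point of
    the disc. The mollified Cauchy-Riemann defects therefore tend to 0 there, and [conv0_ae]
    applies. *)
Lemma conf_CR u ux uy v vx vy : WS u ux uy -> WS v vx vy ->
  (forall z, nn z < 1 -> exists D, jet u z D.1 (- D.2) /\ jet v z D.2 D.1) ->
  {ae @PM R, forall p, nn p < 1 -> ux p - vy p = 0 /\ uy p + vx p = 0}.
Proof.
move=> hu hv hj; have [_ lux luy _] := hu; have [_ lvx lvy _] := hv.
have mD : measurable ([set p : C | nn p < 1] : set (M1 * M1)).
  have cn : ct (@nn R) by apply: ctD; rewrite /=; apply: ctM; (exact: ct1 || exact: ct2).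
  have mn := meas_ct cn.
  rewrite (_ : [set p | _] = (@nn R) @^-1` `]-oo, 1[%classic); first by rewrite -[_ @^-1` _]setTI; exact: mn.
  by apply/seteqP; split=> p /=; rewrite in_itv.
have A1 : {ae @PM R, forall p, nn p < 1 -> ux p - vy p = 0}.
  apply: (conv0_ae (L2l_sub lux lvy) mD) => c /hj[D [ju jv]] e e0.
  have e20 : 0 < e / 2 by rewrite divr_gt0.
  have [d1 d10 h1] := jet_conv hu ju e20; have [d2 d20 h2] := jet_conv hv jv e20.
  exists (Num.min d1 d2); first by rewrite lt_min d10.
  move=> s; rewrite lt_min => /and3P[s0 s1 s2].
  have [|a1 _] := h1 s; first by rewrite s0.
  have [|_ a2] := h2 s; first by rewrite s0.
  rewrite conv_sub//; try exact: L2l_Ll.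
  rewrite (_ : _ - _ = (conv ux (rho s) c - D.1) - (conv vy (rho s) c - D.1)); last by ring.
  by apply: le_trans (ler_normB _ _) _; (clear -a2 a1; lra).
have A2 : {ae @PM R, forall p, nn p < 1 -> uy p - - vx p = 0}.
  apply: (conv0_ae (L2l_sub luy (L2l_opp lvx)) mD) => c /hj[D [ju jv]] e e0.
  have e20 : 0 < e / 2 by rewrite divr_gt0.
  have [d1 d10 h1] := jet_conv hu ju e20; have [d2 d20 h2] := jet_conv hv jv e20.
  exists (Num.min d1 d2); first by rewrite lt_min d10.
  move=> s; rewrite lt_min => /and3P[s0 s1 s2].
  have [|_ a1] := h1 s; first by rewrite s0.
  have [|a2 _] := h2 s; first by rewrite s0.
  rewrite conv_sub//; try exact: L2l_Ll; last exact/L2l_Ll/L2l_opp.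
  have -> : conv (fun q => - vx q) (rho s) c = - conv vx (rho s) c.
    have Z0 : L2l (fun=> 0 : R) by apply: L2l_ct; exact: ct_cst.
    have := conv_sub c s0 (L2l_Ll Z0) (L2l_Ll lvx).
    rewrite /conv (_ : I (fun q => 0 * _) = 0); last first.
      by rewrite -[RHS](Int0 (@PM R)); apply: Int_ext => q; exact: mul0r.
    by rewrite sub0r => <-; apply: Int_ext => q; rewrite sub0r.
  rewrite (_ : _ - _ = (conv uy (rho s) c - - D.2) + (conv vx (rho s) c - D.2)); last by ring.
  by apply: le_trans (ler_normD _ _) _; (clear -a2 a1; lra).
apply: (ae_imp (ae_and A1 A2)) => p [a1 a2] hp; split; first exact: a1.
by rewrite -{1}(opprK (vx p)); exact: a2.
Qed.

(** [E], [F], [G] are the coefficients of the first fundamental form. The product of [S - 2 * J] and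
    [S + 2 * J] is [(E - G) ^+ 2 + (2 * F) ^+ 2], of order [e ^+ 2 * S ^+ 2]. As [J] is nonnegative
    the second factor is at least [S], so the first one is O([e ^+ 2 * S]). *)
Lemma distort (E G F J e S : R) : 0 <= e <= 1 / 10 -> 0 <= J -> J ^+ 2 = E * G - F ^+ 2 -> S = E + G ->
  0 <= E -> 0 <= G ->
  E <= (1 + e) ^+ 2 * G -> G <= (1 + e) ^+ 2 * E ->
  E + G + 2 * F <= (1 + e) ^+ 2 * (E + G - 2 * F) -> E + G - 2 * F <= (1 + e) ^+ 2 * (E + G + 2 * F) ->
  S - 2 * J <= 9 * e ^+ 2 * S /\ S <= 4 * J.
Proof.
move=> /andP[e0 e1] J0 JE -> E0 G0 h1 h2 h3 h4.
pose k := (1 + e) ^+ 2 - 1.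
have k0 : 0 <= k by rewrite /k; nra.
have k3 : k <= 21 / 10 * e by rewrite /k; nra.
have kE : (1 + e) ^+ 2 = 1 + k by rewrite /k; ring.
rewrite kE in h1 h2 h3 h4.
have S0 : 0 <= E + G by exact: addr_ge0.
have a1 : `|E - G| <= k * (E + G) / 2 by rewrite ler_norml; nra.
have a2 : `|2 * F| <= k * (E + G) / 2 by rewrite ler_norml; nra.
have b1 : (E - G) ^+ 2 <= (k * (E + G) / 2) ^+ 2.
  by rewrite -(real_normK (num_real (E - G))) ler_pXn2r ?nnegrE// divr_ge0// mulr_ge0.
have b2 : (2 * F) ^+ 2 <= (k * (E + G) / 2) ^+ 2.
  by rewrite -(real_normK (num_real (2 * F))) ler_pXn2r ?nnegrE// divr_ge0// mulr_ge0.
have k2 : k ^+ 2 <= 9 * e ^+ 2.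
  have : k ^+ 2 <= (3 * e) ^+ 2 by rewrite ler_pXn2r ?nnegrE//; (clear -k3 e0; lra).
  by rewrite exprMn; (clear; lra).
have m1 : (E + G - 2 * J) * (E + G + 2 * J) <= 9 * e ^+ 2 * (E + G) * (E + G).
  apply: (@le_trans _ _ (k ^+ 2 * (E + G) ^+ 2)); last first.
    rewrite expr2 mulrA ler_wpM2r// ler_wpM2r//.
  have : (E + G - 2 * J) * (E + G + 2 * J) = (E - G) ^+ 2 + (2 * F) ^+ 2.
    by rewrite -subr_sqr exprMn JE; ring.
  move=> ->; have := sqr_ge0 (k * (E + G)); move: b1 b2; rewrite expr_div_n exprMn; (clear; lra).
have g : E + G - 2 * J <= 9 * e ^+ 2 * (E + G).
  move: S0; rewrite le_eqVlt => /orP[/eqP S0|S0].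
    by rewrite -S0; (clear -J0; lra).
  have [h|h] := lerP (E + G - 2 * J) 0.
    by apply: le_trans h _; rewrite mulr_ge0// ?(ltW S0)// mulr_ge0// sqr_ge0.
  rewrite -(ler_pM2r S0); apply: le_trans m1; rewrite ler_wpM2l ?(ltW h)//; move: J0; (clear; lra).
split=> //; have : e ^+ 2 <= 1 / 100 by (clear -e1 e0; nra).
have := sqr_ge0 e; (clear -k2 h4 h3 h2 h1 k3 JE J0 e1; nra).
Qed.

Lemma qc_data f (e : R) : 0 <= e <= 1 / 10 -> quasiconformal (1 + e) f -> conformal_on (@unit_disk R) f ->
  exists g ux uy vx vy, [/\ WS (fun p => (f p).1) ux uy, WS (fun p => (f p).2) vx vy,
    [/\ ct (fun p => (g p).1), ct (fun p => (g p).2), cancel f g & cancel g f],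
    {ae @PM R, forall p, gsq ux uy vx vy p <= 4 * (ux p * vy p - uy p * vx p) /\
       (ux p - vy p) ^+ 2 + (uy p + vx p) ^+ 2 <= 9 * e ^+ 2 * gsq ux uy vx vy p} &
    {ae @PM R, forall p, nn p < 1 -> ux p - vy p = 0 /\ uy p + vx p = 0}].
Proof.
move=> he [[g [fK [gK [cf cg]]]] [fx [fy [[_ [_ [L1x [L2x [L1y L2y]]]]] [[W1 [W2 [W3 W4]]] D]]]]] hc.
have cc (h : C -> C) : continuous h -> ct (fun p => (h p).1) /\ ct (fun p => (h p).2).
  move=> ch; split; apply/ctP => p.
    by apply: (@continuous_comp _ _ _ h fst) ; [exact: ch|exact: (ctP _).1 (@ct1 R) _].
  by apply: (@continuous_comp _ _ _ h snd) ; [exact: ch|exact: (ctP _).1 (@ct2 R) _].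
have [cf1 cf2] := cc _ cf; have [cg1 cg2] := cc _ cg.
have wu := weak_WS cf1 (locL2_L2l L1x) (locL2_L2l L1y) W1 W3.
have wv := weak_WS cf2 (locL2_L2l L2x) (locL2_L2l L2y) W2 W4.
have CR := conf_CR wu wv (fun z hz => conf_jet hc hz).
exists g, (fun p => (fx p).1), (fun p => (fy p).1), (fun p => (fx p).2), (fun p => (fy p).2); split=> //.
(* The square of half-side 1/2 lies in the disc, where by Cauchy-Riemann the Jacobian is a sum of
   squares; [jac_pos] carries the sign to the plane. *)
have J0 : {ae @PM R, forall p, 0 <= (fx p).1 * (fy p).2 - (fy p).1 * (fx p).2}.
  have h p : g ((f p).1, (f p).2) = p by rewrite -surjective_pairing.
  have h' p : ((f (g p)).1, (f (g p)).2) = p by rewrite -surjective_pairing.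
  apply: (jac_pos wu wv cg1 cg2 h h' (c := (0, 0)) (d := 1 / 2)); first by rewrite divr_gt0.
  apply: (ae_imp CR) => p hp; rewrite /pm /= !subr0 -surjective_pairing => np.
  have [|E1 E2] := hp.
    apply: le_lt_trans (nn_le p) _; have := nm_ge0 p; nra.
  have -> : (fx p).1 = (fy p).2 by apply/subr0_eq.
  have -> : (fy p).1 = - (fx p).2 by apply/eqP; rewrite -addr_eq0 E2.
  by rewrite mulNr opprK addr_ge0// -expr2 sqr_ge0.
apply: (ae_imp (ae_and J0 D)) => p [{}J0 {}D].
have k0 : 0 <= 1 + e by lra.
have sq a b : enorm (ddir fx fy a p) ^+ 2 <= (1 + e) ^+ 2 * enorm (ddir fx fy b p) ^+ 2.
  by rewrite -exprMn ler_pXn2r ?nnegrE ?mulr_ge0 ?enorm_ge0//; exact: D.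
set A := (fx p).1 in J0 *; set B := (fy p).2 in J0 *; set Cc := (fy p).1 in J0 *; set G := (fx p).2 in J0 *.
pose E := A ^+ 2 + G ^+ 2; pose H := Cc ^+ 2 + B ^+ 2; pose F := A * Cc + G * B.
have [c4 s4] : cos (pi / 4) ^+ 2 = 1 / 2 :> R /\ 2 * (sin (pi / 4) * cos (pi / 4)) = 1 :> R /\ sin (pi / 4) ^+ 2 = 1 / 2 :> R.
  have := cos2Dsin2 (pi / 4 : R); have := cosD (pi / 4 : R) (pi / 4); have := sinD (pi / 4 : R) (pi / 4).
  have -> : pi / 4 + pi / 4 = pi / 2 :> R by field.
  by rewrite cos_pihalf sin_pihalf; lra.
have en a : enorm (ddir fx fy a p) ^+ 2 = cos a ^+ 2 * E + 2 * (sin a * cos a) * F + sin a ^+ 2 * H.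
  by rewrite enorm2 /= -/A -/B -/Cc -/G /E /F /H; ring.
(* Four directions suffice: 0 and pi / 2 compare [E] with [H], and the two diagonals isolate [F]. *)
have q1 := sq 0 (pi / 2); have q2 := sq (pi / 2) 0.
have q3 := sq (pi / 4) (- (pi / 4)); have q4 := sq (- (pi / 4)) (pi / 4).
rewrite !en cos0 sin0 cos_pihalf sin_pihalf ?cosN ?sinN in q1 q2 q3 q4.
rewrite !sqrrN c4 s4.1 s4.2 mulNr mulrN s4.1 in q3 q4.
have [] := @distort E H F (A * B - Cc * G) e (E + H) he J0.
- by rewrite /E /H /F; ring.
- by [].
- by rewrite addr_ge0// sqr_ge0.
- by rewrite addr_ge0// sqr_ge0.
- by move: q1; (clear; lra).
- by move: q2; (clear; lra).
- by move: q3; (clear; lra).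
- by move: q4; (clear; lra).
have gE : gsq (fun p => (fx p).1) (fun p => (fy p).1) (fun p => (fx p).2) (fun p => (fy p).2) p = E + H.
  by rewrite /gsq -/A -/B -/Cc -/G /E /H; ring.
rewrite gE => r1 r2; split=> //; apply: le_trans r1.
by rewrite le_eqVlt; apply/orP; left; apply/eqP; rewrite /E /H; ring.
Qed.

Lemma nn_pp z p : enorm z < 1 -> nm p <= (1 - enorm z) / 2 -> nn (pp p z) < 1.
Proof.
move=> hz hp; have a := enorm_ge0 z.
have := nn_le p; rewrite /nn /= => h.
have h2 : enorm p < 1 - enorm z.
  rewrite -(ltr_pXn2r (_ : 0 < 2)%N) ?nnegrE ?enorm_ge0// ?subr_ge0 ?(ltW hz)// enorm2.
  have := nm_ge0 p; nra.
have := enorm2 (pp p z); rewrite /= => <-; have := enormD p z; have := enorm_ge0 (pp p z); nra.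
Qed.
End PlaneMaps.


(** * Quasiconformal maps conformal in the disc *)

Section LocalLinear.
Variable R : realType.
Local Notation C := (R * R)%type.
Implicit Types (p q c z w h k D : C) (f : C -> C) (d r e t : R).

(** Near [z] the map is a similarity with complex factor [D], up to the relative error [d]. *)
Definition near_lin f z D d r := forall w, enorm w <= r ->
  enorm (pm (pm (f (pp z w)) (f z)) (cmul D w)) <= d * enorm D * enorm w.

Lemma le_limR (x a b T : R) : 0 < T -> (forall t, 0 < t <= T -> x <= a + b * t) -> x <= a.
Proof.
move=> T0 h; apply/ler_addgt0Pr => e e0.
pose t := Num.min T (e / (`|b| + 1)).
have b0 : 0 < `|b| + 1 by rewrite ltr_wpDl.
have t0 : 0 < t by rewrite lt_min T0 divr_gt0.
apply: le_trans (h t _) _; first by rewrite t0 ge_min lexx.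
rewrite lerD2l; apply: (@le_trans _ _ ((`|b| + 1) * t)).
  by rewrite ler_wpM2r ?(ltW t0)//; apply: le_trans (ler_norm b) _; rewrite lerDl.
by rewrite mulrC -ler_pdivlMr// ge_min lexx orbT.
Qed.

(** After translation by [z], the inverse estimate applies with [r0 = (1 - enorm z) / 4]: twice this
    radius still stays in the disc, where the map is conformal. *)
Lemma qc_near_lin : exists K e0 : R, [/\ 0 < K, 0 < e0 & forall e f, 0 <= e <= e0 -> quasiconformal (1 + e) f ->
  conformal_on (@unit_disk R) f -> forall z, enorm z < 1 -> exists D, cjet f z D /\
    (D <> (0, 0) -> near_lin f z D (K * e) ((1 - enorm z) / 4))].
Proof.
have [K [b0 [K0 b00 st]]] := inverse_bound R.
(* The 3 is the root of the 9 in the distortion bound, the 2 compares the Euclidean and sup norms.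
   [b0 / 6] leaves half of [b0] for the auxiliary [t]. *)
exists (2 * (3 * K)), (Num.min (1 / 10) (b0 / 6)); split; first by rewrite !mulr_gt0.
  by rewrite lt_min !divr_gt0.
move=> e f /andP[e0]; rewrite le_min => /andP[e1 e2] qc cf z z1.
have he : 0 <= e <= 1 / 10 by rewrite e0.
have [g [ux [uy [vx [vy [hu hv [cg1 cg2 fK gK] hJ hol]]]]]] := @qc_data R f e he qc cf.
have z1n : nn z < 1.
  by rewrite /nn -enorm2; have := enorm_ge0 z; (clear -z1; nra).
have [D jD] := conf_jet cf z1n; exists D; split=> // D0 w hw.
have nD : 0 < nm (D.1, D.2).
  rewrite -surjective_pairing lt_neqAle nm_ge0 andbT; apply/eqP => /esym/nm_eq0; exact: D0.
have su : WS (fun p => (f (pp p z)).1 - (f z).1) (fun p => ux (pp p z)) (fun p => uy (pp p z)).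
  by apply: (WS_ext (WS_sub (WS_shift z hu) (WS_cst (f z).1))) => p //; rewrite subr0.
have sv : WS (fun p => (f (pp p z)).2 - (f z).2) (fun p => vx (pp p z)) (fun p => vy (pp p z)).
  by apply: (WS_ext (WS_sub (WS_shift z hv) (WS_cst (f z).2))) => p //; rewrite subr0.
have z0 : pp (0, 0) z = z by rewrite /pp /= !add0r -surjective_pairing.
have [ju jv] := jD.
have ju' : jet (fun p => (f (pp p z)).1 - (f z).1) (0, 0) D.1 (- D.2).
  move=> e' /ju[d d0 hd]; exists d => // q hq.
  have E : pm (pp q z) z = pm q (0, 0) by rewrite /pm /pp /= !addrK !subr0.
  by have := hd (pp q z); rewrite E => /(_ hq); rewrite z0 /= !addrK !subr0 subrr subr0.
have jv' : jet (fun p => (f (pp p z)).2 - (f z).2) (0, 0) D.2 D.1.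
  move=> e' /jv[d d0 hd]; exists d => // q hq.
  have E : pm (pp q z) z = pm q (0, 0) by rewrite /pm /pp /= !addrK !subr0.
  by have := hd (pp q z); rewrite E => /(_ hq); rewrite z0 /= !addrK !subr0 subrr subr0.
have inj d : 0 < d -> exists2 h : R, 0 < h & forall p,
    nm ((f (pp p z)).1 - (f z).1, (f (pp p z)).2 - (f z).2) < h -> nm p < d.
  move=> d0; have [h1 h10 H1] := cg1 (f z) d d0; have [h2 h20 H2] := cg2 (f z) d d0.
  exists (Num.min h1 h2); first by rewrite lt_min h10.
  move=> p; rewrite lt_min => /andP[/H1 a /H2].
  by move: a; rewrite !fK /= !addrK nm_lt => -> ->.
have prop (k : R) : exists M : R, forall p, nm ((f (pp p z)).1 - (f z).1, (f (pp p z)).2 - (f z).2) <= k -> nm p <= M.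
  have fK' p : g ((f p).1, (f p).2) = p by rewrite -surjective_pairing.
  have [M _ hM] := proper_map cg1 cg2 fK' (k + nm (f z)).
  exists (M + nm z) => p hp.
  have E : p = pm (pp p z) z by rewrite /pm /pp /= !addrK -surjective_pairing.
  rewrite E; apply: le_trans (nmB _ _) _; rewrite lerD2r; apply: hM.
  rewrite -surjective_pairing.
  have E2 : f (pp p z) = pp (pm (f (pp p z)) (f z)) (f z) by rewrite /pm /pp /= !subrK -surjective_pairing.
  by rewrite E2; apply: le_trans (nmD _ _) _; rewrite lerD2r.
have r0 : 0 < (1 - enorm z) / 4 by rewrite divr_gt0// subr_gt0.
have aJ := ae_shift z hJ; have aH := ae_shift z hol.
have A1 := ae_imp aJ (fun p => @proj1 _ _).
have A3 : {ae @PM R, forall p, nm p <= 2 * ((1 - enorm z) / 4) -> ux (pp p z) - vy (pp p z) = 0 /\ uy (pp p z) + vx (pp p z) = 0}.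
  apply: (ae_imp aH) => p hp np; apply: hp; apply: nn_pp => //.
  by apply: le_trans np _; rewrite le_eqVlt; apply/orP; left; apply/eqP; field.
(* The inverse estimate asks for a positive dilatation, and [e] may be 0: it is applied with
   [3 * e + t], then [t] tends to 0. *)
have bd t : 0 < t <= b0 / 2 -> nm (pm (pm (f (pp z w)) (f z)) (cmul D w)) <=
    K * (3 * e) * nm D * nm w + K * nm D * nm w * t.
  move=> /andP[t0 tb].
  have A2 : {ae @PM R, forall p, (ux (pp p z) - vy (pp p z)) ^+ 2 + (uy (pp p z) + vx (pp p z)) ^+ 2 <=
      (3 * e + t) ^+ 2 * gsq (fun p => ux (pp p z)) (fun p => uy (pp p z)) (fun p => vx (pp p z)) (fun p => vy (pp p z)) p}.
    apply: (ae_imp aJ) => p [_ hp]; apply: le_trans hp _; rewrite /gsq; apply: ler_wpM2r.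
      by rewrite !addr_ge0// sqr_ge0.
    by rewrite (_ : 9 * e ^+ 2 = (3 * e) ^+ 2); [rewrite ler_pXn2r ?nnegrE//; clear -e0 t0; lra|ring].
  have be0 : 0 < 3 * e + t by clear -e0 t0; lra.
  have be1 : 3 * e + t <= b0 by clear -e2 tb; lra.
  have E1 : (fun p => (f (pp p z)).1 - (f z).1) (0, 0) = 0 by rewrite z0 subrr.
  have E2 : (fun p => (f (pp p z)).2 - (f z).2) (0, 0) = 0 by rewrite z0 subrr.
  have wr : nm w <= (1 - enorm z) / 4 by apply: le_trans (nm_enorm w) hw.
  have := st _ _ _ _ _ _ _ _ _ _ su sv E1 E2 inj prop r0 be0 be1 nD ju' jv' A1 A2 A3 w wr.
  rewrite -surjective_pairing (_ : pp w z = pp z w); last by rewrite /pp addrC (addrC w.2).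
  rewrite (_ : (_, _) = pm (pm (f (pp z w)) (f z)) (cmul D w)); last first.
    by rewrite /pm /cmul /=; congr pair; rewrite (addrC (D.1 * w.2)).
  by move=> hh; apply: le_trans hh _; rewrite le_eqVlt; apply/orP; left; apply/eqP; ring.
have b2 : 0 < b0 / 2 by rewrite divr_gt0.
have := le_limR b2 bd => fin.
apply: le_trans (enorm_nm _) _.
apply: (@le_trans _ _ (2 * (K * (3 * e) * nm D * nm w))); first by rewrite ler_pM2l.
rewrite (_ : 2 * (3 * K) * e * enorm D * enorm w = 2 * (K * (3 * e) * enorm D * enorm w)); last by ring.
rewrite ler_pM2l// ler_pM ?nm_ge0 ?nm_enorm//; first by rewrite mulr_ge0 ?nm_ge0// mulr_ge0 ?(ltW K0)// mulr_ge0.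
by rewrite ler_wpM2l ?nm_enorm// mulr_ge0 ?(ltW K0)// mulr_ge0.
Qed.

(** The approximation at [z'] is used for the increments to [z] and to [pp z k], of lengths at most
    once and twice that of [k]; hence the 3. *)
Lemma near_lin2 f z z' D d r k : 0 <= d -> near_lin f z' D d r -> enorm (pm z z') <= enorm k -> 2 * enorm k <= r ->
  enorm (pm (pm (f (pp z k)) (f z)) (cmul D k)) <= 3 * d * enorm D * enorm k.
Proof.
move=> d0 H zz kr; have k0 := enorm_ge0 k; have D0 := enorm_ge0 D.
have w1 : enorm (pm z z') <= r by apply: le_trans zz _; lra.
have e2 : enorm (pp (pm z z') k) <= 2 * enorm k by apply: le_trans (enormD _ _) _; lra.
have h1 := H _ w1; have h2 := H _ (le_trans e2 kr).
have E1 : pp z' (pm z z') = z by rewrite /pp /pm /= !(addrC _ (_ - _)) !subrK -surjective_pairing.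
have E2 : pp z' (pp (pm z z') k) = pp z k by rewrite /pp /pm /=; congr pair; ring.
rewrite E1 in h1; rewrite E2 in h2.
rewrite (_ : pm _ _ = pm (pm (pm (f (pp z k)) (f z')) (cmul D (pp (pm z z') k))) (pm (pm (f z) (f z')) (cmul D (pm z z')))); last first.
  by rewrite /pm /pp /cmul /=; congr pair; ring.
apply: le_trans (enormB _ _) _.
have dD : 0 <= d * enorm D by exact: mulr_ge0.
move: (ler_wpM2l dD e2) (ler_wpM2l dD zz) h1 h2; move: (enorm (pm (pm (f z) _) _)) (enorm (pm (pm (f (pp z k)) _) _)) => a b.
rewrite (_ : 3 * d * enorm D * enorm k = 3 * (d * enorm D * enorm k)); last by ring.
rewrite mulrCA; move: (d * enorm D * enorm k) (d * enorm D * _) (d * enorm D * _) => x y v; lra.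
Qed.

Lemma jet_const f z d : 0 < d -> (forall p, nm (pm p z) <= d -> cjet f p (0, 0)) -> f (pp z (d, 0)) = f z.
Proof.
move=> d0 H.
have key (u : C -> R) : (forall p, nm (pm p z) <= d -> jet u p 0 0) -> u (pp z (d, 0)) = u z.
  move=> hu; pose h t := u (pp z (t, 0)).
  have dh t : 0 <= t <= d -> der h t 0.
    move=> /andP[t0 td] e e0.
    have [|s s0 hs] := hu (pp z (t, 0)) _ e e0.
      by rewrite /pm /pp /= addrC addKr addr0 subrr nm_le /= normr0 ger0_norm// td (ltW d0).
    exists s => // x hx.
    have E : pm (pp z (t + x, 0)) (pp z (t, 0)) = (x, 0) by rewrite /pm /pp /=; congr pair; ring.
    have nE : nm (x, 0) = `|x| by rewrite /nm /= normr0 max_l.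
    have := hs (pp z (t + x, 0)); rewrite E nE => /(_ hx).
    by rewrite !mul0r addr0 subr0 /h mulr0 subr0.
  have [c _ hc] := der_mvt d0 dh.
  by move/eqP: hc; rewrite mul0r subr_eq0 /h /pp /= !addr0 -surjective_pairing => /eqP.
have [h1 h2] : (f (pp z (d, 0))).1 = (f z).1 /\ (f (pp z (d, 0))).2 = (f z).2.
  split; [apply: (key (fun p => (f p).1))|apply: (key (fun p => (f p).2))] => p /H[a b] //.
  by move: a; rewrite /= oppr0.
by rewrite [LHS]surjective_pairing h1 h2 -surjective_pairing.
Qed.

(** Suppose the derivative vanishes at [z]. Injectivity provides points arbitrarily near [z] with
    nonzero derivative, and near-linearity at these points forces increments from [z] to be at least
    a fixed multiple of their length, which the zero derivative contradicts. *)
Lemma near_lin_nz f (K e : R) : injective f -> 0 <= e -> K * e <= 1 / 9 -> 0 <= K ->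
  (forall z, enorm z < 1 -> exists D, cjet f z D /\ (D <> (0, 0) -> near_lin f z D (K * e) ((1 - enorm z) / 4))) ->
  forall z, enorm z < 1 -> exists D, D <> (0, 0) /\ near_lin f z D (K * e) ((1 - enorm z) / 4).
Proof.
move=> fi e0 Ke K0 H z z1; set d := K * e in Ke *; have d0 : 0 <= d by exact: mulr_ge0.
have [D [jD hD]] := H z z1; have [D0|D0] := eqVneq D (0, 0); last by exists D; split; [exact/eqP|exact/hD/eqP].
exfalso; rewrite {}D0 in jD => {D hD}.
(* Otherwise the derivative would vanish on a neighbourhood of [z], making [f] constant on a
   segment. *)
have dense r : 0 < r -> exists z' D, [/\ enorm (pm z z') <= r, enorm z' < 1, D <> (0, 0) & near_lin f z' D d ((1 - enorm z') / 4)].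
  move=> r0; apply: contrapT => hno.
  pose s := Num.min (r / 2) ((1 - enorm z) / 4).
  have s0 : 0 < s by rewrite lt_min !divr_gt0// subr_gt0.
  have sr : s <= r / 2 by rewrite ge_min lexx.
  have sz : s <= (1 - enorm z) / 4 by rewrite ge_min lexx orbT.
  have jj p : nm (pm p z) <= s -> cjet f p (0, 0).
    move=> ps; have a := enorm_nm (pm p z).
    have p1 : enorm p < 1.
      have : p = pp (pm p z) z by rewrite /pp /pm /= !subrK -surjective_pairing.
      move=> ->; apply: le_lt_trans (enormD _ _) _; lra.
    have [Dp [jp hp]] := H p p1; have [E|nE] := eqVneq Dp (0, 0); first by rewrite -E.
    exfalso; apply: hno; exists p, Dp; split=> //; [rewrite enormC; lra|exact/eqP|exact/hp/eqP].
  have := fi _ _ (jet_const s0 jj) => /(congr1 fst) /= /eqP.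
  by rewrite -subr_eq0 addrC addKr gt_eqF.
have cmp z0 D0 k : enorm k <= (1 - enorm z) / 9 -> near_lin f z0 D0 d ((1 - enorm z0) / 4) -> enorm (pm z z0) <= enorm k ->
    enorm (pm (pm (f (pp z k)) (f z)) (cmul D0 k)) <= enorm D0 * enorm k / 3.
  move=> kz h zz; have rr : 2 * enorm k <= (1 - enorm z0) / 4.
    have a := enorm_tri z0 (0, 0) z; rewrite {1 3}/pm /= !subr0 -!surjective_pairing enormC in a.
    have := enorm_ge0 k; lra.
  apply: le_trans (near_lin2 d0 h zz rr) _.
  have := mulr_ge0 (enorm_ge0 D0) (enorm_ge0 k); rewrite -mulrA; move: (enorm D0 * enorm k) => x x0; nra.
have low z0 D0 k : enorm k <= (1 - enorm z) / 9 -> near_lin f z0 D0 d ((1 - enorm z0) / 4) -> enorm (pm z z0) <= enorm k ->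
    enorm D0 * enorm k * (2 / 3) <= enorm (pm (f (pp z k)) (f z)) <= enorm D0 * enorm k * (4 / 3).
  move=> h1 h2 h3; have a := cmp _ _ _ h1 h2 h3; rewrite -enorm_cmul in a *.
  move: (pm (f (pp z k)) (f z)) (cmul D0 k) a => X Y a; apply/andP; split.
    have := enormB X (pm X Y); rewrite (_ : pm X (pm X Y) = Y); first by lra.
    by rewrite /pm /= !subKr -surjective_pairing.
  have := enormD (pm X Y) Y; rewrite (_ : pp (pm X Y) Y = X); first by lra.
  by rewrite /pm /pp /= !subrK -surjective_pairing.
pose k0 := (1 - enorm z) / 9; have k00 : 0 < k0 by rewrite divr_gt0// subr_gt0.
have ek t : 0 <= t -> enorm (t, 0) = t by move=> t0; rewrite /enorm /= expr0n addr0 sqrtr_sqr ger0_norm.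
have [z0 [D0 [a0 a1 D0n a2]]] := dense k0 k00.
(* Two admissible derivatives measure the same increment of [f], within factors 2/3 and 4/3 because
   [3 * d <= 1/3]; so none is less than half of [D0]. *)
have L0 z' D' : enorm (pm z z') <= k0 -> near_lin f z' D' d ((1 - enorm z') / 4) -> enorm D0 <= 2 * enorm D'.
  move=> h1 h2; have kk := ek k0 (ltW k00).
  have := low _ _ (k0, 0) _ a2; rewrite kk lexx => /(_ isT a0)/andP[b1 _].
  have := low _ _ (k0, 0) _ h2; rewrite kk lexx => /(_ isT h1)/andP[_ b2].
  have : enorm D0 * k0 <= 2 * enorm D' * k0 by (clear -b2 b1; lra).
  by rewrite ler_pM2r.
have D0p : 0 < enorm D0 by rewrite lt_neqAle enorm_ge0 andbT; apply/eqP => /esym/enorm_eq0.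
(* The zero derivative gives increments at most 2/12 of [enorm D0 * t], the nearby derivative at
   least 2/3 * 1/2 of it. *)
have ep : 0 < enorm D0 / 12 by rewrite divr_gt0.
have [ju jv] := jD; have [s1 s10 hs1] := ju _ ep; have [s2 s20 hs2] := jv _ ep.
pose t := Num.min k0 (Num.min (s1 / 2) (s2 / 2)).
have t0 : 0 < t by rewrite !lt_min k00 !divr_gt0.
have tk : t <= k0 by rewrite ge_min lexx.
have [ts1 ts2] : t < s1 /\ t < s2.
  have b1 : t <= s1 / 2 by rewrite !ge_min lexx orbT.
  have b2 : t <= s2 / 2 by rewrite !ge_min lexx !orbT.
  by split; (clear -b1 s10 b2 s20; lra).
have [z' [D' [c0 c1 D'n c2]]] := dense t t0.
have L1 := L0 _ _ (le_trans c0 tk) c2.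
have := low _ _ (t, 0) _ c2; rewrite ek ?(ltW t0)// => /(_ tk c0)/andP[b1 _].
have E : pm (pp z (t, 0)) z = (t, 0) by rewrite /pm /pp /=; congr pair; ring.
have nE : nm (t, 0) = t by rewrite /nm /= normr0 max_l ?normr_ge0// ger0_norm// ltW.
have up : nm (pm (f (pp z (t, 0))) (f z)) <= enorm D0 / 12 * t.
  have := hs1 (pp z (t, 0)); rewrite E nE => /(_ ts1); have := hs2 (pp z (t, 0)); rewrite E nE => /(_ ts2).
  by rewrite nm_le /= !oppr0 !mul0r !addr0 !subr0 => -> ->.
have b3 := enorm_nm (pm (f (pp z (t, 0))) (f z)).
have : enorm D0 * t <= 2 * enorm D' * t by rewrite ler_pM2r.
have : 0 < enorm D0 * t by exact: mulr_gt0.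
clear -b3 up b1; lra.
Qed.
End LocalLinear.

(** * From the disc to its boundary circle *)

Section Chain.
Variable R : realType.
Local Notation C := (R * R)%type.
Implicit Types (p q c z w : C) (h t x y : R).
Definition circ x : C := (cos x, sin x).

Lemma enorm_circ x : enorm (circ x) = 1.
Proof. by rewrite /enorm /= cos2Dsin2 sqrtr1. Qed.

Definition sc (a : R) p : C := (a * p.1, a * p.2).

Lemma enorm_sc a p : enorm (sc a p) = `|a| * enorm p.
Proof. by rewrite /enorm /sc /= !exprMn -mulrDr sqrtrM ?sqr_ge0// sqrtr_sqr. Qed.

Lemma sin_le x : `|sin x| <= `|x|.
Proof.
have := @der_lip R sin cos 0 x 1; rewrite sin0 !subr0 mul1r; apply=> y _; first exact: der_sin.
exact: cos_max.
Qed.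

Lemma chord x y : enorm (pm (circ x) (circ y)) ^+ 2 = 2 - 2 * cos (x - y).
Proof. by rewrite enorm2 /= cosB; have := cos2Dsin2 x; have := cos2Dsin2 y; lra. Qed.

Lemma cos_half x : 2 - 2 * cos x = (2 * sin (x / 2)) ^+ 2.
Proof.
have := cosD (x / 2) (x / 2); rewrite (_ : x / 2 + x / 2 = x); last by field.
by move=> ->; have := cos2Dsin2 (x / 2); lra.
Qed.

Lemma chord_le x y : enorm (pm (circ x) (circ y)) <= `|x - y|.
Proof.
apply: enorm_le => //; rewrite -enorm2 chord cos_half -(real_normK (num_real (2 * _))) ler_pXn2r ?nnegrE//.
rewrite normrM ger0_norm//; have := sin_le ((x - y) / 2).
by rewrite normrM (ger0_norm (_ : 0 <= 2^-1))//; lra.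
Qed.

Variables (f : C -> C) (d : R).
Hypotheses (d0 : 0 <= d) (d1 : 3 * d <= 1 / 14) (cf1 : ct (fun p => (f p).1)) (cf2 : ct (fun p => (f p).2)).
Variable D : C -> C.
Hypothesis Dn : forall z, enorm z < 1 -> D z <> (0, 0).
Hypothesis DL : forall z, enorm z < 1 -> near_lin f z (D z) d ((1 - enorm z) / 4).

(** Near-linearity at both ends evaluates the same increment [w], so the two derivatives differ by
    at most [d] times the sum of their moduli; the smallness of [d] turns this into [3 * d]. *)
Lemma D_step z w : enorm z < 1 -> enorm w <= (1 - enorm z) / 8 ->
  enorm (pp z w) < 1 /\ enorm (pm (D (pp z w)) (D z)) <= 3 * d * enorm (D z).
Proof.
move=> z1 hw; have zw := enormD z w.
have z1' : enorm (pp z w) < 1 by lra.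
split=> //; have [->|w0] := eqVneq w (0, 0).
  rewrite (_ : pp z (0, 0) = z); last by rewrite /pp /= !addr0 -surjective_pairing.
  by rewrite /pm !subrr enorm0 !mulr_ge0// enorm_ge0.
have wp : 0 < enorm w by rewrite lt_neqAle enorm_ge0 andbT eq_sym; apply: contraNneq w0 => /enorm_eq0 ->.
have h1 := DL z1 (w := w); have h2 := DL z1' (w := (- w.1, - w.2)).
rewrite enorm_opp in h2.
have {}h1 := h1 (ltac:(lra)); have {}h2 := h2 (ltac:(lra)).
have E : pp (pp z w) (- w.1, - w.2) = z by rewrite /pp /= !addrK -surjective_pairing.
rewrite E in h2.
have : enorm (cmul (pm (D (pp z w)) (D z)) w) <= d * enorm (D z) * enorm w + d * enorm (D (pp z w)) * enorm w.
  apply: le_trans (lerD h1 h2); apply: le_trans _ (enormD _ _).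
  by rewrite le_eqVlt; apply/orP; left; apply/eqP; congr enorm; rewrite /cmul /pm /pp /=; congr pair; ring.
rewrite enorm_cmul -mulrDl ler_pM2r// => h3.
have h4 := enormD (pm (D (pp z w)) (D z)) (D z); rewrite (_ : pp (pm _ _) _ = D (pp z w)) in h4; last first.
  by rewrite /pm /pp /= !subrK -surjective_pairing.
have a0 := enorm_ge0 (pm (D (pp z w)) (D z)); have b0 := enorm_ge0 (D z).
move: (enorm (pm _ _)) (enorm (D z)) (enorm (D (pp z w))) a0 b0 h3 h4 => a b c a0 b0 h3 h4.
have h5 : d * c <= d * (a + b) by exact: ler_wpM2l.
have d42 : d <= 1 / 42 by move: d1; lra.
have h6 : d * a <= 1 / 42 * a by exact: ler_wpM2r.
have h7 : 0 <= d * b by exact: mulr_ge0.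
clear -h6 h5 h3 a0 DL Dn cf2 cf1 d1 d0; lra.
Qed.

Lemma D_grow z w : enorm z < 1 -> enorm w <= (1 - enorm z) / 8 -> enorm (D (pp z w)) <= 15 / 14 * enorm (D z).
Proof.
move=> z1 hw; have [_ h] := D_step z1 hw.
have h4 := enormD (pm (D (pp z w)) (D z)) (D z); rewrite (_ : pp (pm _ _) _ = D (pp z w)) in h4; last first.
  by rewrite /pm /pp /= !subrK -surjective_pairing.
apply: le_trans h4 _; have := ler_wpM2r (enorm_ge0 (D z)) d1; lra.
Qed.

(** Each step covers an eighth of the remaining distance to the circle. The derivative may grow by
    15/14 while the distance shrinks by 7/8, a product 15/16 below 1, so the errors form a
    convergent series. The constant solves 44 = 44 * 15/16 + 3 * 7/8 + 1/8. *)
Lemma radial_fin n e h : enorm e = 1 -> 0 < h <= 1 ->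
  enorm (pm (pm (f (sc (1 - h * (7 / 8) ^+ n) e)) (f (sc (1 - h) e)))
    (cmul (D (sc (1 - h) e)) (pm (sc (1 - h * (7 / 8) ^+ n) e) (sc (1 - h) e)))) <= 44 * d * enorm (D (sc (1 - h) e)) * h.
Proof.
move=> e1; elim: n h => [|n IH] h /andP[h0 h1].
  rewrite expr0 mulr1 /pm /cmul /= !(subrr, mulr0, subr0, addr0) enorm0.
  by rewrite !mulr_ge0// ?enorm_ge0// ltW.
have l0 : 0 < h * (7 / 8) by rewrite mulr_gt0// divr_gt0.
have l1 : 0 < h * (7 / 8) <= 1 by rewrite l0; lra.
have := IH _ l1; rewrite -mulrA -exprS.
set z := sc (1 - h) e; set z1 := sc (1 - h * (7 / 8)) e; set z' := sc _ e => IH1.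
pose w := sc (h / 8) e.
have zE : enorm z = 1 - h by rewrite enorm_sc e1 mulr1 ger0_norm// subr_ge0.
have wE : enorm w = h / 8 by rewrite enorm_sc e1 mulr1 ger0_norm// divr_ge0// ltW.
have zz1 : pp z w = z1 by rewrite /pp /z /z1 /w /sc /=; congr pair; field.
have zl : enorm z < 1 by rewrite zE; lra.
have wl : enorm w <= (1 - enorm z) / 8 by rewrite wE zE subKr.
have [_ s1] := D_step zl wl; have s2 := D_grow zl wl.
have s3 := DL zl (w := w); rewrite wE zE subKr in s3; have {}s3 := s3 (ltac:((clear -h0 DL Dn cf2 cf1 d1 d0; lra))).
rewrite zz1 in s1 s2 s3.
have z'1 : enorm (pm z' z1) <= h * (7 / 8).
  rewrite (_ : pm z' z1 = sc (h * (7 / 8) * (1 - (7 / 8) ^+ n)) e); last first.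
    by rewrite /pm /z' /z1 /sc /= exprS; congr pair; ring.
  rewrite enorm_sc e1 mulr1 normrM (gtr0_norm l0) ler_piMr// ?(ltW l0)//.
  have p0 : 0 <= (7 / 8 : R) ^+ n <= 1.
    by rewrite exprn_ge0 ?divr_ge0//= exprn_ile1 ?divr_ge0//; (clear -DL Dn cf2 cf1 d1 d0; lra).
  by rewrite ger0_norm; (clear -p0 DL Dn cf2 cf1 d1 d0; lra).
rewrite (_ : pm _ _ = pp (pp (pm (pm (f z') (f z1)) (cmul (D z1) (pm z' z1))) (cmul (pm (D z1) (D z)) (pm z' z1)))
   (pm (pm (f z1) (f z)) (cmul (D z) w))); last first.
  rewrite (_ : w = pm z1 z); last by rewrite /pm /w /z1 /z /sc /=; congr pair; field.
  by rewrite /pm /pp /cmul /=; congr pair; ring.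
apply: le_trans (enormD _ _) _; apply: le_trans (lerD (enormD _ _) s3) _.
rewrite enorm_cmul.
have t1 : enorm (pm (D z1) (D z)) * enorm (pm z' z1) <= 3 * d * enorm (D z) * (h * (7 / 8)).
  by rewrite ler_pM ?enorm_ge0.
apply: le_trans (lerD (lerD IH1 t1) (lexx _)) _.
have t2 : 44 * d * enorm (D z1) * (h * (7 / 8)) <= 44 * d * (15 / 14 * enorm (D z)) * (h * (7 / 8)).
  by apply: ler_wpM2r; [exact: ltW|rewrite ler_wpM2l// mulr_ge0].
apply: le_trans (lerD (lerD t2 (lexx _)) (lexx _)) _.
have : 0 <= d * enorm (D z) * h by rewrite !mulr_ge0 ?enorm_ge0// ltW.
move: (enorm (D z)) => x; (clear -DL Dn cf2 cf1 d1 d0; lra).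
Qed.

(** Continuity of [f] at the end point of the radius lets the number of steps in [radial_fin] tend
    to infinity. *)
Lemma radial e h : enorm e = 1 -> 0 < h <= 1 ->
  enorm (pm (pm (f e) (f (sc (1 - h) e))) (cmul (D (sc (1 - h) e)) (sc h e))) <= 44 * d * enorm (D (sc (1 - h) e)) * h.
Proof.
move=> e1 hh; have [h0 h1] := andP hh; have rf n := radial_fin n e1 hh; set z := sc (1 - h) e in rf *.
apply/ler_addgt0Pr => x x0.
pose B := enorm (D z) + 2; have B0 : 0 < B by rewrite ltr_wpDl ?enorm_ge0.
have y0 : 0 < x / B by rewrite divr_gt0.
have [t1 t10 H1] := cf1 e y0; have [t2 t20 H2] := cf2 e y0.
pose t := Num.min (x / B) (Num.min t1 t2).
have t0 : 0 < t by rewrite !lt_min y0 t10.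
have [n hn] : exists n, (7 / 8 : R) ^+ n < t.
  have : (7 / 8 : R) ^+ n @[n --> \oo] --> (0 : R) by apply: cvg_expr; rewrite ger0_norm; (clear -DL Dn cf2 cf1 d1 d0; lra).
  move=> /cvgrPdist_lt/(_ _ t0)[N _ /(_ N (leqnn N))] /=.
  by rewrite sub0r normrN ger0_norm ?exprn_ge0//; exists N.
have p0 : 0 <= (7 / 8 : R) ^+ n by rewrite exprn_ge0// divr_ge0.
have := rf n; set z' := sc _ e => {}rf.
have z'e : enorm (pm e z') < t.
  rewrite (_ : pm _ _ = sc (h * (7 / 8) ^+ n) e); last by rewrite /pm /z' /sc /=; congr pair; ring.
  rewrite enorm_sc e1 mulr1 ger0_norm ?mulr_ge0 ?(ltW h0)//; apply: le_lt_trans hn.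
  by rewrite ler_piMl.
have nz : nm (pm z' e) < t by apply: le_lt_trans (nm_enorm _) _; rewrite enormC.
have fz : enorm (pm (f e) (f z')) <= 2 * (x / B).
  apply: le_trans (enorm_nm _) _; rewrite ler_pM2l// nmN nm_le /=.
  move: nz; rewrite !lt_min => /and3P[_ n1 n2].
  by rewrite !ltW// ?H1// H2.
have tx : t <= x / B by rewrite ge_min lexx.
rewrite (_ : pm _ _ = pp (pm (f e) (f z')) (pm (pm (pm (f z') (f z)) (cmul (D z) (pm z' z))) (cmul (D z) (pm e z')))); last first.
  have -> : sc h e = pm e z by rewrite /z /sc /pm /=; congr pair; ring.
  by rewrite /pm /pp /cmul /=; congr pair; ring.
apply: le_trans (enormD _ _) _; apply: le_trans (lerD (lexx _) (enormB _ _)) _.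
rewrite enorm_cmul.
have : enorm (D z) * enorm (pm e z') <= enorm (D z) * (x / B).
  by rewrite ler_wpM2l ?enorm_ge0// ltW//; exact: lt_le_trans tx.
have xE : x = enorm (D z) * (x / B) + 2 * (x / B) by rewrite -mulrDl mulrC divfK// gt_eqF.
clear -xE fz rf DL Dn cf2 cf1 d1 d0; lra.
Qed.

Lemma aff_arc th t : 0 < t <= 1 / 8 -> exists D0 : C, D0 <> (0, 0) /\ forall x, `|x - th| <= t ->
  enorm (pm (pm (f (circ x)) (f (circ th))) (cmul D0 (pm (circ x) (circ th)))) <= 760 * d * enorm D0 * t.
Proof.
move=> /andP[t0 t1]; pose h := 8 * t; have h0 : 0 < h by exact: mulr_gt0.
have h1 : h <= 1 by rewrite /h; lra.
have hh : 0 < h <= 1 by rewrite h0.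
pose z y := sc (1 - h) (circ y).
have zE y : enorm (z y) = 1 - h by rewrite enorm_sc enorm_circ mulr1 ger0_norm// subr_ge0.
have zl y : enorm (z y) < 1 by rewrite zE; lra.
exists (D (z th)); split=> [|x hx]; first exact: Dn.
pose w := pm (z x) (z th).
have wl : enorm w <= t.
  rewrite (_ : w = sc (1 - h) (pm (circ x) (circ th))); last by rewrite /w /pm /z /sc /=; congr pair; ring.
  rewrite enorm_sc ger0_norm ?subr_ge0//; apply: (@le_trans _ _ (enorm (pm (circ x) (circ th)))).
    by rewrite ler_piMl ?enorm_ge0//; lra.
  exact: le_trans (chord_le _ _) hx.
have wl8 : enorm w <= (1 - enorm (z th)) / 8 by rewrite zE; move: wl; rewrite /h; lra.
have zz : pp (z th) w = z x by rewrite /w /pp /pm [RHS]surjective_pairing /=; congr pair; ring.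
have [_ s1] := D_step (zl th) wl8; have s2 := D_grow (zl th) wl8.
have wl4 : enorm w <= (1 - enorm (z th)) / 4 by move: wl8; rewrite zE; move: h0; lra.
have s3 := DL (zl th) wl4; rewrite zz in s1 s2 s3.
have r1 := radial (enorm_circ x) hh; have r2 := radial (enorm_circ th) hh.
rewrite -/(z x) -/(z th) in r1 r2.
rewrite (_ : pm _ _ = pm (pp (pp (pm (pm (f (circ x)) (f (z x))) (cmul (D (z x)) (sc h (circ x)))) (cmul (pm (D (z x)) (D (z th))) (sc h (circ x))))
  (pm (pm (f (z x)) (f (z th))) (cmul (D (z th)) w))) (pm (pm (f (circ th)) (f (z th))) (cmul (D (z th)) (sc h (circ th))))); last first.
  have -> : pm (circ x) (circ th) = pm (pp w (sc h (circ x))) (sc h (circ th)).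
    by rewrite /w /z /sc /pm /pp /=; congr pair; ring.
  by rewrite /pm /pp /cmul /=; congr pair; ring.
apply: le_trans (enormB _ _) _; apply: le_trans (lerD (enormD _ _) r2) _.
apply: le_trans (lerD (lerD (enormD _ _) s3) (lexx _)) _.
apply: le_trans (lerD (lerD (lerD r1 (lexx _)) (lexx _)) (lexx _)) _.
rewrite enorm_cmul enorm_sc enorm_circ mulr1 (gtr0_norm h0).
have dD : 0 <= d * enorm (D (z th)) by rewrite mulr_ge0// enorm_ge0.
have u1 := ler_wpM2r (ltW h0) s1; have u2 : d * enorm (D (z th)) * enorm w <= d * enorm (D (z th)) * t by rewrite ler_wpM2l.
have u3 : d * enorm (D (z x)) * h <= d * (15 / 14 * enorm (D (z th))) * h.
  by rewrite ler_wpM2r ?(ltW h0)// ler_wpM2l.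
have u4 : 0 <= d * enorm (D (z th)) * t by rewrite mulr_ge0// ltW.
rewrite /h in u1 u3 *.
move: (enorm (pm (D _) _)) (enorm w) (enorm (D (z x))) (enorm (D (z th))) u1 u2 u3 u4 => a b x' y u1 u2 u3 u4; (clear -u4 u3 u2 u1 DL Dn cf2 cf1 d1 d0; lra).
Qed.
End Chain.

Lemma qc_aff (R : realType) : exists K e0 : R, [/\ 0 < K, 0 < e0 & forall (e : R) (f : R * R -> R * R), 0 <= e <= e0 ->
  quasiconformal (1 + e) f -> conformal_on (@unit_disk R) f -> forall th t, 0 < t <= 1 / 8 ->
  exists D : R * R, D <> (0, 0) /\ forall x, `|x - th| <= t ->
    enorm (pm (pm (f (circ x)) (f (circ th))) (cmul D (pm (circ x) (circ th)))) <= K * e * enorm D * t].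
Proof.
have [K [e0 [K0 e00 st]]] := qc_near_lin R.
have K9 : 0 < 1 / 42 / K by rewrite !divr_gt0.
have [A [A0 AE]] : exists A : R, 0 < A /\ A = 760 by exists 760; split; [rewrite ltr0n|].
(* [K * e <= 1 / 42] yields both the bound 1/9 of [near_lin_nz] and the bound 1/14 of the
   chaining. *)
exists (A * K), (Num.min e0 (1 / 42 / K)); split; first by rewrite mulr_gt0.
  by rewrite lt_min e00.
move=> e f /andP[e1]; rewrite le_min => /andP[e2 e3] qc cf th t ht.
have H := st e f; rewrite e1 e2 in H; have {}H := H isT qc cf.
have Ke : K * e <= 1 / 42 by rewrite mulrC -ler_pdivlMr.
have [[g [fK [_ [ctf _]]]] _] := qc.
have fi : injective f by exact: can_inj fK.
have Ke9 : K * e <= 1 / 9 by move: Ke; (clear; lra).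
have nz := near_lin_nz fi e1 Ke9 (ltW K0) H.
have [D hD] : {D : R * R -> R * R & forall z, enorm z < 1 -> D z <> (0, 0) /\ near_lin f z (D z) (K * e) ((1 - enorm z) / 4)}.
  apply: (@choice _ _ (fun z Dz => enorm z < 1 -> Dz <> (0, 0) /\ near_lin f z Dz (K * e) ((1 - enorm z) / 4))) => z.
  have [z1|z1] := boolP (enorm z < 1); last by exists z.
  by have [Dz hz] := nz z z1; exists Dz.
have d0 : 0 <= K * e by rewrite mulr_ge0// ltW.
have d1 : 3 * (K * e) <= 1 / 14 by move: Ke; (clear; lra).
have c1 : ct (fun p => (f p).1).
  by apply/ctP => p; apply: (@continuous_comp _ _ _ f fst); [exact: ctf|exact: (ctP _).1 (@ct1 R) _].
have c2 : ct (fun p => (f p).2).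
  by apply/ctP => p; apply: (@continuous_comp _ _ _ f snd); [exact: ctf|exact: (ctP _).1 (@ct2 R) _].
have [D0 [Dn hD0]] := aff_arc d0 d1 c1 c2 (fun z hz => (hD z hz).1) (fun z hz => (hD z hz).2) th ht.
by exists D0; split=> // x /hD0; rewrite -AE mulrA.
Qed.


(** * Dyadic arcs *)

Section Trig.
Variable R : realType.
Local Notation C := (R * R)%type.
Implicit Types (x y t : R).

Lemma pi_le4 : pi <= 4 :> R.
Proof. by have [/andP[_ h] _] := pihalf_02_cos_pihalf R; move: h; lra. Qed.

Lemma cos_ge x : 1 - x ^+ 2 / 2 <= cos x.
Proof.
have h := sin_le (x / 2); have e := cos_half x.
have : sin (x / 2) ^+ 2 <= (x / 2) ^+ 2.
  by rewrite -(real_normK (num_real (sin _))) -(real_normK (num_real (x / 2))) ler_pXn2r ?nnegrE.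
move: e; rewrite exprMn expr_div_n; lra.
Qed.

Lemma sin_ge x : 0 <= x <= 1 / 2 -> 7 / 8 * x <= sin x.
Proof.
move=> /andP[x0 x1]; move: x0; rewrite le_eqVlt => /orP[/eqP<-|x0]; first by rewrite sin0 mulr0.
have [c /andP[c0 c1]] := der_mvt x0 (fun y _ => der_sin y).
rewrite sin0 !subr0 => ->; apply: ler_wpM2r; first exact: ltW.
by apply: le_trans _ (cos_ge c); nra.
Qed.

Lemma sin_ge_half x : 0 <= x <= pi / 2 -> x / 8 <= sin x.
Proof.
move=> /andP[x0 x1]; have p4 := pi_le4; have [h|h] := lerP x (1 / 2).
  by apply: le_trans _ (sin_ge _); [|rewrite x0]; lra.
have s : sin (1 / 2) <= sin x by rewrite ltW// ltr_sin// in_itv /=; apply/andP; split; lra.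
have := @sin_ge (1 / 2); have := p4; lra.
Qed.

Lemma chordE x y : enorm (pm (circ x) (circ y)) = `|2 * sin ((x - y) / 2)|.
Proof.
apply/eqP; rewrite -(eqrXn2 (_ : 0 < 2)%N) ?enorm_ge0//; apply/eqP.
by rewrite chord cos_half real_normK ?num_real.
Qed.

Lemma chord_ge x y : `|x - y| <= 1 -> 7 / 8 * `|x - y| <= enorm (pm (circ x) (circ y)).
Proof.
move=> h; have sg (u v : R) : 0 <= u - v <= 1 -> 7 / 8 * (u - v) <= enorm (pm (circ u) (circ v)).
  move=> /andP[u0 u1]; rewrite chordE; apply: le_trans _ (ler_norm _).
  have : 0 <= (u - v) / 2 <= 1 / 2 by lra.
  by move/sin_ge; lra.
have [xy|xy] := lerP 0 (x - y).
  by rewrite ger0_norm// in h *; apply: sg; rewrite xy.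
rewrite enormC ltr0_norm// opprB; apply: sg; move: h; rewrite ltr0_norm//; lra.
Qed.

(** Since [pi <= 4], the interval up to 8 contains a full period; a rational end suits the count of
    dyadic arcs. *)
Lemma circ_onto (p : C) : unit_circle p -> exists2 x, 0 <= x <= 8 & circ x = p.
Proof.
move=> hp; have p4 := pi_le4; have hp' : p.1 ^+ 2 + p.2 ^+ 2 = 1 := hp.
have h1 : -1 <= p.1 <= 1 by have := sqr_ge0 p.2; nra.
have [/andP[a0 a1] ca] := acos_def h1; have sa := sin_acos h1.
have E : Num.sqrt (1 - p.1 ^+ 2) = `|p.2| by rewrite -hp' addrC addKr sqrtr_sqr.
rewrite E in sa; have [p20|p20] := lerP 0 p.2.
  exists (acos p.1); first by lra.
  by rewrite /circ ca sa ger0_norm// -surjective_pairing.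
exists (- acos p.1 + pi *+ 2); first by rewrite mulr2n; lra.
by rewrite /circ cosD2pi sinD2pi cosN sinN ca sa ltr0_norm// opprK -surjective_pairing.
Qed.

(** Chooses the lift of the point nearest to [y]. The half angle lies in the first quarter turn,
    where the crude bound [sin_ge_half] gives the factor 8. *)
Lemma circ_near x y : exists2 z, circ z = circ x & `|z - y| <= 8 * enorm (pm (circ x) (circ y)).
Proof.
pose u := cos (x - y); have u1 : -1 <= u <= 1 by rewrite cos_geN1 cos_le1.
have [/andP[a0 a1] ca] := acos_def u1; have sa := sin_acos u1.
have E : Num.sqrt (1 - u ^+ 2) = `|sin (x - y)| by rewrite -(cos2Dsin2 (x - y)) addrC addKr sqrtr_sqr.
rewrite E in sa.
have [v [cv sv va]] : exists v, [/\ cos v = cos (x - y), sin v = sin (x - y) & `|v| = acos u].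
  have [s0|s0] := lerP 0 (sin (x - y)).
    by exists (acos u); rewrite ca sa !ger0_norm.
  by exists (- acos u); rewrite cosN sinN ca sa normrN (ger0_norm a0) ltr0_norm// opprK.
have zx : circ (y + v) = circ x.
  by rewrite /circ cosD sinD cv sv -cosD -sinD subrKC.
have yv : y + v - y = v by ring.
exists (y + v) => //; rewrite yv va -zx chordE yv.
have : enorm (pm (circ (y + v)) (circ y)) ^+ 2 = (2 * sin (acos u / 2)) ^+ 2.
  by rewrite chord yv -cos_half cv ca.
rewrite chordE yv real_normK ?num_real// => /eqP; rewrite -subr_eq0 subr_sqr mulf_eq0.
have sp := @sin_ge_half (acos u / 2).
have {}sp : acos u / 2 / 8 <= sin (acos u / 2) by apply: sp; lra.
have nb := ler_norm (2 * sin (v / 2)); have nb2 := ler_norm (- (2 * sin (v / 2))); rewrite normrN in nb2.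
by move=> /orP[/eqP e|/eqP e]; (clear -e nb sp nb2; lra).
Qed.
End Trig.

Section DyadicSums.
Variable R : realType.
Local Notation C := (R * R)%type.
Variables (phi : R -> C) (kap : R).
Hypotheses (k0 : 0 <= kap) (k1 : kap <= 1 / 8).
Hypothesis aff : forall th t, 0 < t <= 1 / 8 -> exists D : C, D <> (0, 0) /\ forall x, `|x - th| <= t ->
  enorm (pm (pm (phi x) (phi th)) (cmul D (pm (circ x) (circ th)))) <= kap * enorm D * t.
Implicit Types (x y t a : R).

Definition arcl a t := enorm (pm (phi (a + t)) (phi a)).

(** Both points are compared with the centre [th], each at the cost [kap * enorm D * t]; the chord
    lies between 7/8 of the angle and the angle. *)
Lemma aff2 th t x y D : (forall x, `|x - th| <= t ->
   enorm (pm (pm (phi x) (phi th)) (cmul D (pm (circ x) (circ th)))) <= kap * enorm D * t) ->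
  `|x - th| <= t -> `|y - th| <= t -> `|x - y| <= 1 ->
  enorm D * (7 / 8 * `|x - y| - 2 * kap * t) <= enorm (pm (phi x) (phi y)) <= enorm D * (`|x - y| + 2 * kap * t).
Proof.
move=> H hx hy xy; have h1 := H x hx; have h2 := H y hy; have D0 := enorm_ge0 D.
set X := pm (pm (phi x) _) _ in h1; set Y := pm (pm (phi y) _) _ in h2.
have E : pm (phi x) (phi y) = pp (pm X Y) (cmul D (pm (circ x) (circ y))).
  by rewrite /X /Y /pm /pp /cmul /=; congr pair; ring.
have E2 : cmul D (pm (circ x) (circ y)) = pm (pm (phi x) (phi y)) (pm X Y).
  by rewrite /X /Y /pm /pp /cmul /=; congr pair; ring.
have XY := enormB X Y; have c1 := chord_le x y; have c2 := chord_ge xy.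
apply/andP; split.
  have := enormB (pm (phi x) (phi y)) (pm X Y); rewrite -E2 enorm_cmul.
  have := ler_wpM2l D0 c2; lra.
rewrite E; apply: le_trans (enormD _ _) _; rewrite enorm_cmul.
have := ler_wpM2l D0 c1; lra.
Qed.

Lemma arcl_gt0 a t : 0 < t <= 1 / 8 -> 0 < arcl a t.
Proof.
move=> tt; have [t0 t1] := andP tt; have [D [Dn H]] := aff a tt.
have D0 : 0 < enorm D by rewrite lt_neqAle enorm_ge0 andbT; apply/eqP => /esym/enorm_eq0.
have E : `|a + t - a| = t by rewrite addrC addKr gtr0_norm.
have h1 : `|a + t - a| <= t by rewrite E.
have h2 : `|a - a| <= t by rewrite subrr normr0 ltW.
have h3 : `|a + t - a| <= 1 by rewrite E; lra.
have /andP[h _] := aff2 H h1 h2 h3; apply: lt_le_trans h.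
by apply: mulr_gt0 => //; rewrite E; have := ler_wpM2r (ltW t0) k1; lra.
Qed.

(* With [X] and [Y] the chords of the halves, [X - Y] is a second difference, hence small, and enters only through its square. *)
Lemma split_arc a t : 0 < t <= 1 / 8 ->
  let eta := 2 * kap + t in let X := arcl a t in let Y := arcl (a + t) t in let Z := arcl a (t * 2) in
  X ^+ 2 + Y ^+ 2 <= 2^-1 * (1 + 8 * eta ^+ 2) * Z ^+ 2 /\
  (X ^+ 2)^-1 + (Y ^+ 2)^-1 <= 8 * (1 + 8 * eta ^+ 2) * (Z ^+ 2)^-1.
Proof.
move=> tt; have [t0 t1] := andP tt; have [D [Dn H]] := aff (a + t) tt.
have D0 : 0 < enorm D by rewrite lt_neqAle enorm_ge0 andbT; apply/eqP => /esym/enorm_eq0.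
move=> eta; rewrite /arcl; have -> : a + t * 2 = a + t + t by ring.
set x := pm (phi (a + t)) (phi a); set y := pm (phi (a + t + t)) (phi (a + t)); set z := pm (phi (a + t + t)) (phi a).
have ha : `|a - (a + t)| <= t by rewrite opprD addNKr normrN gtr0_norm.
have hb : `|a + t + t - (a + t)| <= t by rewrite addrC addKr gtr0_norm.
have X0 : 0 < enorm x := arcl_gt0 a tt.
have Y0 : 0 < enorm y := arcl_gt0 (a + t) tt.
have zb : enorm D * t <= enorm z.
  have E : `|a + t + t - a| = 2 * t by rewrite (_ : _ - _ = 2 * t); [rewrite gtr0_norm ?mulr_gt0|ring].
  have h3 : `|a + t + t - a| <= 1 by rewrite E; lra.
  have /andP[h _] := aff2 H hb ha h3; apply: le_trans h; rewrite E ler_pM2l//; have := ler_wpM2r (ltW t0) k1; (clear -tt aff k1 k0; lra).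
pose w := pm x y.
have wz : enorm w <= eta * enorm z.
  have h1 := H _ ha; have h2 := H _ hb.
  set P := pm _ _ in h1; set Q := pm _ _ in h2.
  have E : w = pm (cmul (- D.1, - D.2) (sc (- (2 - 2 * cos t)) (circ (a + t)))) (pp P Q).
    rewrite /w /x /y /P /Q /pm /pp /cmul /sc /circ /= !(cosD (a + t)) !(sinD (a + t)).
    have -> : cos a = cos (a + t - t) by rewrite addrK.
    have -> : sin a = sin (a + t - t) by rewrite addrK.
    by rewrite cosB sinB; congr pair; ring.
  rewrite E; apply: le_trans (enormB _ _) _; apply: le_trans (lerD (lexx _) (enormD _ _)) _.
  rewrite enorm_cmul enorm_opp enorm_sc enorm_circ mulr1 normrN cos_half ger0_norm ?sqr_ge0//.
  have : (2 * sin (t / 2)) ^+ 2 <= t ^+ 2.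
    by rewrite -cos_half; have := cos_ge t; (clear -aff k1 k0; lra).
  move=> s2; have := ler_wpM2l (ltW D0) s2.
  have e0 : 0 <= eta by move: k0; rewrite /eta; (clear -tt aff k1 k0; lra).
  have := ler_wpM2l e0 zb; rewrite /eta; (clear -h2 h1 aff k1 k0; lra).
have xyz : enorm x ^+ 2 + enorm y ^+ 2 = (enorm z ^+ 2 + enorm w ^+ 2) / 2.
  by rewrite !enorm2 /w /x /y /z /pm /=; field.
have e0 : 0 <= eta by move: k0; rewrite /eta; (clear -tt aff k1 k0; lra).
have e1 : eta <= 3 / 8 by move: k1; rewrite /eta; lra.
have Z0 : 0 < enorm z by apply: lt_le_trans zb; exact: mulr_gt0.
have prod : (1 - eta ^+ 2) * enorm z ^+ 2 <= 4 * (enorm x * enorm y).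
  have : cmul (sc 2 x) (sc 2 y) = pm (cmul z z) (cmul w w).
    by rewrite /w /z /x /y /cmul /sc /pm /=; congr pair; ring.
  move=> /(congr1 (@enorm R)); rewrite enorm_cmul !enorm_sc ger0_norm// => E.
  have := enormD (pm (cmul z z) (cmul w w)) (cmul w w); rewrite (_ : pp _ _ = cmul z z); last by rewrite /pm /pp /= !subrK.
  rewrite -E !enorm_cmul => h.
  have : enorm w * enorm w <= (eta * enorm z) * (eta * enorm z) by rewrite ler_pM ?enorm_ge0.
  clear -h aff k1 k0; lra.
move: (enorm x) (enorm y) (enorm z) (enorm w) (enorm_ge0 w) X0 Y0 Z0 wz xyz prod => X Y Z W W0 X0 Y0 Z0 wz xyz prod.
have W2 : W ^+ 2 <= eta ^+ 2 * Z ^+ 2 by rewrite -exprMn ler_pXn2r ?nnegrE// mulr_ge0// ltW.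
have s0 : 0 <= eta ^+ 2 <= 9 / 64.
  by rewrite sqr_ge0 /=; apply: (@le_trans _ _ ((3 / 8) ^+ 2)); [rewrite ler_pXn2r ?nnegrE//; (clear -aff k1 k0; lra)|(clear -aff k1 k0; lra)].
have Z2 : 0 < Z ^+ 2 by exact: exprn_gt0.
have sum2 : X ^+ 2 + Y ^+ 2 <= 2^-1 * (1 + eta ^+ 2) * Z ^+ 2 by rewrite xyz; (clear -W2 aff k1 k0; lra).
split.
  apply: le_trans sum2 _; apply: ler_wpM2r; [exact: ltW|apply: ler_wpM2l => //; (clear -s0 aff k1 k0; lra)].
have X2 : 0 < X ^+ 2 by exact: exprn_gt0.
have Y2 : 0 < Y ^+ 2 by exact: exprn_gt0.
have -> : (X ^+ 2)^-1 + (Y ^+ 2)^-1 = (X ^+ 2 + Y ^+ 2) / (X * Y) ^+ 2 by field; rewrite !gt_eqF.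
rewrite ler_pdivrMr ?exprn_gt0 ?mulr_gt0//.
apply: le_trans sum2 _.
have q : (1 - eta ^+ 2) ^+ 2 * Z ^+ 2 * Z ^+ 2 <= 16 * (X * Y) ^+ 2.
  have : ((1 - eta ^+ 2) * Z ^+ 2) ^+ 2 <= (4 * (X * Y)) ^+ 2.
    by rewrite ler_pXn2r ?nnegrE//; rewrite ?mulr_ge0 ?(ltW X0) ?(ltW Y0) ?(ltW Z2)//; (clear -s0 aff k1 k0 Z0; lra).
  by rewrite !exprMn; move: (Z ^+ 2) => v; (clear -aff k1 k0; lra).
move: (eta ^+ 2) s0 q => s /andP[s0 s1] q.
have -> : 8 * (1 + 8 * s) / Z ^+ 2 * (X * Y) ^+ 2 = 2^-1 * (1 + 8 * s) * (16 * (X * Y) ^+ 2) / Z ^+ 2 by field; rewrite gt_eqF.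
rewrite ler_pdivlMr//; apply: (@le_trans _ _ (2^-1 * (1 + 8 * s) * ((1 - s) ^+ 2 * Z ^+ 2 * Z ^+ 2))); last first.
  by rewrite ler_wpM2l//; (clear -s0 aff k1 k0; lra).
have core : 2^-1 * (1 + s) <= 2^-1 * (1 + 8 * s) * (1 - s) ^+ 2.
  rewrite -mulrA; apply: ler_wpM2l => //.
  have : (1 + 8 * s) * (1 - s) ^+ 2 - (1 + s) = s * (5 - 15 * s + 8 * s ^+ 2) by ring.
  have : 0 <= s * (5 - 15 * s + 8 * s ^+ 2) by apply: mulr_ge0 => //; have := sqr_ge0 s; (clear -s1 aff k1 k0; lra).
  clear -aff k1 k0; lra.
rewrite (_ : 2^-1 * (1 + 8 * s) * _ = 2^-1 * (1 + 8 * s) * (1 - s) ^+ 2 * Z ^+ 2 * Z ^+ 2); last by ring.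
by do 2! (apply: ler_wpM2r; first exact: ltW); exact: core.
Qed.

(** Starting at 1/16 makes [2 * dyad n] an admissible scale too, as [arc_bounds] requires. *)
Definition dyad n : R := 16^-1 * 2^-1 ^+ n.

Lemma dyad_gt0 n : 0 < dyad n.
Proof. by rewrite mulr_gt0 ?invr_gt0// exprn_gt0// invr_gt0. Qed.

Lemma dyadS n : dyad n = dyad n.+1 * 2.
Proof. by rewrite /dyad exprS; field. Qed.

Lemma half_pow n : 0 < (2^-1 : R) ^+ n <= 1.
Proof. by rewrite exprn_gt0 ?invr_gt0//= exprn_ile1// ?invr_ge0//; lra. Qed.

Lemma dyad_le n : dyad n <= 16^-1.
Proof. by have /andP[_ h] := half_pow n; rewrite /dyad ler_piMr// invr_ge0. Qed.

(** In the square of [2 * kap + dyad n.+1] the part due to [kap] recurs at every level and gives the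
    exponential rate, while the dyadic part is summable and costs [expR 1] in total: [8 * (2 * kap +
    x / 16) ^+ 2 <= 64 * kap ^+ 2 + x], and the [x = 2^-1 ^+ n] telescope. *)
Lemma growth (S : nat -> R) (q : R) : 0 <= q -> (forall n, 0 <= S n) ->
  (forall n, S n.+1 <= q * (1 + 8 * (2 * kap + dyad n.+1) ^+ 2) * S n) ->
  forall n, S n <= S 0%N * expR 1 * (q * expR (64 * kap ^+ 2)) ^+ n.
Proof.
move=> q0 S0 SS n.
have E0 := expR_ge0 (64 * kap ^+ 2).
have H m : S m <= S 0%N * expR (1 - 2^-1 ^+ m) * (q * expR (64 * kap ^+ 2)) ^+ m.
  elim: m => [|m IH]; first by rewrite !expr0 subrr expR0 !mulr1.
  apply: le_trans (SS m) _.
  have st : 1 + 8 * (2 * kap + dyad m.+1) ^+ 2 <= expR (64 * kap ^+ 2) * expR (2^-1 ^+ m.+1).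
    rewrite -expRD; apply: le_trans _ (expR_ge1Dx _); rewrite lerD2l.
    have /andP[x0 x1] := half_pow m.+1; rewrite /dyad; move: (2^-1 ^+ m.+1) x0 x1 => x x0 x1.
    have := sqr_ge0 (2 * kap - 16^-1 * x); nra.
  apply: (@le_trans _ _ (q * (expR (64 * kap ^+ 2) * expR (2^-1 ^+ m.+1)) * S m)).
    by rewrite ler_wpM2r// ler_wpM2l.
  apply: le_trans (ler_wpM2l _ IH) _; first by rewrite !mulr_ge0 ?expR_ge0.
  have -> : 1 - 2^-1 ^+ m.+1 = (1 - 2^-1 ^+ m) + 2^-1 ^+ m.+1 :> R by rewrite exprS; field.
  by rewrite (expRD (1 - _)) (exprS (q * _)) le_eqVlt; apply/orP; left; apply/eqP; ring.
apply: le_trans (H n) _; apply: ler_wpM2r; first by rewrite exprn_ge0 ?mulr_ge0.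
by rewrite ler_wpM2l// ler_expR; have /andP[x0 _] := half_pow n; lra.
Qed.

Lemma uniq_sum (T : eqType) (s s' : seq T) (F : T -> R) : (forall x : T, 0 <= F x) -> uniq s -> uniq s' -> {subset s <= s'} ->
  \sum_(x <- s) F x <= \sum_(x <- s') F x.
Proof.
move=> F0 us us' ss; rewrite [leRHS](bigID (mem s)) /=.
have -> : \sum_(x <- s) F x = \sum_(x <- s' | x \in s) F x.
  rewrite -[RHS]big_filter; apply: perm_big; apply: uniq_perm => //; first exact: filter_uniq.
  by move=> x; rewrite mem_filter; have [/ss ->|//] := boolP (x \in s).
by rewrite lerDl sumr_ge0.
Qed.

Variable N0 : nat.
Definition narc n := (N0 * 2 ^ n)%N.

Lemma narcS n : narc n.+1 = (narc n).*2.
Proof. by rewrite /narc expnS mulnCA mul2n. Qed.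

Lemma sum_double (F : nat -> R) m : \sum_(0 <= k < m.*2) F k = \sum_(0 <= k < m) (F k.*2 + F k.*2.+1).
Proof. elim: m => [|m IH]; first by rewrite !big_geq.
by rewrite doubleS !big_nat_recr//= IH addrA. Qed.

(** The sum over one generation grows by at most the factor of [growth], and the weight [dyad n] to
    the power [b] beats it. A bound for all finite families without repetition stands for
    convergence of the full sum. *)
Lemma pair_sum (w : nat -> nat -> R) (q b : R) : 0 <= q -> (forall n k, 0 <= w n k) ->
  (forall n k, w n.+1 k.*2 + w n.+1 k.*2.+1 <= q * (1 + 8 * (2 * kap + dyad n.+1) ^+ 2) * w n k) ->
  q * expR (64 * kap ^+ 2) * 2^-1 `^ b < 1 ->
  exists M : R, 0 <= M /\ forall s : seq (nat * nat), uniq s -> (forall x : nat * nat, x \in s -> (x.2 < narc x.1)%N) ->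
    \sum_(x <- s) w x.1 x.2 * dyad x.1 `^ b <= M.
Proof.
move=> q0 w0 ww r1; set rho := _ * _ in r1.
have rho0 : 0 <= rho by rewrite !mulr_ge0 ?expR_ge0 ?powR_ge0.
pose S n := \sum_(0 <= k < narc n) w n k.
have S0 n : 0 <= S n by exact: sumr_ge0.
have SS n : S n.+1 <= q * (1 + 8 * (2 * kap + dyad n.+1) ^+ 2) * S n.
  by rewrite /S narcS sum_double mulr_sumr; apply: ler_sum.
have G := growth q0 S0 SS.
pose A := S 0%N * expR 1 * 16^-1 `^ b.
have A0 : 0 <= A by rewrite !mulr_ge0 ?expR_ge0 ?powR_ge0.
exists (A * (1 - rho)^-1); split; first by rewrite mulr_ge0// invr_ge0 subr_ge0 ltW.
move=> s us sK; pose m := \max_(x <- s) x.1.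
have hm (x : nat * nat) : x \in s -> (x.1 < m.+1)%N by move=> xs; rewrite ltnS /m (big_rem x)//= leq_maxl.
pose s' := [seq (n, k) | n <- iota 0 m.+1, k <- iota 0 (narc n)].
have us' : uniq s'.
  by apply: allpairs_uniq_dep => [|n _|]; rewrite ?iota_uniq// => -[n k] [n' k'] _ _ /= [-> ->].
have ss (x : nat * nat) : x \in s -> x \in s'.
  move=> xs; apply/allpairsPdep; exists x.1, x.2; rewrite !mem_iota !add0n -surjective_pairing.
  by split=> //; [exact: hm|exact: sK].
apply: le_trans (uniq_sum _ us us' ss) _; first by move=> x; rewrite mulr_ge0 ?powR_ge0.
rewrite big_allpairs_dep /= -/(index_iota 0 m.+1).
have bd n : \sum_(k <- iota 0 (narc n)) w n k * dyad n `^ b <= A * rho ^+ n.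
  rewrite -mulr_suml -[iota _ _](_ : index_iota 0 (narc n) = _); last by rewrite /index_iota subn0.
  rewrite -/(S n) /dyad powRM ?invr_ge0 ?exprn_ge0 ?invr_ge0//.
  have -> : (2^-1 ^+ n) `^ b = (2^-1 `^ b) ^+ n :> R.
    by rewrite -powR_mulrn ?invr_ge0// -powRrM mulrC powRrM powR_mulrn ?powR_ge0.
  rewrite /A /rho exprMn; have := ler_wpM2r (_ : 0 <= 16^-1 `^ b * (2^-1 `^ b) ^+ n) (G n).
  rewrite mulr_ge0 ?exprn_ge0 ?powR_ge0// => /(_ isT) h; apply: le_trans h _.
  by rewrite le_eqVlt; apply/orP; left; apply/eqP; ring.
rewrite -[X in \sum_(i <- X) _](_ : index_iota 0 m.+1 = _); last by rewrite /index_iota subn0.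
apply: le_trans (ler_sum _ (fun n _ => bd n)) _; rewrite -mulr_sumr ler_wpM2l//.
by rewrite big_mkord; exact: geo_sum.
Qed.

Definition arcd n k := arcl (k%:R * dyad n) (dyad n).

Lemma dyad8 n : 0 < dyad n <= 1 / 8.
Proof. by rewrite dyad_gt0; apply: le_trans (dyad_le n) _; lra. Qed.

Lemma arcd_gt0 n k : 0 < arcd n k. Proof. exact: arcl_gt0 (dyad8 n). Qed.

Lemma arcd_split n k : let eta := 2 * kap + dyad n.+1 in
  arcd n.+1 k.*2 ^+ 2 + arcd n.+1 k.*2.+1 ^+ 2 <= 2^-1 * (1 + 8 * eta ^+ 2) * arcd n k ^+ 2 /\
  (arcd n.+1 k.*2 ^+ 2)^-1 + (arcd n.+1 k.*2.+1 ^+ 2)^-1 <= 8 * (1 + 8 * eta ^+ 2) * (arcd n k ^+ 2)^-1.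
Proof.
have := split_arc (k%:R * dyad n) (dyad8 n.+1); rewrite /arcd -dyadS.
have -> : k.*2%:R * dyad n.+1 = k%:R * dyad n by rewrite -muln2 natrM (dyadS n); ring.
by have -> : k.*2.+1%:R * dyad n.+1 = k%:R * dyad n + dyad n.+1 by rewrite -[k.*2.+1]addn1 natrD -muln2 natrM (dyadS n); ring.
Qed.

(** Squares halve and inverse squares multiply by 8 at each subdivision; the exponents [b - 1] and
    [3 + b] compensate exactly, so that both series have the same ratio, the quantity assumed below
    1. *)
Lemma arcd_sums b : expR (64 * kap ^+ 2) * 2^-1 `^ b < 1 ->
  exists M : R, 0 <= M /\ forall s : seq (nat * nat), uniq s -> (forall x : nat * nat, x \in s -> (x.2 < narc x.1)%N) ->
    \sum_(x <- s) arcd x.1 x.2 ^+ 2 * dyad x.1 `^ (b - 1) <= M /\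
    \sum_(x <- s) (arcd x.1 x.2 ^+ 2)^-1 * dyad x.1 `^ (3 + b) <= M.
Proof.
move=> hb.
have p2 : (2^-1 : R) != 0 by rewrite invr_eq0.
have [M1 [M10 h1]] : exists M : R, 0 <= M /\ forall s : seq (nat * nat), uniq s -> (forall x : nat * nat, x \in s -> (x.2 < narc x.1)%N) ->
    \sum_(x <- s) arcd x.1 x.2 ^+ 2 * dyad x.1 `^ (b - 1) <= M.
  apply: (@pair_sum (fun n k => arcd n k ^+ 2) 2^-1); first by rewrite invr_ge0.
  - by move=> n k; exact: sqr_ge0.
  - by move=> n k; have [] := arcd_split n k.
  rewrite powRD ?p2 ?implybT// powR_inv1 ?invr_ge0// invrK.
  by move: hb; move: (expR _) (2^-1 `^ b) => x y; lra.
have [M2 [M20 h2]] : exists M : R, 0 <= M /\ forall s : seq (nat * nat), uniq s -> (forall x : nat * nat, x \in s -> (x.2 < narc x.1)%N) ->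
    \sum_(x <- s) (arcd x.1 x.2 ^+ 2)^-1 * dyad x.1 `^ (3 + b) <= M.
  apply: (@pair_sum (fun n k => (arcd n k ^+ 2)^-1) 8) => //.
  - by move=> n k; rewrite invr_ge0 sqr_ge0.
  - by move=> n k; have [] := arcd_split n k.
  rewrite powRD ?p2 ?implybT// powR_mulrn ?invr_ge0//.
  by move: hb; move: (expR _) (2^-1 `^ b) => x y; lra.
exists (M1 + M2); split; first exact: addr_ge0.
by move=> s us sK; split; [apply: le_trans (h1 s us sK) _; rewrite lerDl|apply: le_trans (h2 s us sK) _; rewrite lerDr].
Qed.
End DyadicSums.


(** * Hausdorff dimension *)

Section NullSets.
Variable R : realType.
Local Notation C := (R * R)%type.
Implicit Types (A X : set C) (s t e x : R).

Definition small_cover s e A (F : nat -> set C) (r : nat -> R) :=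
  [/\ forall n, 0 <= r n, forall n p q, F n p -> F n q -> Defs.edist p q <= r n,
    A `<=` \bigcup_n F n & forall N, \sum_(0 <= n < N) r n `^ s <= e].

(** Vanishing Hausdorff measure with finite partial sums and no bound on the radii; for [s > 0] such
    a bound follows from the smallness of the sum. *)
Definition null_dim s A := forall e, 0 < e -> exists F r, small_cover s e A F r.

Lemma powR_le_inv s x e : 0 < s -> 0 <= x -> 0 <= e -> x `^ s <= e `^ s -> x <= e.
Proof.
move=> s0 x0 e0; rewrite !leNgt; apply: contra => ex.
by apply: (gt0_ltr_powR s0) => //; rewrite nnegrE.
Qed.

Lemma term_le (u : nat -> R) e n : (forall n, 0 <= u n) -> (forall N, \sum_(0 <= n < N) u n <= e) -> u n <= e.
Proof.
move=> u0 h; apply: le_trans (h n.+1); rewrite big_nat_recr//= lerDr; exact: sumr_ge0.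
Qed.

Lemma nullP s A : 0 < s -> null_dim s A <-> Hmeasure s A = 0%E.
Proof.
move=> s0; split=> [h|h e e0].
  apply/eqP; rewrite eq_le; apply/andP; split.
    apply: ge_ereal_sup => _ [d d0 <-]; apply/lee_addgt0Pr => e e0; rewrite add0e.
    (* A total of at most [d] to the power [s] forces every radius below [d]. *)
    have e1 : 0 < Num.min e (d `^ s) by rewrite lt_min e0 powR_gt0.
    have [F [r [r0 hd cov hs]]] := h _ e1.
    have ps N : 0 <= r N `^ s by exact: powR_ge0.
    apply: ge_ereal_inf; exists (\sum_(0 <= n <oo) ((r n) `^ s)%:E)%E.
      exists F, r; split=> // n; rewrite r0 /=.
      apply: (powR_le_inv s0) => //; first exact: ltW.
      by apply: le_trans (term_le n ps hs) _; rewrite ge_min lexx orbT.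
    apply: lime_le; first by apply: is_cvg_nneseries => n _ _; rewrite lee_fin.
    by near=> N; rewrite sumEFin lee_fin; apply: le_trans (hs N) _; rewrite ge_min lexx.
  apply: le_ereal_sup_tmp; exists (Hcontent s 1 A); first by exists 1 => //=.
  by apply: le_ereal_inf_tmp => _ [F [r [_ _ _ ->]]]; apply: nneseries_ge0 => n _ _; rewrite lee_fin powR_ge0.
have : (Hcontent s 1 A < e%:E)%E.
  apply: (@le_lt_trans _ _ 0%E); last by rewrite lte_fin.
  by rewrite -h; apply: le_ereal_sup_tmp; exists (Hcontent s 1 A) => //; exists 1 => //=.
move=> /ereal_inf_lt[_ [F [r [hr hd cov ->]]] lt]; exists F, r; split=> //.
  by move=> n; have /andP[] := hr n.
move=> N; rewrite -lee_fin -sumEFin; apply: le_trans _ (ltW lt).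
by apply: nneseries_lim_ge => n _ _; rewrite lee_fin powR_ge0.
Unshelve. all: by end_near. Qed.

Lemma hdim_le A x : (forall e, 0 < e -> exists s, [/\ 0 < s, s < x + e & null_dim s A]) -> (hdim A <= x%:E)%E.
Proof.
move=> h; apply/lee_addgt0Pr => e e0; have [s [s0 sx hs]] := h e e0.
apply: ge_ereal_inf; exists s%:E; last by rewrite -EFinD lee_fin ltW.
by exists s => //; split=> //; apply/(nullP _ s0).
Qed.

Lemma hdim_lt A x : (hdim A < x%:E)%E -> exists s, [/\ 0 < s, s < x & null_dim s A].
Proof.
move=> /ereal_inf_lt[_ [s [s0 hs] <-]]; rewrite lte_fin => sx; exists s; split=> //.
by apply/(nullP _ s0).
Qed.

(** Vanishing radii are enlarged along a geometric series of total cost [e / 2]; positive radii are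
    what allows a dyadic scale to be assigned to each set of the cover. *)
Lemma null_pos s A : 0 < s -> null_dim s A -> forall e, 0 < e ->
  exists F r, small_cover s e A F r /\ forall n, 0 < r n.
Proof.
move=> s0 h e e0; have e20 : 0 < e / 2 by rewrite divr_gt0.
have [F [r [r0 hd cov hs]]] := h _ e20.
pose d n := e / 4 * 2^-1 ^+ n.
have d0 n : 0 < d n by rewrite mulr_gt0 ?divr_gt0// exprn_gt0// invr_gt0.
have dK n : (d n `^ s^-1) `^ s = d n by rewrite -powRrM mulVf ?gt_eqF// powRr1// ltW.
exists F, (fun n => Num.max (r n) (d n `^ s^-1)); split; last by move=> n; rewrite lt_max powR_gt0 ?orbT.
split=> // [n|n p q hp hq|N]; first by rewrite le_max r0.
  by rewrite le_max hd.
apply: (@le_trans _ _ (\sum_(0 <= n < N) (r n `^ s + d n))).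
  apply: ler_sum => n _; have := powR_ge0 (r n) s; have := d0 n.
  by case: (leP (r n) (d n `^ s^-1)) => _; rewrite ?dK; lra.
rewrite big_split /=; have h1 := hs N.
have : \sum_(0 <= n < N) d n <= e / 2.
  rewrite -mulr_sumr big_mkord.
  have := @geo_sum R 2^-1 N; rewrite (_ : (1 - 2^-1)^-1 = 2 :> R); last by field.
  move=> g; apply: le_trans (ler_wpM2l _ (g _ _)) _; rewrite ?divr_ge0 ?invr_ge0 ?(ltW e0)//; lra.
clear -h1; lra.
Qed.

(** The weights [lam] and [lam] to the power [- (q / p)] cancel in the product; then Young's
    inequality is applied and the factors [p^-1], [q^-1] are bounded by 1. That [lam] is arbitrary
    matters in [transfer]. *)
Lemma young (p q lam : R) : 0 < p -> 0 < q -> p^-1 + q^-1 = 1 -> 0 < lam ->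
  exists K, 0 < K /\ forall u v, 0 <= u -> 0 <= v -> u `^ p^-1 * v `^ q^-1 <= lam * u + K * v.
Proof.
move=> p0 q0 pq l0; pose K := lam `^ (- (q / p)).
have K0 : 0 < K by exact: powR_gt0.
exists K; split=> // u v u0 v0.
have lu : 0 <= lam * u by rewrite mulr_ge0// ltW.
have kv : 0 <= K * v by rewrite mulr_ge0// ltW.
have E : u `^ p^-1 * v `^ q^-1 = (lam * u) `^ p^-1 * (K * v) `^ q^-1.
  rewrite !powRM// ?(ltW l0) ?(ltW K0)// mulrACA.
  rewrite /K -powRrM -powRD; last by rewrite (gt_eqF l0) implybT.
  have -> : p^-1 + - (q / p) * q^-1 = 0 by field; rewrite !gt_eqF.
  by rewrite powRr0 mul1r.
rewrite E; apply: le_trans (conjugate_powR _ _ p0 q0 pq) _; rewrite ?powR_ge0//.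
rewrite -!powRrM !mulVf ?gt_eqF// !powRr1//.
have pi : 0 < p^-1 by rewrite invr_gt0.
have qi : 0 < q^-1 by rewrite invr_gt0.
by apply: lerD; rewrite ler_piMr//; (clear -qi pq pi; lra).
Qed.

(** Several sets of a cover may select the same arc. Keeping only the first occurrence turns the sum
    of weights into a sum over distinct arcs, the only kind that is bounded. *)
Lemma first_occ (T : eqType) (pr : nat -> option T) (wt : T -> R) :
  let y j := if all (fun i => pr i != pr j) (iota 0 j) then pr j else None in
  forall N, exists S : seq T, [/\ uniq S, forall x : T, x \in S -> exists2 i, (i < N)%N & pr i = Some x &
    \sum_(0 <= j < N) (if y j is Some x then wt x else 0) = \sum_(x <- S) wt x].
Proof.
move=> y; elim=> [|N [S [uS hS eS]]]; first by exists [::]; rewrite big_geq// big_nil.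
have sub (x : T) : x \in S -> exists2 i, (i < N.+1)%N & pr i = Some x.
  by move=> /hS[i iN e]; exists i => //; exact: ltnW.
rewrite big_nat_recr//= eS; case E : (y N) => [z|]; last by exists S; rewrite addr0.
move: E; rewrite /y; case: ifP => // /allP al_ Ez.
exists (z :: S); rewrite /= uS andbT big_cons addrC; split=> //.
  apply/negP => /hS[i iN e]; have := al_ i; rewrite mem_iota /= add0n iN => /(_ isT).
  by rewrite Ez e eqxx.
by move=> x; rewrite inE => /orP[/eqP->|/sub//]; exists N.
Qed.

(** Common mechanism for both directions. The weights have bounded total over distinct pieces, so
    choosing [lam] first makes their share at most [e / 2]; only then is the given cover taken fine
    enough to beat the resulting constant [K]. *)
Lemma transfer (T : eqType) X (Pc : T -> set C) (rad wt : T -> R) (Ix : T -> Prop) s t (M : R) : 0 < t -> 0 <= M ->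
  (forall x : T, 0 <= rad x) -> (forall (x : T) p q, Pc x p -> Pc x q -> Defs.edist p q <= rad x) ->
  (forall S : seq T, uniq S -> (forall x : T, x \in S -> Ix x) -> \sum_(x <- S) wt x <= M) ->
  (forall lam : R, 0 < lam -> exists K : R, 0 < K /\ forall e, 0 < e -> exists (pr : nat -> option T) (r : nat -> R),
    [/\ forall N, \sum_(0 <= n < N) r n `^ s <= e, X `<=` [set p | exists j (x : T), pr j = Some x /\ Pc x p] &
      forall j (x : T), pr j = Some x -> Ix x /\ rad x `^ t <= lam * wt x + K * r j `^ s]) -> null_dim t X.
Proof.
move=> t0 M0 rad0 hd hM H e e0.
have M1 : 0 < 2 * (M + 1) by rewrite mulr_gt0// ltr_wpDl.
have l0 : 0 < e / (2 * (M + 1)) by rewrite divr_gt0.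
have [K [K0 HK]] := H _ l0; set lam := e / _ in l0 HK.
have e1 : 0 < e / (2 * K) by rewrite divr_gt0// mulr_gt0.
have [pr [r [hs cov hpr]]] := HK _ e1.
pose y j := if all (fun i => pr i != pr j) (iota 0 j) then pr j else None.
have yE j (x : T) : y j = Some x -> pr j = Some x by rewrite /y; case: ifP.
exists (fun j => if y j is Some x then Pc x else set0), (fun j => if y j is Some x then rad x else 0); split.
- by move=> j; case: (y j).
- by move=> j p q; case: (y j) => [x|//]; exact: hd.
- move=> p /cov[j0 [x [hj hp]]].
  have ex : exists j, pr j == Some x by exists j0; apply/eqP.
  have [j /eqP hj1 jmin] := ex_minnP ex; exists j => //=.
  suff -> : y j = Some x by [].
  rewrite /y; case: ifP => // /negP[]; apply/allP => i; rewrite mem_iota add0n /= => ij.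
  by apply/negP; rewrite hj1 => hi; have := jmin i hi; rewrite leqNgt ij.
move=> N; have [S [uS hS eS]] := first_occ pr wt N; rewrite -/y in eS.
apply: (@le_trans _ _ (\sum_(0 <= j < N) (lam * (if y j is Some x then wt x else 0) + K * r j `^ s))).
  apply: ler_sum => j _; case E : (y j) => [x|]; first by have [] := hpr j x (yE _ _ E).
  by rewrite powR0 ?gt_eqF// mulr0 add0r mulr_ge0 ?powR_ge0// ltW.
rewrite big_split /= -!mulr_sumr; have h1 := hs N; rewrite -(ler_pM2l K0) in h1.
have E2 : K * (e / (2 * K)) = e / 2 by field; rewrite gt_eqF.
rewrite E2 in h1; rewrite (eS : \sum_(0 <= j < N) _ = _).
have h2 : \sum_(x <- S) wt x <= M by apply: hM => // x /hS[i _ /hpr[]].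
rewrite -(ler_pM2l l0) in h2.
have : lam * M <= e / 2.
  rewrite /lam mulrAC ler_pdivrMr//; (clear -e0; nra).
clear -h2 h1; lra.
Qed.
End NullSets.

Lemma dist_double (R : realFieldType) (x y z d : R) : `|x - y| <= d -> `|y - z| <= d -> `|x - z| <= 2 * d.
Proof.
by move=> h1 h2; have := ler_normD (x - y) (y - z); rewrite addrA subrK; lra.
Qed.

Lemma young_scale (R : realFieldType) (a lam w k v c s : R) : 0 < a -> 0 < k -> v <= c * s ->
  a * (lam / a * w + k * v) <= lam * w + a * (k * c) * s.
Proof.
move=> a0 k0 h; have -> : a * (lam / a * w + k * v) = lam * w + a * k * v by field; rewrite gt_eqF.
by rewrite lerD2l -!mulrA !ler_pM2l.
Qed.

(** * Covers of subsets of the circle and of their images *)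

Section CircleDims.
Variable R : realType.
Local Notation C := (R * R)%type.
Variables (f : C -> C) (kap : R) (N0 : nat).
Local Notation phi := (fun x => f (circ x)).
Hypotheses (k0 : 0 <= kap) (k1 : kap <= 1 / 8) (hN : (128 < N0)%N).
Hypothesis aff : forall th t, 0 < t <= 1 / 8 -> exists D : C, D <> (0, 0) /\ forall x : R, `|x - th| <= t ->
  enorm (pm (pm (phi x) (phi th)) (cmul D (pm (circ x) (circ th)))) <= kap * enorm D * t.
Hypotheses (cf1 : ct (fun p => (f p).1)) (cf2 : ct (fun p => (f p).2)).
Hypothesis hom : forall e : R, 0 < e -> exists2 d : R, 0 < d & forall p q, @unit_circle R p -> @unit_circle R q ->
  enorm (pm (f p) (f q)) <= d -> enorm (pm p q) <= e.
Implicit Types (A : set C) (y s t b r : R).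
Local Notation dt := (dyad R).
Local Notation al := (arcd phi).
Local Notation near_arc n k y := (`|y - k%:R * dt n| <= 2 * dt n).

Lemma dt_lim e : 0 < e -> exists n, dt n < e.
Proof.
move=> e0; have : (2^-1 : R) ^+ n @[n --> \oo] --> (0 : R) by apply: cvg_expr; rewrite ger0_norm; lra.
move=> /cvgrPdist_lt/(_ _ e0)[n _ /(_ n (leqnn n))] /=.
rewrite sub0r normrN ger0_norm ?exprn_ge0 ?invr_ge0// => h; exists n.
apply: le_lt_trans h; rewrite /dyad ler_piMl ?exprn_ge0 ?invr_ge0//; lra.
Qed.

Lemma level r : 0 < r <= 16^-1 -> exists n, r <= dt n /\ dt n <= 2 * r.
Proof.
move=> /andP[r0 r1]; have ex : exists n, dt n.+1 < r.
  by have [n hn] := dt_lim r0; exists n; apply: le_lt_trans hn; rewrite [leRHS]dyadS ler_peMr ?ltW ?dyad_gt0//; lra.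
have [n hn nmin] := ex_minnP ex; exists n; split; last by rewrite dyadS mulrC ler_pM2l// ltW.
case: n hn nmin => [|n] hn nmin; first by rewrite /dyad expr0 mulr1.
by rewrite leNgt; apply/negP => /nmin; rewrite ltnn.
Qed.

(** The interval of length 8 holds 128 arcs of length 1/16; more than 128 initial arcs therefore
    suffice at every level. *)
Lemma arc_index y n : 0 <= y <= 8 -> exists2 k, (k < narc N0 n)%N & `|y - k%:R * dt n| <= dt n.
Proof.
move=> /andP[y0 y8]; have d0 := dyad_gt0 R n.
have q0 : 0 <= y / dt n by rewrite divr_ge0// ltW.
have /andP[h1 h2] := truncn_itv q0; set k := Num.truncn _ in h1 h2.
rewrite ler_pdivlMr// in h1; rewrite ltr_pdivrMr// -addn1 natrD mulrDl mul1r in h2.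
exists k; last by rewrite ger0_norm; lra.
rewrite /narc -(ltr_nat R) natrM natrX -(ltr_pM2r d0); apply: le_lt_trans h1 _; apply: le_lt_trans y8 _.
have -> : 8 = 128%:R * 2%:R ^+ n * dt n.
  have e : 2%:R ^+ n * 2^-1 ^+ n = 1 :> R by rewrite -exprMn divff ?expr1n.
  by rewrite /dyad; transitivity (8 * (2%:R ^+ n * 2^-1 ^+ n) : R); [rewrite e mulr1|field].
by rewrite ltr_pM2r// ltr_pM2r ?exprn_gt0// ltr_nat.
Qed.

(** The affine approximation at scale [2 * dt n] has error [2 * kap * (2 * dt n)], at most
    [dt n / 2] since [kap <= 1 / 8]. *)
Lemma arc_bounds n k : exists2 D : R, 0 < D & forall x y : R, near_arc n k x -> near_arc n k y ->
  D * (7 / 8 * `|x - y| - dt n / 2) <= enorm (pm (phi x) (phi y)) <= D * (`|x - y| + dt n / 2).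
Proof.
have d0 := dyad_gt0 R n; have d16 := dyad_le R n.
have tt : 0 < 2 * dt n <= 1 / 8 by rewrite mulr_gt0//; lra.
have [D [Dn H]] := aff (k%:R * dt n) tt.
have D0 : 0 < enorm D by rewrite lt_neqAle enorm_ge0 andbT; apply/eqP => /esym/enorm_eq0.
exists (enorm D) => // x y hx hy.
have xy : `|x - y| <= 1.
  have : `|x - y| <= `|x - k%:R * dt n| + `|y - k%:R * dt n|.
    by rewrite (distrC y); apply: le_trans _ (ler_normD _ _); rewrite addrA subrK.
  clear -hy hx d16 hom cf2 cf1 aff hN k1 k0; lra.
have /andP[h1 h2] := aff2 H hx hy xy.
have kd := ler_wpM2r (ltW d0) k1.
apply/andP; split; [apply: le_trans _ h1|apply: le_trans h2 _]; rewrite ler_pM2l//; (clear -kd hom cf2 cf1 aff hN k1 k0; lra).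
Qed.

Lemma near_arc_self n k : near_arc n k (k%:R * dt n) /\ near_arc n k (k%:R * dt n + dt n).
Proof.
have d0 := dyad_gt0 R n; rewrite subrr normr0 mulr_ge0 ?(ltW d0)//; split=> //.
by rewrite addrC addKr gtr0_norm//; lra.
Qed.

(** Points near the arc are at most [4 * dt n] apart, so their images at most 9/2 [D * dt n], while
    the chord of the arc is at least 3/8 [D * dt n]; the quotient is 12. *)
Lemma arc_diam n k (x y : R) : near_arc n k x -> near_arc n k y -> enorm (pm (phi x) (phi y)) <= 12 * al n k.
Proof.
move=> hx hy; have d0 := dyad_gt0 R n; have [D D0 H] := arc_bounds n k.
have [s1 s2] := near_arc_self n k.
have /andP[_ h1] := H x y hx hy; have /andP[h2 _] := H _ _ s2 s1.
have E : `|k%:R * dt n + dt n - k%:R * dt n| = dt n by rewrite addrC addKr gtr0_norm.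
rewrite E in h2; rewrite /arcd /arcl.
have xy : `|x - y| <= `|x - k%:R * dt n| + `|y - k%:R * dt n|.
  by rewrite (distrC y); apply: le_trans _ (ler_normD _ _); rewrite addrA subrK.
have : D * (`|x - y| + dt n / 2) <= D * (9 / 2 * dt n) by rewrite ler_pM2l//; (clear -xy hy hx hom cf2 cf1 aff hN k1 k0; lra).
have := mulr_gt0 D0 d0; (clear -h2 h1 hom cf2 cf1 aff hN k1 k0; lra).
Qed.

Lemma circ_in (x : R) : @unit_circle R (circ x).
Proof. exact: cos2Dsin2. Qed.

Lemma edistE (p q : C) : Defs.edist p q = enorm (pm p q). Proof. by []. Qed.

(** Each set of a cover of [A] is replaced by a dyadic arc of comparable length, whose image has
    diameter comparable to its chord. The condition on [s] lets a power of the arc length be bounded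
    by its power [s], the length being at most 1. *)
Lemma dim_up A b s t : A `<=` @unit_circle R -> 0 < s -> 0 < t < 2 -> b < 1 ->
  expR (64 * kap ^+ 2) * 2^-1 `^ b < 1 -> s <= (1 - b) * t / (2 - t) -> null_dim s A -> null_dim t (f @` A).
Proof.
move=> AC s0 /andP[t0 t2] b1 hb st hA.
have [M [M0 hM]] := arcd_sums k0 k1 aff N0 hb.
apply: (@transfer R (nat * nat)%type (f @` A) (fun x => [set q | exists2 y, near_arc x.1 x.2 y & phi y = q])
  (fun x => 12 * al x.1 x.2) (fun x => al x.1 x.2 ^+ 2 * dt x.1 `^ (b - 1)) (fun x => (x.2 < narc N0 x.1)%N) s t M) => //.
- by move=> x; rewrite mulr_ge0// enorm_ge0.
- by move=> x p q [y hy <-] [z hz <-]; rewrite edistE; exact: arc_diam.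
- by move=> S uS hS; have [] := hM S uS hS.
move=> lam l0.
have p0 : 0 < 2 / t by rewrite divr_gt0.
have q0 : 0 < 2 / (2 - t) by rewrite divr_gt0// subr_gt0.
have pq : (2 / t)^-1 + (2 / (2 - t))^-1 = 1 by field; rewrite !gt_eqF// subr_gt0.
have t12 : 0 < 12 `^ t :> R by apply: powR_gt0; rewrite ltr0n.
have l1 : 0 < lam / 12 `^ t by rewrite divr_gt0.
(* [l^t = (l^2 T^(b-1))^(t/2) (T^((1-b)t/(2-t)))^((2-t)/2)]: the first factor is summable over all arcs, the second over those met by the cover. *)
have [K [K0 hK]] := young p0 q0 pq l1.
have s16 : 0 < 16 `^ s :> R by apply: powR_gt0; rewrite ltr0n.
exists (12 `^ t * (K * 16 `^ s)); split; first by rewrite !mulr_gt0.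
move=> e e0; have r128 : 0 < (8^-1 * 16^-1 : R) `^ s by rewrite powR_gt0// mulr_gt0// invr_gt0.
have e1 : 0 < Num.min e ((8^-1 * 16^-1) `^ s) by rewrite lt_min e0.
have [F [r [[r0 hd cov hs] rp]]] := null_pos s0 hA e1.
have rs j : 8 * r j <= 16^-1.
  suff : r j <= 8^-1 * 16^-1 by (clear -hom cf2 cf1 aff hN k1 k0; lra).
  apply: (powR_le_inv s0); [exact: r0|by rewrite mulr_ge0 ?invr_ge0|].
  by apply: le_trans (term_le j (fun n => powR_ge0 _ _) hs) _; rewrite ge_min lexx orbT.
have claim j : exists o : option (nat * nat), (o = None -> forall p, A p -> ~ F j p) /\
    forall x, o = Some x -> [/\ (x.2 < narc N0 x.1)%N, dt x.1 <= 16 * r j & forall p, A p -> F j p ->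
      exists2 y, near_arc x.1 x.2 y & circ y = p].
  have [[p [Ap Fp]]|no] := pselect (exists p, A p /\ F j p); last first.
    by exists None; split=> // _ p Ap Fp; apply: no; exists p.
  have [x0 x08 xp] := circ_onto (AC _ Ap).
  (* [circ_near] turns a chord of length [r j] into an angle up to [8 * r j], so the arc is taken at
     that scale. *)
  have [|n [n1 n2]] := @level (8 * r j); first by rewrite rs andbT mulr_gt0.
  have [k kn kx] := arc_index n x08.
  exists (Some (n, k)); split=> // _ [<-] /=; split=> //; first by apply: le_trans n2 _; rewrite mulrA -natrM.
  move=> q Aq Fq; have [x _ xq] := circ_onto (AC _ Aq).
  have [z zx zd] := circ_near x x0; exists z; last by rewrite zx.
  have h := hd j q p Fq Fp; rewrite edistE -xp -xq in h.
  have zz : `|z - x0| <= dt n.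
    by apply: le_trans zd _; apply: le_trans n1; rewrite ler_pM2l.
  exact: dist_double zz kx.
have [pr hpr] := choice claim.
exists pr, r; split.
- by move=> N; apply: le_trans (hs N) _; rewrite ge_min lexx.
- move=> _ [p Ap <-]; have [j _ Fp] := cov p Ap; have [h1 h2] := hpr j.
  case E : (pr j) => [x|]; last by case: (h1 E p Ap Fp).
  by exists j, x; split=> //; have [_ _ /(_ p Ap Fp)[y hy <-]] := h2 x E; exists y.
move=> j x E; have [_ /(_ x E)[h1 h2 _]] := hpr j; split=> //.
have d0 := dyad_gt0 R x.1; have a0 := arcd_gt0 k1 aff x.1 x.2.
move: (al _ _) (dt x.1) a0 d0 h2 (dyad_le R x.1) => l T l0' T0 Tr T1.
have := hK (l ^+ 2 * T `^ (b - 1)) (T `^ ((1 - b) * t / (2 - t))).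
have w0 : 0 <= l ^+ 2 * T `^ (b - 1) by apply: mulr_ge0; [exact: sqr_ge0|exact: powR_ge0].
move=> /(_ w0 (powR_ge0 _ _)).
have -> : (l ^+ 2 * T `^ (b - 1)) `^ (2 / t)^-1 * (T `^ ((1 - b) * t / (2 - t))) `^ (2 / (2 - t))^-1 = l `^ t.
  rewrite powRM ?sqr_ge0 ?powR_ge0// -powR_mulrn ?(ltW l0')// -!powRrM -mulrA -powRD; last by rewrite (gt_eqF T0) implybT.
  have -> : 2%:R * (2 / t)^-1 = t by field; rewrite gt_eqF.
  have -> : (b - 1) * (2 / t)^-1 + (1 - b) * t / (2 - t) * (2 / (2 - t))^-1 = 0 by field; rewrite !gt_eqF// subr_gt0.
  by rewrite powRr0 mulr1.
move=> h; rewrite powRM ?(ltW l0')//; apply: le_trans (ler_wpM2l (ltW t12) h) _.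
apply: young_scale => //; rewrite -powRM// ?(ltW (rp j))//; apply: (@le_trans _ _ (T `^ s)).
  by apply: ger_powR => //; rewrite T0; (clear -T1 hom cf2 cf1 aff hN k1 k0; lra).
by apply: ge0_ler_powR; rewrite ?nnegrE ?mulr_ge0 ?(ltW s0) ?(ltW T0) ?(ltW (rp j)).
Qed.

(* Descending through the dyadic scales: as long as the image of the arc of length [dt m] after [x0] is longer than [16 r],
   near-linearity at scale [dt m] confines the preimage of an [r]-ball to the arc of radius [dt m / 2]. *)
Lemma confine r (x0 : R) : 0 < r -> exists n, enorm (pm (phi (x0 + dt n)) (phi x0)) < 16 * r /\
  forall x : R, `|x - x0| <= dt 0 -> enorm (pm (phi x) (phi x0)) <= r -> `|x - x0| <= dt n.
Proof.
move=> r0; pose g n := enorm (pm (phi (x0 + dt n)) (phi x0)).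
have ex : exists n, g n < 16 * r.
  have r80 : 0 < 8 * r by rewrite mulr_gt0.
  have [d1 d10 h1] := cf1 (circ x0) r80; have [d2 d20 h2] := cf2 (circ x0) r80.
  have d0 : 0 < Num.min d1 d2 by rewrite lt_min d10.
  have [n hn] := dt_lim d0; exists n.
  have hc : nm (pm (circ (x0 + dt n)) (circ x0)) < Num.min d1 d2.
    apply: le_lt_trans (nm_enorm _) _; apply: le_lt_trans (chord_le _ _) _.
    by rewrite addrC addKr gtr0_norm// dyad_gt0.
  move: hc; rewrite lt_min => /andP[/h1 c1 /h2 c2].
  apply: le_lt_trans (enorm_nm _) _; rewrite (_ : 16 * r = 2 * (8 * r)); last by ring.
  by rewrite ltr_pM2l// nm_lt /= c1.
have [n hn nmin] := ex_minnP ex; exists n; split=> // x hx hr.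
suff H m : (m <= n)%N -> `|x - x0| <= dt m by exact: H.
elim: m => [//|m IH] mn; have {}IH := IH (ltnW mn).
have gm : 16 * r <= g m by rewrite leNgt; apply/negP => /nmin; rewrite leqNgt mn.
have d0 := dyad_gt0 R m; have d16 := dyad_le R m.
have tt : 0 < dt m <= 1 / 8 by rewrite d0; lra.
have [D [Dn H]] := aff x0 tt.
have D0 : 0 < enorm D by rewrite lt_neqAle enorm_ge0 andbT; apply/eqP => /esym/enorm_eq0.
have s0 : `|x0 - x0| <= dt m by rewrite subrr normr0 ltW.
have E : `|x0 + dt m - x0| = dt m by rewrite addrC addKr gtr0_norm.
have s1 : `|x0 + dt m - x0| <= dt m by rewrite E.
have b1 : `|x0 + dt m - x0| <= 1 by rewrite E; (clear -d16 hom cf2 cf1 aff hN k1 k0; lra).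
have b2 : `|x - x0| <= 1 by (clear -d16 IH hom cf2 cf1 aff hN k1 k0; lra).
have /andP[_ h1] := aff2 H s1 s0 b1; have /andP[h2 _] := aff2 H IH s0 b2.
rewrite E -/(g m) in h1.
have kd := ler_wpM2r (ltW d0) k1.
have u1 : enorm D * (7 / 8 * `|x - x0| - dt m / 4) <= r.
  by apply: le_trans hr; apply: le_trans h2; rewrite ler_pM2l//; (clear -kd hom cf2 cf1 aff hN k1 k0; lra).
have u2 : 16 * r <= enorm D * (5 / 4 * dt m).
  by apply: le_trans gm _; apply: le_trans h1 _; rewrite ler_pM2l//; (clear -kd hom cf2 cf1 aff hN k1 k0; lra).
(* 8/7 * (1/4 + 5/64) = 3/8, below the 1/2 needed to descend one level; the 5/64 comes from the
   factor 16 in the stopping rule. *)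
have : enorm D * (7 / 8 * `|x - x0| - dt m / 4) <= enorm D * (5 / 64 * dt m) by (clear -u2 u1 hom cf2 cf1 aff hN k1 k0; lra).
rewrite ler_pM2l// => u3; rewrite (dyadS R m) in d0 u3; (clear -u3 d0 hom cf2 cf1 aff hN k1 k0; lra).
Qed.

(** With T the length of an arc and l the chord of its image, T^t = (l^-2 T^(3+b))^(s/(2+s))
    (l^s)^(2/(2+s)): the first base is summable over all arcs, the second over those selected by the
    cover of the image. *)
Lemma dim_down A b s : A `<=` @unit_circle R -> 0 < s -> 0 < 3 + b ->
  expR (64 * kap ^+ 2) * 2^-1 `^ b < 1 -> null_dim s (f @` A) -> null_dim ((3 + b) * s / (2 + s)) A.
Proof.
move=> AC s0 b0 hb hA.
have [M [M0 hM]] := arcd_sums k0 k1 aff N0 hb.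
have s2 : 0 < 2 + s by rewrite addr_gt0.
set t := (3 + b) * s / (2 + s); have t0 : 0 < t by rewrite divr_gt0// mulr_gt0.
apply: (@transfer R (nat * nat)%type A (fun x => [set q | exists2 y, near_arc x.1 x.2 y & circ y = q])
  (fun x => 4 * dt x.1) (fun x => (al x.1 x.2 ^+ 2)^-1 * dt x.1 `^ (3 + b)) (fun x => (x.2 < narc N0 x.1)%N) s t M) => //.
- by move=> x; rewrite mulr_ge0// ltW// dyad_gt0.
- move=> x p q [y hy <-] [z hz <-]; rewrite edistE; apply: le_trans (chord_le _ _) _.
  have : `|y - z| <= `|y - x.2%:R * dt x.1| + `|z - x.2%:R * dt x.1|.
    by rewrite (distrC z); apply: le_trans _ (ler_normD _ _); rewrite addrA subrK.
  clear -hz hy hom cf2 cf1 aff hN k1 k0; lra.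
- by move=> S uS hS; have [] := hM S uS hS.
move=> lam l0.
have p0 : 0 < (2 + s) / s by rewrite divr_gt0.
have q0 : 0 < (2 + s) / 2 by rewrite divr_gt0.
have pq : ((2 + s) / s)^-1 + ((2 + s) / 2)^-1 = 1 by field; rewrite !gt_eqF.
have t4 : 0 < 4 `^ t :> R by apply: powR_gt0; rewrite ltr0n.
have l1 : 0 < lam / 4 `^ t by rewrite divr_gt0.
have [K [K0 hK]] := young p0 q0 pq l1.
have s64 : 0 < 64 `^ s :> R by apply: powR_gt0; rewrite ltr0n.
exists (4 `^ t * (K * 64 `^ s)); split; first by rewrite !mulr_gt0.
(* A chord of at most 1/128 gives by [circ_near] an angle of at most 1/16, the top scale from which
   [confine] descends. *)
move=> e e0; have e8 : 0 < 8^-1 * 16^-1 :> R by rewrite mulr_gt0 ?invr_gt0.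
have [rho rho0 hrho] := hom e8.
have e1 : 0 < Num.min e (rho `^ s) by rewrite lt_min e0 powR_gt0.
have [F [r [[r0 hd cov hs] rp]]] := null_pos s0 hA e1.
have rs j : r j <= rho.
  apply: (powR_le_inv s0); [exact: r0|exact: ltW|].
  by apply: le_trans (term_le j (fun n => powR_ge0 _ _) hs) _; rewrite ge_min lexx orbT.
have claim j : exists o : option (nat * nat), (o = None -> forall p, A p -> ~ F j (f p)) /\
    forall x : nat * nat, o = Some x -> [/\ (x.2 < narc N0 x.1)%N, al x.1 x.2 <= 64 * r j & forall p, A p -> F j (f p) ->
      exists2 y, near_arc x.1 x.2 y & circ y = p].
  have [[p [Ap Fp]]|no] := pselect (exists p, A p /\ F j (f p)); last first.
    by exists None; split=> // _ p Ap Fp; apply: no; exists p.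
  have [x0 x08 xp] := circ_onto (AC _ Ap).
  have [n [n1 n2]] := confine x0 (rp j).
  have [k kn kx] := arc_index n x08; have d0 := dyad_gt0 R n.
  exists (Some (n, k)); split=> // _ [<-] /=; split=> //.
    (* The arc starting at [x0] has chord at least 3/8 [D * dt n] and less than [16 * r j]; the
       dyadic arc has chord at most 3/2 [D * dt n], four times as much, whence 64. *)
    have [D D0 H] := arc_bounds n k; have [a1 a2] := near_arc_self n k.
    have b1 : near_arc n k x0 by apply: le_trans kx _; rewrite mulr_natl mulr2n lerDl ltW.
    have b2 : near_arc n k (x0 + dt n).
      by apply: dist_double kx; rewrite addrAC subrr add0r gtr0_norm.
    have /andP[h1 _] := H _ _ b2 b1; have /andP[_ h2] := H _ _ a2 a1.
    rewrite !(addrC _ (dt n)) !addrK (gtr0_norm d0) in h1 h2.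
    rewrite addrC in n1; rewrite /arcd /arcl (addrC _ (dt n)); apply: le_trans h2 _.
    have : D * (7 / 8 * dt n - dt n / 2) <= 16 * r j by apply: le_trans h1 (ltW n1).
    clear -hom cf2 cf1 aff hN k1 k0; lra.
  move=> q Aq Fq; have [x _ xq] := circ_onto (AC _ Aq).
  have [z zx zd] := circ_near x x0; exists z; last by rewrite zx.
  have h := hd j _ _ Fq Fp; rewrite edistE in h.
  have cz : enorm (pm (circ x) (circ x0)) <= 8^-1 * 16^-1.
    apply: hrho; [exact: circ_in|exact: circ_in|rewrite xq xp; exact: le_trans h (rs j)].
  have z0 : `|z - x0| <= dt 0.
    by apply: le_trans zd _; rewrite /dyad expr0 mulr1; (clear -cz hom cf2 cf1 aff hN k1 k0; lra).
  have := n2 z z0; rewrite zx xq xp => /(_ h) zn.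
  exact: dist_double zn kx.
have [pr hpr] := choice claim.
exists pr, r; split.
- by move=> N; apply: le_trans (hs N) _; rewrite ge_min lexx.
- move=> p Ap; have [j _ Fp] := cov (f p) (imageP f Ap); have [h1 h2] := hpr j.
  case E : (pr j) => [x|]; last by case: (h1 E p Ap Fp).
  by exists j, x; split=> //; have [_ _ /(_ p Ap Fp)] := h2 x E.
move=> j x E; have [_ /(_ x E)[h1 h2 _]] := hpr j; split=> //.
have d0 := dyad_gt0 R x.1; have a0 := arcd_gt0 k1 aff x.1 x.2.
move: (al _ _) (dt x.1) a0 d0 h2 => l T l0' T0 Tr.
have := hK ((l ^+ 2)^-1 * T `^ (3 + b)) (l `^ s).
rewrite mulr_ge0 ?powR_ge0 ?invr_ge0 ?sqr_ge0//= => /(_ isT isT).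
have -> : ((l ^+ 2)^-1 * T `^ (3 + b)) `^ ((2 + s) / s)^-1 * (l `^ s) `^ ((2 + s) / 2)^-1 = T `^ t.
  rewrite powRM ?invr_ge0 ?sqr_ge0 ?powR_ge0// -powR_mulrn ?(ltW l0')// -powRN -!powRrM mulrAC -powRD; last by rewrite (gt_eqF l0') implybT.
  have -> : - 2%:R * ((2 + s) / s)^-1 + s * ((2 + s) / 2)^-1 = 0 by field; rewrite !gt_eqF.
  have -> : (3 + b) * ((2 + s) / s)^-1 = t by rewrite /t; field; rewrite !gt_eqF.
  by rewrite powRr0 mul1r.
move=> h; rewrite powRM ?(ltW T0)//; apply: le_trans (ler_wpM2l (ltW t4) h) _.
apply: young_scale => //; rewrite -powRM// ?(ltW (rp j))//.
by apply: ge0_ler_powR; rewrite ?nnegrE ?mulr_ge0 ?(ltW s0) ?(ltW l0') ?(ltW (rp j)).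
Qed.
End CircleDims.

Lemma expR_half (R : realType) (x b : R) : x < ln 2 * b -> expR x * 2^-1 `^ b < 1.
Proof.
move=> h; have -> : 2^-1 = expR (- ln 2) :> R by rewrite expRN lnK// posrE.
by rewrite -expRM -expRD expR_lt1; lra.
Qed.

Lemma qc_dims (R : realType) : exists K e0 : R, [/\ 0 < K, 0 < e0 & forall (e : R) (f : R * R -> R * R), 0 <= e <= e0 ->
  quasiconformal (1 + e) f -> conformal_on (@unit_disk R) f -> forall A, A `<=` @unit_circle R ->
  forall b : R, 64 * (K * e) ^+ 2 < ln 2 * b ->
  (forall s t : R, 0 < s -> 0 < t < 2 -> b < 1 -> s <= (1 - b) * t / (2 - t) -> null_dim s A -> null_dim t (f @` A)) /\
  (forall s : R, 0 < s -> 0 < 3 + b -> null_dim s (f @` A) -> null_dim ((3 + b) * s / (2 + s)) A)].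
Proof.
have [K [e0 [K0 e00 H]]] := qc_aff R.
have K8 : 0 < 1 / 8 / K by rewrite !divr_gt0.
exists K, (Num.min e0 (1 / 8 / K)); split=> //; first by rewrite lt_min e00.
move=> e f /andP[e1]; rewrite le_min => /andP[e2 e3] qc cf A AC b /expR_half hb.
have k0 : 0 <= K * e by rewrite mulr_ge0// ltW.
have k1 : K * e <= 1 / 8 by rewrite mulrC -ler_pdivlMr.
have := H e f; rewrite e1 e2 => /(_ isT qc cf) aff.
have hN : (128 < 129)%N by [].
have [[g [fK [_ [ctf ctg]]]] _] := qc.
have cc (h : R * R -> R * R) : continuous h -> ct (fun p => (h p).1) /\ ct (fun p => (h p).2).
  move=> ch; split; apply/ctP => p.
    by apply: (@continuous_comp _ _ _ h fst); [exact: ch|exact: (ctP _).1 (@ct1 R) _].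
  by apply: (@continuous_comp _ _ _ h snd); [exact: ch|exact: (ctP _).1 (@ct2 R) _].
have [cf1 cf2] := cc _ ctf; have [cg1 cg2] := cc _ ctg.
split=> [s t s0 t02 b1 st|s s0 b3].
  exact: (dim_up k0 k1 hN aff AC s0 t02 b1 hb st).
(* The hypothesis left open is uniform continuity of the inverse on the image of the circle, which
   lies in a fixed square. *)
apply: (dim_down k0 k1 hN aff cf1 cf2 _ AC s0 b3 hb) => d d0.
have [B1 _ hB1] := ct_bounded 1 cf1; have [B2 _ hB2] := ct_bounded 1 cf2.
have d20 : 0 < d / 2 by rewrite divr_gt0.
have [h1 h10 H1] := ct_unif (Num.max B1 B2) cg1 d20; have [h2 h20 H2] := ct_unif (Num.max B1 B2) cg2 d20.
exists (Num.min h1 h2 / 2); first by rewrite divr_gt0// lt_min h10.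
move=> p q Cp Cq hpq; have q1 : nm q <= 1.
  by apply: le_trans (nm_enorm q) _; rewrite /enorm (Cq : q.1 ^+ 2 + q.2 ^+ 2 = 1) sqrtr1.
have fq : nm (f q) <= Num.max B1 B2 by rewrite nm_le !le_max hB1// hB2// orbT.
have lt : nm (pm (f p) (f q)) < Num.min h1 h2.
  apply: le_lt_trans (nm_enorm _) _; apply: le_lt_trans hpq _.
  by rewrite ltr_pdivrMr// ltr_pMr ?lt_min ?h10// ltr1n.
move: lt; rewrite lt_min => /andP[l1 l2].
have := H1 _ _ fq l1; have := H2 _ _ fq l2; rewrite !fK => a2 a1.
apply: le_trans (enorm_nm _) _; rewrite mulrC -ler_pdivlMr// nm_le /=.
by rewrite !ltW.
Qed.

Theorem mainTheorem11 (R : realType) :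
  exists c0 c1 g0 g1 e0 : R,
    [/\ 0 < c0, 0 < c1, 0 < g0, 0 < g1 & 0 < e0] /\
    forall eps : R, 0 <= eps -> eps < e0 ->
    forall f : R * R -> R * R,
      quasiconformal (1 + eps) f -> conformal_on (@unit_disk R) f ->
      forall A : set (R * R), A `<=` @unit_circle R ->
        ((((1 - c0 * eps ^+ 2)%:E <= hdim A)%E ->
            ((1 - c1 * eps ^+ 2)%:E <= hdim (f @` A))%E) /\
         ((hdim A <= (1 - g0 * eps ^+ 2)%:E)%E ->
            (hdim (f @` A) <= (1 - g1 * eps ^+ 2)%:E)%E)).
Proof.
have [K [e0 [K0 e00 H]]] := qc_dims R.
have l2 : 0 < ln 2 :> R by rewrite ln_gt0// ltr1n.
(* [c] makes [64 (K eps)^2 = ln 2 * (c eps^2)]. *)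
pose c := 64 * K ^+ 2 / ln 2.
have c0 : 0 < c by rewrite divr_gt0// mulr_gt0 ?ltr0n// exprn_gt0.
have k0 : 0 < (4 * (c + 2))^-1 by rewrite invr_gt0 mulr_gt0// addr_gt0.
(* Put x = c eps^2, essentially the loss [b]. To first order (3 + b) s / (2 + s) at s = 1 - 2 x is 1
   - 4/3 x + 1/3 x = 1 - x, hence the pair c, 2 c. And (1 - b) t / (2 - t) at t = 1 - eps^2 is 1 - x
   - 2 eps^2, hence the pair c + 2, 1. The bound on [eps] keeps x + 2 eps^2 below 1/4, so that the
   second-order terms do no harm. *)
exists c, (2 * c), (c + 2), 1, (Num.min e0 (Num.min 1 (4 * (c + 2))^-1)); split.
  have c2 : 0 < c + 2 by rewrite addr_gt0.
  split; [exact: c0|by rewrite mulr_gt0|exact: c2|exact: ltr01|by rewrite !lt_min e00 ltr01 k0].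
move=> eps h0; rewrite !lt_min => /and3P[h1 h2 h3] f qc cf A AC.
have he : 0 <= eps <= e0 by rewrite h0 ltW.
have := H eps f he qc cf A AC => {}H.
pose x := c * eps ^+ 2.
have e2 : 0 <= eps ^+ 2 by exact: sqr_ge0.
have x0 : 0 <= x by rewrite mulr_ge0// ltW.
have sm : x + 2 * eps ^+ 2 <= 1 / 4.
  rewrite -mulrDl; have : (c + 2) * eps <= 1 / 4.
    have c2 : 0 < 4 * (c + 2) by rewrite mulr_gt0// addr_gt0.
    by move: (ltW h3); rewrite -[X in _ <= X]mul1r ler_pdivlMr//; lra.
  have : eps ^+ 2 <= eps by rewrite expr2 ler_piMl// ltW.
  have cc : 0 <= c + 2 by rewrite addr_ge0// ltW.
  by move=> /(ler_wpM2l cc) u v; exact: le_trans u v.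
have hx (t : R) : 0 < t -> 64 * (K * eps) ^+ 2 < ln 2 * (x + t).
  move=> t0; have -> : 64 * (K * eps) ^+ 2 = ln 2 * x by rewrite /x /c; field; rewrite gt_eqF.
  by rewrite ltr_pM2l// ltrDl.
split=> hA.
  (* By contradiction: if the image has dimension below 1 - 2 x, the slack [t] between it and [s]
     serves as the margin of [b] over [x] and still leaves [A] with dimension below 1 - x. *)
  rewrite leNgt; apply/negP => /hdim_lt[s [s0 s1 hs]].
  rewrite -mulrA -/x in s1.
  pose t := 1 - s - 2 * x; have t0 : 0 < t by rewrite /t; lra.
  have b0 : 0 < 3 + (x + t) by lra.
  have [_ /(_ s s0 b0 hs) hq] := H _ (hx t t0).
  have s2 : 0 < 2 + s by lra.
  have q1 : (3 + (x + t)) * s / (2 + s) < 1 - x.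
    by rewrite ltr_pdivrMr// /t; nra.
  have : (hdim A <= ((3 + (x + t)) * s / (2 + s))%:E)%E.
    apply: ge_ereal_inf; exists ((3 + (x + t)) * s / (2 + s))%:E => //.
    have q0 : 0 < (3 + (x + t)) * s / (2 + s) by rewrite divr_gt0// mulr_gt0.
    by exists ((3 + (x + t)) * s / (2 + s)) => //; split=> //; apply/nullP.
  by move=> /(le_trans hA); rewrite lee_fin leNgt q1.
apply: hdim_le => e e0'.
(* Half of [d] is the margin of [b] over [x], half of it the margin of [s], and all of it is added
   to the target exponent. *)
pose d := Num.min (e / 2) (1 / 8).
have d0 : 0 < d by rewrite lt_min !divr_gt0.
have [d1 d2] : d <= e / 2 /\ d <= 1 / 8 by rewrite !ge_min !lexx orbT.
have d20 : 0 < d / 2 by rewrite divr_gt0.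
have [s [s0 s1 hs]] : exists s, [/\ 0 < s, s < 1 - (c + 2) * eps ^+ 2 + d / 2 & null_dim s A].
  by apply: hdim_lt; apply: le_lt_trans hA _; rewrite lte_fin ltrDl.
have [up _] := H _ (hx _ d20).
rewrite mul1r; exists (1 - eps ^+ 2 + d); split; [lra|lra|].
apply: (up s) => //; [lra|lra|].
have t2 : 0 < 2 - (1 - eps ^+ 2 + d) by lra.
rewrite ler_pdivlMr//.
have E : (c + 2) * eps ^+ 2 = x + 2 * eps ^+ 2 by rewrite mulrDl.
rewrite E in s1.
apply: (@le_trans _ _ ((1 - (x + 2 * eps ^+ 2) + d / 2) * (2 - (1 - eps ^+ 2 + d)))).
  by rewrite ler_pM2r// ltW.
rewrite -subr_ge0 (_ : _ - _ = d * (1 - 2 * (x + eps ^+ 2)) + 2 * eps ^+ 2 * (x + eps ^+ 2)); last by field.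
have q : 0 <= 1 - 2 * (x + eps ^+ 2) by move: sm e2; lra.
by apply: addr_ge0; apply: mulr_ge0; [exact: ltW|exact: q|exact: mulr_ge0|exact: addr_ge0].
Qed.
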